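(* Let $-1<a<1$ and suppose that $q,r$ satisfy $$\frac2q+\frac dr=\frac{d+a+1}2$$ with $r\ge2$ and $q>2$. Given $\Phi\in L^{q'}_tL^{r'}_x$, the function $\Theta_a^\star(\Phi)$ belongs to the space $C^b_zL^q_tL^r_x$; that is, for every $z_0\ge0$, $$\lim_{z\to z_0}\|\Theta_a^\star(\Phi)(\cdot,z,\cdot)-\Theta_a^\star(\Phi)(\cdot,z_0,\cdot)\|_{L^q_tL^r_x}=0 .$$
   Context: Let $d\ge1$ be an integer; points of the half-space $\mathbb R^{d+1}_+$ are $X=(x,z)$, $x\in\mathbb R^d$, $z>0$. Primes denote conjugate exponents and $\|\Phi\|_{L^q_tL^r_x}=\big(\int_{\mathbb R}\|\Phi(\cdot,t)\|_{L^r(\mathbb R^d)}^q\,dt\big)^{1/q}$. For $t\neq0$ and $Y_0=(y,0)$, $$\mathbb S_a(X,Y_0,t)=\frac{e^{-i\,\mathrm{sgn}(t)\frac{(d+a+1)\pi}4}}{2^{d+a}\pi^{\frac d2}\Gamma(\frac{a+1}2)}\,\frac{e^{i\frac{z^2+|x-y|^2}{4t}}}{|t|^{\frac{d+a+1}2}}.$$ For $\Phi\in\mathscr S(\mathbb R^{d+1})$ (Schwartz in $(x,t)$), $$\Theta_a^\star(\Phi)(x,z,t)=-i\int_0^t\int_{\mathbb R^d}\mathbb S_a(X,Y_0,t-\tau)\Phi(y,\tau)\,dy\,d\tau\qquad(z\ge0,\ t\in\mathbb R),$$ the $y$-integral being performed first. For general $\Phi\in L^{q'}_tL^{r'}_x$,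 $\Theta_a^\star(\Phi)$ denotes the value of the unique continuous extension, by density, of this operator from $L^{q'}_tL^{r'}_x$ to $L^\infty_zL^q_tL^r_x$ (norm $\operatorname{ess\,sup}_{z>0}\|\cdot\|_{L^q_tL^r_x}$); the assertion means that it has a (unique) representative in the space below. $C^b_zL^q_tL^r_x$ is the space of functions $V$ such that $z\mapsto V(\cdot,z,\cdot)$ is continuous and bounded on $[0,\infty)$ with values in $L^q_tL^r_x$, normed by $\sup_{z\ge0}\|V(\cdot,z,\cdot)\|_{L^q_tL^r_x}$. *)

(* Defs.v *)
From HB Require Import structures.
From mathcomp Require Import all_boot all_order all_algebra.
From mathcomp Require Import complex.
From mathcomp Require Import all_classical all_reals all_analysis.
From mathcomp Require Import ess_sup_inf.
Set Implicit Arguments. Unset Strict Implicit. Unset Printing Implicit Defensive.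
Import Order.TTheory GRing.Theory Num.Theory.
Import numFieldNormedType.Exports.
Local Open Scope classical_set_scope.
Local Open Scope ring_scope.

Notation RM := measurableTypeR.

(* Points of R^d are d-tuples, which carry the product (= Borel)
   sigma-algebra of d copies of R. *)
Notation Rn R d := (d.-tuple (RM R)).

Section lebesgue_n.
Context (R : realType).

Definition tcons d (p : RM R * Rn R d) : Rn R d.+1 := [tuple of p.1 :: p.2].

Lemma measurable_tcons d : measurable_fun [set: RM R * Rn R d] (@tcons d).
Proof. exact: measurable_cons. Qed.

Definition tuncons d (x : Rn R d.+1) : RM R * Rn R d :=
  (thead x, [tuple of behead x]).

Lemma measurable_tuncons d : measurable_fun [set: Rn R d.+1] (@tuncons d).
Proof.
apply/measurable_fun_pairP; split; first exact: measurable_tnth.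
exact: measurable_behead.
Qed.

Lemma tconsK d : cancel (@tcons d) (@tuncons d).
Proof.
by move=> [x y]; congr pair; rewrite ?theadE//; exact/val_inj.
Qed.

Lemma tunconsK d : cancel (@tuncons d) (@tcons d).
Proof. by move=> x; rewrite [RHS]tuple_eta; exact/val_inj. Qed.

Section step.
Context (d : nat) (m : {sigma_finite_measure set (Rn R d) -> \bar R}).

Definition leb_step : set (Rn R d.+1) -> \bar R :=
  pushforward (lebesgue_measure \x m)%E (@tcons d).

Let mu : {measure set (Rn R d.+1) -> \bar R} :=
  measure_function_pushforward__canonical__measure_function_Measure
    (lebesgue_measure \x m)%E (@measurable_tcons d).

Let leb_step0 : leb_step set0 = 0%E. Proof. exact: (measure0 mu). Qed.

Let leb_step_ge0 A : (0 <= leb_step A)%E. Proof. exact: (measure_ge0 mu). Qed.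

Let leb_step_sigma_additive : semi_sigma_additive leb_step.
Proof. exact: (@measure_semi_sigma_additive _ _ _ mu). Qed.

HB.instance Definition _ := isMeasure.Build _ _ _ leb_step
  leb_step0 leb_step_ge0 leb_step_sigma_additive.

Let leb_step_sigma_finite : sigma_finite setT leb_step.
Proof.
have /sigma_finiteP[F [TF ndF Foo]] := sigma_finiteT (@lebesgue_measure R).
have /sigma_finiteP[G [TG ndG Goo]] := sigma_finiteT m.
exists (fun n => @tuncons d @^-1` (F n `*` G n)).
  rewrite -preimage_bigcup (_ : \bigcup_k _ = setT) ?preimage_setT//.
  rewrite -subTset => -[x y] _.
  have [n _ Fnx] : (\bigcup_k F k) x by rewrite -TF.
  have [k _ Gky] : (\bigcup_k G k) y by rewrite -TG.
  exists (maxn n k) => //; split => /=.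
  - by move: x Fnx; exact/subsetPset/ndF/leq_maxl.
  - by move: y Gky; exact/subsetPset/ndG/leq_maxr.
move=> n; have [mF Fn] := Foo n; have [mG Gn] := Goo n.
have mFG : measurable (F n `*` G n) by exact: measurableX.
split; first by rewrite -[X in measurable X]setTI; exact: measurable_tuncons.
rewrite /leb_step /pushforward -comp_preimage.
rewrite (_ : _ \o _ = id); last by apply/funext => p /=; rewrite tconsK.
by rewrite preimage_id product_measure1E// lte_mul_pinfty// ge0_fin_numE.
Qed.

HB.instance Definition _ := Measure_isSigmaFinite.Build _ _ _ leb_step
  leb_step_sigma_finite.

End step.

(* Lebesgue measure on the Borel sets of R^d, as the d-fold product of the
   one-dimensional one; lebesgue_n_box characterizes it. *)
Fixpoint lebesgue_n d : {sigma_finite_measure set (Rn R d) -> \bar R} :=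
  match d return {sigma_finite_measure set (Rn R d) -> \bar R} with
  | 0 => dirac [tuple]
  | d'.+1 => leb_step (lebesgue_n d')
  end.

Lemma lebesgue_n_box d (A : 'I_d -> set (RM R)) :
  (forall i, measurable (A i)) ->
  lebesgue_n d [set x | forall i, A i (tnth x i)] =
  (\prod_(i < d) lebesgue_measure (A i))%E.
Proof.
elim: d A => [|d IH] A mA.
  by rewrite big_ord0 /= diracE mem_set// => -[].
rewrite big_ord_recl -IH//=.
rewrite -product_measure1E//; last first.
  rewrite (_ : [set _ | _] =
      \bigcap_(i in [set: 'I_d]) ((@tnth _ _)^~ i @^-1` A (lift ord0 i))).
    apply: fin_bigcap_measurable => // i _.
    by rewrite -[X in measurable X]setTI; exact: measurable_tnth.
  by apply/seteqP; split => x /= h i; [move=> _; exact: h|exact: h].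
rewrite /leb_step /pushforward; congr (_ _).
apply/seteqP; split => -[x y] /=.
  move=> h; split; first exact: (h ord0).
  by move=> i; have := h (lift ord0 i); rewrite tnthS.
move=> [h0 h] i; case: (unliftP ord0 i) => [j ->|->]; last exact: h0.
by rewrite tnthS; exact: h.
Qed.

End lebesgue_n.

Section complex_valued.
Context (R : realType).
Local Open Scope complex_scope.

Definition expi (theta : R) : R[i] := cos theta +i* sin theta.

Definition cmeasurable_fun disp (T : measurableType disp) (D : set T)
    (f : T -> R[i]) : Prop :=
  measurable_fun D (fun x => complex.Re (f x)) /\
  measurable_fun D (fun x => complex.Im (f x)).

Definition cintegral disp (T : measurableType disp)
    (mu : {measure set T -> \bar R}) (D : set T) (f : T -> R[i]) : R[i] :=
  (\int[mu]_(x in D) complex.Re (f x)) +i* (\int[mu]_(x in D) complex.Im (f x)).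

(* The oriented integral from 0 to t, for t of either sign. *)
Definition cintegral0 (t : R) (f : R -> R[i]) : R[i] :=
  if 0 <= t then cintegral lebesgue_measure (`[0, t] : set (RM R)) f
  else - cintegral lebesgue_measure (`[t, 0] : set (RM R)) f.

Definition Gamma (s : R) : R :=
  \int[lebesgue_measure]_(u in (`]0%R, +oo[ : set (RM R)))
    (u `^ (s - 1) * expR (- u)).

End complex_valued.

Section schwartz.
Context (R : realType) (d : nat).

(* The coordinate directions of space (Some i) and time (None). *)
Definition coord_dir (i : option 'I_d) : 'rV[R]_d * R :=
  if i is Some j then (delta_mx 0 j, 0) else (0, 1).

Definition iter_partial (s : seq (option 'I_d)) (f : 'rV[R]_d * R -> R) :
    'rV[R]_d * R -> R :=
  foldr (fun i g => 'D_(coord_dir i) g) f s.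

Definition schwartz_real (f : 'rV[R]_d * R -> R) : Prop :=
  forall s : seq (option 'I_d),
    (forall p, differentiable (iter_partial s f) p) /\
    (forall k : nat, exists C : R,
      forall p, `|p| ^+ k * `|iter_partial s f p| <= C).

(* Differential calculus is available on row vectors, measure theory on tuples;
   hence the change of coordinates. *)
Definition schwartz (Phi : Rn R d * RM R -> R[i]) : Prop :=
  let F (p : 'rV[R]_d * R) := Phi ([tuple p.1 0 i | i < d], p.2) in
  schwartz_real (fun p => complex.Re (F p)) /\
  schwartz_real (fun p => complex.Im (F p)).

End schwartz.

Section mixed_spaces.
Context (R : realType) (d : nat) (q r : \bar R).
Implicit Types (f : Rn R d * RM R -> R[i]) (V W : R -> Rn R d * RM R -> R[i]).

Definition mixed_norm f : \bar R :=
  Lnorm lebesgue_measure q (fun t : RM R =>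
    Lnorm (lebesgue_n R d) r (fun x => (Normc.normc (f (x, t)))%:E)).

Definition in_LqLr f : Prop :=
  cmeasurable_fun setT f /\ (mixed_norm f < +oo)%E.

Definition lebesgue_pos : {measure set (RM R) -> \bar R} :=
  mrestr lebesgue_measure
    (measurable_itv `]0%R, +oo[ : measurable (`]0%R, +oo[ : set (RM R))).

Definition eq_LqLr f g : Prop :=
  \forall p \ae (lebesgue_n R d \x lebesgue_measure)%E, f p = g p.

Definition in_LinfLqLr V : Prop :=
  cmeasurable_fun (`]0%R, +oo[ `*` setT : set (RM R * (Rn R d * RM R)))
    (fun u => V u.1 u.2) /\
  (ess_sup lebesgue_pos (fun z => mixed_norm (V z)) < +oo)%E.

Definition eq_LinfLqLr V W : Prop :=
  \forall z \ae lebesgue_pos, eq_LqLr (V z) (W z).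

Definition in_CbLqLr V : Prop :=
  [/\ forall z : R, 0 <= z -> in_LqLr (V z),
      exists C : R, forall z : R, 0 <= z -> (mixed_norm (V z) <= C%:E)%E &
      forall z0 : R, 0 <= z0 ->
        mixed_norm (fun p => V z p - V z0 p)
          @[z --> within `[0%R, +oo[%classic (nbhs z0)] --> 0%E].

End mixed_spaces.

Section Theta_star.
Context (R : realType) (d : nat) (a : R).
Local Open Scope complex_scope.

(* S_a((x, z), (y, 0), t); only t != 0 is meaningful *)
Definition Sa (x : Rn R d) (z : R) (y : Rn R d) (t : R) : R[i] :=
  expi (- Num.sg t * ((d%:R + a + 1) * pi / 4))
  / (2 `^ (d%:R + a) * pi `^ (d%:R / 2) * Gamma ((a + 1) / 2))%:C
  * (expi ((z ^+ 2 + \sum_(i < d) (tnth x i - tnth y i : R) ^+ 2) / (4 * t))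
     / (`|t| `^ ((d%:R + a + 1) / 2))%:C).

Definition Theta_star (Phi : Rn R d * RM R -> R[i]) (z : R)
    (p : Rn R d * RM R) : R[i] :=
  - ('i%C * cintegral0 p.2 (fun tau =>
      cintegral (lebesgue_n R d) setT
        (fun y => Sa p.1 z y (p.2 - tau) * Phi (y, tau)))).

Definition continuous_extension (q r : \bar R)
    (T : (Rn R d * RM R -> R[i]) -> R -> Rn R d * RM R -> R[i]) : Prop :=
  let q' := hoelder_conjugate q in let r' := hoelder_conjugate r in
  [/\ forall Phi, in_LqLr q' r' Phi -> in_LinfLqLr q r (T Phi),
      forall (k : R[i]) Phi Psi, in_LqLr q' r' Phi -> in_LqLr q' r' Psi ->
        eq_LinfLqLr (T (fun p => k * Phi p + Psi p))
          (fun z p => k * T Phi z p + T Psi z p),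
      exists C : R, forall Phi, in_LqLr q' r' Phi ->
        (ess_sup (lebesgue_pos R) (fun z => mixed_norm q r (T Phi z))
          <= C%:E * mixed_norm q' r' Phi)%E &
      forall Phi, schwartz Phi -> eq_LinfLqLr (T Phi) (Theta_star Phi)].

End Theta_star.

(* Main.v *)
(** For [Phi] in the Schwartz class, [z] enters the kernel only through the
    unimodular factor [e^(i z^2 / (4 (t - tau)))], and the spatial integral is
    a power of [|t - tau|] times the convolution of [Phi(., tau)] with the chirp
    [e^(i |x|^2 / (4 (t - tau)))].  Convolution with [e^(i theta |x|^2)] maps
    [L^1] to [L^oo] with norm 1; it maps [L^2] to [L^2] with norm
    [O(|theta|^(-d/2))], which follows one coordinate at a time from Schur's test
    after inserting the weight [max(0, 1 - x^2/N^2)] and letting [N] go to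
    infinity.  Interpolation by truncation gives the [L^r' -> L^r] bound, and
    Minkowski's inequality together with the Hardy-Littlewood-Sobolev inequality
    in [t] bounds the operator from [L^q'_t L^r'_x] to [L^q_t L^r_x] uniformly in
    [z].  Continuity in [z] on Schwartz data is dominated convergence, and it
    passes to the extension because the convergence of the approximations is
    uniform in [z].  Schwartz functions are dense because the indicator of a box
    is a limit of functions [e^(-P)] with [P] a polynomial. *)

Require Import Defs.
From mathcomp Require Import all_boot all_order all_algebra.
From mathcomp Require Import complex.
From mathcomp Require Import all_classical all_reals all_analysis.
From mathcomp Require Import ess_sup_inf measurable_realfun.
From mathcomp Require Import ring lra.
Set Implicit Arguments. Unset Strict Implicit. Unset Printing Implicit Defensive.
Import Order.TTheory GRing.Theory Num.Theory.
Import numFieldNormedType.Exports.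
Local Open Scope classical_set_scope.
Local Open Scope ring_scope.

(** The hypotheses on the exponents enter through one identity: the kernel's [|s|^(-(d+a+1)/2)]
    times the [|s|^(d/r)] of the unnormalised chirp is [|s|^(-2/q)], and [q > 2] makes this power
    locally integrable. The chirp has modulus 1 everywhere, so the integral obtained by expanding
    the [L^2] norm does not converge absolutely; the weight makes Fubini's theorem legitimate. It
    must also vanish continuously at [|x| = N]: a sharp cut-off leaves a kernel of size [1/|u|],
    whose mass diverges, while this one leaves [min(N, 1/(N u^2))] up to powers of [theta], whose
    mass is independent of [N]. Interpolation and fractional integration share a device replacing
    distribution functions: a value [B] forces the truncated operator to be at least [B/2] at every
    level past a threshold, and integrating this over the level against a power recovers the right
    power of [B]; Tonelli's theorem does the rest. The extension is determined only for almost every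
    [z], so a candidate is built for every [z] at once and then identified with it. *)

Lemma aeS2 {d} {T : measurableType d} {R : realType}
    (mu : {measure set T -> \bar R}) (A B C : T -> Prop) :
  (forall x, A x -> B x -> C x) -> {ae mu, forall x, A x} ->
  {ae mu, forall x, B x} -> {ae mu, forall x, C x}.
Proof.
move=> ABC hA hB; near=> x.
by apply: ABC; near: x.
Unshelve. all: by end_near. Qed.

(** * [L^p] norms of nonnegative functions on product spaces *)

Section Lnorm_nonneg.
Context {d} {T : measurableType d} {R : realType}.
Context (mu : {measure set T -> \bar R}).
Local Open Scope ereal_scope.
Implicit Types (f g : T -> \bar R) (p : \bar R).

Lemma lee_poweR (r : R) (x y : \bar R) :
  (0 <= r)%R -> 0 <= x -> x <= y -> x `^ r <= y `^ r.
Proof.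
move=> r0 x0 xy; apply: gt0_ler_poweR => //; rewrite in_itv/= leey andbT//.
exact: le_trans xy.
Qed.

Lemma le_limn_nd (u : (\bar R)^nat) n : nondecreasing_seq u -> u n <= limn u.
Proof.
move=> ndu; have -> : limn u = ereal_sup (range u).
  by apply/cvg_lim => //; exact: ereal_nondecreasing_cvgn.
by apply: ereal_sup_ubound; exists n.
Qed.

Lemma measurable_fun_poweR (r : R) f :
  measurable_fun setT f -> measurable_fun setT (fun x => f x `^ r).
Proof. by move=> mf; exact: (measurableT_comp (measurable_poweR r)). Qed.

Lemma ge0_LnormE (r : R) f : (forall x, 0 <= f x) ->
  Lnorm mu r%:E f = (\int[mu]_x f x `^ r) `^ r^-1.
Proof.
move=> f0; rewrite unlock; congr (_ `^ _).
by apply: eq_integral => x _; rewrite gee0_abs.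
Qed.

Lemma Lnorm_ley f (c : \bar R) : (forall x, 0 <= f x) -> 0 <= c ->
  (Lnorm mu +oo f <= c) <-> (\forall x \ae mu, f x <= c).
Proof.
move=> f0 c0; rewrite unlock; case: ifPn => [mu0|].
  split=> [/ess_supP|h].
    by apply: filterS => x /=; rewrite gee0_abs.
  by apply/ess_supP; apply: filterS h => x /=; rewrite gee0_abs.
(* On a space of measure zero the sup norm is 0 by definition, and every statement holds almost
   everywhere. *)
rewrite -leNgt => mu0; split=> // _.
exists setT; split => //.
by apply/eqP; rewrite eq_le mu0 measure_ge0.
Qed.

Lemma Lnorm_le_fin (r : R) f (c : \bar R) : (0 < r)%R ->
  (forall x, 0 <= f x) -> 0 <= c ->
  (Lnorm mu r%:E f <= c) <-> (\int[mu]_x f x `^ r <= c `^ r).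
Proof.
move=> r0 f0 c0; rewrite ge0_LnormE//.
have i0 : 0 <= \int[mu]_x f x `^ r by apply: integral_ge0 => x _; exact: poweR_ge0.
split=> h.
  have := lee_poweR (ltW r0) (poweR_ge0 _ _) h.
  by rewrite -poweRrM mulVf ?gt_eqF// poweRe1.
have := lee_poweR (ltW (eq_ind_r (fun x => is_true (0 < x)%R) r0 (invrK r))) i0 h.
have -> : (r^-1^-1 = r)%R by rewrite invrK.
move=> _.
have rV0 : (0 <= r^-1)%R by rewrite invr_ge0 ltW.
have := lee_poweR rV0 i0 h.
by rewrite -poweRrM mulfV ?gt_eqF// poweRe1.
Qed.

Lemma le_Lnorm_ae p f g : 0 < p -> measurable_fun setT f ->
  measurable_fun setT g -> (forall x, 0 <= f x) -> (forall x, 0 <= g x) ->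
  (\forall x \ae mu, f x <= g x) -> Lnorm mu p f <= Lnorm mu p g.
Proof.
case: p => [r||//]; rewrite ?lte_fin.
- move=> r0 mf mg f0 g0 fg; rewrite !ge0_LnormE//.
  apply: lee_poweR; first by rewrite invr_ge0 ltW.
    by apply: integral_ge0 => x _; exact: poweR_ge0.
  apply: ae_ge0_le_integral => //.
  + by move=> x _; exact: poweR_ge0.
  + exact: measurable_fun_poweR.
  + by move=> x _; exact: poweR_ge0.
  + exact: measurable_fun_poweR.
  + by apply: filterS fg => x /= + _; apply: lee_poweR => //; exact: ltW.
- move=> _ _ _ f0 g0 fg; apply/Lnorm_ley => //; first exact: Lnorm_ge0.
  have h := (Lnorm_ley g0 (Lnorm_ge0 _ _ _)).1 (lexx (Lnorm mu +oo g)).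
  by apply: aeS2 fg h => x; exact: le_trans.
Qed.

Lemma le_Lnorm p f g : 0 < p -> measurable_fun setT f ->
  measurable_fun setT g -> (forall x, 0 <= f x) ->
  (forall x, f x <= g x) -> Lnorm mu p f <= Lnorm mu p g.
Proof.
move=> p0 mf mg f0 fg; apply: le_Lnorm_ae => //.
- by move=> x; exact: le_trans (fg x).
- exact: aeW.
Qed.

Lemma ge0_LnormZ p f (k : R) : 0 < p -> measurable_fun setT f ->
  (forall x, 0 <= f x) -> (0 <= k)%R ->
  Lnorm mu p (fun x => k%:E * f x) = k%:E * Lnorm mu p f.
Proof.
case: p => [r||//]; rewrite ?lte_fin => r0 mf f0 k0.
- have kf0 x : 0 <= k%:E * f x by rewrite mule_ge0.
  rewrite !ge0_LnormE//.
  under eq_integral do rewrite poweRM//.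
  rewrite ge0_integralZl//; last 3 first.
    exact: measurable_fun_poweR.
    by move=> x _; exact: poweR_ge0.
    exact: poweR_ge0.
  rewrite poweRM ?poweR_ge0//; last first.
    by apply: integral_ge0 => x _; exact: poweR_ge0.
  by rewrite -poweRrM mulfV ?gt_eqF// poweRe1.
- rewrite unlock; case: ifPn => mu0; last by rewrite mule0.
  rewrite -ess_supZl//; congr ess_sup; apply/funext => x /=.
  by rewrite abseM gee0_abs.
Qed.

(* [(lim f_n)^r <= lim (f_n^r)] is obtained from the monotonicity of
   [x |-> x^(1/r)], so that no continuity of powers is needed. *)
Lemma Lnorm_nd p (f_ : (T -> \bar R)^nat) (c : \bar R) : 0 < p -> 0 <= c ->
  (forall n, measurable_fun setT (f_ n)) -> (forall n x, 0 <= f_ n x) ->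
  (forall x, nondecreasing_seq (f_ ^~ x)) ->
  (forall n, Lnorm mu p (f_ n) <= c) ->
  Lnorm mu p (fun x => limn (f_ ^~ x)) <= c.
Proof.
move=> p0 c0 mf f0 ndf fc.
have cf x : cvgn (f_ ^~ x) by exact: ereal_nondecreasing_is_cvgn.
have lim0 x : 0 <= limn (f_ ^~ x) by apply: lime_ge => //; exact: nearW.
case: p p0 fc => [r||//]; rewrite ?lte_fin => r0 fc.
- apply/Lnorm_le_fin => //.
  have cfr x : cvgn (fun n => f_ n x `^ r).
    apply: ereal_nondecreasing_is_cvgn => m n mn.
    by apply: lee_poweR => //; [exact: ltW|exact: ndf].
  apply: (@le_trans _ _ (\int[mu]_x limn (fun n => f_ n x `^ r))).
    have mlim : measurable_fun setT (fun x => limn (f_ ^~ x)).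
      by apply: (emeasurable_fun_cvg f_) => // x _; exact: cf.
    apply: ge0_le_integral => //.
    + by move=> x _; exact: poweR_ge0.
    + exact: measurable_fun_poweR.
    + apply: (emeasurable_fun_cvg (fun n x => f_ n x `^ r)) => //.
      by move=> n; exact: measurable_fun_poweR.
    + move=> x _.
      rewrite -[leRHS]poweRe1; last first.
        by apply: lime_ge => //; apply: nearW => n; exact: poweR_ge0.
      rewrite -(mulVf (lt0r_neq0 r0)) poweRrM.
      apply: lee_poweR => //; first exact: ltW.
      apply: lime_le => //; apply: nearW => n.
      rewrite -[leLHS]poweRe1// -(mulfV (lt0r_neq0 r0)) poweRrM.
      apply: lee_poweR => //; [by rewrite invr_ge0 ltW|exact: poweR_ge0|].
      apply: (@le_limn_nd (fun n => f_ n x `^ r) n) => m k mk.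
      by apply: lee_poweR => //; [exact: ltW|exact: ndf].
  rewrite monotone_convergence//; last 3 first.
    by move=> n; exact: measurable_fun_poweR.
    by move=> n x _; exact: poweR_ge0.
    by move=> x _ m n mn; apply: lee_poweR => //; [exact: ltW|exact: ndf].
  apply: lime_le; last by apply: nearW => n; apply/Lnorm_le_fin.
  apply: ereal_nondecreasing_is_cvgn => m n mn.
  apply: ge0_le_integral => //.
  + by move=> x _; exact: poweR_ge0.
  + exact: measurable_fun_poweR.
  + exact: measurable_fun_poweR.
  + by move=> x _; apply: lee_poweR => //; [exact: ltW|exact: ndf].
- apply/Lnorm_ley => //.
  have : \forall x \ae mu, forall n, f_ n x <= c.
    by apply/ae_foralln => n; apply/Lnorm_ley.
  by apply: filterS => x h; apply: lime_le => //; exact: nearW.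
Qed.

(** The lower limit is the increasing limit of the tail infima [einfs], so [Lnorm_nd] applies, for
    [p = +oo] too; each tail infimum has norm below that of every later term. *)
Lemma Lnorm_fatou p (f_ : (T -> \bar R)^nat) : 0 < p ->
  (forall n, measurable_fun setT (f_ n)) -> (forall n x, 0 <= f_ n x) ->
  Lnorm mu p (fun x => limn_einf (f_ ^~ x)) <=
  limn_einf (fun n => Lnorm mu p (f_ n)).
Proof.
move=> p0 mf f0.
have -> : (fun x => limn_einf (f_ ^~ x)) =
    (fun x => limn ((fun n x => einfs (f_ ^~ x) n) ^~ x)).
  by apply/funext => x; rewrite limn_einf_lim.
have e0 n x : 0 <= einfs (f_ ^~ x) n.
  by apply: le_ereal_inf_tmp => _ [k _ <-].
have me n : measurable_fun setT (fun x => einfs (f_ ^~ x) n).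
  exact: measurable_fun_einfs.
apply: Lnorm_nd => //.
- rewrite limn_einf_lim; apply: lime_ge.
    by apply: ereal_nondecreasing_is_cvgn; exact: nondecreasing_einfs.
  by apply: nearW => n; apply: le_ereal_inf_tmp => _ [k _ <-]; exact: Lnorm_ge0.
- by move=> x; exact: nondecreasing_einfs.
- move=> n; rewrite limn_einf_lim.
  apply: (@le_trans _ _ (einfs (fun n => Lnorm mu p (f_ n)) n)).
    apply: le_ereal_inf_tmp => _ [k /= nk <-].
    apply: le_Lnorm => // x.
    by apply: ereal_inf_lbound; exists k.
  by apply: le_limn_nd; exact: nondecreasing_einfs.
Qed.

Lemma Lnorm_lty_ae p f : 0 < p -> measurable_fun setT f ->
  (forall x, 0 <= f x) -> Lnorm mu p f < +oo -> \forall x \ae mu, f x < +oo.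
Proof.
case: p => [r||//]; rewrite ?lte_fin => r0 mf f0.
- rewrite ge0_LnormE// => /lty_poweRy; rewrite invr_neq0 ?gt_eqF// => /(_ isT) h.
  have : mu.-integrable setT (fun x => f x `^ r).
    apply/integrableP; split; first exact: measurable_fun_poweR.
    by under eq_integral do rewrite gee0_abs ?poweR_ge0//.
  move=> /(integrable_ae measurableT); apply: filterS => x /= /(_ I).
  rewrite ge0_fin_numE ?poweR_ge0//; apply: lty_poweRy; exact: lt0r_neq0.
- move=> h.
  have := (Lnorm_ley f0 (Lnorm_ge0 _ _ _)).1 (lexx (Lnorm mu +oo f)).
  by apply: filterS => x /le_lt_trans; apply.
Qed.

Lemma ge0_Lnorm_eq0 p f : 0 < p -> measurable_fun setT f ->
  (forall x, 0 <= f x) -> (Lnorm mu p f = 0) <-> (\forall x \ae mu, f x = 0).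
Proof.
move=> p0 mf f0; split=> [h|h].
  by have := Lnorm_eq0_eq0 mf p0 h; apply: filterS => x; exact.
apply/eqP; rewrite eq_le Lnorm_ge0 andbT -(@Lnorm0 _ _ _ mu p) ?gt_eqF//.
apply: le_Lnorm_ae => //.
by apply: filterS h => x ->.
Qed.

Lemma eq_Lnorm_ae p f g : 0 < p -> measurable_fun setT f ->
  measurable_fun setT g -> (forall x, 0 <= f x) -> (forall x, 0 <= g x) ->
  (\forall x \ae mu, f x = g x) -> Lnorm mu p f = Lnorm mu p g.
Proof.
move=> p0 mf mg f0 g0 fg; apply/eqP; rewrite eq_le; apply/andP; split.
  by apply: le_Lnorm_ae => //; apply: filterS fg => x ->.
by apply: le_Lnorm_ae => //; apply: filterS fg => x ->.
Qed.

(** An infinite norm on the right is trivial. Otherwise [f] and [g] are finite almost everywhere,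
    and Minkowski's inequality for the real functions [fine \o f] and [fine \o g] carries over. *)
Lemma ge0_LnormD p f g : 1 <= p -> measurable_fun setT f ->
  measurable_fun setT g -> (forall x, 0 <= f x) -> (forall x, 0 <= g x) ->
  Lnorm mu p (f \+ g) <= Lnorm mu p f + Lnorm mu p g.
Proof.
move=> p1 mf mg f0 g0.
have p0 : 0 < p by exact: lt_le_trans p1.
have [->|foo] := eqVneq (Lnorm mu p f) +oo.
  by rewrite addye ?leey// gt_eqF// (lt_le_trans _ (Lnorm_ge0 _ _ _)).
have [->|goo] := eqVneq (Lnorm mu p g) +oo.
  by rewrite addey ?leey// gt_eqF// (lt_le_trans _ (Lnorm_ge0 _ _ _)).
have aef : \forall x \ae mu, f x = (fine (f x))%:E.
  have := Lnorm_lty_ae p0 mf f0; rewrite ltey => /(_ foo).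
  by apply: filterS => x h; rewrite fineK// ge0_fin_numE.
have aeg : \forall x \ae mu, g x = (fine (g x))%:E.
  have := Lnorm_lty_ae p0 mg g0; rewrite ltey => /(_ goo).
  by apply: filterS => x h; rewrite fineK// ge0_fin_numE.
have mF : measurable_fun setT (fine \o f) by exact: measurableT_comp.
have mG : measurable_fun setT (fine \o g) by exact: measurableT_comp.
have F0 x : 0 <= (fine (f x))%:E by rewrite lee_fin fine_ge0.
have G0 x : 0 <= (fine (g x))%:E by rewrite lee_fin fine_ge0.
have := eminkowski mu mF mG p1.
have -> : Lnorm mu p (EFin \o (fine \o f)) = Lnorm mu p f.
  apply/esym/eq_Lnorm_ae => //; exact/measurable_EFinP.
have -> : Lnorm mu p (EFin \o (fine \o g)) = Lnorm mu p g.
  apply/esym/eq_Lnorm_ae => //; exact/measurable_EFinP.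
apply: le_trans; rewrite le_eqVlt; apply/orP; left; apply/eqP.
apply: eq_Lnorm_ae => //.
- exact: emeasurable_funD.
- by apply/measurable_EFinP/measurable_funD.
- by move=> x; rewrite adde_ge0.
- by move=> x; rewrite /= EFinD adde_ge0.
- by apply: aeS2 aef aeg => x /= {1}-> {1}->; rewrite -EFinD.
Qed.

Lemma Lnorm_series p (f_ : (T -> \bar R)^nat) : 1 <= p ->
  (forall n, measurable_fun setT (f_ n)) -> (forall n x, 0 <= f_ n x) ->
  Lnorm mu p (fun x => \sum_(0 <= n <oo) f_ n x) <=
  \sum_(0 <= n <oo) Lnorm mu p (f_ n).
Proof.
move=> p1 mf f0; have p0 : 0 < p by exact: lt_le_trans p1.
apply: (@Lnorm_nd p (fun n x => \sum_(0 <= k < n) f_ k x)) => //.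
- by apply: nneseries_ge0 => n _ _; exact: Lnorm_ge0.
- by move=> n; exact: emeasurable_sum.
- by move=> n x; exact: sume_ge0.
- by move=> x; apply: ereal_nondecreasing_series.
- move=> n; apply: (@le_trans _ _ (\sum_(0 <= k < n) Lnorm mu p (f_ k))).
    elim: n => [|n ih].
      rewrite big_geq//; under eq_fun do rewrite big_geq//.
      by rewrite (Lnorm0 mu) ?gt_eqF.
    rewrite big_nat_recr//=; under eq_fun do rewrite big_nat_recr//=.
    apply: le_trans (leeD ih (lexx _)); apply: ge0_LnormD => //.
      exact: emeasurable_sum.
    by move=> x; exact: sume_ge0.
  apply: (@le_limn_nd (fun n => \sum_(0 <= k < n) Lnorm mu p (f_ k)) n).
  by apply: ereal_nondecreasing_series => k _ _; exact: Lnorm_ge0.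
Qed.

End Lnorm_nonneg.

(** * Minkowski's integral inequality and measurability of slice norms *)

Section Lnorm_product.
Context {d1 d2} {T1 : measurableType d1} {T2 : measurableType d2} {R : realType}.
Context (m1 : {sigma_finite_measure set T1 -> \bar R}).
Context (m2 : {sigma_finite_measure set T2 -> \bar R}).
Local Open Scope ereal_scope.

Lemma measurable_section1 {d3} {T3 : measurableType d3} (F : T1 * T2 -> T3) y :
  measurable_fun setT F -> measurable_fun setT (fun x => F (x, y)).
Proof. by move=> mF; exact: (measurableT_comp mF (measurable_pair2 y)). Qed.

Lemma measurable_section2 {d3} {T3 : measurableType d3} (F : T1 * T2 -> T3) x :
  measurable_fun setT F -> measurable_fun setT (fun y => F (x, y)).
Proof. by move=> mF; exact: (measurableT_comp mF (measurable_pair1 x)). Qed.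

Lemma ge0_integral_eq0 {d} {T : measurableType d}
    (mu : {measure set T -> \bar R}) (f : T -> \bar R) :
  measurable_fun setT f -> (forall x, 0 <= f x) ->
  \int[mu]_x f x = 0 <-> (\forall x \ae mu, f x = 0).
Proof.
move=> mf f0; have := ae_eq_integral_abs mu measurableT mf.
under eq_integral do rewrite gee0_abs//.
move=> [h1 h2]; split=> [/h1|h].
  by apply: filterS => x; exact.
by apply: h2; apply: filterS h => x.
Qed.

Lemma ge0_integralMl {d} {T : measurableType d}
    (mu : {measure set T -> \bar R}) (k : R) (f : T -> R) : (0 <= k)%R ->
  measurable_fun setT f -> (forall x, (0 <= f x)%R) ->
  \int[mu]_x (k * f x)%:E = k%:E * \int[mu]_x (f x)%:E.
Proof.
move=> k0 mf f0; under eq_integral do rewrite EFinM.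
rewrite ge0_integralZl_EFin//; last exact/measurable_EFinP.
by move=> x _; rewrite lee_fin.
Qed.

(** Both statements say that an iterated integral of [G] vanishes, and Tonelli's theorem exchanges
    the order. *)
Lemma ae_ae_swap (G : T1 * T2 -> \bar R) : measurable_fun setT G ->
  (forall p, 0 <= G p) ->
  (\forall y \ae m2, \forall x \ae m1, G (x, y) = 0) ->
  \forall x \ae m1, \forall y \ae m2, G (x, y) = 0.
Proof.
move=> mG G0 h.
have h2 : \int[m2]_y \int[m1]_x G (x, y) = 0.
  apply/ge0_integral_eq0.
  - exact: (measurable_fun_fubini_tonelli_G G mG G0).
  - by move=> y; exact: integral_ge0.
  - apply: filterS h => y h; apply/ge0_integral_eq0 => //.
    exact: measurable_section1.
move: h2; rewrite -fubini_tonelli// => /ge0_integral_eq0 h2.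
have := h2 (measurable_fun_fubini_tonelli_F G mG G0) (fun x => integral_ge0 _ (fun y _ => G0 _)).
apply: filterS => x /ge0_integral_eq0; apply => //.
exact: measurable_section2.
Qed.

(** For finite [p] this is Tonelli's theorem. For [p = +oo] and [c >= 0], the norm of a slice
    exceeds [c] exactly when [G > c] on a subset of the slice of positive measure, that is, when the
    integral of the indicator [H] over the slice is positive. *)
Lemma measurable_Lnorm1 p (G : T1 * T2 -> \bar R) : 0 < p ->
  measurable_fun setT G -> (forall z, 0 <= G z) ->
  measurable_fun setT (fun y => Lnorm m1 p (fun x => G (x, y))).
Proof.
case: p => [r||//] r0 mG G0.
- under eq_fun do rewrite ge0_LnormE//.
  apply: measurable_fun_poweR.
  apply: (measurable_fun_fubini_tonelli_G (fun z => G z `^ r)).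
    exact: measurable_fun_poweR.
  by move=> z; exact: poweR_ge0.
- pose f y := Lnorm m1 +oo (fun x => G (x, y)).
  have f0 y : 0 <= f y by exact: Lnorm_ge0.
  move=> mD; apply: (measurability _ (ErealGenOInfty.measurableE R)) => //.
  move=> _ [_ [c ->] <-]; rewrite setTI.
  have [c0|c0] := ltP c%:E 0.
    rewrite (_ : _ @^-1` _ = setT); first exact: measurableT.
    apply/seteqP; split => // y _ /=; rewrite in_itv/= andbT.
    exact: lt_le_trans c0 (f0 y).
  pose A := [set z : T1 * T2 | c%:E < G z].
  pose H z := (\1_A z)%:E : \bar R.
  have mH : measurable_fun setT H.
    apply/measurable_EFinP; apply: measurable_indic.
    rewrite -[X in measurable X]setTI; exact: emeasurable_fun_o_infty.
  have H0 z : 0 <= H z by rewrite lee_fin.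
  rewrite (_ : _ @^-1` _ = [set y | 0 < \int[m1]_x H (x, y)]).
    rewrite -[X in measurable X]setTI; apply: emeasurable_fun_o_infty => //.
    exact: (measurable_fun_fubini_tonelli_G H mH H0).
  apply/seteqP; split => y /=; rewrite in_itv/= andbT => h.
    rewrite lt0e integral_ge0// andbT; apply/eqP => /ge0_integral_eq0 h2.
    move: h; rewrite ltNge => /negP; apply; apply/Lnorm_ley => //.
    have := h2 (measurable_section1 _ mH) (fun x => H0 _).
    apply: filterS => x; rewrite /H indicE; case: ltP => //.
    by move=> cG; rewrite mem_set// => -[/eqP]; rewrite oner_eq0.
  rewrite ltNge; apply/negP => /Lnorm_ley h2; move: h.
  suff -> : \int[m1]_x H (x, y) = 0 by rewrite ltxx.
  apply/ge0_integral_eq0 => //; first exact: measurable_section1.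
  have := h2 (fun x => G0 _) c0.
  apply: filterS => x Gc; rewrite /H indicE memNset//= => cG.
  by move: Gc; rewrite leNgt cG.
Qed.

(* Hoelder's inequality applied to [F = (F w^-a) w^a], [a = 1 - 1/r]. *)
Lemma Lnorm_integral_le (r : \bar R) (F : T1 * T2 -> R) (w : T2 -> R) :
  1 < r -> measurable_fun setT F -> (forall z, (0 <= F z)%R) ->
  measurable_fun setT w -> (forall y, (0 <= w y)%R) ->
  (forall y, Lnorm m1 r (fun x => (F (x, y))%:E) <= (w y)%:E) ->
  Lnorm m1 r (fun x => \int[m2]_y (F (x, y))%:E) <= \int[m2]_y (w y)%:E.
Proof.
move=> r1 mF F0 mw w0 Fw.
have mEF : measurable_fun setT (fun z => (F z)%:E) by exact/measurable_EFinP.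
have EF0 z : 0 <= (F z)%:E by rewrite lee_fin.
have intF0 x : 0 <= \int[m2]_y (F (x, y))%:E by exact: integral_ge0.
have mintF : measurable_fun setT (fun x => \int[m2]_y (F (x, y))%:E).
  exact: (measurable_fun_fubini_tonelli_F _ mEF EF0).
have W0 : 0 <= \int[m2]_y (w y)%:E by apply: integral_ge0 => y _; rewrite lee_fin.
case: r r1 Fw => [r||//] r1 Fw; last first.
  apply/Lnorm_ley => //.
  (* For [r = +oo] the hypothesis holds at each [y] for almost every [x]; the excess of [F] over [w]
     lets [ae_ae_swap] exchange the quantifiers. *)
  pose G z := (Num.max 0 (F z - w z.2))%:E : \bar R.
  have mG : measurable_fun setT G.
    apply/measurable_EFinP; apply: measurable_maxr => //.
    by apply: measurable_funB => //; exact: measurableT_comp.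
  have G0 z : 0 <= G z by rewrite lee_fin le_max lexx.
  have : \forall x \ae m1, \forall y \ae m2, G (x, y) = 0.
    apply: ae_ae_swap => //; apply: aeW => y.
    have := (Lnorm_ley m1 (fun x => EF0 (x, y)) _).1 (Fw y).
    rewrite lee_fin => /(_ (w0 y)); apply: filterS => x.
    by rewrite lee_fin /G -subr_le0 => h; congr EFin; exact/max_idPl.
  apply: filterS => x h; apply: ae_ge0_le_integral => //.
  - exact: (measurable_section2 _ mEF).
  - by move=> y _; rewrite lee_fin.
  - exact/measurable_EFinP.
  - apply: filterS h => y + _; rewrite lee_fin => -[/max_idPl].
    by rewrite subr_le0.
rewrite lte_fin in r1.
have r0 : (0 < r)%R by exact: lt_trans r1.
apply/Lnorm_le_fin => //.
have [Woo|Woo] := eqVneq (\int[m2]_y (w y)%:E) +oo.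
  by rewrite Woo poweRyr ?gt_eqF// leey.
have Wfin : \int[m2]_y (w y)%:E \is a fin_num by rewrite ge0_fin_numE// ltey.
pose a := ((r - 1) / r)%R.
pose A := [set z : T1 * T2 | w z.2 = 0%R].
pose G z := (F z * \1_A z)%:E : \bar R.
have mw2 : measurable_fun setT (fun z : T1 * T2 => w z.2) by exact: measurableT_comp.
have mG : measurable_fun setT G.
  apply/measurable_EFinP; apply: measurable_funM => //; apply: measurable_indic.
  rewrite -[X in measurable X]setTI; exact: (mw2 _ [set 0%R]).
have G0 z : 0 <= G z by rewrite lee_fin mulr_ge0.
(* Where [w] vanishes its powers no longer recombine to 1, but there the slice of [F] has norm 0, so
   [F] is 0 almost everywhere on it. *)
have aeG : \forall x \ae m1, \forall y \ae m2, G (x, y) = 0.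
  apply: ae_ae_swap => //; apply: aeW => y.
  have [wy|wy] := eqVneq (w y) 0%R; last first.
    by apply: aeW => x; rewrite /G indicE memNset ?mulr0//=; exact/eqP.
  have : Lnorm m1 r%:E (fun x => (F (x, y))%:E) = 0.
    by apply/eqP; rewrite eq_le Lnorm_ge0 andbT; have := Fw y; rewrite wy.
  move/ge0_Lnorm_eq0; rewrite lte_fin => /(_ r0 (measurable_section1 _ mEF) (fun x => EF0 _)).
  by apply: filterS => x h; rewrite /G EFinM h mul0e.
(* The [r]-th power of the factor [F w^-a], since [a r = r - 1]; its integral in [x] is at most
   [w^(1-r) w^r = w]. *)
pose K z := (F z `^ r * w z.2 `^ (1 - r))%R.
have K0 z : (0 <= K z)%R by rewrite mulr_ge0 ?powR_ge0.
have mpow (s : R) d' (T : measurableType d') (f : T -> R) : measurable_fun setT f ->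
    measurable_fun setT (fun x => f x `^ s)%R.
  exact: (@measurableT_comp _ _ _ _ _ _ (@powR R ^~ s)).
have mK : measurable_fun setT (fun z => (K z)%:E).
  by apply/measurable_EFinP; apply: measurable_funM; exact: mpow.
have EK0 z : 0 <= (K z)%:E by rewrite lee_fin.
have key : \forall x \ae m1, (\int[m2]_y (F (x, y))%:E) `^ r <=
    (\int[m2]_y (w y)%:E) `^ (r - 1) * \int[m2]_y (K (x, y))%:E.
  apply: filterS aeG => x aeG.
  pose f y := (F (x, y) * w y `^ (- a))%R. pose g y := (w y `^ a)%R.
  have mf : measurable_fun setT f.
    by apply: measurable_funM; [exact: measurable_section2|exact: mpow].
  have mg : measurable_fun setT g by exact: mpow.
  have f0 y : (0 <= f y)%R by rewrite mulr_ge0 ?powR_ge0.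
  have g0 y : (0 <= g y)%R by rewrite powR_ge0.
  have rr : (0 < r / (r - 1))%R by rewrite divr_gt0// subr_gt0.
  have a0 : (a != 0)%R by rewrite mulf_neq0 ?invr_neq0 ?subr_eq0 ?gt_eqF.
  have rne : r != 0%R by rewrite gt_eqF.
  have r1ne : (r - 1 != 0)%R by rewrite subr_eq0 gt_eqF.
  have := hoelder m2 mf mg r0 rr _.
  have -> : (r^-1 + (r / (r - 1))^-1 = 1)%R.
    by rewrite invf_div -[X in (X + _)%R]mul1r -mulrDl addrC subrK mulfV.
  move=> /(_ erefl).
  rewrite Lnorm1 ge0_LnormE; last by move=> y; rewrite /= lee_fin.
  rewrite ge0_LnormE; last by move=> y; rewrite /= lee_fin.
  have -> : \int[m2]_y `|(EFin \o (f \* g)%R) y| = \int[m2]_y (F (x, y))%:E.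
    apply: ge0_ae_eq_integral => //=.
    - by apply/measurable_EFinP; apply: measurableT_comp => //; exact: measurable_funM.
    - exact: (measurable_section2 _ mEF).
    - apply: filterS aeG => y Gy _.
      have -> : (`|f y * g y| = F (x, y) * (w y `^ (- a) * w y `^ a))%R.
        rewrite ger0_norm; first by rewrite /f /g; ring.
        exact: mulr_ge0.
      have [wy|wy] := eqVneq (w y) 0%R.
        move: Gy; rewrite /G indicE mem_set//= mulr1 => -[->].
        by rewrite mul0r.
      by rewrite -powRD ?addNr ?powRr0 ?mulr1// wy implybT.
  have -> : \int[m2]_y (EFin \o f) y `^ r = \int[m2]_y (K (x, y))%:E.
    apply: eq_integral => y _; rewrite poweR_EFin powRM ?powR_ge0// -powRrM.
    by rewrite /K /=; congr (_ * _ `^ _)%:E; rewrite /a; field.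
  have -> : \int[m2]_y (EFin \o g) y `^ (r / (r - 1)) = \int[m2]_y (w y)%:E.
    apply: eq_integral => y _; rewrite /= -powRrM.
    have -> : (a * (r / (r - 1)) = 1)%R by rewrite /a; field; rewrite r1ne rne.
    by rewrite powRr1.
  move=> h; apply: (le_trans (lee_poweR (ltW r0) (intF0 x) h)).
  rewrite poweRM ?poweR_ge0// -!poweRrM mulVf// poweRe1; last first.
    by apply: integral_ge0 => y _.
  by rewrite invf_div divfK// muleC.
apply: (@le_trans _ _ (\int[m1]_x ((\int[m2]_y (w y)%:E) `^ (r - 1) *
    \int[m2]_y (K (x, y))%:E))).
  have mKF := measurable_fun_fubini_tonelli_F (m2 := m2) _ mK EK0.
  apply: ae_ge0_le_integral => //.
  - by move=> x _; exact: poweR_ge0.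
  - exact: measurable_fun_poweR.
  - by move=> x _; rewrite mule_ge0 ?poweR_ge0//; exact: integral_ge0.
  - exact: measurable_funeM.
  - by apply: filterS key.
rewrite ge0_integralZl//; last 3 first.
- exact: (measurable_fun_fubini_tonelli_F (m2 := m2) _ mK EK0).
- by move=> x _; exact: integral_ge0.
- exact: poweR_ge0.
rewrite (fubini_tonelli (fun z => (K z)%:E))//.
have -> : (\int[m2]_y (w y)%:E) `^ r =
    (\int[m2]_y (w y)%:E) `^ (r - 1) * \int[m2]_y (w y)%:E.
  rewrite -[in X in _ = _ * X](poweRe1 W0) -poweRD ?subrK//.
  by rewrite add_neq0_poweRD_def// subrK gt_eqF.
apply: lee_wpmul2l; first exact: poweR_ge0.
apply: ge0_le_integral => //.
- by move=> y _; exact: integral_ge0.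
- exact: (measurable_fun_fubini_tonelli_G (m1 := m1) _ mK EK0).
- exact/measurable_EFinP.
- move=> y _.
  under eq_integral do rewrite /K /= EFinM muleC.
  rewrite ge0_integralZl_EFin ?powR_ge0//; last 2 first.
  + by move=> x _; rewrite lee_fin powR_ge0.
  + by apply/measurable_EFinP/mpow; exact: measurable_section1.
  have := (Lnorm_le_fin m1 r0 (fun x => EF0 (x, y)) _).1 (Fw y).
  rewrite lee_fin => /(_ (w0 y)) h.
  apply: (@le_trans _ _ ((w y `^ (1 - r))%:E * (w y)%:E `^ r)).
    by apply: lee_wpmul2l => //; rewrite lee_fin powR_ge0.
  rewrite poweR_EFin -EFinM lee_fin.
  have [->|wy] := eqVneq (w y) 0%R; first by rewrite (powR0 (lt0r_neq0 r0)) mulr0.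
  by rewrite -powRD ?subrK ?powRr1// wy implybT.
Qed.

End Lnorm_product.

(** * Integrals of powers on the line *)

Section real_integrals.
Context {R : realType}.
Notation mu := (@lebesgue_measure R).
Implicit Types (f : R -> \bar R).

Lemma lebesgue_measure_translate (tau : R) (A : set (RM R)) : measurable A ->
  lebesgue_measure A =
  pushforward lebesgue_measure (fun t : RM R => (t - tau : RM R)) A.
Proof.
have mphi : measurable_fun setT (fun t : RM R => (t - tau : RM R)).
  by apply: measurable_funB => //; exact: measurable_cst.
pose nu : {measure set (RM R) -> \bar R} :=
  measure_function_pushforward__canonical__measure_function_Measure
    (@lebesgue_measure R) mphi.
move=> mA; apply: (@lebesgue_measure_unique R nu) => // _ [[a b]] _ <- /=.
rewrite /pushforward.
rewrite (_ : _ @^-1` _ = [set` `]a + tau, b + tau]]); last first.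
  by apply/seteqP; split=> t /=; rewrite !in_itv/= ltrBrDr lerBlDr.
rewrite !lebesgue_measure_itv /= !lte_fin ltrD2r; case: ifP => // _.
by rewrite -!EFinB; congr EFin; ring.
Qed.

Lemma ge0_integral_translate f (tau : R) : measurable_fun setT f ->
  (forall t, 0 <= f t)%E -> (\int[mu]_t f (t - tau)%R = \int[mu]_t f t)%E.
Proof.
move=> mf f0.
have mphi : measurable_fun setT (fun t : RM R => (t - tau : RM R)).
  by apply: measurable_funB => //; exact: measurable_cst.
have := @ge0_integral_pushforward _ _ _ _ _ _ mphi mu setT f measurableT mf
  (fun y _ => f0 y).
rewrite preimage_setT => <-.
by apply: eq_measure_integral => A mA _; exact/esym/lebesgue_measure_translate.
Qed.

Lemma ge0_integral_opp f : measurable_fun setT f ->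
  (forall t, 0 <= f t)%E -> (\int[mu]_t f (- t)%R = \int[mu]_t f t)%E.
Proof.
move=> mf f0.
have mphi : measurable_fun setT (-%R : RM R -> RM R) by [].
have := @ge0_integral_pushforward _ _ _ _ _ _ mphi mu setT f measurableT mf
  (fun y _ => f0 y).
rewrite preimage_setT => <-.
by apply: eq_measure_integral => A mA _; exact: lebesgue_measureN.
Qed.

Lemma ge0_integral_reflect f (t : R) : measurable_fun setT f ->
  (forall s, 0 <= f s)%E -> (\int[mu]_s f (t - s)%R = \int[mu]_s f s)%E.
Proof.
move=> mf f0.
rewrite -(ge0_integral_opp (f := fun s => f (t - s)))//; last first.
  by apply: measurableT_comp => //; exact: measurable_funB.
under eq_integral do rewrite opprK -[X in (X + _)]opprK addrC.
exact: ge0_integral_translate.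
Qed.

Lemma ge0_integral_even f : measurable_fun setT f ->
  (forall t, 0 <= f t)%E -> (forall t, f (- t)%R = f t) ->
  (\int[mu]_t f t = 2%:E * \int[mu]_(t in `[0%R, +oo[) f t)%E.
Proof.
move=> mf f0 fN.
have -> : [set: R] = `]-oo, 0%R[ `|` `[0%R, +oo[.
  apply/seteqP; split => // t _ /=; rewrite !in_itv/= andbT.
  by case: (ltP t 0) => h; [left|right].
rewrite ge0_integral_setU//=; last first.
- rewrite disj_set2E; apply/eqP/seteqP; split => // t /=.
  by rewrite !in_itv/= andbT => -[]; rewrite ltNge => /negP.
- exact: measurable_funTS.
rewrite integral_itv_bndo_bndc; last exact: measurable_funTS.
have h := ge0_integration_by_substitution0 mf f0.
have {}h : (\int[mu]_(r in `]-oo, 0%R]) f r = \int[mu]_(r in `[0%R, +oo[) f r)%E.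
  by rewrite h; apply: eq_integral => r _; rewrite fN.
by rewrite h -mule2n mule_natl.
Qed.

Lemma cvg_powR_pinfty (c : R) : 0 < c -> x `^ (- c) @[x --> +oo] --> (0 : R).
Proof.
move=> c0; apply/cvgrPdist_le => /= e e0; near=> x.
have x0 : 0 < x by near: x; exact: nbhs_pinfty_gt.
rewrite sub0r normrN ger0_norm ?powR_ge0//.
rewrite powRN invf_ple ?posrE ?powR_gt0//.
have -> : e^-1 = (e^-1 `^ (c^-1)) `^ c.
  by rewrite -powRrM mulVf ?gt_eqF// powRr1// invr_ge0 ltW.
apply: ge0_ler_powR; rewrite ?nnegrE ?powR_ge0 ?ltW//.

Unshelve. all: by end_near. Qed.

Lemma continuous_powR (c x : R) : 0 < x -> {for x, continuous (fun u : R => u `^ c)}.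
Proof.
move=> x0; apply: differentiable_continuous; apply/derivable1_diffP.
by apply: derivable_powR; rewrite in_itv/= x0.
Qed.

Lemma integral_powR_tail (c m : R) : 0 < c -> 0 < m ->
  (\int[mu]_(u in `[m, +oo[) (u `^ (- 1 - c))%R%:E = (m `^ (- c) / c)%:E)%E.
Proof.
move=> c0 m0.
rewrite (@ge0_continuous_FTC2y _ _ (fun u => u `^ (- c) * - c^-1) m 0).
- by rewrite -EFinB sub0r mulrN opprK.
- by move=> x _; exact: powR_ge0.
- apply: continuous_in_subspaceT => x; rewrite inE/= in_itv/= andbT => mx.
  by apply: continuous_powR; exact: lt_le_trans mx.
- rewrite -[X in _ --> X](mul0r (- c^-1)); apply: cvgMr_tmp.
  exact: cvg_powR_pinfty.
- move=> x mx; apply: derivableM => //.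
  by apply: derivable_powR; rewrite in_itv/= (lt_trans m0 mx).
- apply: cvg_at_right_filter; apply: cvgMr_tmp.
  exact: continuous_powR.
- move=> x; rewrite in_itv/= andbT => mx.
  have x0 : 0 < x by exact: lt_trans mx.
  rewrite derive1Mr; last by apply: derivable_powR; rewrite in_itv/= x0.
  rewrite powR_derive1; last by rewrite in_itv/= x0.
  rewrite mulrN mulNr mulNr opprK mulrAC mulfV ?gt_eqF// mul1r.
  by congr (_ `^ _); ring.
Qed.

(** The fundamental theorem of calculus applies on [[1/(n+1), rho]], away from the singularity, and
    monotone convergence removes the lower end. At [u = 0] the integrand is 0, the convention for a
    nonzero power of 0. *)
Lemma integral_powR_near (l rho : R) : 0 < l < 1 -> 0 < rho ->
  (\int[mu]_(u in `[0%R, rho]) (u `^ (- l))%R%:E <=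
   (rho `^ (1 - l) / (1 - l))%:E)%E.
Proof.
move=> /andP[l0 l1] rho0.
have l1' : 0 < 1 - l by rewrite subr_gt0.
pose g (n : nat) (u : R) : \bar R :=
  ((u `^ (- l)) * \1_(`[n.+1%:R^-1, rho]%classic) u)%:E.
have mp : measurable_fun setT (fun u : R => u `^ (- l)).
  exact: measurable_powR.
have mg n : measurable_fun setT (g n).
  by apply/measurable_EFinP; apply: measurable_funM.
have g0 n u : (0 <= g n u)%E by rewrite lee_fin mulr_ge0 ?powR_ge0.
have ndg u : nondecreasing_seq (g ^~ u).
  move=> m n mn; rewrite lee_fin ler_wpM2l ?powR_ge0// !indicE ler_nat.
  rewrite !mem_setE !in_itv/=; case: (boolP (_ <= u <= _)) => // /andP[mu ->].
  by rewrite (le_trans _ mu)// lef_pV2 ?posrE// ler_nat.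
apply: (@le_trans _ _ (\int[mu]_u limn (g ^~ u))%E).
  rewrite integral_mkcond; apply: ge0_le_integral => //.
  - by move=> x _; apply: erestrict_ge0 => y _; rewrite lee_fin powR_ge0.
  - by apply/(measurable_restrictT _ _).1 => //; exact/measurable_funTS/measurable_EFinP.
  - by apply: (emeasurable_fun_cvg g) => // x _; exact: ereal_nondecreasing_is_cvgn.
  - move=> u _; rewrite patchE; case: ifPn => [|_]; last first.
      by apply: lime_ge; [exact: ereal_nondecreasing_is_cvgn|exact: nearW].
    rewrite inE/= in_itv/= => /andP[]; rewrite le_eqVlt => /predU1P[<- _|u0 urho].
      rewrite powR0 ?oppr_eq0 ?gt_eqF//.
      by apply: lime_ge; [exact: ereal_nondecreasing_is_cvgn|exact: nearW].
    pose n := Num.truncn u^-1.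
    apply: le_trans (le_limn_nd n (ndg u)).
    rewrite lee_fin indicE mem_set ?mulr1//= in_itv/= urho andbT.
    rewrite invf_ple ?posrE//.
    by rewrite ltW// truncnS_gt.
rewrite monotone_convergence//.
apply: lime_le.
  apply: ereal_nondecreasing_is_cvgn => m n mn.
  by apply: ge0_le_integral => //; [exact: mg|exact: mg|move=> x _; exact: ndg].
apply: nearW => n.
pose e : R := n.+1%:R^-1.
have e0 : 0 < e by rewrite invr_gt0.
have -> : (\int[mu]_u g n u = \int[mu]_(u in `[e, rho]) (u `^ (- l))%R%:E)%E.
  rewrite [RHS]integral_mkcond; apply: eq_integral => u _.
  by rewrite patchE /g indicE; case: ifPn; rewrite ?mulr1 ?mulr0.
have [erho|] := ltP e rho; last first.
  rewrite le_eqVlt => /predU1P[->|re]; last first.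
    by rewrite set_itv_ge ?integral_set0 ?lee_fin ?divr_ge0 ?powR_ge0 ?ltW// -ltNge.
  by rewrite set_itv1 integral_set1 lee_fin divr_ge0 ?powR_ge0 ?ltW.
rewrite (@continuous_FTC2 _ _ (fun u => u `^ (1 - l) * (1 - l)^-1))//.
- by rewrite -EFinB lee_fin lerBlDr lerDl mulr_ge0 ?powR_ge0 ?invr_ge0 ?ltW.
- apply: continuous_in_subspaceT => x; rewrite inE/= in_itv/= => /andP[ex _].
  by apply: continuous_powR; exact: lt_le_trans ex.
- split.
  + move=> x; rewrite in_itv/= => /andP[ex _]; apply: derivableM => //.
    by apply: derivable_powR; rewrite in_itv/= (lt_trans e0 ex).
  + by apply: cvg_at_right_filter; apply: cvgMr_tmp; exact: continuous_powR.
  + by apply: cvg_at_left_filter; apply: cvgMr_tmp; exact: continuous_powR.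
- move=> x; rewrite in_itv/= => /andP[ex _].
  have x0 : 0 < x by exact: lt_trans ex.
  rewrite derive1Mr; last by apply: derivable_powR; rewrite in_itv/= x0.
  rewrite powR_derive1; last by rewrite in_itv/= x0.
  rewrite mulrAC mulfV ?gt_eqF// mul1r.
  by congr (_ `^ _); ring.
Qed.

End real_integrals.

(** * Measurability of elementary expressions *)

Section measurability_helpers.
Context {d} {T : measurableType d} {R : realType}.
Implicit Types f g : T -> R.

Lemma measurable_ltR f g : measurable_fun setT f -> measurable_fun setT g ->
  measurable_fun setT (fun x => (f x < g x)%R%:R : R).
Proof.
move=> mf mg; apply: (@measurableT_comp _ _ _ _ _ _ (fun b : bool => b%:R : R)) => //.
exact: measurable_fun_ltr.
Qed.

Lemma measurable_leR f g : measurable_fun setT f -> measurable_fun setT g ->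
  measurable_fun setT (fun x => (f x <= g x)%R%:R : R).
Proof.
move=> mf mg; apply: (@measurableT_comp _ _ _ _ _ _ (fun b : bool => b%:R : R)) => //.
exact: measurable_fun_ler.
Qed.

Lemma measurable_funpowR (c : R) f : measurable_fun setT f ->
  measurable_fun setT (fun x => f x `^ c).
Proof. exact: (@measurableT_comp _ _ _ _ _ _ (@powR R ^~ c)). Qed.

Lemma measurable_funnorm f : measurable_fun setT f ->
  measurable_fun setT (fun x => `|f x|).
Proof. by move=> mf; exact: measurableT_comp. Qed.

Lemma measurable_funcos f : measurable_fun setT f ->
  measurable_fun setT (fun x => cos (f x)).
Proof.
apply: measurableT_comp; apply: continuous_measurable_fun.
exact: continuous_cos.
Qed.

Lemma measurable_funsin f : measurable_fun setT f ->
  measurable_fun setT (fun x => sin (f x)).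
Proof.
apply: measurableT_comp; apply: continuous_measurable_fun.
exact: continuous_sin.
Qed.

End measurability_helpers.

Ltac mfun := lazymatch goal with
  | |- measurable_fun _ (fun x => fst (@?f x)) =>
      apply: (measurableT_comp measurable_fst); mfun
  | |- measurable_fun _ (fun x => snd (@?f x)) =>
      apply: (measurableT_comp measurable_snd); mfun
  | |- measurable_fun _ (fun x => EFin (@?f x)) => apply/measurable_EFinP; mfun
  | |- measurable_fun _ (fun x => GRing.mul (@?f x) (@?g x)) =>
      apply: measurable_funM; [mfun|mfun]
  | |- measurable_fun _ (fun x => GRing.add (@?f x) (GRing.opp (@?g x))) =>
      apply: measurable_funB; [mfun|mfun]
  | |- measurable_fun _ (fun x => GRing.add (@?f x) (@?g x)) =>
      apply: measurable_funD; [mfun|mfun]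
  | |- measurable_fun _ (fun x => powR (@?f x) ?c) =>
      apply: (measurable_funpowR c); mfun
  | |- measurable_fun _ (fun x => cos (@?f x)) =>
      apply: measurable_funcos; mfun
  | |- measurable_fun _ (fun x => sin (@?f x)) =>
      apply: measurable_funsin; mfun
  | |- measurable_fun _ (fun x => GRing.exp (@?f x) ?n) =>
      apply: measurable_funX; mfun
  | |- measurable_fun _ (fun x => Num.norm (@?f x)) =>
      apply: measurable_funnorm; mfun
  | |- measurable_fun _ (fun x => GRing.natmul _ (nat_of_bool (_ < _)%R)) =>
      apply: measurable_ltR; [mfun|mfun]
  | |- measurable_fun _ (fun x => GRing.natmul _ (nat_of_bool (_ <= _)%R)) =>
      apply: measurable_leR; [mfun|mfun]
  | |- _ => first [assumption | exact: measurable_id | exact: measurable_cst | exact: measurable_fst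
                  | exact: measurable_snd
                  | match goal with H : measurable_fun _ ?h
                      |- measurable_fun _ (fun x => ?h (@?f x)) =>
                      apply: (measurableT_comp H); mfun end | idtac]
  end.

(** * Powers of the distance to a point of the line *)

Section radial_integrals.
Context {R : realType}.
Notation mu := (@lebesgue_measure R).

Lemma ge0_integral_radial (g : R -> R) (tau : R) : measurable_fun setT g ->
  (forall t, 0 <= g t) ->
  (\int[mu]_t (g `|t - tau|)%:E = 2%:E * \int[mu]_(t in `[0%R, +oo[) (g t)%:E)%E.
Proof.
move=> mg g0.
rewrite (ge0_integral_translate (f := fun t => (g `|t|)%:E)); last 2 first.
- by apply/measurable_EFinP; apply: measurableT_comp => //; exact: measurable_funnorm.
- by move=> t; rewrite lee_fin.
rewrite ge0_integral_even.
- congr (_ * _)%E; apply: eq_integral => t; rewrite inE/= in_itv/= andbT => t0.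
  by rewrite ger0_norm.
- by apply/measurable_EFinP; apply: measurableT_comp => //; exact: measurable_funnorm.
- by move=> t; rewrite lee_fin.
- by move=> t; rewrite normrN.
Qed.

Lemma integral_norm_near (l rho tau : R) : 0 < l < 1 -> 0 < rho ->
  (\int[mu]_t ((`|t - tau| `^ (- l)) * (`|t - tau| < rho)%R%:R)%:E <=
   (2 / (1 - l) * rho `^ (1 - l))%:E)%E.
Proof.
move=> l01 rho0.
rewrite (ge0_integral_radial (g := fun s => s `^ (- l) * (s < rho)%R%:R)).
- rewrite mulrAC -mulrA EFinM lee_pmul2l//.
  apply: le_trans (integral_powR_near l01 rho0).
  rewrite integral_mkcond [leRHS]integral_mkcond.
  have m1 : measurable_fun setT (fun u : R => (u `^ (- l))%:E).
    by apply/measurable_EFinP; exact: measurable_powR.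
  apply: ge0_le_integral => //.
  + by move=> u _; apply: erestrict_ge0 => y _; rewrite lee_fin mulr_ge0 ?powR_ge0.
  + apply/(measurable_restrictT _ _).1 => //; apply: measurable_funTS.
    by mfun.
  + by apply/(measurable_restrictT _ _).1 => //; exact: measurable_funTS.
  + move=> u _; rewrite !patchE !mem_setE !in_itv/= andbT.
    case: (leP 0 u) => //= u0; case: (ltP u rho) => ur.
      by rewrite (ltW ur) mulr1.
    by rewrite mulr0; case: ifP; rewrite // lee_fin powR_ge0.
- by mfun.
- by move=> t; rewrite mulr_ge0 ?powR_ge0.
Qed.

Lemma integral_norm_far (c rho tau : R) : 0 < c -> 0 < rho ->
  (\int[mu]_t ((`|t - tau| `^ (- 1 - c)) * (rho <= `|t - tau|)%R%:R)%:E =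
   (2 / c * rho `^ (- c))%:E)%E.
Proof.
move=> c0 rho0.
rewrite (ge0_integral_radial (g := fun s => s `^ (- 1 - c) * (rho <= s)%R%:R)).
- rewrite mulrAC -mulrA EFinM; congr (_ * _)%E.
  rewrite -integral_powR_tail// integral_mkcond [RHS]integral_mkcond.
  apply: eq_integral => u _; rewrite !patchE !mem_setE !in_itv/= !andbT.
  case: (leP rho u) => ur; last by rewrite mulr0; case: ifP.
  by rewrite (le_trans (ltW rho0) ur) mulr1.
- by mfun.
- by move=> t; rewrite mulr_ge0 ?powR_ge0.
Qed.

End radial_integrals.

(** * The Hardy-Littlewood-Sobolev inequality in dimension one *)

Section HLS.
Context {R : realType}.
Notation mu := (@lebesgue_measure R).
Context (Q : R) (Q2 : 2 < Q).
Let p := Q / (Q - 1).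
Let l := 2 / Q.
Let Q0 : 0 < Q. Proof. by rewrite (lt_trans _ Q2). Qed.
Let Q1 : 0 < Q - 1. Proof. by rewrite subr_gt0 (lt_trans _ Q2)// ltr1n. Qed.
Let p0 : 0 < p. Proof. by rewrite divr_gt0. Qed.
Let l01 : 0 < l < 1. Proof. by rewrite divr_gt0//= ltr_pdivrMr// mul1r. Qed.
Let Qne : Q != 0. Proof. exact: lt0r_neq0. Qed.
Let Q1ne : Q - 1 != 0. Proof. exact: lt0r_neq0. Qed.

Context (h : R -> R) (mh : measurable_fun setT h) (h0 : forall t, 0 <= h t).
Context (H : R) (H0 : 0 < H).
Context (HE : (\int[mu]_t (h t `^ p)%:E = (H `^ p)%:E)%E).

Let I t := (\int[mu]_s (`|t - s| `^ (- l) * h s)%R%:E)%E.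
(** The exponent for which integrating the constant [B/2] over [rho >= (2DH/B)^Q] gives a multiple
    of [B^Q], because [Q/p = Q - 1]. The factor [(0 < rho)] confines the integral over the line to
    positive levels. *)
Let a (rho : R) : R := rho `^ (- 1 - p^-1) * (0 < rho)%R%:R.
Let phi (z : R * R * R) : R := a z.1.2 *
  ((`|z.1.1 - z.2| `^ (- l) * (`|z.1.1 - z.2| < z.1.2)%R%:R) *
   (h z.2 * (z.1.2 `^ (- p^-1) * H < h z.2)%R%:R)).
Let J rho t := (\int[mu]_s ((`|t - s| `^ (- l) * (`|t - s| < rho)%R%:R) *
   (h s * (rho `^ (- p^-1) * H < h s)%R%:R))%R%:E)%E.
Let D : R := 2 / (1 - l) + 2 `^ Q^-1.

Let D0 : 0 < D.
Proof.
by rewrite addr_gt0 ?powR_gt0// divr_gt0// subr_gt0; case/andP: l01.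
Qed.

(** The kernel is cut at distance [rho] and [h] at height [rho^(-1/p) H]. Near and low: the kernel
    has mass at most [2/(1-l) rho^(1-l)], and [1 - l - 1/p = -1/Q]. Far: Hoelder's inequality, the
    [Q]-th power of the kernel being [|t-s|^-2]. Both remainders scale as [rho^(-1/Q) H], whence the
    two terms of [D]; the near and high part is [J]. *)
Let hls_split (t rho : R) : 0 < rho ->
  (I t <= J rho t + (D * rho `^ (- Q^-1) * H)%:E)%E.
Proof.
move=> rho0.
pose f1 s := (`|t - s| `^ (- l) * (`|t - s| < rho)%R%:R) *
   (h s * (rho `^ (- p^-1) * H < h s)%R%:R).
pose f2 s := (rho `^ (- p^-1) * H) * (`|t - s| `^ (- l) * (`|t - s| < rho)%R%:R).
pose f3 s := (`|t - s| `^ (- l) * (rho <= `|t - s|)%R%:R) * h s.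
have mf1 : measurable_fun setT f1 by rewrite /f1; mfun.
have mf2 : measurable_fun setT f2 by rewrite /f2; mfun.
have mf3 : measurable_fun setT f3 by rewrite /f3; mfun.
have f10 s : 0 <= f1 s by rewrite !mulr_ge0 ?powR_ge0.
have f20 s : 0 <= f2 s by rewrite !mulr_ge0 ?powR_ge0 ?(ltW H0).
have f30 s : 0 <= f3 s by rewrite !mulr_ge0 ?powR_ge0.
apply: (@le_trans _ _ (\int[mu]_s ((f1 s)%:E + ((f2 s)%:E + (f3 s)%:E)))%E).
  apply: ge0_le_integral => //.
  - by move=> s _; rewrite lee_fin mulr_ge0 ?powR_ge0.
  - by mfun.
  - by apply/measurable_EFinP; apply: measurable_funD => //; apply: measurable_funD.
  - move=> s _; rewrite -!EFinD lee_fin /f1 /f2 /f3.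
    case: (ltP `|t - s| rho) => ts; rewrite ?mulr1 ?mulr0 ?mul0r ?addr0 ?add0r//.
    case: (ltP (rho `^ (- p^-1) * H) (h s)) => hs; rewrite ?mulr1 ?mulr0 ?add0r.
      by rewrite lerDl !mulr_ge0 ?powR_ge0 ?(ltW H0).
    by rewrite mulrC ler_wpM2r ?powR_ge0.
rewrite ge0_integralD//; last 4 first.
- by move=> s _; rewrite lee_fin.
- exact/measurable_EFinP.
- by move=> s _; rewrite -EFinD lee_fin addr_ge0.
- by apply/measurable_EFinP; apply: measurable_funD.
apply: leeD => //.
rewrite ge0_integralD//; last 4 first.
- by move=> s _; rewrite lee_fin.
- exact/measurable_EFinP.
- by move=> s _; rewrite lee_fin.
- exact/measurable_EFinP.
have -> : D * rho `^ (- Q^-1) * H = 2 / (1 - l) * rho `^ (- Q^-1) * H +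
    2 `^ Q^-1 * rho `^ (- Q^-1) * H by rewrite /D; ring.
rewrite EFinD; apply: leeD.
- rewrite /f2; under eq_integral do rewrite EFinM distrC.
  rewrite ge0_integralZl_EFin; last 4 first.
  + exact: measurableT.
  + by move=> s _; rewrite lee_fin mulr_ge0 ?powR_ge0.
  + by mfun.
  + by rewrite mulr_ge0 ?powR_ge0 ?(ltW H0).
  apply: le_trans (lee_wpmul2l _ (integral_norm_near t l01 rho0)) _.
    by rewrite lee_fin mulr_ge0 ?powR_ge0 ?(ltW H0).
  rewrite -EFinM lee_fin le_eqVlt; apply/orP; left; apply/eqP.
  have -> : - Q^-1 = - p^-1 + (1 - l) by rewrite /p /l; field; rewrite Qne Q1ne.
  by rewrite [rho `^ (- p^-1 + (1 - l))]powRD ?(gt_eqF rho0) ?implybT//; ring.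
- pose g (s : R) : R := `|t - s| `^ (- l) * (rho <= `|t - s|)%R%:R.
  have mg : measurable_fun setT g by rewrite /g; mfun.
  have g0 s : 0 <= g s by rewrite mulr_ge0 ?powR_ge0.
  have pQ : Q^-1 + p^-1 = 1 by rewrite /p; field; rewrite Qne Q1ne.
  have := hoelder mu mg mh Q0 p0 pQ.
  rewrite Lnorm1 ge0_LnormE; last by move=> s; rewrite /= lee_fin.
  rewrite ge0_LnormE; last by move=> s; rewrite /= lee_fin.
  have -> : (\int[mu]_x `|(EFin \o (g \* h)%R) x| = \int[mu]_x (f3 x)%:E)%E.
    by apply: eq_integral => s _; rewrite gee0_abs// lee_fin.
  have -> : (\int[mu]_x (EFin \o h) x `^ p = (H `^ p)%:E)%E by rewrite -HE.
  have -> : (\int[mu]_x (EFin \o g) x `^ Q = (2 * rho `^ (- 1))%:E)%E.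
    transitivity (\int[mu]_s (`|s - t| `^ (- 1 - 1) * (rho <= `|s - t|)%R%:R)%R%:E)%E.
      apply: eq_integral => s _ /=; rewrite distrC.
      rewrite powRM ?powR_ge0// -powRrM; congr (_ `^ _ * _)%:E.
        by rewrite /l; field.
      by case: (_ <= _); rewrite ?powR1// powR0.
    by rewrite integral_norm_far// divr1.
  move=> hh; apply: (le_trans hh).
  rewrite !poweR_EFin -EFinM lee_fin powRM ?powR_ge0// -!powRrM mulfV ?gt_eqF//.
  by rewrite powRr1 ?(ltW H0)// mulN1r.
Qed.

Let a0 rho : 0 <= a rho. Proof. by rewrite mulr_ge0 ?powR_ge0. Qed.

Let ma : measurable_fun setT a. Proof. by rewrite /a; mfun. Qed.

Let phi0 z : 0 <= phi z.
Proof. by rewrite mulr_ge0// !mulr_ge0 ?powR_ge0. Qed.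

Let mphi : measurable_fun setT phi.
Proof. by rewrite /phi; mfun. Qed.

Let phiJ t rho : (\int[mu]_s (phi (t, rho, s))%:E = (a rho)%:E * J rho t)%E.
Proof.
rewrite /phi /J; under eq_integral do rewrite /= EFinM.
rewrite ge0_integralZl_EFin//.
- by move=> s _; rewrite lee_fin !mulr_ge0 ?powR_ge0.
- by mfun.
Qed.

Let mphiJ : measurable_fun setT
  (fun z : R * R => \int[mu]_s (phi (z.1, z.2, s))%:E)%E.
Proof.
rewrite (_ : (fun _ => _) = (fun z => \int[mu]_s (phi (z, s))%:E)%E); last first.
  by apply/funext => -[].
apply: (measurable_fun_fubini_tonelli_F (m2 := mu) (fun z : (R * R) * R => (phi z)%:E)).
  exact/measurable_EFinP.
by move=> z; rewrite lee_fin.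
Qed.

(** If [I t >= B], the remainder in [hls_split] is at most [B/2] once [rho >= (2DH/B)^Q], so
    [J rho t >= B/2] for all these [rho]. Integration against [a] turns this into a bound on [B^Q],
    without any weak-type inequality. *)
Let hls_pointwise (t : R) :
  (I t `^ Q <= (2 / p * (2 * D * H) `^ (Q - 1))%:E *
     \int[mu]_rho \int[mu]_s (phi (t, rho, s))%:E)%E.
Proof.
have I0 : (0 <= I t)%E.
  by apply: integral_ge0 => s _; rewrite lee_fin mulr_ge0 ?powR_ge0.
set c := 2 / p * _; set E := (\int[mu]_rho _)%E.
have E0 : (0 <= E)%E.
  by apply: integral_ge0 => rho _; apply: integral_ge0 => s _; rewrite lee_fin.
have c0 : 0 < c by rewrite mulr_gt0 ?divr_gt0 ?powR_gt0 ?mulr_gt0.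
have key (B : R) : 0 < B -> (B%:E <= I t)%E -> ((B `^ Q)%:E <= c%:E * E)%E.
  move=> B0 BI; pose rB := (2 * D * H / B) `^ Q.
  have rB0 : 0 < rB by rewrite powR_gt0// divr_gt0// !mulr_gt0.
  have JB rho : rB <= rho -> ((B / 2)%:E <= J rho t)%E.
    move=> rBr; have rho0 : 0 < rho by exact: lt_le_trans rBr.
    have := le_trans BI (hls_split t rho0).
    rewrite -leeBlDr// => h1; apply: le_trans h1.
    rewrite -EFinB lee_fin lerBrDr -lerBrDl.
    have -> : B - B / 2 = B / 2 by field.
    have : rho `^ (- Q^-1) <= B / (2 * D * H).
      rewrite powRN invf_ple ?posrE ?powR_gt0 ?divr_gt0 ?mulr_gt0// invf_div.
      rewrite -[leLHS]powRr1 ?divr_ge0 ?mulr_ge0 ?(ltW D0) ?(ltW H0) ?(ltW B0)//.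
      rewrite -[X in _ `^ X](mulfV Qne) powRrM.
      apply: ge0_ler_powR; rewrite ?nnegrE ?powR_ge0 ?invr_ge0 ?(ltW Q0)//.
      exact: ltW.
    rewrite ler_pdivlMr ?mulr_gt0// => h1.
    by rewrite ler_pdivlMr//; apply: le_trans h1; rewrite le_eqVlt; apply/orP; left; apply/eqP; ring.
  apply: (@le_trans _ _ (c%:E * \int[mu]_(rho in `[rB, +oo[) ((B / 2) * rho `^ (- 1 - p^-1))%:E)%E).
    under eq_integral do rewrite EFinM.
    rewrite ge0_integralZl_EFin; last 4 first.
    - exact: measurable_itv.
    - by move=> rho _; rewrite lee_fin powR_ge0.
    - by apply/measurable_funTS/measurable_EFinP; exact: measurable_powR.
    - by rewrite divr_ge0// ltW.
    rewrite integral_powR_tail ?invr_gt0// -!EFinM lee_fin.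
    rewrite /c /rB -powRrM invrK.
    have -> : Q * - p^-1 = - (Q - 1) by rewrite /p; field; rewrite Qne Q1ne.
    have X0 : 0 < 2 * D * H by rewrite !mulr_gt0.
    have -> : (2 * D * H / B) `^ (- (Q - 1)) =
        B `^ (Q - 1) / (2 * D * H) `^ (Q - 1).
      rewrite powRM ?invr_ge0 ?(ltW B0) ?(ltW X0)// -(powR_inv1 (ltW B0)) -powRrM.
      by rewrite mulrNN mul1r powRN mulrC.
    have -> : B `^ Q = B * B `^ (Q - 1).
      by rewrite mulr_powRB1 ?(ltW B0).
    have : (2 * D * H) `^ (Q - 1) != 0.
      by rewrite gt_eqF// powR_gt0// !mulr_gt0.
    have pne : p != 0 by rewrite gt_eqF.
    move: (_ `^ (Q - 1)) (B `^ (Q - 1)) => u v une.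
    by rewrite le_eqVlt; apply/orP; left; apply/eqP; field; rewrite pne une.
  apply: lee_wpmul2l; first by rewrite lee_fin ltW.
  rewrite integral_mkcond; apply: ge0_le_integral => //.
  - move=> rho _; apply: erestrict_ge0 => y _.
    by rewrite lee_fin mulr_ge0 ?powR_ge0// divr_ge0// ltW.
  - apply/(measurable_restrictT _ _).1 => //; apply: measurable_funTS.
    by mfun.
  - have mm := (measurable_section2 (T3 := \bar R) t mphiJ).
    exact mm.
  - move=> rho _; rewrite patchE; case: ifPn; last first.
      by move=> _; apply: integral_ge0 => s _; rewrite lee_fin.
    rewrite inE/= in_itv/= andbT => rBr; rewrite phiJ mulrC EFinM /a.
    rewrite (lt_le_trans rB0 rBr) mulr1; apply: lee_wpmul2l; last exact: JB.
    by rewrite lee_fin powR_ge0.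
(* An infinite [I t] exceeds every [B]; if [E] were finite, [B^Q = c E + 1] would contradict
   [key]. *)
have [Ioo|Ioo] := eqVneq (I t) +oo%E.
  suff -> : (c%:E * E = +oo)%E by rewrite leey.
  apply/eqP; rewrite -leye_eq; apply: contraT; rewrite -ltNge => Elt.
  have Efin : (c%:E * E)%E \is a fin_num by rewrite ge0_fin_numE// mule_ge0// lee_fin ltW.
  pose B := (fine (c%:E * E) + 1) `^ Q^-1.
  have e0 : 0 <= fine (c%:E * E)%E by rewrite fine_ge0// mule_ge0// lee_fin ltW.
  have B0 : 0 < B by rewrite powR_gt0// ltr_wpDl.
  have := key B B0; rewrite Ioo leey => /(_ isT).
  rewrite -(fineK Efin) lee_fin /B -powRrM mulVf// powRr1 ?addr_ge0//.
  by rewrite gerDl ler10.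
have Ifin : I t \is a fin_num by rewrite ge0_fin_numE// ltey.
have [It0|It0] := eqVneq (I t) 0%E.
  by rewrite It0 poweR0r// mule_ge0// lee_fin ltW.
rewrite -(fineK Ifin) poweR_EFin; apply: key; last by rewrite fineK.
by rewrite fine_gt0// lt0e It0 I0 ltey.
Qed.

(** The bound for [phi] once integrated in [t]: the kernel truncated at distance [rho] contributes
    at most [2/(1-l) rho^(1-l)]. *)
Let psi (z : R * R) : R := 2 / (1 - l) * (a z.1 * z.1 `^ (1 - l) *
  (h z.2 * (z.1 `^ (- p^-1) * H < h z.2)%R%:R)).

Let psi0 z : 0 <= psi z.
Proof.
rewrite mulr_ge0 ?divr_ge0 ?subr_ge0//; first by case/andP: l01 => _ /ltW.
by rewrite !mulr_ge0 ?powR_ge0.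
Qed.

Let mpsi : measurable_fun setT psi.
Proof. by rewrite /psi; mfun. Qed.

(** The height condition [h s > rho^(-1/p) H] means [rho > (H/h s)^p], and the power of [rho] left
    is [-1 - 1/Q]. The tail integral gives [(H/h s)^(1-p)] since [p/Q = p - 1], and the factor [h s]
    completes it to [h s ^ p]. *)
Let hls_inner (s : R) : (\int[mu]_rho (psi (rho, s))%:E <=
  (2 * Q / (1 - l) * H `^ (1 - p) * h s `^ p)%:E)%E.
Proof.
have l1 : 0 < 1 - l by rewrite subr_gt0; case/andP: l01.
have := h0 s; rewrite le_eqVlt => /predU1P[hs|hs].
  rewrite integral0_eq ?lee_fin ?mulr_ge0 ?powR_ge0 ?invr_ge0 ?(ltW Q0) ?(ltW l1)//.
  by move=> rho _; rewrite /psi /= -hs mul0r !mulr0.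
pose m := (H / h s) `^ p.
have m0 : 0 < m by rewrite powR_gt0// divr_gt0.
pose k := 2 / (1 - l) * h s.
have k0 : 0 < k by rewrite mulr_gt0// divr_gt0.
apply: (@le_trans _ _ (\int[mu]_(rho in `[m, +oo[) (k * rho `^ (- 1 - Q^-1))%:E)%E).
  rewrite [leRHS]integral_mkcond; apply: ge0_le_integral => //.
  - by move=> rho _; rewrite lee_fin.
  - apply/measurable_EFinP.
    have mm := (measurable_section1 (T3 := R) s mpsi).
    exact mm.
  - apply/(measurable_restrictT _ _).1 => //; apply: measurable_funTS.
    by mfun.
  - move=> rho _; rewrite patchE /psi /a /=.
    case: (ltP 0 rho) => rho0; last first.
      rewrite !(mulr0, mul0r); case: ifPn => // _.
      by rewrite lee_fin mulr_ge0 ?powR_ge0// ltW.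
    case: (ltP _ (h s)) => hr; last first.
      rewrite !(mulr0, mul0r); case: ifPn => // _.
      by rewrite lee_fin mulr_ge0 ?powR_ge0// ltW.
    rewrite !mulr1 ifT; last first.
      rewrite inE/= in_itv/= andbT /m.
      move: hr; rewrite -ltr_pdivlMr// powRN invf_plt ?posrE ?powR_gt0 ?divr_gt0// invf_div => hr.
      rewrite [leRHS](_ : _ = (rho `^ p^-1) `^ p); last first.
        by rewrite -powRrM mulVf ?(lt0r_neq0 p0)// powRr1// ltW.
      apply: ge0_ler_powR; [exact: ltW| |by rewrite nnegrE powR_ge0|exact: ltW].
      by rewrite nnegrE divr_ge0// ltW.
    rewrite lee_fin /k le_eqVlt; apply/orP; left; apply/eqP.
    have -> : - 1 - Q^-1 = (- 1 - p^-1) + (1 - l) by rewrite /p /l; field; rewrite Qne Q1ne.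
    by rewrite [X in _ = _ * X]powRD ?(gt_eqF rho0) ?implybT//; ring.
under eq_integral do rewrite EFinM.
rewrite ge0_integralZl_EFin; last 4 first.
- exact: measurable_itv.
- by move=> rho _; rewrite lee_fin powR_ge0.
- by apply/measurable_funTS/measurable_EFinP; exact: measurable_powR.
- exact: ltW.
rewrite integral_powR_tail ?invr_gt0// -EFinM lee_fin /k /m -powRrM.
have -> : p * - Q^-1 = 1 - p by rewrite /p; field; rewrite Qne Q1ne.
have -> : (H / h s) `^ (1 - p) = H `^ (1 - p) * h s `^ (p - 1).
  rewrite powRM ?invr_ge0 ?(ltW hs) ?(ltW H0)// -(powR_inv1 (ltW hs)) -powRrM.
  by congr (_ * _ `^ _); ring.
rewrite -(mulr_powRB1 (ltW hs) p0).
have l1ne : 1 - l != 0 by rewrite gt_eqF.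
by rewrite invrK le_eqVlt; apply/orP; left; apply/eqP; field.
Qed.

(** Tonelli's theorem integrates [phi] in [t] first, then in [rho], then in [s]. The powers of [H]
    met on the way are [Q - 1], [1 - p] and [p], which add up to [Q]. *)
Lemma hls_strong : (\int[mu]_t (I t) `^ Q <=
  (2 / p * (2 * D) `^ (Q - 1) * (2 * Q / (1 - l)) * H `^ Q)%:E)%E.
Proof.
have l1 : 0 < 1 - l by rewrite subr_gt0; case/andP: l01.
have I0 t : (0 <= I t)%E.
  by apply: integral_ge0 => s _; rewrite lee_fin mulr_ge0 ?powR_ge0.
have mI : measurable_fun setT I.
  apply: (measurable_fun_fubini_tonelli_F (m2 := mu)
    (fun z : R * R => (`|z.1 - z.2| `^ (- l) * h z.2)%:E)).
    by mfun.
  by move=> z; rewrite lee_fin mulr_ge0 ?powR_ge0.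
have PJ0 z : (0 <= \int[mu]_s (phi (z.1, z.2, s))%:E)%E.
  by apply: integral_ge0 => s _; rewrite lee_fin.
pose c := 2 / p * (2 * D * H) `^ (Q - 1).
have c0 : 0 <= c by rewrite mulr_ge0 ?powR_ge0// divr_ge0// ltW.
apply: (@le_trans _ _ (\int[mu]_t (c%:E * \int[mu]_rho \int[mu]_s (phi (t, rho, s))%:E))%E).
  apply: ge0_le_integral => //.
  - by move=> t _; exact: poweR_ge0.
  - exact: measurable_fun_poweR.
  - apply: measurable_funeM.
    exact: (measurable_fun_fubini_tonelli_F (m2 := mu) _ mphiJ).
rewrite ge0_integralZl_EFin; last 4 first.
- exact: measurableT.
- by move=> t _; apply: integral_ge0 => rho _; exact: (PJ0 (t, rho)).
- exact: (measurable_fun_fubini_tonelli_F (m2 := mu) _ mphiJ).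
- exact: c0.
apply: (@le_trans _ _ (c%:E * (2 * Q / (1 - l) * H)%:E)%E); last first.
  rewrite -EFinM lee_fin /c powRM ?mulr_ge0 ?(ltW D0) ?(ltW H0)//.
  rewrite -(mulr_powRB1 (ltW H0) Q0).
  by rewrite le_eqVlt; apply/orP; left; apply/eqP; ring.
apply: lee_wpmul2l; first by rewrite lee_fin.
have /= -> := fubini_tonelli (m1 := mu) (m2 := mu) _ mphiJ PJ0.
have mpsiE : measurable_fun setT (fun z => (psi z)%:E) by exact/measurable_EFinP.
have psiE0 z : (0 <= (psi z)%:E)%E by rewrite lee_fin.
apply: (@le_trans _ _ (\int[mu]_rho \int[mu]_s (psi (rho, s))%:E)%E).
  apply: ge0_le_integral => //.
  - by move=> rho _; apply: integral_ge0 => t _; exact: (PJ0 (t, rho)).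
  - exact: (measurable_fun_fubini_tonelli_G (m1 := mu) _ mphiJ).
  - exact: (measurable_fun_fubini_tonelli_F (m2 := mu) _ mpsiE).
  move=> rho _.
  pose phr (z : R * R) := (phi (z.1, rho, z.2))%:E.
  have mphr : measurable_fun setT phr.
    rewrite /phr /phi /=; mfun.
  have phr0 z : (0 <= phr z)%E by rewrite lee_fin.
  have /= -> := fubini_tonelli (m1 := mu) (m2 := mu) _ mphr phr0.
  apply: ge0_le_integral => //.
  - by move=> s _; exact: integral_ge0.
  - exact: (measurable_fun_fubini_tonelli_G (m1 := mu) _ mphr).
  - have mm := (measurable_section2 (T3 := \bar R) rho mpsiE).
    exact mm.
  move=> s _; rewrite /phr /phi /psi /=.
  have [rho0|rho0] := ltP 0 rho; last first.
    rewrite integral0_eq ?lee_fin.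
      by rewrite /a ltNge rho0 !(mulr0, mul0r).
    by move=> t _; rewrite /a ltNge rho0 !(mulr0, mul0r).
  under eq_integral do rewrite mulrCA EFinM.
  pose v := a rho * (h s * (rho `^ (- p^-1) * H < h s)%R%:R).
  have v0 : 0 <= v by apply: mulr_ge0 => //; rewrite mulr_ge0.
  under eq_integral do rewrite muleC -/v.
  rewrite ge0_integralZl_EFin; last 4 first.
  - exact: measurableT.
  - by move=> t _; rewrite lee_fin mulr_ge0 ?powR_ge0.
  - by mfun.
  - exact: v0.
  apply: le_trans (lee_wpmul2l _ (integral_norm_near s l01 rho0)) _.
    by rewrite lee_fin.
  by rewrite -EFinM lee_fin le_eqVlt /v; apply/orP; left; apply/eqP; ring.
have /= -> := fubini_tonelli (m1 := mu) (m2 := mu) _ mpsiE psiE0.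
apply: (@le_trans _ _ (\int[mu]_s ((2 * Q / (1 - l) * H `^ (1 - p))%:E * (h s `^ p)%:E))%E).
  apply: ge0_le_integral => //.
  - by move=> s _; exact: integral_ge0.
  - exact: (measurable_fun_fubini_tonelli_G (m1 := mu) _ mpsiE).
  - apply: measurable_funeM; mfun.
rewrite ge0_integralZl_EFin; last 4 first.
- exact: measurableT.
- by move=> t _; rewrite lee_fin powR_ge0.
- by mfun.
- by rewrite mulr_ge0 ?powR_ge0// divr_ge0 ?(ltW l1)// mulr_ge0// ltW.
rewrite HE -EFinM lee_fin -(mulrA _ (H `^ (1 - p))).
by rewrite -powRD ?subrK ?powRr1 ?(ltW H0)// (gt_eqF H0) implybT.
Qed.

End HLS.

Lemma hardy_littlewood_sobolev {R : realType} (Q : R) : 2 < Q ->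
  exists2 C : R, 0 < C & forall h : R -> R, measurable_fun setT h ->
    (forall t, 0 <= h t) ->
    (Lnorm lebesgue_measure Q%:E (fun t =>
       \int[lebesgue_measure]_s (`|t - s| `^ (- (2 / Q)) * h s)%R%:E) <=
     C%:E * Lnorm lebesgue_measure (Q / (Q - 1))%:E (EFin \o h))%E.
Proof.
move=> Q2; set p := Q / (Q - 1).
have Q0 : 0 < Q by rewrite (lt_trans _ Q2).
have Q1 : 0 < Q - 1 by rewrite subr_gt0 (lt_trans _ Q2)// ltr1n.
have p0 : 0 < p by rewrite divr_gt0.
pose l := 2 / Q.
have l1 : 0 < 1 - l by rewrite subr_gt0 /l ltr_pdivrMr// mul1r.
pose D : R := 2 / (1 - l) + 2 `^ Q^-1.
have D0 : 0 < D by rewrite addr_gt0 ?powR_gt0// divr_gt0.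
pose K := 2 / p * (2 * D) `^ (Q - 1) * (2 * Q / (1 - l)).
have K0 : 0 < K.
  apply: mulr_gt0; last by rewrite divr_gt0// mulr_gt0.
  by apply: mulr_gt0; [rewrite divr_gt0|rewrite powR_gt0// mulr_gt0].
exists (K `^ Q^-1); first by rewrite powR_gt0.
move=> h mh h0.
have mI : measurable_fun setT (fun t : R =>
    \int[lebesgue_measure]_s (`|t - s| `^ (- (2 / Q)) * h s)%R%:E)%E.
  apply: (measurable_fun_fubini_tonelli_F (m2 := lebesgue_measure)
    (fun z : R * R => (`|z.1 - z.2| `^ (- (2 / Q)) * h z.2)%:E)).
    by mfun.
  by move=> z; rewrite lee_fin mulr_ge0 ?powR_ge0.
have I0 (t : R) : (0 <= \int[lebesgue_measure]_s (`|t - s| `^ (- (2 / Q)) * h s)%R%:E)%E.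
  by apply: integral_ge0 => s _; rewrite lee_fin mulr_ge0 ?powR_ge0.
have Eh0 t : (0 <= (EFin \o h) t)%E by rewrite lee_fin.
have mEh : measurable_fun setT (EFin \o h) by exact/measurable_EFinP.
have [Hoo|Hoo] := eqVneq (Lnorm lebesgue_measure p%:E (EFin \o h)) +oo%E.
  by rewrite Hoo gt0_muley ?leey// lte_fin powR_gt0.
(* [hls_strong] needs a norm in [(0, +oo)]. If the norm is 0, [h] vanishes almost everywhere and so
   does every integral on the left. *)
have [H0|H0] := eqVneq (Lnorm lebesgue_measure p%:E (EFin \o h)) 0%E.
  rewrite H0 mule0 le_eqVlt; apply/orP; left; apply/eqP.
  apply/ge0_Lnorm_eq0; rewrite ?lte_fin//.
  move/ge0_Lnorm_eq0 : H0; rewrite lte_fin => /(_ p0 mEh Eh0) aeh.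
  apply: aeW => t; apply/ge0_integral_eq0.
  - by apply/measurable_EFinP; apply: measurable_funM; mfun.
  - by move=> s; rewrite lee_fin mulr_ge0 ?powR_ge0.
  - by apply: filterS aeh => s /=; rewrite EFinM => ->; rewrite mule0.
have Hfin : Lnorm lebesgue_measure p%:E (EFin \o h) \is a fin_num.
  by rewrite ge0_fin_numE ?Lnorm_ge0// ltey.
pose H := fine (Lnorm lebesgue_measure p%:E (EFin \o h)).
have HH : 0 < H by rewrite fine_gt0// lt0e H0 Lnorm_ge0 ltey.
have HE : (\int[lebesgue_measure]_t (h t `^ p)%:E = (H `^ p)%:E)%E.
  rewrite -poweR_EFin fineK// ge0_LnormE// -poweRrM mulVf ?gt_eqF// poweRe1//.
  by apply: integral_ge0 => t _; rewrite lee_fin powR_ge0.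
rewrite -(fineK Hfin) -EFinM; apply/Lnorm_le_fin => //.
  by rewrite lee_fin mulr_ge0 ?powR_ge0// ltW.
rewrite poweR_EFin powRM ?powR_ge0 ?(ltW HH)// -powRrM mulVf ?gt_eqF// powRr1 ?(ltW K0)//.
exact: hls_strong.
Qed.

(** * The [L^2] bound for convolution with a chirp *)

Section oscillatory.
Context {R : realType}.
Notation mu := (@lebesgue_measure R).

(* The antiderivative comes from integrating by parts twice; both boundary
   terms of order [1/b] vanish, hence the decay in [b^-2]. *)
Let is_derive_primitive (a b N x : R) : b != 0 -> N != 0 ->
  is_derive x 1 (fun u : R => (1 - u ^+ 2 / N ^+ 2) * (sin (a + b * u) / b) -
      (2 * u / N ^+ 2) * (cos (a + b * u) / b ^+ 2) +
      (2 / N ^+ 2) * (sin (a + b * u) / b ^+ 3))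
    ((1 - x ^+ 2 / N ^+ 2) * cos (a + b * x)).
Proof.
move=> b0 N0; apply: is_derive_eq; rewrite /GRing.scale/=.
by field; rewrite b0 N0.
Qed.

Let is_derive_cont (F : R -> R) (x df : R) : is_derive x 1 F df ->
  F u @[u --> x] --> F x.
Proof.
by move=> [dF _]; apply: differentiable_continuous; exact/derivable1_diffP.
Qed.

(** The truncated parabola is continuous across [|x| = N], so that its cosine transform decays like
    [b^-2], which is integrable at infinity; and it increases to 1 with [N]. *)
Definition weight (N x : R) : R := Num.max 0 (1 - x ^+ 2 / N ^+ 2).

Lemma weight_ge0 N x : 0 <= weight N x.
Proof. by rewrite le_max lexx. Qed.

Lemma weight_le1 N x : weight N x <= 1.
Proof. by rewrite ge_max ler01/= gerBl mulr_ge0 ?sqr_ge0// invr_ge0 sqr_ge0. Qed.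

Lemma weight_le_itv N x : 0 < N -> weight N x <= \1_(`[- N, N]%classic) x.
Proof.
move=> N0; rewrite indicE mem_setE in_itv/=; case: (boolP (- N <= x <= N)) => [_|h].
  exact: weight_le1.
rewrite ge_max lexx/= subr_le0 ler_pdivlMr ?exprn_gt0// mul1r.
rewrite -[x ^+ 2]real_normK ?num_real// lerXn2r ?nnegrE ?(ltW N0)//.
by move: h; rewrite -ler_norml -ltNge => /ltW.
Qed.

Lemma measurable_weight N : measurable_fun setT (weight N).
Proof.
apply: measurable_maxr => //; apply: measurable_funB => //.
by apply: measurable_funM => //; exact: measurable_funX.
Qed.

Lemma integral_weight_cos (a b N : R) : b != 0 -> 0 < N ->
  (\int[mu]_x (weight N x * cos (a + b * x))%:E =
   ((2 / N ^+ 2) * ((sin (a + b * N) - sin (a - b * N)) / b ^+ 3) -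
    (2 / N) * ((cos (a + b * N) + cos (a - b * N)) / b ^+ 2))%:E)%E.
Proof.
move=> b0 N0; have Nne : N != 0 by rewrite gt_eqF.
transitivity (\int[mu]_(x in `[(- N)%R, N]) ((1 - x ^+ 2 / N ^+ 2) * cos (a + b * x))%:E)%E.
  rewrite [RHS]integral_mkcond; apply: eq_integral => x _.
  rewrite patchE; have := weight_le_itv x N0; have := weight_ge0 N x.
  rewrite indicE; case: ifPn => [|_]; last first.
    by move=> h1 h2; rewrite (_ : weight N x = 0) ?mul0r//; apply/eqP; rewrite eq_le h1 h2.
  rewrite inE/= in_itv/= -ler_norml => xN _ _; congr (_ * _)%:E; apply/max_idPr.
  rewrite subr_ge0 ler_pdivrMr ?exprn_gt0// mul1r -[X in X <= _]real_normK ?num_real//.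
  by rewrite lerXn2r ?nnegrE// ltW.
rewrite (@continuous_FTC2 _ _ (fun u : R => (1 - u ^+ 2 / N ^+ 2) * (sin (a + b * u) / b) -
      (2 * u / N ^+ 2) * (cos (a + b * u) / b ^+ 2) +
      (2 / N ^+ 2) * (sin (a + b * u) / b ^+ 3))).
- rewrite -EFinB mulrN; congr EFin.
  by field; rewrite b0 Nne.
- by rewrite gtrN.
- apply: continuous_subspaceT => x.
  apply: cvgM; last first.
    apply: continuous_comp; last exact: continuous_cos.
    by apply: cvgD; [exact: cvg_cst|apply: cvgM; [exact: cvg_cst|exact: cvg_id]].
  apply: cvgB; first exact: cvg_cst.
  by apply: cvgMr_tmp; exact: exprn_continuous.
- split.
  + by move=> x _; case: (is_derive_primitive a x b0 Nne).
  + apply: cvg_at_right_filter.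
    exact: (is_derive_cont (is_derive_primitive a (- N) b0 Nne)).
  + apply: cvg_at_left_filter.
    exact: (is_derive_cont (is_derive_primitive a N b0 Nne)).
- by move=> x _; rewrite derive1E; case: (is_derive_primitive a x b0 Nne).
Qed.

(** The first piece is the trivial bound by the length of the support of [weight N], the second the
    decay of its cosine transform at frequency [2 theta u]; they meet at [|u| = 1/(2 N |theta|)].
    The shapes [u - 0] and [- 1 - 1] are those of [integral_norm_far]. *)
Definition kappa (N theta u : R) : R :=
  2 * N * (`|u - 0| < (2 * N * `|theta|)^-1)%R%:R +
  2 / (N * theta ^+ 2) *
    (`|u - 0| `^ (- 1 - 1) * ((2 * N * `|theta|)^-1 <= `|u - 0|)%R%:R).

Lemma kappa_ge0 N theta u : 0 < N -> 0 <= kappa N theta u.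
Proof.
move=> N0; rewrite addr_ge0// mulr_ge0 ?mulr_ge0 ?powR_ge0// ?(ltW N0)//.
by rewrite invr_ge0 mulr_ge0 ?sqr_ge0// ltW.
Qed.

Lemma measurable_kappa N theta : measurable_fun setT (kappa N theta).
Proof. by rewrite /kappa; mfun. Qed.

Lemma weight_cos_integrable (a b N : R) : 0 < N ->
  mu.-integrable setT (fun x => (weight N x * cos (a + b * x))%:E).
Proof.
move=> N0; apply: (le_integrable measurableT _ _ (integrable_indic_itv (- N) N true false)) => //.
- apply/measurable_EFinP; apply: measurable_funM; first exact: measurable_weight.
  by mfun.
- move=> x _; rewrite lee_fin normrM ger0_norm ?weight_ge0// [leRHS]ger0_norm ?indicE//.
  rewrite -indicE; apply: le_trans (weight_le_itv x N0).
  by rewrite ler_piMr ?weight_ge0// ler_norml cos_geN1 cos_le1.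
Qed.

Lemma weight_cos_le (a u N theta : R) : theta != 0 -> 0 < N ->
  `| \int[mu]_x (weight N x * cos (a + 2 * theta * u * x)) | <= kappa N theta u.
Proof.
move=> t0 N0; rewrite /kappa subr0.
set b := 2 * theta * u.
have tN : 0 < 2 * N * `|theta| by rewrite !mulr_gt0// normr_gt0.
case: (ltP `|u| (2 * N * `|theta|)^-1) => hu.
  rewrite mulr1 mulr0 mulr0 addr0.
  rewrite -lee_fin EFin_normr_Rintegral//; last exact: weight_cos_integrable.
  have mw : measurable_fun setT (fun x => (weight N x * cos (a + b * x))%:E).
    exact: (measurable_int mu (weight_cos_integrable a b N0)).
  apply: (le_trans (le_abse_integral mu measurableT mw)).
  apply: (@le_trans _ _ (\int[mu]_x (\1_(`[(- N)%R, N]%classic) x)%:E)%E).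
    apply: ge0_le_integral => //; first exact: measurableT_comp.
      by apply/measurable_EFinP; exact: measurable_indic.
    move=> x _; rewrite lee_fin normrM ger0_norm ?weight_ge0//.
    apply: le_trans (weight_le_itv x N0).
    by rewrite ler_piMr ?weight_ge0// ler_norml cos_geN1 cos_le1.
  rewrite integral_indic//= setIT lebesgue_measure_itv/= lte_fin gtrN//.
  by rewrite -EFinB lee_fin opprK mulr2n mulrDl mul1r.
rewrite mulr0 add0r mulr1.
have u0 : 0 < `|u| by apply: lt_le_trans hu; rewrite invr_gt0.
have une : u != 0 by rewrite -normr_gt0.
have bne : b != 0 by rewrite !mulf_neq0.
rewrite /Rintegral integral_weight_cos//=.
have b0 : 0 < `|b| by rewrite normr_gt0.
(* Beyond the threshold [N |b| >= 1], so the term of order [N^-2 |b|^-3] is absorbed by the one of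
   order [N^-1 |b|^-2]. *)
have bN : (N * `|b|)^-1 <= 1.
  rewrite invf_le1 ?mulr_gt0// /b !normrM (ger0_norm (ler0n _ 2)).
  move: hu; rewrite invf_ple ?posrE// ?invr_gt0// => hu.
  move: hu; rewrite -(ler_pM2r u0) mulVf ?gt_eqF//.
  by rewrite (_ : N * _ = 2 * N * `|theta| * `|u|)//; ring.
have -> : `|u| `^ (- 1 - 1) = (`|u| ^+ 2)^-1.
  by rewrite (_ : - 1 - 1 = - 2%:R) ?powRN ?powR_mulrn//; ring.
apply: (le_trans (ler_normB _ _)).
have sl x : `|sin x| <= 1 :> R by rewrite ler_norml sin_geN1 sin_le1.
have cl x : `|cos x| <= 1 :> R by rewrite ler_norml cos_geN1 cos_le1.
apply: (@le_trans _ _ (2 / N ^+ 2 * (2 / `|b| ^+ 3) + 2 / N * (2 / `|b| ^+ 2))).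
  apply: lerD; rewrite normrM ger0_norm ?divr_ge0 ?exprn_ge0 ?(ltW N0)//.
  - apply: ler_wpM2l; first by rewrite divr_ge0 ?exprn_ge0 ?(ltW N0).
    rewrite normrM normfV normrX ler_wpM2r ?invr_ge0 ?exprn_ge0//.
    by apply: (le_trans (ler_normB _ _)); rewrite [leRHS](_ : _ = 1 + 1)// lerD.
  - apply: ler_wpM2l; first by rewrite divr_ge0 ?(ltW N0).
    rewrite normrM normfV normrX ler_wpM2r ?invr_ge0 ?exprn_ge0//.
    by apply: (le_trans (ler_normD _ _)); rewrite [leRHS](_ : _ = 1 + 1)// lerD.
have -> : 2 / N ^+ 2 * (2 / `|b| ^+ 3) = 4 / (N * `|b| ^+ 2) * (N * `|b|)^-1.
  by field; rewrite !gt_eqF.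
have -> : 2 / (N * theta ^+ 2) * (`|u| ^+ 2)^-1 = 8 / (N * `|b| ^+ 2).
  rewrite -[theta ^+ 2]real_normK ?num_real// /b !normrM (ger0_norm (ler0n _ 2)).
  by field; rewrite !gt_eqF// normr_gt0.
apply: (@le_trans _ _ (4 / (N * `|b| ^+ 2) * 1 + 2 / N * (2 / `|b| ^+ 2))).
  rewrite lerD2r ler_wpM2l// divr_ge0// mulr_ge0 ?exprn_ge0// ltW//.
by rewrite le_eqVlt; apply/orP; left; apply/eqP; field; rewrite !gt_eqF.
Qed.

End oscillatory.

(** * Fubini's theorem for real-valued integrals with a product majorant *)

Section Rintegral_product.
Context {d1 d2} {T1 : measurableType d1} {T2 : measurableType d2} {R : realType}.
Context (m1 : {sigma_finite_measure set T1 -> \bar R}).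
Context (m2 : {sigma_finite_measure set T2 -> \bar R}).

Lemma measurable_Rintegral_section (F : T1 * T2 -> R) : measurable_fun setT F ->
  measurable_fun setT (fun x => \int[m2]_y F (x, y)).
Proof.
move=> mF; apply: measurableT_comp => //.
have mEF : measurable_fun setT (EFin \o F) by exact/measurable_EFinP.
rewrite (_ : (fun _ => _) = (fun x => \int[m2]_y ((EFin \o F)^\+ (x, y)) -
    \int[m2]_y ((EFin \o F)^\- (x, y)))%E); last first.
  by apply/funext => x; rewrite integralE; congr (_ - _)%E; apply: eq_integral => y _; rewrite ?funeposE ?funenegE.
apply: emeasurable_funB.
  apply: (measurable_fun_fubini_tonelli_F (m2 := m2) (EFin \o F)^\+)%E => //.
  exact: measurable_funepos.
apply: (measurable_fun_fubini_tonelli_F (m2 := m2) (EFin \o F)^\-)%E => //.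
exact: measurable_funeneg.
Qed.

Section dominated.
Context (F : T1 * T2 -> R) (g1 : T1 -> R) (g2 : T2 -> R).
Context (mF : measurable_fun setT F).
Context (ig1 : m1.-integrable setT (EFin \o g1)).
Context (ig2 : m2.-integrable setT (EFin \o g2)).
Context (Fg : forall x y, `|F (x, y)| <= `|g1 x * g2 y|).

Lemma dominated_section2 x : m2.-integrable setT (fun y => (F (x, y))%:E).
Proof.
apply: (le_integrable measurableT _ _ (integrableZl measurableT (g1 x) ig2)).
  by apply/measurable_EFinP; exact: (measurable_section2 _ mF).
by move=> y _; rewrite -EFinM !abse_EFin lee_fin.
Qed.

Lemma dominated_section1 y : m1.-integrable setT (fun x => (F (x, y))%:E).
Proof.
apply: (le_integrable measurableT _ _ (integrableZl measurableT (g2 y) ig1)).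
  by apply/measurable_EFinP; exact: (measurable_section1 _ mF).
by move=> x _; rewrite -EFinM !abse_EFin lee_fin mulrC.
Qed.

Lemma dominated_integrable_prod : (m1 \x m2)%E.-integrable setT (EFin \o F).
Proof.
have /measurable_EFinP mg1 := measurable_int m1 ig1.
have /measurable_EFinP mg2 := measurable_int m2 ig2.
have mg1' : measurable_fun setT (fun x => `|g1 x|%:E) by mfun.
have mg2' : measurable_fun setT (fun x => `|g2 x|%:E) by mfun.
apply/integrable12ltyP; first exact/measurable_EFinP.
apply: (@le_lt_trans _ _ (\int[m1]_x ((\int[m2]_y `|g2 y|%:E) * `|g1 x|%:E))%E).
  apply: ge0_le_integral => //.
  - by move=> x _; exact: integral_ge0.
  - apply: (measurable_fun_fubini_tonelli_F (m2 := m2) (fun z => `|(EFin \o F) z|))%E => //.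
    by apply: measurableT_comp => //; exact/measurable_EFinP.
  - exact: emeasurable_funM.
  - move=> x _; rewrite muleC -ge0_integralZl_EFin//.
    apply: ge0_le_integral => //.
    + apply: measurableT_comp => //; apply/measurable_EFinP.
      exact: (measurable_section2 _ mF).
    + exact: measurable_funeM.
    + by move=> y _; rewrite -EFinM lee_fin -normrM.
move: ig1 => /integrableP[_]; move: ig2 => /integrableP[_].
rewrite /= => i2 i1; rewrite ge0_integralZl//; last exact: integral_ge0.
by rewrite lte_mul_pinfty ?integral_ge0// ge0_fin_numE ?integral_ge0.
Qed.

Lemma Rintegral_fubini :
  \int[m1]_x \int[m2]_y F (x, y) = \int[m2]_y \int[m1]_x F (x, y).
Proof.
rewrite /Rintegral; congr fine.
transitivity (\int[m1]_x \int[m2]_y (EFin \o F) (x, y))%E.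
  apply: eq_integral => x _; rewrite fineK//.
  exact: (integrable_fin_num measurableT (dominated_section2 x)).
rewrite (Fubini dominated_integrable_prod).
apply: eq_integral => y _; rewrite fineK//.
exact: (integrable_fin_num measurableT (dominated_section1 y)).
Qed.

End dominated.

End Rintegral_product.

(** [fine] sends an infinite integral to 0, so the inequality holds for every measurable [g]. *)
Lemma normr_Rintegral_le {d} {T : measurableType d} {R : realType}
    (mu : {measure set T -> \bar R}) (g : T -> R) : measurable_fun setT g ->
  (`|\int[mu]_x g x|%:E <= \int[mu]_x `|g x|%:E)%E.
Proof.
move=> mg; apply: (@le_trans _ _ `|\int[mu]_x (g x)%:E|%E).
  by rewrite /Rintegral; case: (integral _ _ _) => //=; rewrite normr0 leey.
apply: (le_trans (le_abse_integral mu measurableT _)) => //.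
exact/measurable_EFinP.
Qed.

Section kappa_integral.
Context {R : realType}.
Notation mu := (@lebesgue_measure R).
Context (N theta : R).
Context (N0 : 0 < N).
Context (theta0 : theta != 0).

(** The two pieces have mass [2N / (N |theta|)] and [(2 / (N theta^2)) 2 (2 N |theta|)], that is
    [2/|theta|] and [8/|theta|]. [N] cancels, which is what allows the limit [N -> oo]. *)
Lemma integral_kappa : (\int[mu]_u (kappa N theta u)%:E <= (10 / `|theta|)%:E)%E.
Proof.
rewrite /kappa; set rho := (2 * N * `|theta|)^-1.
have t0 : 0 < `|theta| by rewrite normr_gt0.
have rho0 : 0 < rho by rewrite invr_gt0 !mulr_gt0.
have c0 : 0 <= 2 / (N * theta ^+ 2) by rewrite divr_ge0// mulr_ge0 ?sqr_ge0// ltW.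
under eq_integral do rewrite EFinD.
rewrite ge0_integralD//; last 4 first.
- by move=> u _; rewrite lee_fin !mulr_ge0// ltW.
- by apply/measurable_EFinP; rewrite /rho; mfun.
- by move=> u _; rewrite lee_fin mulr_ge0// mulr_ge0// powR_ge0.
- by apply/measurable_EFinP; rewrite /rho; mfun.
have -> : 10 / `|theta| = 2 / `|theta| + 8 / `|theta| by field; rewrite gt_eqF.
rewrite EFinD; apply: leeD.
- rewrite (_ : (fun u => _) = (fun u => (2 * N)%:E * (\1_(`](- rho)%R, rho[%classic) u)%:E)%E); last first.
    apply/funext => u; rewrite EFinM; congr (_ * _%:E)%E.
    by rewrite subr0 indicE mem_setE in_itv/= ltr_norml.
  rewrite ge0_integralZl_EFin//; last 2 first.
    by apply/measurable_EFinP; exact: measurable_indic.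
    by rewrite mulr_ge0// ltW.
  rewrite integral_indic//= setIT lebesgue_measure_itv/= lte_fin gtrN//.
  rewrite -EFinB -EFinM lee_fin /rho.
  by rewrite le_eqVlt; apply/orP; left; apply/eqP; field; rewrite !gt_eqF.
- under eq_integral do rewrite EFinM.
  rewrite ge0_integralZl_EFin; last 4 first.
  + exact: measurableT.
  + by move=> u _; rewrite lee_fin mulr_ge0// powR_ge0.
  + by apply/measurable_EFinP; rewrite /rho; mfun.
  + exact: c0.
  rewrite integral_norm_far// -EFinM lee_fin powR_inv1 ?(ltW rho0)//.
  rewrite /rho -[theta ^+ 2]real_normK ?num_real//.
  by rewrite le_eqVlt; apply/orP; left; apply/eqP; field; rewrite !gt_eqF.
Qed.

Lemma integral_kappa1 y : (\int[mu]_u (kappa N theta (u - y))%:E <= (10 / `|theta|)%:E)%E.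
Proof.
apply: le_trans integral_kappa.
rewrite (ge0_integral_translate (f := fun u => (kappa N theta u)%:E))//.
- by apply/measurable_EFinP; exact: measurable_kappa.
- by move=> u; rewrite lee_fin kappa_ge0.
Qed.

Lemma integral_kappa2 y : (\int[mu]_u (kappa N theta (y - u))%:E <= (10 / `|theta|)%:E)%E.
Proof.
apply: le_trans integral_kappa.
rewrite (ge0_integral_reflect (f := fun u => (kappa N theta u)%:E))//.
- by apply/measurable_EFinP; exact: measurable_kappa.
- by move=> u; rewrite lee_fin kappa_ge0.
Qed.

End kappa_integral.

(** * The one-dimensional chirp: expanding the square and Schur's test *)

Section chirp1.
Context {R : realType}.
Notation mu := (@lebesgue_measure R).
Context (theta : R) (f : R -> R).
Context (theta0 : theta != 0).
Context (intf : mu.-integrable setT (EFin \o f)).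

Let mf : measurable_fun setT f.
Proof. by apply/measurable_EFinP; exact: (measurable_int mu intf). Qed.

Let A (x y : R) := theta * (x - y) ^+ 2.
Let C x := \int[mu]_y (f y * cos (A x y)).
Let S x := \int[mu]_y (f y * sin (A x y)).
(** [C] and [S] are the real and imaginary parts of the convolution with the chirp. [D x y] is the
    real part of this convolution rotated back by the phase at [y], so that integrating
    [f y * D x y] in [y] gives the squared modulus. *)
Let D x y := \int[mu]_y' (f y' * cos (A x y - A x y')).
Let M := \int[mu]_y `|f y|.

Let cos_le1' (x : R) : `|cos x| <= 1.
Proof. by rewrite ler_norml cos_geN1 cos_le1. Qed.

Let sin_le1' (x : R) : `|sin x| <= 1.
Proof. by rewrite ler_norml sin_geN1 sin_le1. Qed.

Let int_mul (g : R -> R) : measurable_fun setT g -> (forall y, `|g y| <= 1) ->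
  mu.-integrable setT (fun y => (f y * g y)%:E).
Proof.
move=> mg g1; apply: (le_integrable measurableT _ _ intf).
  by apply/measurable_EFinP; apply: measurable_funM.
by move=> y _; rewrite !abse_EFin lee_fin normrM ler_piMr.
Qed.

Let intC x : mu.-integrable setT (fun y => (f y * cos (A x y))%:E).
Proof. by apply: int_mul => //; rewrite /A; mfun. Qed.

Let intS x : mu.-integrable setT (fun y => (f y * sin (A x y))%:E).
Proof. by apply: int_mul => //; rewrite /A; mfun. Qed.

Let bound_mul (g : R -> R) : measurable_fun setT g -> (forall y, `|g y| <= 1) ->
  `|\int[mu]_y (f y * g y)| <= M.
Proof.
move=> mg g1; have ifg := int_mul mg g1.
apply: (le_trans (le_normr_Rintegral measurableT ifg)).
apply: le_Rintegral => //.
- exact: (integrable_norm ifg).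
- exact: (integrable_norm intf).
- by move=> y _; rewrite normrM ler_piMr.
Qed.

Let DE x y : D x y = cos (A x y) * C x + sin (A x y) * S x.
Proof.
transitivity (\int[mu]_y' (cos (A x y) * (f y' * cos (A x y')) +
    sin (A x y) * (f y' * sin (A x y')))).
  by apply: eq_Rintegral => y' _; rewrite cosB; ring.
rewrite RintegralD//.
- by rewrite (RintegralZl _ measurableT (intC x)) (RintegralZl _ measurableT (intS x)).
- by have := integrableZl measurableT (cos (A x y)) (intC x).
- by have := integrableZl measurableT (sin (A x y)) (intS x).
Qed.

Let DM x y : `|D x y| <= `|M|.
Proof.
apply: le_trans (ler_norm M).
apply: (@bound_mul (fun y' => cos (A x y - A x y'))) => //.
by rewrite /A; mfun.
Qed.

Let M0 : 0 <= M. Proof. exact: Rintegral_ge0. Qed.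

Let mD : measurable_fun setT (fun z : R * R => D z.1 z.2).
Proof.
have := measurable_Rintegral_section mu
  (F := fun z : (R * R) * R => f z.2 * cos (A z.1.1 z.1.2 - A z.1.1 z.2)).
by apply; rewrite /A; mfun.
Qed.

Let CSE x : C x ^+ 2 + S x ^+ 2 = \int[mu]_y (f y * D x y).
Proof.
transitivity (\int[mu]_y (C x * (f y * cos (A x y)) + S x * (f y * sin (A x y)))).
  rewrite RintegralD//.
  - by rewrite (RintegralZl _ measurableT (intC x)) (RintegralZl _ measurableT (intS x)) !expr2.
  - by have := integrableZl measurableT (C x) (intC x).
  - by have := integrableZl measurableT (S x) (intS x).
by apply: eq_Rintegral => y _; rewrite DE; ring.
Qed.

Let E N y y' := \int[mu]_x (weight N x * cos (A x y - A x y')).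

(** The terms [theta x^2] cancel in the difference of the two phases, which is therefore affine in
    [x] with slope [2 theta (y' - y)]. *)
Let E_le N y y' : 0 < N -> `|E N y y'| <= kappa N theta (y' - y).
Proof.
move=> N0; rewrite /E.
have -> : \int[mu]_x (weight N x * cos (A x y - A x y')) =
    \int[mu]_x (weight N x *
      cos (theta * (y ^+ 2 - y' ^+ 2) + 2 * theta * (y' - y) * x)).
  apply: eq_Rintegral; move=> x _; congr (_ * cos _); rewrite /A; ring.
exact: weight_cos_le.
Qed.

Let int_indic N : mu.-integrable setT (EFin \o (\1_(`[- N, N]%classic) : R -> R)).
Proof. exact: (integrable_indic_itv (- N) N true false). Qed.

(** Expanding the square and integrating in [x] first. Both exchanges have product majorants: the
    indicator of [[-N, N]] in [x], and a multiple of [f] in the other variable. *)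
Let weighted_sum N : 0 < N ->
  \int[mu]_x (weight N x * (C x ^+ 2 + S x ^+ 2)) =
  \int[mu]_y (f y * \int[mu]_y' (f y' * E N y y')).
Proof.
move=> N0.
have wN x : `|weight N x| <= `|\1_(`[- N, N]%classic) x : R|.
  rewrite ger0_norm ?weight_ge0// ger0_norm ?indicE//.
  by rewrite -indicE; exact: weight_le_itv.
transitivity (\int[mu]_x \int[mu]_y (weight N x * (f y * D x y))).
  apply: eq_Rintegral => x _; rewrite CSE.
  suff ifD : mu.-integrable setT (fun y => (f y * D x y)%:E).
    by rewrite (RintegralZl (weight N x) measurableT ifD).
  apply: (le_integrable measurableT _ _ (integrableZl measurableT M intf)).
    apply/measurable_EFinP; apply: measurable_funM => //.
    exact: (measurable_section2 _ mD).
  move=> y _; rewrite -EFinM !abse_EFin lee_fin !normrM mulrC.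
  exact: ler_wpM2r.
have := @Rintegral_fubini _ _ _ _ R mu mu
  (fun z : R * R => weight N z.1 * (f z.2 * D z.1 z.2)) \1_(`[- N, N]%classic)
  (fun y => M * f y).
move=> /= ->.
- apply: eq_Rintegral => y _.
  transitivity (\int[mu]_x (f y * (weight N x * D x y))).
    by apply: eq_Rintegral => x _; ring.
  have iwD : mu.-integrable setT (fun x => (weight N x * D x y)%:E).
    apply: (le_integrable measurableT _ _ (integrableZl measurableT M (int_indic N))).
      apply/measurable_EFinP; apply: measurable_funM => //.
        exact: measurable_weight.
      exact: (measurable_section1 _ mD).
    move=> x _; rewrite -EFinM !abse_EFin lee_fin !normrM mulrC.
    exact: ler_pM.
  transitivity (f y * \int[mu]_x (weight N x * D x y)).
    exact: (RintegralZl (f y) measurableT iwD).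
  apply: (congr1 (fun u => f y * u)).
  transitivity (\int[mu]_x \int[mu]_y' (f y' * (weight N x * cos (A x y - A x y')))).
    apply: eq_Rintegral => x _.
    have iD : mu.-integrable setT (fun y' => (f y' * cos (A x y - A x y'))%:E).
      by apply: int_mul => //; rewrite /A; mfun.
    rewrite -(RintegralZl (weight N x) measurableT iD).
    by apply: eq_Rintegral => y' _; ring.
  have := @Rintegral_fubini _ _ _ _ R mu mu
    (fun z : R * R => f z.2 * (weight N z.1 * cos (A z.1 y - A z.1 z.2)))
    \1_(`[- N, N]%classic) f.
  move=> /= ->.
  + apply: eq_Rintegral => y' _.
    have iw : mu.-integrable setT (fun x => (weight N x * cos (A x y - A x y'))%:E).
      have := weight_cos_integrable (theta * (y ^+ 2 - y' ^+ 2)) (2 * theta * (y' - y)) N0.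
      congr (_.-integrable _ _); apply/funext => x.
      by congr (_ * cos _)%:E; rewrite /A; ring.
    by rewrite (RintegralZl (f y') measurableT iw).
  + apply: measurable_funM; first by mfun.
    apply: measurable_funM.
      by apply: (measurableT_comp (measurable_weight N)); exact: measurable_fst.
    by rewrite /A; mfun.
  + exact: int_indic.
  + exact: intf.
  + move=> x y'; rewrite !normrM mulrCA ler_pM//.
    by rewrite -[leRHS]mulr1 ler_pM.
- apply: measurable_funM.
    by apply: (measurableT_comp (measurable_weight N)); exact: measurable_fst.
  by apply: measurable_funM => //; mfun.
- exact: int_indic.
- by have := integrableZl measurableT M intf.
- by move=> x y; rewrite !normrM ler_pM// mulrC ler_wpM2r.
Qed.

(** [|f y| |f y'| <= (f y ^ 2 + f y' ^ 2) / 2] splits the form into two halves; in each, [f] depends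
    on one variable and the other one integrates [kappa] to its mass. *)
Let schur (N : R) : 0 < N ->
  (\int[mu]_y (`|f y|%:E * \int[mu]_y' (`|f y'| * kappa N theta (y' - y))%:E) <=
   (10 / `|theta|)%:E * \int[mu]_y (f y ^+ 2)%:E)%E.
Proof.
move=> N0; pose k y y' := kappa N theta (y' - y).
have k0 y y' : 0 <= k y y' by exact: kappa_ge0.
have mk : measurable_fun setT (fun z : R * R => k z.1 z.2).
  apply: (measurableT_comp (measurable_kappa N theta)).
  by mfun.
pose K : R := 10 / `|theta|.
have K0 : 0 <= K by rewrite divr_ge0.
pose g (z : R * R) := f z.1 ^+ 2 / 2 * k z.1 z.2.
pose g' (z : R * R) := f z.2 ^+ 2 / 2 * k z.1 z.2.
have g0 z : (0 <= (g z)%:E)%E by rewrite lee_fin mulr_ge0// divr_ge0// sqr_ge0.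
have g'0 z : (0 <= (g' z)%:E)%E by rewrite lee_fin mulr_ge0// divr_ge0// sqr_ge0.
have mg : measurable_fun setT (fun z => (g z)%:E).
  by apply/measurable_EFinP; apply: measurable_funM => //; mfun.
have mg' : measurable_fun setT (fun z => (g' z)%:E).
  by apply/measurable_EFinP; apply: measurable_funM => //; mfun.
have mgg' : measurable_fun setT (fun z => (g z)%:E + (g' z)%:E)%E by exact: emeasurable_funD.
have gg'0 z : (0 <= (g z)%:E + (g' z)%:E)%E by exact: adde_ge0.
have mI : measurable_fun setT (fun z : R * R => (`|f z.2| * k z.1 z.2)%:E).
  by apply/measurable_EFinP; apply: measurable_funM => //; mfun.
have I0 (z : R * R) : (0 <= (`|f z.2| * k z.1 z.2)%:E)%E by rewrite lee_fin mulr_ge0.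
apply: (@le_trans _ _ (\int[mu]_y \int[mu]_y' ((g (y, y'))%:E + (g' (y, y'))%:E))%E).
  apply: ge0_le_integral => //.
  - by move=> y _; apply: mule_ge0 => //; apply: integral_ge0 => y' _; exact: (I0 (y, y')).
  - apply: emeasurable_funM; first by apply/measurable_EFinP; exact: measurable_funnorm.
    exact: (measurable_fun_fubini_tonelli_F (m2 := mu) _ mI I0).
  - exact: (measurable_fun_fubini_tonelli_F (m2 := mu) _ mgg' gg'0).
  - move=> y _; rewrite -ge0_integralZl_EFin//; last 2 first.
      by move=> y' _; exact: (I0 (y, y')).
      exact: (measurable_section2 _ mI).
    apply: ge0_le_integral => //.
    + by move=> y' _; apply: mule_ge0 => //; exact: (I0 (y, y')).
    + by apply: measurable_funeM; exact: (measurable_section2 _ mI).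
    + exact: (measurable_section2 _ mgg').
    + move=> y' _; rewrite -EFinM -EFinD lee_fin /g /g' /= -mulrDl mulrA.
      rewrite -/(k y y'); apply: ler_wpM2r; first exact: k0.
      rewrite -(real_normK (num_real (f y))) -(real_normK (num_real (f y'))).
      have := sqr_ge0 (`|f y| - `|f y'|); rewrite sqrrB; lra.
have half y : (\int[mu]_y' (g (y, y'))%:E <= (K / 2)%:E * (f y ^+ 2)%:E)%E.
  have -> : (\int[mu]_y' (g (y, y'))%:E = (f y ^+ 2 / 2)%:E * \int[mu]_y' (k y y')%:E)%E.
    have h1 : 0 <= f y ^+ 2 / 2 by rewrite divr_ge0 ?sqr_ge0.
    exact (ge0_integralMl mu h1 (measurable_section2 (T3 := R) y mk) (k0 y)).
  apply: le_trans (lee_wpmul2l _ (integral_kappa1 N0 theta0 y)) _.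
    by rewrite lee_fin divr_ge0 ?sqr_ge0.
  by rewrite -!EFinM lee_fin /K le_eqVlt; apply/orP; left; apply/eqP; ring.
have half' y' : (\int[mu]_y (g' (y, y'))%:E <= (K / 2)%:E * (f y' ^+ 2)%:E)%E.
  have -> : (\int[mu]_y (g' (y, y'))%:E = (f y' ^+ 2 / 2)%:E * \int[mu]_y (k y y')%:E)%E.
    have h1 : 0 <= f y' ^+ 2 / 2 by rewrite divr_ge0 ?sqr_ge0.
    exact (ge0_integralMl mu h1 (measurable_section1 (T3 := R) y' mk) (k0 ^~ y')).
  apply: le_trans (lee_wpmul2l _ (integral_kappa2 N0 theta0 y')) _.
    by rewrite lee_fin divr_ge0 ?sqr_ge0.
  by rewrite -!EFinM lee_fin /K le_eqVlt; apply/orP; left; apply/eqP; ring.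
have mf2 : measurable_fun setT (fun y => (f y ^+ 2)%:E) by mfun.
have f20 y : (0 <= (f y ^+ 2)%:E)%E by rewrite lee_fin sqr_ge0.
have K20 : (0 <= (K / 2)%:E)%E by rewrite lee_fin divr_ge0.
have mG : measurable_fun setT (fun y => \int[mu]_y' (g (y, y'))%:E)%E.
  exact: (measurable_fun_fubini_tonelli_F (m2 := mu) _ mg g0).
have mG' : measurable_fun setT (fun y => \int[mu]_y' (g' (y, y'))%:E)%E.
  exact: (measurable_fun_fubini_tonelli_F (m2 := mu) _ mg' g'0).
apply: (@le_trans _ _ (\int[mu]_y ((\int[mu]_y' (g (y, y'))%:E) + \int[mu]_y' (g' (y, y'))%:E))%E).
  rewrite le_eqVlt; apply/orP; left; apply/eqP; apply: eq_integral => y _.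
  rewrite ge0_integralD//; first exact: (measurable_section2 _ mg).
  exact: (measurable_section2 _ mg').
rewrite ge0_integralD//; last 2 first.
- by move=> y _; exact: integral_ge0.
- by move=> y _; exact: integral_ge0.
have /= -> := fubini_tonelli (m1 := mu) (m2 := mu) _ mg' g'0.
have -> : (10 / `|theta|)%:E = ((K / 2)%:E + (K / 2)%:E)%E.
  by rewrite -EFinD -splitr.
rewrite ge0_muleDl//.
have bnd (F : R -> \bar R) : measurable_fun setT F -> (forall y, 0 <= F y)%E ->
    (forall y, F y <= (K / 2)%:E * (f y ^+ 2)%:E)%E ->
    (\int[mu]_y F y <= (K / 2)%:E * \int[mu]_y (f y ^+ 2)%:E)%E.
  move=> mF F0 FK; rewrite -ge0_integralZl_EFin ?divr_ge0//.
  by apply: ge0_le_integral => //; exact: measurable_funeM.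
apply: leeD; apply: bnd => //.
- by move=> y; exact: integral_ge0.
- exact: (measurable_fun_fubini_tonelli_G (m1 := mu) _ mg' g'0).
- by move=> y; exact: integral_ge0.
Qed.

Let mCS : measurable_fun setT (fun x => C x ^+ 2 + S x ^+ 2).
Proof.
have mC : measurable_fun setT C.
  have := measurable_Rintegral_section mu (F := fun z : R * R => f z.2 * cos (A z.1 z.2)).
  by apply; rewrite /A; mfun.
have mS : measurable_fun setT S.
  have := measurable_Rintegral_section mu (F := fun z : R * R => f z.2 * sin (A z.1 z.2)).
  by apply; rewrite /A; mfun.
by mfun.
Qed.

Let mE N : measurable_fun setT (fun z : R * R => E N z.1 z.2).
Proof.
have := measurable_Rintegral_section mu
  (F := fun z : (R * R) * R => weight N z.2 * cos (A z.2 z.1.1 - A z.2 z.1.2)).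
apply; apply: measurable_funM; last by rewrite /A; mfun.
by apply: (measurableT_comp (measurable_weight N)); exact: measurable_snd.
Qed.

Let weighted_bound N : 0 < N ->
  (\int[mu]_x (weight N x * (C x ^+ 2 + S x ^+ 2))%:E <=
   (10 / `|theta|)%:E * \int[mu]_y (f y ^+ 2)%:E)%E.
Proof.
move=> N0; apply: le_trans (schur N0).
have CS0 x : 0 <= C x ^+ 2 + S x ^+ 2 by rewrite addr_ge0 ?sqr_ge0.
have CM x : `|C x| <= M by apply: bound_mul => //; rewrite /A; mfun.
have SM x : `|S x| <= M by apply: bound_mul => //; rewrite /A; mfun.
have iw : mu.-integrable setT (fun x => (weight N x * (C x ^+ 2 + S x ^+ 2))%:E).
  apply: (le_integrable measurableT _ _ (integrableZl measurableT (M ^+ 2 + M ^+ 2) (int_indic N))).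
    by apply/measurable_EFinP; apply: measurable_funM => //; exact: measurable_weight.
  move=> x _; rewrite -EFinM !abse_EFin lee_fin !normrM mulrC.
  apply: ler_pM => //.
    rewrite !ger0_norm ?addr_ge0 ?sqr_ge0// lerD//.
      by rewrite -(real_normK (num_real (C x))) lerXn2r ?nnegrE.
    by rewrite -(real_normK (num_real (S x))) lerXn2r ?nnegrE.
  rewrite ger0_norm ?weight_ge0// ger0_norm ?indicE//.
  by rewrite -indicE; exact: weight_le_itv.
have mfE : measurable_fun setT (fun z : R * R => f z.2 * E N z.1 z.2).
  by apply: measurable_funM => //; mfun.
pose H y := \int[mu]_y' (f y' * E N y y').
have mH : measurable_fun setT H.
  exact: (measurable_Rintegral_section mu mfE).
have -> : (\int[mu]_x (weight N x * (C x ^+ 2 + S x ^+ 2))%:E)%E =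
    (\int[mu]_x (weight N x * (C x ^+ 2 + S x ^+ 2)))%:E.
  by rewrite fineK//; exact: (integrable_fin_num measurableT iw).
rewrite (weighted_sum N0).
apply: (@le_trans _ _ `|\int[mu]_y (f y * H y)|%:E); first by rewrite lee_fin ler_norm.
apply: (le_trans (normr_Rintegral_le mu _)); first exact: measurable_funM.
have mk : measurable_fun setT (fun z : R * R => (`|f z.2| * kappa N theta (z.2 - z.1))%:E).
  apply/measurable_EFinP; apply: measurable_funM; first by mfun.
  by apply: (measurableT_comp (measurable_kappa N theta)); mfun.
have k0 (z : R * R) : (0 <= (`|f z.2| * kappa N theta (z.2 - z.1))%:E)%E.
  by rewrite lee_fin mulr_ge0// kappa_ge0.
apply: ge0_le_integral => //.
- by apply/measurable_EFinP; apply: measurable_funnorm; exact: measurable_funM.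
- apply: emeasurable_funM; first by apply/measurable_EFinP; exact: measurable_funnorm.
  exact: (measurable_fun_fubini_tonelli_F (m2 := mu) _ mk k0).
- move=> y _; rewrite normrM EFinM; apply: lee_wpmul2l => //.
  apply: (le_trans (normr_Rintegral_le mu _)).
    exact: (measurable_section2 _ mfE).
  apply: ge0_le_integral => //.
  + by apply/measurable_EFinP; apply: measurable_funnorm; exact: (measurable_section2 _ mfE).
  + exact: (measurable_section2 _ mk).
  + by move=> y' _; rewrite normrM lee_fin ler_wpM2l// E_le.
Qed.

Lemma chirp1_L2 :
  (\int[mu]_x ((\int[mu]_y (f y * cos (theta * (x - y) ^+ 2))) ^+ 2 +
               (\int[mu]_y (f y * sin (theta * (x - y) ^+ 2))) ^+ 2)%R%:E <=
   (10 / `|theta|)%:E * \int[mu]_y (f y ^+ 2)%:E)%E.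
Proof.
have CS0 x : 0 <= C x ^+ 2 + S x ^+ 2 by rewrite addr_ge0 ?sqr_ge0.
pose g (n : nat) (x : R) := (weight n.+1%:R x * (C x ^+ 2 + S x ^+ 2))%:E.
have ndw x : {homo (fun n => weight n.+1%:R x) : m n / (m <= n)%N >-> m <= n}.
  move=> m n mn; rewrite /weight ge_max !le_max lexx/=; apply/orP; right.
  rewrite lerD2l lerN2 ler_wpM2l ?sqr_ge0// lef_pV2 ?posrE ?exprn_gt0//.
  by rewrite lerXn2r ?nnegrE// ler_nat.
have ndg x : nondecreasing_seq (g ^~ x).
  by move=> m n mn; rewrite lee_fin ler_wpM2r// ndw.
have mg n : measurable_fun setT (g n).
  apply/measurable_EFinP; apply: measurable_funM => //; exact: measurable_weight.
have g0 n x : (0 <= g n x)%E by rewrite lee_fin mulr_ge0// weight_ge0.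
rewrite [leLHS](_ : _ = \int[mu]_x limn (g ^~ x))%E; last first.
  apply: eq_integral => x _; apply/esym/cvg_lim => //.
  rewrite -[X in _ --> X%:E]mul1r; apply: cvg_EFin; first exact: nearW.
  apply: cvgMr_tmp.
  (* The lower bound uses [(n+1)^2 >= n+1], so as to end on the harmonic sequence. *)
  apply: (@squeeze_cvgr _ _ _ _ (fun n => 1 - x ^+ 2 / n.+1%:R) (cst 1)).
  - apply: nearW => n; rewrite weight_le1 andbT le_max; apply/orP; right.
    rewrite lerD2l lerN2 ler_wpM2l ?sqr_ge0// lef_pV2 ?posrE ?exprn_gt0//.
    by rewrite -natrX ler_nat expnS expn1 leq_pmulr.
  - rewrite -[X in _ --> X]subr0; apply: cvgB; first exact: cvg_cst.
    rewrite -[X in _ --> X](mulr0 (x ^+ 2)); apply: cvgMl_tmp.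
    exact: cvg_harmonic.
  - exact: cvg_cst.
rewrite monotone_convergence//.
apply: lime_le; last by apply: nearW => n; exact: weighted_bound.
apply: ereal_nondecreasing_is_cvgn => m n mn.
by apply: ge0_le_integral => //; [exact: mg|exact: mg|move=> x _; exact: ndg].
Qed.

End chirp1.

(** * Integration on [R^(d+1)] by slices *)

Section lebesgue_n_integral.
Context {R : realType} (d : nat).
Notation mu := (@lebesgue_measure R).
Notation nu := (@lebesgue_n R d).

Lemma ge0_integral_lebesgue_nS (F : Rn R d.+1 -> \bar R) :
  measurable_fun setT F -> (forall x, 0 <= F x)%E ->
  (\int[lebesgue_n R d.+1]_x F x = \int[mu]_t \int[nu]_y F (tcons (t, y)))%E.
Proof.
move=> mF F0.
have mFt : measurable_fun setT (F \o @tcons R d).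
  by apply: measurableT_comp => //; exact: measurable_tcons.
transitivity (\int[(mu \x nu)%E]_p (F \o @tcons R d) p)%E; last first.
  exact: (fubini_tonelli1 (m1 := mu) (m2 := nu) _ mFt (fun x => F0 _)).
have := @ge0_integral_pushforward _ _ _ _ _ _ (@measurable_tcons R d) (mu \x nu)%E
  setT F measurableT mF (fun y _ => F0 y).
rewrite preimage_setT => <-.
by apply: (eq_measure_integral
    (measure_function_pushforward__canonical__measure_function_Measure
      (mu \x nu)%E (@measurable_tcons R d))).
Qed.

Section integrable.
Context (F : Rn R d.+1 -> R).
Context (iF : (lebesgue_n R d.+1).-integrable setT (EFin \o F)).

Let mF : measurable_fun setT F.
Proof. by apply/measurable_EFinP; exact: (measurable_int _ iF). Qed.

Let mFt : measurable_fun setT (fun p => F (tcons p)).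
Proof. by apply: (measurableT_comp mF); exact: measurable_tcons. Qed.

Lemma integrable_tcons :
  (mu \x nu)%E.-integrable setT (fun p => (F (tcons p))%:E).
Proof.
apply/integrable12ltyP; first exact/measurable_EFinP.
move: iF => /integrableP[_]; rewrite ge0_integral_lebesgue_nS//.
by apply: measurableT_comp => //; exact/measurable_EFinP.
Qed.

Lemma ae_integrable_tcons :
  {ae mu, forall t, nu.-integrable setT (fun y => (F (tcons (t, y)))%:E)}.
Proof. exact: (ae_integrable1 integrable_tcons). Qed.

(** Fubini's theorem for the image of the product measure. The inner real integral is known to equal
    the extended one only on integrable slices, that is, for almost every [t], hence the
    almost-everywhere comparison. *)
Lemma Rintegral_lebesgue_nS :
  \int[lebesgue_n R d.+1]_x F x = \int[mu]_t \int[nu]_y F (tcons (t, y)).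
Proof.
rewrite /Rintegral; congr fine.
transitivity (\int[(mu \x nu)%E]_p (F (tcons p))%:E)%E.
  have mEF : measurable_fun setT (EFin \o F) by exact/measurable_EFinP.
  have := @integral_pushforward _ _ _ _ _ _ (@measurable_tcons R d) (mu \x nu)%E
    setT _ mEF.
  rewrite preimage_setT => /(_ integrable_tcons measurableT) <-.
  by apply: (eq_measure_integral
    (measure_function_pushforward__canonical__measure_function_Measure
      (mu \x nu)%E (@measurable_tcons R d))).
have mFs t : measurable_fun setT (fun y => (F (tcons (t, y)))%:E).
  by apply/measurable_EFinP; exact: (measurable_section2 _ mFt).
rewrite -(integral12_prod_meas1 integrable_tcons).
apply: ae_eq_integral => //.
- exact: (measurable_fubini_F integrable_tcons).
- apply/measurable_EFinP.
  exact: (measurable_Rintegral_section nu mFt).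
- have := ae_integrable_tcons; apply: filterS => t it _.
  by rewrite fineK//; exact: (integrable_fin_num measurableT it).
Qed.

End integrable.

End lebesgue_n_integral.

Definition sqdist {R : realType} d (x y : Rn R d) : R :=
  \sum_(i < d) (tnth x i - tnth y i : R) ^+ 2.

Lemma sqdist_tcons {R : realType} d (s t : R) (x y : Rn R d) :
  sqdist (tcons (s, x)) (tcons (t, y)) = (s - t) ^+ 2 + sqdist x y.
Proof.
rewrite /sqdist big_ord_recl; congr (_ + _).
by apply: eq_bigr => i _; rewrite !tnthS.
Qed.

Lemma measurable_sqdist {R : realType} d {d'} {T : measurableType d'}
    (f g : T -> Rn R d) : measurable_fun setT f -> measurable_fun setT g ->
  measurable_fun setT (fun z => sqdist (f z) (g z)).
Proof.
move=> mf mg; rewrite /sqdist.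
apply: measurable_sum => i; apply: measurable_funX; apply: measurable_funB.
  by apply: (measurableT_comp (measurable_tnth i)).
by apply: (measurableT_comp (measurable_tnth i)).
Qed.

(** * Chirps in dimension [d], by induction on the coordinates *)

Section chirp.
Context {R : realType}.
Notation mu := (@lebesgue_measure R).

(* [chirp k] with [k = cos] and [k = sin] is the real, resp. imaginary, part of
   convolution with [e^(i theta |x|^2)]. *)
Definition chirp (k : R -> R) d (theta : R) (f : Rn R d -> R) (x : Rn R d) : R :=
  \int[lebesgue_n R d]_y (f y * k (theta * sqdist x y)).

Lemma trig_le1 (k : R -> R) : k = cos \/ k = sin -> forall x, `|k x| <= 1.
Proof.
by move=> [->|->] x; rewrite ler_norml ?cos_geN1 ?cos_le1 ?sin_geN1 ?sin_le1.
Qed.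

Lemma measurable_trig (k : R -> R) : k = cos \/ k = sin -> measurable_fun setT k.
Proof.
by move=> [->|->]; apply: continuous_measurable_fun;
  [exact: continuous_cos|exact: continuous_sin].
Qed.

Lemma integrable_chirp (k : R -> R) d (theta : R) (f : Rn R d -> R) x :
  k = cos \/ k = sin -> (lebesgue_n R d).-integrable setT (EFin \o f) ->
  (lebesgue_n R d).-integrable setT (fun y => (f y * k (theta * sqdist x y))%:E).
Proof.
move=> hk intf; apply: (le_integrable measurableT _ _ intf).
  apply/measurable_EFinP; apply: measurable_funM.
    by apply/measurable_EFinP; exact: (measurable_int _ intf).
  apply: (measurableT_comp (measurable_trig hk)); apply: measurable_funM => //.
  by apply: measurable_sqdist => //; exact: measurable_cst.
by move=> y _; rewrite !abse_EFin lee_fin normrM ler_piMr// trig_le1.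
Qed.

Lemma measurable_chirp (k : R -> R) d (theta : R) (f : Rn R d -> R) :
  k = cos \/ k = sin -> measurable_fun setT f ->
  measurable_fun setT (chirp k theta f).
Proof.
move=> hk mf.
apply: (measurable_Rintegral_section (lebesgue_n R d)
  (F := fun z => f z.2 * k (theta * sqdist z.1 z.2))).
apply: measurable_funM; first by apply: (measurableT_comp mf); exact: measurable_snd.
apply: (measurableT_comp (measurable_trig hk)); apply: measurable_funM => //.
by apply: measurable_sqdist; [exact: measurable_fst|exact: measurable_snd].
Qed.

(** The real and imaginary parts of a product of chirps have the forms [a - b] and [c + e]. The two
    sides differ by [(a + b)^2 + (c - e)^2]; dropping it costs a factor 2 per coordinate. *)
Let sqr_mix (a b c e : R) : (a - b) ^+ 2 + (c + e) ^+ 2 <=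
  2 * ((a ^+ 2 + c ^+ 2) + (e ^+ 2 + b ^+ 2)).
Proof.
rewrite -subr_ge0 (_ : _ - _ = (a + b) ^+ 2 + (c - e) ^+ 2); last by ring.
by rewrite addr_ge0 ?sqr_ge0.
Qed.

Section step.
Context (d : nat) (theta : R) (f : Rn R d.+1 -> R).
Context (theta0 : theta != 0).
Context (intf : (lebesgue_n R d.+1).-integrable setT (EFin \o f)).
Notation nu := (@lebesgue_n R d).

Let mf : measurable_fun setT f.
Proof. by apply/measurable_EFinP; exact: (measurable_int _ intf). Qed.

Let mft : measurable_fun setT (fun p => f (tcons p)).
Proof. by apply: (measurableT_comp mf); exact: measurable_tcons. Qed.

Let g (k : R -> R) (x : Rn R d) (t : R) := chirp k theta (fun y => f (tcons (t, y))) x.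

Let mg k : k = cos \/ k = sin -> measurable_fun setT (fun z : Rn R d * RM R => g k z.1 z.2).
Proof.
move=> hk.
have := measurable_Rintegral_section nu (F := fun z : (Rn R d * RM R) * Rn R d =>
  f (tcons (z.1.2, z.2)) * k (theta * sqdist z.1.1 z.2)).
apply; apply: measurable_funM.
  apply: (measurableT_comp mft); apply/measurable_fun_pairP; split => /=.
    by apply: (measurableT_comp measurable_snd); exact: measurable_fst.
  exact: measurable_snd.
apply: (measurableT_comp (measurable_trig hk)); apply: measurable_funM => //.
apply: measurable_sqdist; last exact: measurable_snd.
by apply: (measurableT_comp measurable_fst); exact: measurable_fst.
Qed.

Let intg k x : k = cos \/ k = sin -> mu.-integrable setT (EFin \o g k x).
Proof.
move=> hk.
have mF : measurable_fun setT (fun t => \int[nu]_y `|f (tcons (t, y))|%:E)%E.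
  apply: (measurable_fun_fubini_tonelli_F (m2 := nu) (fun p => `|f (tcons p)|%:E)) => //.
  by apply/measurable_EFinP; exact: measurable_funnorm.
have iF : mu.-integrable setT (fun t => \int[nu]_y `|f (tcons (t, y))|%:E)%E.
  apply/integrableP; split => //.
  have /integrable12ltyP := integrable_tcons intf.
  move=> /(_ (iffRL (measurable_EFinP _ _) mft)).
  suff -> : (\int[mu]_t `|\int[nu]_y `|f (tcons (t, y))|%:E| =
    \int[mu]_t \int[nu]_y `|(f (tcons (t, y)))%:E|)%E by [].
  by apply: eq_integral => t _; rewrite gee0_abs ?integral_ge0.
apply: (le_integrable measurableT _ _ iF).
  apply/measurable_EFinP; have mm := measurable_section2 (T3 := R) x (mg hk).
  exact mm.
move=> t _; rewrite [leRHS]gee0_abs ?integral_ge0//.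
have mfs : measurable_fun setT (fun y => f (tcons (t, y))) by exact: (measurable_section2 _ mft).
have mm : measurable_fun setT (fun y => f (tcons (t, y)) * k (theta * sqdist x y)).
  apply: measurable_funM => //.
  apply: (measurableT_comp (measurable_trig hk)); apply: measurable_funM => //.
  by apply: measurable_sqdist => //; exact: measurable_cst.
apply: (le_trans (normr_Rintegral_le nu mm)).
apply: ge0_le_integral => //.
- by apply/measurable_EFinP; exact: measurable_funnorm.
- by apply/measurable_EFinP; exact: measurable_funnorm.
- by move=> y _; rewrite lee_fin normrM ler_piMr// trig_le1.
Qed.

Let c1 (h : R -> R) (s : R) := \int[mu]_t (h t * cos (theta * (s - t) ^+ 2)).
Let s1 (h : R -> R) (s : R) := \int[mu]_t (h t * sin (theta * (s - t) ^+ 2)).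

Let int1 (k : R -> R) (h : R -> R) s : k = cos \/ k = sin ->
  mu.-integrable setT (EFin \o h) ->
  mu.-integrable setT (fun t => (h t * k (theta * (s - t) ^+ 2))%:E).
Proof.
move=> hk ih; apply: (le_integrable measurableT _ _ ih).
  apply/measurable_EFinP; apply: measurable_funM.
    by apply/measurable_EFinP; exact: (measurable_int _ ih).
  by apply: (measurableT_comp (measurable_trig hk)); mfun.
by move=> t _; rewrite !abse_EFin lee_fin normrM ler_piMr// trig_le1.
Qed.

Let hcos : @cos R = cos \/ @cos R = sin. Proof. by left. Qed.
Let hsin : @sin R = cos \/ @sin R = sin. Proof. by right. Qed.

(** By [sqdist_tcons] the chirp on [R^(d+1)] is the product of one in the first coordinate and one
    in the others; this is the real part of that product and [chirp_sin] the imaginary part. The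
    inner integral splits on integrable slices, so the integrands agree almost everywhere. *)
Let chirp_cos s x : chirp cos theta f (tcons (s, x)) = c1 (g cos x) s - s1 (g sin x) s.
Proof.
rewrite /chirp (Rintegral_lebesgue_nS (integrable_chirp theta _ hcos intf)).
rewrite -(RintegralB measurableT (int1 s hcos (intg x hcos)) (int1 s hsin (intg x hsin))).
rewrite /Rintegral; congr fine; apply: ae_eq_integral => //.
- apply/measurable_EFinP.
  have := measurable_Rintegral_section nu (F := fun z : RM R * Rn R d =>
    f (tcons (z.1, z.2)) * cos (theta * sqdist (tcons (s, x)) (tcons (z.1, z.2)))).
  apply; apply: measurable_funM.
    by rewrite (_ : (fun _ => _) = (fun p => f (tcons p)))//; apply/funext => -[].
  apply: measurable_funcos; apply: measurable_funM => //.
  apply: measurable_sqdist => //.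
  by rewrite (_ : (fun _ => _) = @tcons R d); [exact: measurable_tcons|apply/funext => -[]].
- apply/measurable_EFinP; apply: measurable_funB.
    by apply/measurable_EFinP; exact: (measurable_int _ (int1 s hcos (intg x hcos))).
  by apply/measurable_EFinP; exact: (measurable_int _ (int1 s hsin (intg x hsin))).
have := ae_integrable_tcons intf; apply: filterS => t it _; congr EFin.
rewrite /g /chirp ![_ * _ (theta * (s - t) ^+ 2)]mulrC.
rewrite -(RintegralZl _ measurableT (integrable_chirp theta x hcos it)).
rewrite -(RintegralZl _ measurableT (integrable_chirp theta x hsin it)).
rewrite -RintegralB//.
- by apply: eq_Rintegral => y _; rewrite sqdist_tcons mulrDr cosD; ring.
- by have := integrableZl measurableT (cos (theta * (s - t) ^+ 2)) (integrable_chirp theta x hcos it).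
- by have := integrableZl measurableT (sin (theta * (s - t) ^+ 2)) (integrable_chirp theta x hsin it).
Qed.

Let chirp_sin s x : chirp sin theta f (tcons (s, x)) = s1 (g cos x) s + c1 (g sin x) s.
Proof.
rewrite /chirp (Rintegral_lebesgue_nS (integrable_chirp theta _ hsin intf)).
rewrite -(RintegralD measurableT (int1 s hsin (intg x hcos)) (int1 s hcos (intg x hsin))).
rewrite /Rintegral; congr fine; apply: ae_eq_integral => //.
- apply/measurable_EFinP.
  have := measurable_Rintegral_section nu (F := fun z : RM R * Rn R d =>
    f (tcons (z.1, z.2)) * sin (theta * sqdist (tcons (s, x)) (tcons (z.1, z.2)))).
  apply; apply: measurable_funM.
    by rewrite (_ : (fun _ => _) = (fun p => f (tcons p)))//; apply/funext => -[].
  apply: measurable_funsin; apply: measurable_funM => //.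
  apply: measurable_sqdist => //.
  by rewrite (_ : (fun _ => _) = @tcons R d); [exact: measurable_tcons|apply/funext => -[]].
- apply/measurable_EFinP; apply: measurable_funD.
    by apply/measurable_EFinP; exact: (measurable_int _ (int1 s hsin (intg x hcos))).
  by apply/measurable_EFinP; exact: (measurable_int _ (int1 s hcos (intg x hsin))).
have := ae_integrable_tcons intf; apply: filterS => t it _; congr EFin.
rewrite /g /chirp ![_ * _ (theta * (s - t) ^+ 2)]mulrC.
rewrite -(RintegralZl _ measurableT (integrable_chirp theta x hcos it)).
rewrite -(RintegralZl _ measurableT (integrable_chirp theta x hsin it)).
rewrite -RintegralD//.
- by apply: eq_Rintegral => y _; rewrite sqdist_tcons mulrDr sinD; ring.
- by have := integrableZl measurableT (sin (theta * (s - t) ^+ 2)) (integrable_chirp theta x hcos it).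
- by have := integrableZl measurableT (cos (theta * (s - t) ^+ 2)) (integrable_chirp theta x hsin it).
Qed.

(** For fixed [x] in the last [d] coordinates [chirp1_L2] bounds the integral over the first one.
    Tonelli's theorem then puts the integral over [x] inside, where [ih] applies to almost every
    slice of [f]. The factor 2 is that of [sqr_mix]. *)
Lemma chirp_L2_step (K : R) : 0 <= K ->
  (forall h : Rn R d -> R, nu.-integrable setT (EFin \o h) ->
    \int[nu]_x (chirp cos theta h x ^+ 2 + chirp sin theta h x ^+ 2)%:E <=
    K%:E * \int[nu]_y (h y ^+ 2)%:E)%E ->
  (\int[lebesgue_n R d.+1]_x (chirp cos theta f x ^+ 2 + chirp sin theta f x ^+ 2)%:E <=
   (2 * (10 / `|theta|) * K)%:E * \int[lebesgue_n R d.+1]_y (f y ^+ 2)%:E)%E.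
Proof.
move=> K0 ih.
have mCS : measurable_fun setT (fun x : Rn R d.+1 =>
    (chirp cos theta f x ^+ 2 + chirp sin theta f x ^+ 2)%:E).
  apply/measurable_EFinP; apply: measurable_funD; apply: measurable_funX;
    exact: measurable_chirp.
have mf2 : measurable_fun setT (fun x => (f x ^+ 2)%:E) by mfun.
rewrite !ge0_integral_lebesgue_nS//; last 2 first.
- by move=> x; rewrite lee_fin sqr_ge0.
- by move=> x; rewrite lee_fin addr_ge0 ?sqr_ge0.
pose G (z : Rn R d * RM R) := g cos z.1 z.2 ^+ 2 + g sin z.1 z.2 ^+ 2.
have mG : measurable_fun setT (fun z => (G z)%:E).
  by apply/measurable_EFinP; apply: measurable_funD; apply: measurable_funX; exact: mg.
have G0 z : (0 <= (G z)%:E)%E by rewrite lee_fin addr_ge0 ?sqr_ge0.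
pose c := 2 * (10 / `|theta|).
have c0 : 0 <= c by rewrite mulr_ge0// divr_ge0.
have mCSt : measurable_fun setT (fun p : RM R * Rn R d =>
    (chirp cos theta f (tcons p) ^+ 2 + chirp sin theta f (tcons p) ^+ 2)%:E).
  exact: (measurableT_comp mCS (@measurable_tcons R d)).
have CSt0 (p : RM R * Rn R d) :
    (0 <= (chirp cos theta f (tcons p) ^+ 2 + chirp sin theta f (tcons p) ^+ 2)%:E)%E.
  by rewrite lee_fin addr_ge0 ?sqr_ge0.
have /= -> := fubini_tonelli (m1 := mu) (m2 := nu) _ mCSt CSt0.
apply: (@le_trans _ _ (\int[nu]_x (c%:E * \int[mu]_t (G (x, t))%:E))%E).
  apply: ge0_le_integral => //.
  - by move=> x _; apply: integral_ge0 => t _; exact: CSt0.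
  - exact: (measurable_fun_fubini_tonelli_G (m1 := mu) _ mCSt CSt0).
  - by apply: measurable_funeM; exact: (measurable_fun_fubini_tonelli_F (m2 := mu) _ mG G0).
  move=> x _.
  have mgx k : k = cos \/ k = sin -> measurable_fun setT (g k x).
    by move=> hk; apply/measurable_EFinP; exact: (measurable_int _ (intg x hk)).
  have Q k : k = cos \/ k = sin -> (\int[mu]_s (c1 (g k x) s ^+ 2 + s1 (g k x) s ^+ 2)%:E <=
      (10 / `|theta|)%:E * \int[mu]_t (g k x t ^+ 2)%:E)%E.
    by move=> hk; apply: chirp1_L2 => //; exact: intg.
  have mcs k : k = cos \/ k = sin ->
      measurable_fun setT (fun s => c1 (g k x) s ^+ 2 + s1 (g k x) s ^+ 2).
    move=> hk; apply: measurable_funD; apply: measurable_funX.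
      have := measurable_Rintegral_section mu
        (F := fun z : R * R => g k x z.2 * cos (theta * (z.1 - z.2) ^+ 2)).
      apply; apply: measurable_funM; last by mfun.
      by apply: (measurableT_comp (mgx k hk)); exact: measurable_snd.
    have := measurable_Rintegral_section mu
      (F := fun z : R * R => g k x z.2 * sin (theta * (z.1 - z.2) ^+ 2)).
    apply; apply: measurable_funM; last by mfun.
    by apply: (measurableT_comp (mgx k hk)); exact: measurable_snd.
  have cs0 k s : 0 <= c1 (g k x) s ^+ 2 + s1 (g k x) s ^+ 2.
    by rewrite addr_ge0 ?sqr_ge0.
  apply: (@le_trans _ _ (\int[mu]_s (2%:E * ((c1 (g cos x) s ^+ 2 + s1 (g cos x) s ^+ 2)%:E +
      (c1 (g sin x) s ^+ 2 + s1 (g sin x) s ^+ 2)%:E)))%E).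
    apply: ge0_le_integral => //.
    - have mm := measurable_section1 (T3 := \bar R) x mCSt. exact mm.
    - apply: measurable_funeM; apply: emeasurable_funD; apply/measurable_EFinP;
        exact: mcs.
    - by move=> s _; rewrite chirp_cos chirp_sin -EFinD -EFinM lee_fin sqr_mix.
  rewrite ge0_integralZl_EFin//; last 2 first.
  - by move=> s _; rewrite adde_ge0// lee_fin.
  - by apply: emeasurable_funD; apply/measurable_EFinP; exact: mcs.
  rewrite ge0_integralD//; last 4 first.
  - by move=> s _; rewrite lee_fin.
  - by apply/measurable_EFinP; exact: mcs.
  - by move=> s _; rewrite lee_fin.
  - by apply/measurable_EFinP; exact: mcs.
  rewrite /c EFinM -muleA; apply: lee_wpmul2l => //.
  apply: (le_trans (leeD (Q _ hcos) (Q _ hsin))).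
  rewrite -ge0_muleDr; last 2 first.
  - by apply: integral_ge0 => t _; rewrite lee_fin sqr_ge0.
  - by apply: integral_ge0 => t _; rewrite lee_fin sqr_ge0.
  apply: lee_wpmul2l; first by rewrite lee_fin divr_ge0.
  rewrite -ge0_integralD//.
  - by move=> t _; rewrite lee_fin sqr_ge0.
  - by apply/measurable_EFinP; apply: measurable_funX; exact: mgx.
  - by move=> t _; rewrite lee_fin sqr_ge0.
  - by apply/measurable_EFinP; apply: measurable_funX; exact: mgx.
rewrite ge0_integralZl_EFin//; last 2 first.
- by move=> x _; apply: integral_ge0 => t _; exact: G0.
- exact: (measurable_fun_fubini_tonelli_F (m2 := mu) _ mG G0).
have -> : (2 * (10 / `|theta|) * K)%:E = (c%:E * K%:E)%E by rewrite -EFinM.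
rewrite -muleA; apply: lee_wpmul2l => //.
have /= -> := fubini_tonelli (m1 := nu) (m2 := mu) _ mG G0.
have mf2t : measurable_fun setT (fun p : RM R * Rn R d => (f (tcons p) ^+ 2)%:E) by mfun.
have f2t0 (p : RM R * Rn R d) : (0 <= (f (tcons p) ^+ 2)%:E)%E by rewrite lee_fin sqr_ge0.
have mI := measurable_fun_fubini_tonelli_F (m2 := nu) _ mf2t f2t0.
rewrite -ge0_integralZl_EFin//; last first.
  by move=> t _; apply: integral_ge0 => y _; exact: (f2t0 (t, y)).
apply: ae_ge0_le_integral => //.
- by move=> t _; apply: integral_ge0 => x _; exact: G0.
- exact: (measurable_fun_fubini_tonelli_G (m1 := nu) _ mG G0).
- by move=> t _; apply: mule_ge0 => //; apply: integral_ge0 => y _; exact: (f2t0 (t, y)).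
- exact: measurable_funeM.
- have := ae_integrable_tcons intf; apply: filterS => t it _.
  exact (ih (fun y => f (tcons (t, y))) it).
Qed.

End step.

End chirp.

Section chirp_L2.
Context {R : realType}.

Lemma chirp_L2 d : exists2 K : R, 0 < K & forall (theta : R) (f : Rn R d -> R),
  theta != 0 -> (lebesgue_n R d).-integrable setT (EFin \o f) ->
  (\int[lebesgue_n R d]_x (chirp cos theta f x ^+ 2 + chirp sin theta f x ^+ 2)%:E <=
   (K / `|theta| ^+ d)%:E * \int[lebesgue_n R d]_y (f y ^+ 2)%:E)%E.
Proof.
elim: d => [|d [K K0 ih]].
  (* [R^0] is one point of mass 1, where the chirp is [f] times [cos 0] or [sin 0]. *)
  exists 1; first exact: ltr01.
  move=> theta f theta0 intf.
  have mf : measurable_fun setT f.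
    by apply/measurable_EFinP; exact: (measurable_int _ intf).
  have e k x : k = cos \/ k = sin -> chirp k theta f x = f [tuple] * k 0.
    move=> hk; rewrite /chirp /Rintegral.
    have := measurable_int _ (integrable_chirp theta x hk intf).
    move=> mm; rewrite (integral_dirac [tuple] measurableT mm).
    by rewrite diracT mul1e /= /sqdist big_ord0 mulr0.
  rewrite expr0 divr1 mul1e; apply: ge0_le_integral => //.
  - by move=> x _; rewrite lee_fin addr_ge0 ?sqr_ge0.
  - by apply/measurable_EFinP; apply: measurable_funD; apply: measurable_funX;
      apply: measurable_chirp => //; [left|right].
  - by mfun.
  - move=> x _; rewrite !e; [|by right|by left].
    by rewrite sin0 cos0 mulr0 mulr1 expr0n addr0 (tuple0 x).
(* [20 = 2 * 10]: the 2 of [sqr_mix] and the 10 of [integral_kappa]. *)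
exists (20 * K); first by rewrite mulr_gt0.
move=> theta f theta0 intf.
have t0 : 0 < `|theta| by rewrite normr_gt0.
have Kt0 : 0 <= K / `|theta| ^+ d by rewrite divr_ge0 ?exprn_ge0// ltW.
have := chirp_L2_step theta0 intf Kt0 (fun h => ih theta h theta0).
move=> /le_trans; apply; rewrite le_eqVlt; apply/orP; left; apply/eqP.
by congr (_%:E * _)%E; rewrite exprS; field; rewrite expf_neq0 gt_eqF.
Qed.

End chirp_L2.

(** * Interpolation between [L^2] and [L^1 -> L^oo] *)

Section interpolation.
Context {d} {X : measurableType d} {R : realType}.
Context (m : {sigma_finite_measure set X -> \bar R}).
Notation mu := (@lebesgue_measure R).
Context (kap : X * X -> R) (mkap : measurable_fun setT kap).
Context (kap1 : forall z, `|kap z| <= 1).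
Context (A : R) (A0 : 0 < A).
Let K (f : X -> R) (x : X) := \int[m]_y (f y * kap (x, y)).
Context (L2 : forall f : X -> R, m.-integrable setT (EFin \o f) ->
  (\int[m]_x (K f x ^+ 2)%:E <= A%:E * \int[m]_y (f y ^+ 2)%:E)%E).
Context (r : R) (r2 : 2 < r).
Let p := r / (r - 1).
Let r0 : 0 < r. Proof. by rewrite (lt_trans _ r2). Qed.
Let r1 : 0 < r - 1. Proof. by rewrite subr_gt0 (lt_trans _ r2)// ltr1n. Qed.
Let rne : r != 0. Proof. exact: lt0r_neq0. Qed.
Let r1ne : r - 1 != 0. Proof. exact: lt0r_neq0. Qed.
Let p1 : 1 < p. Proof. by rewrite ltr_pdivlMr// mul1r gtrBl. Qed.
Let p2 : p < 2. Proof. by rewrite /p ltr_pdivrMr//; move: r2; lra. Qed.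
Context (f : X -> R) (intf : m.-integrable setT (EFin \o f)).

Let mf : measurable_fun setT f.
Proof. by apply/measurable_EFinP; exact: (measurable_int _ intf). Qed.

Let fl (l : R) (y : X) : R := f y * (`|f y| <= l)%R%:R.

Let mfl l : measurable_fun setT (fl l). Proof. by rewrite /fl; mfun. Qed.

Let intfl l : m.-integrable setT (EFin \o fl l).
Proof.
apply: (le_integrable measurableT _ _ intf); first exact/measurable_EFinP.
move=> y _; rewrite !abse_EFin lee_fin normrM ler_piMr//.
by case: (`|f y| <= l); rewrite ?normr1 ?normr0.
Qed.

Let intK h x : m.-integrable setT (EFin \o h) ->
  m.-integrable setT (fun y => (h y * kap (x, y))%:E).
Proof.
move=> ih; apply: (le_integrable measurableT _ _ ih).
  apply/measurable_EFinP; apply: measurable_funM; last exact: (measurable_section2 _ mkap).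
  by apply/measurable_EFinP; exact: (measurable_int _ ih).
by move=> y _; rewrite !abse_EFin lee_fin normrM ler_piMr.
Qed.

Let mK h : measurable_fun setT h -> measurable_fun setT (K h).
Proof.
move=> mh; apply: (measurable_Rintegral_section m (F := fun z => h z.2 * kap z)).
by apply: measurable_funM => //; apply: (measurableT_comp mh); exact: measurable_snd.
Qed.

Let mKl : measurable_fun setT (fun z : X * R => K (fl z.2) z.1).
Proof.
have := measurable_Rintegral_section m
  (F := fun z : (X * R) * X => fl z.1.2 z.2 * kap (z.1.1, z.2)).
apply; apply: measurable_funM; first by rewrite /fl; mfun.
apply: (measurableT_comp mkap); apply/measurable_fun_pairP; split => /=.
  exact: (measurableT_comp measurable_fst measurable_fst).
exact: measurable_snd.
Qed.

Context (N : R) (N0 : 0 < N).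
Context (NE : (\int[m]_y (`|f y| `^ p)%:E = N%:E)%E).

(** On [|f| > l] one has [|f| <= l^(1-p) |f|^p] because [p > 1], and the kernel is bounded by 1: the
    discarded part obeys the [L^1 -> L^oo] bound. *)
Let truncation_error (l : R) x : 0 < l -> `|K f x| <= `|K (fl l) x| + l `^ (1 - p) * N.
Proof.
move=> l0.
have ifu : m.-integrable setT (EFin \o (fun y => f y - fl l y)).
  by have := integrableB measurableT intf (intfl l).
have -> : K f x = K (fl l) x + K (fun y => f y - fl l y) x.
  rewrite -(RintegralD measurableT (intK x (intfl l)) (intK x ifu)).
  by apply: eq_Rintegral => y _; ring.
apply: (le_trans (ler_normD _ _)); rewrite lerD2l -lee_fin.
have mu1 : measurable_fun setT (fun y => (f y - fl l y) * kap (x, y)).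
  apply: measurable_funM; last exact: (measurable_section2 _ mkap).
  exact: measurable_funB.
apply: (le_trans (normr_Rintegral_le m mu1)).
rewrite EFinM -NE -ge0_integralMl ?powR_ge0//; last first.
  by mfun.
apply: ge0_le_integral => //.
- by apply/measurable_EFinP; exact: measurable_funnorm.
- by mfun.
- move=> y _; rewrite lee_fin normrM; apply: (@le_trans _ _ `|f y - fl l y|).
    by rewrite ler_piMr.
  rewrite /fl; case: (leP `|f y| l) => fy; first by rewrite mulr1 subrr normr0 mulr_ge0 ?powR_ge0.
  have fy0 : 0 < `|f y| by exact: lt_trans fy.
  rewrite mulr0 subr0 -[leLHS]powRr1//.
  rewrite [in leLHS](_ : 1 = (1 - p) + p); last by ring.
  rewrite powRD ?(gt_eqF fy0) ?implybT//; apply: ler_wpM2r; first exact: powR_ge0.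
  rewrite -(opprB p 1) !powRN lef_pV2 ?posrE ?powR_gt0//.
  by apply: ge0_ler_powR; rewrite ?nnegrE ?subr_ge0 ?(ltW p1) ?(ltW l0) ?(ltW fy).
Qed.

(** With this weight the integral of [f^2] over the levels [l >= |f|] is [|f|^p / (2 - p)];
    convergence at infinity is [p < 2]. *)
Let a (l : R) : R := l `^ (p - 3) * (0 < l)%R%:R.

Let a0 l : 0 <= a l. Proof. by rewrite mulr_ge0 ?powR_ge0. Qed.

Let ma : measurable_fun setT a. Proof. by rewrite /a; mfun. Qed.

Let mE : measurable_fun setT (fun z : X * R => (a z.2 * K (fl z.2) z.1 ^+ 2)%:E).
Proof.
apply/measurable_EFinP; apply: measurable_funM; last exact: measurable_funX.
by apply: (measurableT_comp ma); exact: measurable_snd.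
Qed.

Let E0 (z : X * R) : (0 <= (a z.2 * K (fl z.2) z.1 ^+ 2)%:E)%E.
Proof. by rewrite lee_fin mulr_ge0 ?sqr_ge0. Qed.

(** As in [hls_pointwise]: past [l = (2N/B)^(1/(p-1))] the truncation error is at most [B/2], so
    [|K (fl l) x| >= B/2], and the weighted integral over these levels yields [B^r] since
    [(2 - p)/(p - 1) = r - 2]. *)
Let pointwise x : ((`|K f x| `^ r)%:E <= (4 * (2 - p) * (2 * N) `^ (r - 2))%:E *
  \int[mu]_l (a l * K (fl l) x ^+ 2)%:E)%E.
Proof.
set B := `|K f x|.
have Bge0 : 0 <= B by exact: normr_ge0.
have p20 : 0 < 2 - p by rewrite subr_gt0.
have [B0|B0] := eqVneq B 0.
  rewrite B0 powR0 ?(gt_eqF r0)//; apply: mule_ge0.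
    by rewrite lee_fin !mulr_ge0 ?powR_ge0 ?(ltW p20).
  by apply: integral_ge0 => l _; exact: (E0 (x, l)).
have {}B0 : 0 < B by rewrite lt0r B0.
pose lB := (2 * N / B) `^ (p - 1)^-1.
have q0 : 0 < 2 * N / B by rewrite divr_gt0// mulr_gt0.
have lB0 : 0 < lB by rewrite powR_gt0.
have p1ne : p - 1 != 0 by rewrite subr_eq0 gt_eqF.
have big l : lB <= l -> B / 2 <= `|K (fl l) x|.
  move=> lBl; have l0 : 0 < l by exact: lt_le_trans lBl.
  have := truncation_error x l0; rewrite -/B.
  suff : l `^ (1 - p) * N <= B / 2 by lra.
  rewrite -ler_pdivlMr// -(opprB p 1) powRN invf_ple ?posrE ?powR_gt0 ?divr_gt0//.
  have -> : (B / 2 / N)^-1 = lB `^ (p - 1).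
    rewrite /lB -powRrM mulVf// powRr1 ?ltW//; field.
    by rewrite !gt_eqF.
  by apply: ge0_ler_powR; rewrite ?nnegrE ?subr_ge0 ?(ltW p1) ?(ltW lB0) ?(le_trans (ltW lB0) lBl).
apply: (@le_trans _ _ ((4 * (2 - p) * (2 * N) `^ (r - 2))%:E *
    \int[mu]_(l in `[lB, +oo[) ((B ^+ 2 / 4) * l `^ (- 1 - (2 - p)))%:E)%E).
  under eq_integral do rewrite EFinM.
  rewrite ge0_integralZl_EFin; last 4 first.
  - exact: measurable_itv.
  - by move=> l _; rewrite lee_fin powR_ge0.
  - by apply/measurable_funTS/measurable_EFinP; exact: measurable_powR.
  - by rewrite divr_ge0 ?sqr_ge0.
  rewrite integral_powR_tail// -!EFinM lee_fin /lB -powRrM.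
  have -> : (p - 1)^-1 * - (2 - p) = - (r - 2).
    rewrite /p; field; rewrite r1ne/=.
    by rewrite (_ : r + -1 * (r - 1) = 1) ?oner_neq0//; ring.
  have N20 : 0 < 2 * N by rewrite mulr_gt0.
  have -> : (2 * N / B) `^ (- (r - 2)) = B `^ (r - 2) / (2 * N) `^ (r - 2).
    rewrite powRM ?invr_ge0 ?(ltW B0) ?(ltW N20)// -(powR_inv1 (ltW B0)) -powRrM.
    by rewrite mulrNN mul1r powRN mulrC.
  have -> : B `^ r = B ^+ 2 * B `^ (r - 2).
    rewrite -powR_mulrn// -powRD ?(gt_eqF B0) ?implybT//.
    by congr (_ `^ _); ring.
  have : (2 * N) `^ (r - 2) != 0 by rewrite gt_eqF// powR_gt0.
  move: (_ `^ (r - 2)) (B `^ (r - 2)) => u v une.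
  by rewrite le_eqVlt; apply/orP; left; apply/eqP; field; rewrite une gt_eqF.
apply: lee_wpmul2l; first by rewrite lee_fin !mulr_ge0 ?powR_ge0 ?(ltW p20).
rewrite integral_mkcond; apply: ge0_le_integral => //.
- move=> l _; apply: erestrict_ge0 => y _.
  by rewrite lee_fin mulr_ge0 ?powR_ge0// divr_ge0 ?sqr_ge0.
- apply/(measurable_restrictT _ _).1 => //; apply: measurable_funTS.
  by mfun.
- have mm := (measurable_section2 (T3 := \bar R) x mE). exact mm.
- move=> l _; rewrite patchE; case: ifPn; last first.
    by move=> _; exact: (E0 (x, l)).
  rewrite inE/= in_itv/= andbT => lBl.
  rewrite /a (lt_le_trans lB0 lBl) mulr1 lee_fin mulrC.
  rewrite [in leLHS](_ : - 1 - (2 - p) = p - 3); last by ring.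
  apply: ler_wpM2l; first exact: powR_ge0.
  rewrite -(real_normK (num_real (K (fl l) x))).
  rewrite (_ : B ^+ 2 / 4 = (B / 2) ^+ 2); last by field.
  by rewrite lerXn2r ?nnegrE ?divr_ge0// big.
Qed.

(** After [pointwise], Tonelli's theorem puts the level outside, the [L^2] bound is applied to each
    [fl l], and the level integral restores [|f|^p]. The factors [2 - p] cancel. *)
Lemma interpolation_bound :
  (\int[m]_x (`|K f x| `^ r)%:E <= (4 * 2 `^ (r - 2) * A * N `^ (r - 1))%:E)%E.
Proof.
have p20 : 0 < 2 - p by rewrite subr_gt0.
pose c := 4 * (2 - p) * (2 * N) `^ (r - 2).
have c0 : 0 <= c by rewrite !mulr_ge0 ?powR_ge0// ltW.
have mEx := measurable_fun_fubini_tonelli_F (m2 := mu) _ mE E0.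
have Ex0 x : (0 <= \int[mu]_l (a l * K (fl l) x ^+ 2)%:E)%E.
  by apply: integral_ge0 => l _; exact: (E0 (x, l)).
apply: (@le_trans _ _ (\int[m]_x (c%:E * \int[mu]_l (a l * K (fl l) x ^+ 2)%:E))%E).
  apply: ge0_le_integral => //.
  - by apply/measurable_EFinP; apply: measurable_funpowR; apply: measurable_funnorm; exact: mK.
  - exact: measurable_funeM.
rewrite ge0_integralZl_EFin; last 4 first.
- exact: measurableT.
- by move=> x _; exact: Ex0.
- exact: mEx.
- exact: c0.
apply: (@le_trans _ _ (c%:E * (A * N / (2 - p))%:E)%E); last first.
  rewrite -EFinM lee_fin /c powRM ?(ltW N0)//.
  have -> : N `^ (r - 1) = N * N `^ (r - 2).
    rewrite -[X in X * _](powRr1 (ltW N0)) -powRD ?(gt_eqF N0) ?implybT//.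
    by congr (_ `^ _); ring.
  by rewrite le_eqVlt; apply/orP; left; apply/eqP; field; rewrite gt_eqF.
apply: lee_wpmul2l; first by rewrite lee_fin.
have /= -> := fubini_tonelli (m1 := m) (m2 := mu) _ mE E0.
pose g (z : R * X) := a z.1 * fl z.1 z.2 ^+ 2.
have mg : measurable_fun setT (fun z => (g z)%:E).
  apply/measurable_EFinP; apply: measurable_funM.
    by apply: (measurableT_comp ma); exact: measurable_fst.
  by apply: measurable_funX; rewrite /fl; mfun.
have g0 z : (0 <= (g z)%:E)%E by rewrite lee_fin mulr_ge0 ?sqr_ge0.
have mG := measurable_fun_fubini_tonelli_F (m2 := m) _ mg g0.
apply: (@le_trans _ _ (\int[mu]_l (A%:E * \int[m]_y (g (l, y))%:E))%E).
  apply: ge0_le_integral => //.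
  - by move=> l _; apply: integral_ge0 => x _; exact: (E0 (x, l)).
  - exact: (measurable_fun_fubini_tonelli_G (m1 := m) _ mE E0).
  - exact: measurable_funeM.
  - move=> l _.
    rewrite ge0_integralMl//; last 2 first.
      by apply: measurable_funX; exact: mK.
      by move=> x; exact: sqr_ge0.
    rewrite /g /= ge0_integralMl//; last 2 first.
      by apply: measurable_funX; exact: mfl.
      by move=> x; exact: sqr_ge0.
    by rewrite muleCA; apply: lee_wpmul2l; [rewrite lee_fin|exact: L2].
rewrite ge0_integralZl_EFin; last 4 first.
- exact: measurableT.
- by move=> l _; apply: integral_ge0 => x _; exact: g0.
- exact: mG.
- exact: ltW.
rewrite -mulrA EFinM; apply: lee_wpmul2l; first by rewrite lee_fin ltW.
have /= -> := fubini_tonelli (m1 := mu) (m2 := m) _ mg g0.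
have -> : (N / (2 - p))%:E = (\int[m]_y ((2 - p)^-1 * (`|f y| `^ p))%:E)%E.
  rewrite ge0_integralMl ?NE -?EFinM ?invr_ge0 ?(ltW p20)//; last by mfun.
  by rewrite mulrC.
apply: ge0_le_integral => //.
- by move=> y _; apply: integral_ge0 => l _; exact: g0.
- exact: (measurable_fun_fubini_tonelli_G (m1 := mu) _ mg g0).
- by mfun.
move=> y _; have [fy|fy] := eqVneq (f y) 0.
  rewrite integral0_eq ?lee_fin ?mulr_ge0 ?powR_ge0 ?invr_ge0 ?(ltW p20)//.
  by move=> l _; rewrite /g /fl /= fy mul0r expr0n mulr0.
have fy0 : 0 < `|f y| by rewrite normr_gt0.
have near : (\int[mu]_l (g (l, y))%:E <=
    \int[mu]_(l in `[`|f y|%R, +oo[) ((f y ^+ 2) * l `^ (- 1 - (2 - p)))%:E)%E.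
  rewrite [leRHS]integral_mkcond; apply: ge0_le_integral => //.
  - have mm := (measurable_section1 (T3 := \bar R) y mg). exact mm.
  - apply/(measurable_restrictT _ _).1 => //; apply: measurable_funTS.
    by mfun.
  - move=> l _; rewrite patchE /g /fl /a /= mem_setE in_itv/= andbT.
    case: (leP `|f y| l) => fyl; last by rewrite mulr0 expr0n mulr0.
    rewrite (lt_le_trans fy0 fyl) !mulr1 mulrC lee_fin.
    by rewrite (_ : - 1 - (2 - p) = p - 3)//; ring.
have tail : (\int[mu]_(l in `[`|f y|%R, +oo[) ((f y ^+ 2) * l `^ (- 1 - (2 - p)))%:E <=
    ((2 - p)^-1 * (`|f y| `^ p))%:E)%E.
  under eq_integral do rewrite EFinM.
  rewrite ge0_integralZl_EFin; last 4 first.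
  - exact: measurable_itv.
  - by move=> l _; rewrite lee_fin powR_ge0.
  - by apply/measurable_funTS/measurable_EFinP; exact: measurable_powR.
  - exact: sqr_ge0.
  rewrite integral_powR_tail// -!EFinM lee_fin.
  have -> : `|f y| `^ p = f y ^+ 2 * `|f y| `^ (- (2 - p)).
    rewrite -(real_normK (num_real (f y))) -powR_mulrn// -powRD ?(gt_eqF fy0) ?implybT//.
    by congr (_ `^ _); ring.
  by rewrite le_eqVlt; apply/orP; left; apply/eqP; ring.
exact (le_trans near tail).
Qed.

End interpolation.

(** * The dispersive estimate at a fixed time *)

Section fixed_time.
Context {R : realType}.

Lemma hoelder_conjugate_EFin (rho : R) : 1 < rho ->
  hoelder_conjugate rho%:E = (rho / (rho - 1))%:E.
Proof.
move=> r1; rewrite /hoelder_conjugate/= eqe gt_eqF ?(lt_trans _ r1)//.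
by rewrite -EFinD inver subr_eq0 gt_eqF// -EFinM.
Qed.

Lemma measurable_funV {d} {T : measurableType d} (f : T -> R) :
  measurable_fun setT f -> measurable_fun setT (fun x => (f x)^-1).
Proof.
move=> mf; rewrite (_ : (fun _ => _) = fun x => ((0 < f x)%R%:R - (f x < 0)%R%:R) * `|f x| `^ (-1)).
  by mfun.
apply/funext => x; case: (ltgtP (f x) 0) => fx.
- by rewrite sub0r ltr0_norm// powR_inv1 ?oppr_ge0 ?ltW// invrN mulN1r opprK.
- by rewrite subr0 mul1r gtr0_norm// powR_inv1// ltW.
- by rewrite fx invr0 subr0 mul0r.
Qed.

Let chirp_L2_one d : exists2 K : R, 0 < K & forall k (s : R) (f : Rn R d -> R),
  k = cos \/ k = sin -> s != 0 -> (lebesgue_n R d).-integrable setT (EFin \o f) ->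
  (\int[lebesgue_n R d]_x (chirp k (4 * s)^-1 f x ^+ 2)%:E <=
   (K * `|s| `^ d%:R)%:E * \int[lebesgue_n R d]_y (f y ^+ 2)%:E)%E.
Proof.
have [K K0 h] := @chirp_L2 R d.
exists (K * 4 ^+ d); first by rewrite mulr_gt0// exprn_gt0.
move=> k s f hk s0 intf.
have mf : measurable_fun setT f.
  by apply/measurable_EFinP; exact: (measurable_int _ intf).
have t0 : (4 * s)^-1 != 0 by rewrite invr_eq0 mulf_neq0.
have := h _ _ t0 intf.
have -> : K / `|(4 * s)^-1| ^+ d = K * 4 ^+ d * `|s| `^ d%:R.
  rewrite powR_mulrn// normrV ?unitfE ?mulf_neq0// normrM ger0_norm//.
  by rewrite exprVn invrK exprMn mulrA.
apply: le_trans; apply: ge0_le_integral => //.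
- by move=> x _; rewrite lee_fin sqr_ge0.
- by apply/measurable_EFinP; apply: measurable_funX; exact: measurable_chirp.
- by apply/measurable_EFinP; apply: measurable_funD; apply: measurable_funX;
    apply: measurable_chirp => //; [left|right].
- by move=> x _; rewrite lee_fin; case: hk => ->; rewrite ?lerDl ?lerDr sqr_ge0.
Qed.

Let chirp_power d (rho : R) : 2 <= rho ->
  exists2 C : R, 0 < C & forall k (s : R) (f : Rn R d -> R) (N : R),
  k = cos \/ k = sin -> s != 0 -> (lebesgue_n R d).-integrable setT (EFin \o f) ->
  0 < N -> (\int[lebesgue_n R d]_y (`|f y| `^ (rho / (rho - 1)))%:E = N%:E)%E ->
  (\int[lebesgue_n R d]_x (`|chirp k (4 * s)^-1 f x| `^ rho)%:E <=
   (C * `|s| `^ d%:R * N `^ (rho - 1))%:E)%E.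
Proof.
have [K K0 L2] := chirp_L2_one d.
(* At [rho = 2] the claim is the [L^2] bound itself; interpolation needs [rho > 2], since the weight
   [l^(p-3)] has a divergent tail at [p = 2]. *)
rewrite le_eqVlt => /orP[/eqP <-|rho2].
  exists K => // k s f N hk s0 intf N0 NE.
  have e (h : Rn R d -> R) : (\int[lebesgue_n R d]_x (`|h x| `^ 2)%:E =
      \int[lebesgue_n R d]_x (h x ^+ 2)%:E)%E.
    by apply: eq_integral => x _; rewrite powR_mulrn// real_normK// num_real.
  rewrite e; apply: (le_trans (L2 k s f hk s0 intf)).
  rewrite -e; move: NE; rewrite (_ : 2 / (2 - 1) = 2 :> R); last by field.
  by move=> ->; rewrite (_ : 2 - 1 = 1 :> R); [rewrite powRr1// ltW|ring].
exists (4 * 2 `^ (rho - 2) * K); first by rewrite !mulr_gt0// powR_gt0.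
move=> k s f N hk s0 intf N0 NE.
pose kap (z : Rn R d * Rn R d) := k ((4 * s)^-1 * sqdist z.1 z.2).
have mkap : measurable_fun setT kap.
  apply: (measurableT_comp (measurable_trig hk)); apply: measurable_funM => //.
  by apply: measurable_sqdist; [exact: measurable_fst|exact: measurable_snd].
have A0 : 0 < K * `|s| `^ d%:R by rewrite mulr_gt0// powR_gt0// normr_gt0.
have := @interpolation_bound _ _ R (lebesgue_n R d) kap mkap
  (fun z => trig_le1 hk _) (K * `|s| `^ d%:R) A0
  (fun h ih => L2 k s h hk s0 ih) rho rho2 f intf N N0 NE.
by rewrite !mulrA.
Qed.

Let Lnorm_chirp d (rho : R) : 2 <= rho ->
  exists2 C : R, 0 < C & forall k (s : R) (f : Rn R d -> R),
  k = cos \/ k = sin -> s != 0 -> (lebesgue_n R d).-integrable setT (EFin \o f) ->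
  (Lnorm (lebesgue_n R d) rho%:E (fun x => `|chirp k (4 * s)^-1 f x|%:E) <=
   (C * `|s| `^ (d%:R / rho))%:E *
   Lnorm (lebesgue_n R d) (rho / (rho - 1))%:E (fun x => `|f x|%:E))%E.
Proof.
move=> rho2; have [C C0 h] := chirp_power d rho2.
have r0 : 0 < rho by rewrite (lt_le_trans _ rho2).
have r1 : 0 < rho - 1 by rewrite subr_gt0 (lt_le_trans _ rho2)// ltr1n.
have p0 : 0 < rho / (rho - 1) by rewrite divr_gt0.
exists (C `^ rho^-1); first by rewrite powR_gt0.
move=> k s f hk s0 intf.
have mf : measurable_fun setT f.
  by apply/measurable_EFinP; exact: (measurable_int _ intf).
have ms : 0 < `|s| `^ (d%:R / rho) by rewrite powR_gt0// normr_gt0.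
have mfa : measurable_fun setT (fun x => `|f x|%:E).
  by apply/measurable_EFinP; exact: measurable_funnorm.
have mch : measurable_fun setT (fun x => `|chirp k (4 * s)^-1 f x|%:E).
  by apply/measurable_EFinP; apply: measurable_funnorm; exact: measurable_chirp.
set L := (X in (_ <= _ * X)%E).
have L0 : (0 <= L)%E by exact: Lnorm_ge0.
have [Ly|Lny] := eqVneq L +oo%E.
  by rewrite Ly gt0_muley ?leey// lte_fin mulr_gt0// powR_gt0.
(* [chirp_power] asks for a positive finite [N]. If the norm is 0, [f] vanishes almost everywhere
   and its chirp identically. *)
have [Lz|Lnz] := eqVneq L 0%E.
  have f0 : \forall x \ae lebesgue_n R d, `|f x|%:E = 0%E.
    have f0 x : (0 <= `|f x|%:E)%E by [].
    have p0e : (0 < (rho / (rho - 1))%:E)%E by rewrite lte_fin.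
    exact: (iffLR (ge0_Lnorm_eq0 _ p0e mfa f0) Lz).
  rewrite Lz mule0 (_ : (fun _ => _) = cst 0%E) ?Lnorm0 ?eqe ?gt_eqF//.
  apply/funext => x /=; congr EFin; rewrite /chirp /Rintegral (ae_eq_integral (cst 0%E)) ?integral0 ?normr0//.
    exact: (measurable_int _ (integrable_chirp _ x hk intf)).
  by apply: filterS f0 => y [] /eqP; rewrite normr_eq0 => /eqP -> _; rewrite mul0r.
have Lfin : (L \is a fin_num)%E by rewrite ge0_fin_numE// ltey.
pose l := fine L; have lE : L = l%:E by rewrite fineK.
have l0 : 0 < l by rewrite -lte_fin -lE lt0e Lnz.
have NE : (\int[lebesgue_n R d]_y (`|f y| `^ (rho / (rho - 1)))%:E =
    (l `^ (rho / (rho - 1)))%:E)%E.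
  have : (L `^ (rho / (rho - 1)) = (l `^ (rho / (rho - 1)))%:E)%E by rewrite lE poweR_EFin.
  rewrite /L ge0_LnormE// -poweRrM mulVf ?gt_eqF// poweRe1//.
  by apply: integral_ge0 => y _; exact: poweR_ge0.
have := h k s f _ hk s0 intf (powR_gt0 _ l0) NE.
rewrite -powRrM mulfVK ?gt_eqF// => hh.
rewrite lE; apply/Lnorm_le_fin => //.
  by rewrite lee_fin !mulr_ge0 ?powR_ge0// ltW.
apply: (le_trans hh); rewrite -EFinM poweR_EFin lee_fin.
rewrite !powRM ?mulr_ge0 ?powR_ge0 ?(ltW l0)//.
by rewrite -!powRrM mulVf ?gt_eqF// powRr1 ?(ltW C0)// mulfVK ?gt_eqF.
Qed.

(** The power of [|s|] is nonnegative because the chirp carries no factor [|s|^(-d/2)]. For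
    [r = +oo] the bound is [|k| <= 1], with constant 1 and power [|s|^0]. *)
Lemma fixed_time d (r : \bar R) : (2%:E <= r)%E ->
  exists2 C : R, 0 < C & forall k (s : R) (f : Rn R d -> R),
  k = cos \/ k = sin -> s != 0 -> (lebesgue_n R d).-integrable setT (EFin \o f) ->
  (Lnorm (lebesgue_n R d) r (fun x => `|chirp k (4 * s)^-1 f x|%:E) <=
   (C * `|s| `^ (d%:R * fine r^-1))%:E *
   Lnorm (lebesgue_n R d) (hoelder_conjugate r) (fun x => `|f x|%:E))%E.
Proof.
case: r => [rho| |//].
  rewrite lee_fin => rho2.
  have r1 : 1 < rho by rewrite (lt_le_trans _ rho2)// ltr1n.
  have [C C0 h] := Lnorm_chirp d rho2; exists C => // k s f hk s0 intf.
  by rewrite hoelder_conjugate_EFin// inver gt_eqF ?(lt_trans _ r1)//; exact: h.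
move=> _; exists 1 => // k s f hk s0 intf.
rewrite hoelder_conjugatey invey/= mulr0 powRr0 mulr1 mul1e.
have mf : measurable_fun setT f.
  by apply/measurable_EFinP; exact: (measurable_int _ intf).
apply/Lnorm_ley => //; first exact: Lnorm_ge0.
apply: aeW => x; rewrite Lnorm1.
have mm : measurable_fun setT (fun y => f y * k ((4 * s)^-1 * sqdist x y)).
  by apply/measurable_EFinP; exact: (measurable_int _ (integrable_chirp _ x hk intf)).
apply: (le_trans (normr_Rintegral_le _ mm)); apply: ge0_le_integral => //.
- by apply/measurable_EFinP; exact: measurable_funnorm.
- by apply/measurable_EFinP; do 2 apply: measurable_funnorm.
- by move=> y _; rewrite lee_fin normrM normr_id ler_piMr// trig_le1.
Qed.

End fixed_time.

(** * Convergence to 0 and lower limits of nonnegative extended reals *)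

Section ereal_cvg0.
Context {R : realType}.
Local Open Scope ereal_scope.

Lemma ge0_cvge0P {T : Type} (F : set_system T) (FF : ProperFilter F) (u : T -> \bar R) :
  (forall x, 0 <= u x) ->
  (u x @[x --> F] --> 0) <-> (forall e : R, (0 < e)%R -> \forall x \near F, u x <= e%:E).
Proof.
move=> u0; split.
  move/fine_cvgP => -[ufin /cvgrPdist_le h] e e0.
  have := h e e0; apply: filterS2 ufin => x ufin.
  by rewrite /= sub0r normrN ger0_norm ?fine_ge0// -lee_fin fineK.
move=> h; apply/fine_cvgP; split.
  by apply: filterS (h 1%R ltr01) => x ux; rewrite ge0_fin_numE// (le_lt_trans ux)// ltry.
apply/cvgrPdist_le => e e0; apply: filterS (h e e0) => x ux /=.
rewrite sub0r normrN ger0_norm ?fine_ge0// -lee_fin fineK//.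
by rewrite ge0_fin_numE// (le_lt_trans ux)// ltry.
Qed.

Lemma ge0_cvge0_poweR {T : Type} (F : set_system T) (FF : ProperFilter F) (u : T -> \bar R) (r : R) :
  (0 < r)%R -> (forall x, 0 <= u x) -> u x @[x --> F] --> 0 -> u x `^ r @[x --> F] --> 0.
Proof.
move=> r0 u0 /(ge0_cvge0P FF u0) h; apply/ge0_cvge0P => [x|e e0]; first exact: poweR_ge0.
apply: filterS (h _ (powR_gt0 r^-1 e0)) => x ux.
apply: (le_trans (lee_poweR (ltW r0) (u0 x) ux)).
by rewrite poweR_EFin -powRrM mulVf ?gt_eqF// powRr1 ?(ltW e0).
Qed.

Lemma limn_einf_ge0 (u : (\bar R)^nat) : (forall n, 0 <= u n) -> 0 <= limn_einf u.
Proof.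
move=> u0; rewrite limn_einf_lim; apply: lime_ge.
  by apply: ereal_nondecreasing_is_cvgn; exact: nondecreasing_einfs.
by apply: nearW => n; apply: le_ereal_inf_tmp => _ [k _ <-].
Qed.

Lemma measurable_limn_einf {d} {T : measurableType d} (f_ : (T -> \bar R)^nat) :
  (forall n, measurable_fun setT (f_ n)) ->
  measurable_fun setT (fun x => limn_einf (f_ ^~ x)).
Proof.
move=> mf; rewrite (_ : (fun _ => _) = fun x => - limn_esup (fun n => - f_ n x)).
  apply: measurableT_comp => //.
  apply: measurable_fun_limn_esup => n; apply: measurableT_comp => //.
by apply/funext => x; rewrite -[RHS]limn_einfN; congr limn_einf; apply/funext => n /=; rewrite oppeK.
Qed.

Lemma Lnorm_dominated {d} {T : measurableType d} (mu : {measure set T -> \bar R}) (p : R)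
    (f_ : (T -> \bar R)^nat) (g : T -> \bar R) : (0 < p)%R ->
  (forall n, measurable_fun setT (f_ n)) -> measurable_fun setT g ->
  (forall n x, 0 <= f_ n x) -> (forall n x, f_ n x <= g x) ->
  Lnorm mu p%:E g < +oo -> (\forall x \ae mu, f_ n x @[n --> \oo] --> 0) ->
  Lnorm mu p%:E (f_ n) @[n --> \oo] --> 0.
Proof.
move=> p0 mf mg f0 fg gfin fcvg.
have g0 x : 0 <= g x by exact: le_trans (fg 0%N x).
rewrite (_ : (fun n => _) = fun n => (\int[mu]_x f_ n x `^ p) `^ p^-1); last first.
  by apply/funext => n; rewrite ge0_LnormE.
apply: ge0_cvge0_poweR; [by rewrite invr_gt0|by move=> n; apply: integral_ge0 => x _; exact: poweR_ge0|].
have ig : mu.-integrable setT (fun x => g x `^ p).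
  apply/integrableP; split; first exact: measurable_fun_poweR.
  under eq_integral do rewrite gee0_abs ?poweR_ge0//.
  by move: gfin; rewrite ge0_LnormE// => /lty_poweRy; rewrite invr_neq0 ?gt_eqF// => /(_ isT).
have [] := @dominated_convergence _ _ _ mu setT measurableT (fun n x => f_ n x `^ p)
  (cst 0) (fun x => g x `^ p).
- by move=> n; exact: measurable_fun_poweR.
- exact: measurable_cst.
- by apply: filterS fcvg => x fx _; exact: ge0_cvge0_poweR.
- exact: ig.
- by apply: aeW => x n _; rewrite gee0_abs ?poweR_ge0//; apply: lee_poweR => //; exact: ltW.
by rewrite integral0.
Qed.

End ereal_cvg0.

(** * Mixed norms of nonnegative functions *)

Section mixn.
Context {d1 d2} {X : measurableType d1} {T : measurableType d2} {R : realType}.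
Context (m1 : {sigma_finite_measure set X -> \bar R}).
Context (m2 : {sigma_finite_measure set T -> \bar R}).
Local Open Scope ereal_scope.

(** [P] is an arbitrary predicate, so the argument runs on a measurable null set containing its
    complement: by Tonelli's theorem almost every slice of that set is null. *)
Lemma ae_prod_section (P : X * T -> Prop) :
  (\forall p \ae (m1 \x m2), P p) -> \forall t \ae m2, \forall x \ae m1, P (x, t).
Proof.
move=> [N [mN N0 PN]].
pose G p : \bar R := (\1_N p)%:E.
have mG : measurable_fun setT G by apply/measurable_EFinP; exact: measurable_indic.
have G0 p : 0 <= G p by rewrite lee_fin.
have : \int[m1 \x m2]_p G p = 0 by rewrite integral_indic// setIT.
rewrite fubini_tonelli2// => h.
have := (iffLR (ge0_integral_eq0 _ (measurable_fun_fubini_tonelli_G G mG G0)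
  (fun t => integral_ge0 _ (fun x _ => G0 (x, t)))) h).
apply: filterS => t /ge0_integral_eq0 ht.
have := ht (measurable_section1 t mG) (fun x => G0 (x, t)).
apply: filterS => x [] Gx; apply: contrapT => nP.
have : N (x, t) by exact: PN.
by move=> /mem_set; move: Gx => /=; rewrite indicE => /eqP; case: (_ \in N); rewrite //= oner_eq0.
Qed.

Lemma ae_section_prod (G : X * T -> \bar R) : measurable_fun setT G -> (forall p, 0 <= G p) ->
  (\forall t \ae m2, \forall x \ae m1, G (x, t) = 0) -> \forall p \ae (m1 \x m2), G p = 0.
Proof.
move=> mG G0 h; apply/ge0_integral_eq0 => //.
rewrite fubini_tonelli2//; apply/ge0_integral_eq0.
- exact: (measurable_fun_fubini_tonelli_G G mG G0).
- by move=> t; exact: integral_ge0.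
- apply: filterS h => t h; apply/ge0_integral_eq0 => //.
  exact: measurable_section1.
Qed.

Context (q r : \bar R).

(** The mixed norm on [[0, +oo]]-valued functions, so that it also measures majorants that may be
    infinite at some points. *)
Definition mixn (F : X * T -> \bar R) : \bar R :=
  Lnorm m2 q (fun t => Lnorm m1 r (fun x => F (x, t))).

Lemma mixn_ge0 F : 0 <= mixn F.
Proof. exact: Lnorm_ge0. Qed.

Lemma eq_mixn F G : F =1 G -> mixn F = mixn G.
Proof. by move=> /funext ->. Qed.

Context (q1 : 1 <= q).
Context (r1 : 1 <= r).
Let q0 : 0 < q. Proof. exact: lt_le_trans q1. Qed.
Let r0 : 0 < r. Proof. exact: lt_le_trans r1. Qed.

Let mN (F : X * T -> \bar R) : measurable_fun setT F -> (forall p, 0 <= F p) ->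
  measurable_fun setT (fun t => Lnorm m1 r (fun x => F (x, t))).
Proof. by move=> mF F0; exact: measurable_Lnorm1. Qed.

Lemma le_mixn_ae F G : measurable_fun setT F -> measurable_fun setT G ->
  (forall p, 0 <= F p) -> (forall p, 0 <= G p) ->
  (\forall p \ae (m1 \x m2), F p <= G p) -> mixn F <= mixn G.
Proof.
move=> mF mG F0 G0 /ae_prod_section FG.
apply: le_Lnorm_ae => //; [exact: mN|exact: mN|by move=> t; exact: Lnorm_ge0|by move=> t; exact: Lnorm_ge0|].
by apply: filterS FG => t FG; apply: le_Lnorm_ae => //; exact: measurable_section1.
Qed.

Lemma le_mixn F G : measurable_fun setT F -> measurable_fun setT G ->
  (forall p, 0 <= F p) -> (forall p, F p <= G p) -> mixn F <= mixn G.
Proof.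
move=> mF mG F0 FG; apply: le_mixn_ae => //; last exact: aeW.
by move=> p; exact: le_trans (FG p).
Qed.

Lemma mixnZ F (k : R) : measurable_fun setT F -> (forall p, 0 <= F p) -> (0 <= k)%R ->
  mixn (fun p => k%:E * F p) = k%:E * mixn F.
Proof.
move=> mF F0 k0; rewrite /mixn -ge0_LnormZ//; last 2 first.
- exact: mN.
- by move=> t; exact: Lnorm_ge0.
congr Lnorm; apply/funext => t; rewrite ge0_LnormZ//.
exact: measurable_section1.
Qed.

Lemma mixnD F G : measurable_fun setT F -> measurable_fun setT G ->
  (forall p, 0 <= F p) -> (forall p, 0 <= G p) -> mixn (F \+ G) <= mixn F + mixn G.
Proof.
move=> mF mG F0 G0; have := ge0_LnormD m2 q1 (mN mF F0) (mN mG G0)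
  (fun t => Lnorm_ge0 _ _ _) (fun t => Lnorm_ge0 _ _ _).
apply: le_trans; apply: le_Lnorm => //.
- by apply: (mN (F := F \+ G)); [exact: emeasurable_funD|move=> p; exact: adde_ge0].
- by apply: emeasurable_funD; exact: mN.
- by move=> t; exact: Lnorm_ge0.
- by move=> t; apply: ge0_LnormD => //; exact: measurable_section1.
Qed.

Lemma mixn_fatou (F_ : (X * T -> \bar R)^nat) :
  (forall n, measurable_fun setT (F_ n)) -> (forall n p, 0 <= F_ n p) ->
  mixn (fun p => limn_einf (F_ ^~ p)) <= limn_einf (fun n => mixn (F_ n)).
Proof.
move=> mF F0; have := @Lnorm_fatou _ _ _ m2 q _ q0 (fun n => mN (mF n) (F0 n)) (fun n t => Lnorm_ge0 _ _ _).
apply: le_trans.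
have L0 p : 0 <= limn_einf (F_ ^~ p).
  exact: limn_einf_ge0.
have ml : measurable_fun setT (fun p => limn_einf (F_ ^~ p)).
  exact: measurable_limn_einf.
apply: le_Lnorm => //; first exact: (mN ml L0).
- by apply: measurable_limn_einf => n; exact: mN.
- by move=> t; exact: Lnorm_ge0.
- by move=> t; apply: Lnorm_fatou => // n; exact: measurable_section1.
Qed.

Lemma mixn_series (F_ : (X * T -> \bar R)^nat) :
  (forall n, measurable_fun setT (F_ n)) -> (forall n p, 0 <= F_ n p) ->
  mixn (fun p => \sum_(0 <= n <oo) F_ n p) <= \sum_(0 <= n <oo) mixn (F_ n).
Proof.
move=> mF F0; have := @Lnorm_series _ _ _ m2 q _ q1 (fun n => mN (mF n) (F0 n)) (fun n t => Lnorm_ge0 _ _ _).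
apply: le_trans.
have ms : measurable_fun setT (fun p => \sum_(0 <= n <oo) F_ n p).
  by apply: ge0_emeasurable_sum.
have s0 p : 0 <= \sum_(0 <= n <oo) F_ n p by exact: nneseries_ge0.
apply: le_Lnorm => //; first exact: (mN ms s0).
- by apply: ge0_emeasurable_sum => [n t _ _|n _]; [exact: Lnorm_ge0|exact: mN].
- by move=> t; exact: Lnorm_ge0.
- by move=> t; apply: Lnorm_series => // n; exact: measurable_section1.
Qed.

Lemma mixn_eq0 F : measurable_fun setT F -> (forall p, 0 <= F p) ->
  (mixn F = 0) <-> (\forall p \ae (m1 \x m2), F p = 0).
Proof.
move=> mF F0; rewrite ge0_Lnorm_eq0//; last 2 first.
- exact: mN.
- by move=> t; exact: Lnorm_ge0.
split=> [h|/ae_prod_section].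
  apply: ae_section_prod => //; apply: filterS h => t ht.
  by apply: (iffLR (ge0_Lnorm_eq0 _ r0 _ _) ht) => //; exact: measurable_section1.
apply: filterS => t ht; apply: (iffRL (ge0_Lnorm_eq0 _ r0 _ _) ht) => //.
exact: measurable_section1.
Qed.

Lemma mixn_lty_ae F : measurable_fun setT F -> (forall p, 0 <= F p) ->
  mixn F < +oo -> \forall p \ae (m1 \x m2), F p < +oo.
Proof.
move=> mF F0 h.
pose G p : \bar R := (F p == +oo%E)%:R%:E.
have mG : measurable_fun setT G.
  rewrite (_ : G = fun p => (\1_(F @^-1` [set +oo%E]) p)%:E); last first.
    apply/funext => p; rewrite /G indicE; congr (_%:R%:E).
    by case: (eqVneq (F p) +oo) => [Fp|/eqP Fp]; [rewrite mem_set|rewrite memNset].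
  apply/measurable_EFinP/measurable_indic; rewrite -[X in measurable X]setTI.
  exact: (measurable_funTS mF).
have G0 p : 0 <= G p by rewrite lee_fin.
have : \forall p \ae (m1 \x m2), G p = 0.
  apply: ae_section_prod => //.
  have := Lnorm_lty_ae q0 (mN mF F0) (fun t => Lnorm_ge0 _ _ _) h.
  apply: filterS => t ht.
  have := Lnorm_lty_ae r0 (measurable_section1 t mF) (fun x => F0 (x, t)) ht.
  by apply: filterS => x; rewrite /G; case: eqVneq => // ->.
by apply: filterS => p; rewrite /G ltey; case: eqVneq => //= _ [] /eqP; rewrite oner_eq0.
Qed.

End mixn.

Section mixn_dominated.
Context {d1 d2} {X : measurableType d1} {T : measurableType d2} {R : realType}.
Context (m1 : {sigma_finite_measure set X -> \bar R}).
Context (m2 : {sigma_finite_measure set T -> \bar R}).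
Local Open Scope ereal_scope.

Lemma mixn_dominated (q r : R) (F_ : (X * T -> \bar R)^nat) (G : X * T -> \bar R) :
  (0 < q)%R -> (0 < r)%R ->
  (forall n, measurable_fun setT (F_ n)) -> measurable_fun setT G ->
  (forall n p, 0 <= F_ n p) -> (forall n p, F_ n p <= G p) ->
  mixn m1 m2 q%:E r%:E G < +oo ->
  (\forall p \ae (m1 \x m2), F_ n p @[n --> \oo] --> 0) ->
  mixn m1 m2 q%:E r%:E (F_ n) @[n --> \oo] --> 0.
Proof.
move=> q0 r0 mF mG F0 FG Gfin /ae_prod_section Fcvg.
have G0 p : 0 <= G p by exact: le_trans (FG 0%N p).
have mN (H : X * T -> \bar R) : measurable_fun setT H -> (forall p, 0 <= H p) ->
    measurable_fun setT (fun t => Lnorm m1 r%:E (fun x => H (x, t))).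
  by move=> mH H0; apply: measurable_Lnorm1 => //; rewrite lte_fin.
apply: (Lnorm_dominated (g := fun t => Lnorm m1 r%:E (fun x => G (x, t)))) => //.
- by move=> n; exact: mN.
- exact: mN.
- by move=> n t; exact: Lnorm_ge0.
- move=> n t; apply: le_Lnorm => //; exact: measurable_section1.
have q0e : 0 < q%:E by rewrite lte_fin.
have := Lnorm_lty_ae q0e (mN G mG G0) (fun t => Lnorm_ge0 _ _ _) Gfin.
apply: aeS2 Fcvg => t Gt Ft.
apply: (Lnorm_dominated (g := fun x => G (x, t))) => //; try exact: measurable_section1.
by move=> n; exact: measurable_section1.
Qed.

End mixn_dominated.

(** * The potential on regular data *)

Section complex_parts.
Context {R : realType}.
Implicit Types z w : R[i].
Local Open Scope complex_scope.

Lemma complex_eqP z w : complex.Re z = complex.Re w -> complex.Im z = complex.Im w -> z = w.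
Proof. by case: z w => [a b] [c e] /= -> ->. Qed.

Lemma ReD z w : complex.Re (z + w) = complex.Re z + complex.Re w.
Proof. by case: z w => [a b] [c e]. Qed.

Lemma ImD z w : complex.Im (z + w) = complex.Im z + complex.Im w.
Proof. by case: z w => [a b] [c e]. Qed.

Lemma ReN z : complex.Re (- z) = - complex.Re z.
Proof. by case: z. Qed.

Lemma ImN z : complex.Im (- z) = - complex.Im z.
Proof. by case: z. Qed.

Lemma ReM z w : complex.Re (z * w) =
  complex.Re z * complex.Re w - complex.Im z * complex.Im w.
Proof. by case: z w => [a b] [c e]. Qed.

Lemma ImM z w : complex.Im (z * w) =
  complex.Re z * complex.Im w + complex.Im z * complex.Re w.
Proof. by case: z w => [a b] [c e]. Qed.

Lemma normcE z : Normc.normc z = Num.sqrt (complex.Re z ^+ 2 + complex.Im z ^+ 2).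
Proof. by case: z. Qed.

Lemma normc_ge0 z : 0 <= Normc.normc z.
Proof. by rewrite normcE sqrtr_ge0. Qed.

Lemma le_Re_normc z : `|complex.Re z| <= Normc.normc z.
Proof. by rewrite normcE -sqrtr_sqr ler_wsqrtr// lerDl sqr_ge0. Qed.

Lemma le_Im_normc z : `|complex.Im z| <= Normc.normc z.
Proof. by rewrite normcE -sqrtr_sqr ler_wsqrtr// lerDr sqr_ge0. Qed.

Lemma normc_le_ReIm z : Normc.normc z <= `|complex.Re z| + `|complex.Im z|.
Proof.
rewrite normcE -[leRHS]ger0_norm ?addr_ge0// -sqrtr_sqr ler_wsqrtr//.
rewrite sqrrD !real_normK ?num_real// lerD2r lerDl.
by rewrite mulrn_wge0// mulr_ge0.
Qed.

Lemma cmeasurable_normc {d} {T : measurableType d} (f : T -> R[i]) :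
  cmeasurable_fun setT f -> measurable_fun setT (fun x => Normc.normc (f x)).
Proof.
move=> [mr mi]; rewrite (_ : (fun _ => _) = (fun x => (complex.Re (f x) ^+ 2 + complex.Im (f x) ^+ 2) `^ 2^-1)).
  by mfun.
by apply/funext => x; rewrite normcE powR12_sqrt// addr_ge0 ?sqr_ge0.
Qed.

Lemma cmeasurable_comb {d} {T : measurableType d} (k : R[i]) (f g : T -> R[i]) :
  cmeasurable_fun setT f -> cmeasurable_fun setT g ->
  cmeasurable_fun setT (fun x => k * f x + g x).
Proof.
move=> [mf1 mf2] [mg1 mg2]; split.
  rewrite (_ : (fun _ => _) = fun x => complex.Re k * complex.Re (f x) -
      complex.Im k * complex.Im (f x) + complex.Re (g x)); first by mfun.
  by apply/funext => x; rewrite ReD ReM.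
rewrite (_ : (fun _ => _) = fun x => complex.Re k * complex.Im (f x) +
    complex.Im k * complex.Re (f x) + complex.Im (g x)); first by mfun.
by apply/funext => x; rewrite ImD ImM.
Qed.

Lemma cmeasurable_sub {d} {T : measurableType d} (f g : T -> R[i]) :
  cmeasurable_fun setT f -> cmeasurable_fun setT g ->
  cmeasurable_fun setT (fun x => f x - g x).
Proof.
move=> [mf1 mf2] [mg1 mg2]; split.
  rewrite (_ : (fun _ => _) = fun x => complex.Re (f x) - complex.Re (g x)); first by mfun.
  by apply/funext => x; rewrite ReD ReN.
rewrite (_ : (fun _ => _) = fun x => complex.Im (f x) - complex.Im (g x)); first by mfun.
by apply/funext => x; rewrite ImD ImN.
Qed.

End complex_parts.

Section Rintegral_comb.
Context {d} {T : measurableType d} {R : realType} (mu : {measure set T -> \bar R}).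

Lemma RintegralN (f : T -> R) : \int[mu]_x (- f x) = - \int[mu]_x f x.
Proof.
rewrite /Rintegral integralE [in RHS]integralE.
have -> : ((fun x => (- f x)%:E)^\+ = (fun x => (f x)%:E)^\-)%E.
  by rewrite (_ : (fun _ => _) = (\- (fun x => (f x)%:E))%E) ?funeposN//.
have -> : ((fun x => (- f x)%:E)^\- = (fun x => (f x)%:E)^\+)%E.
  by rewrite (_ : (fun _ => _) = (\- (fun x => (f x)%:E))%E) ?funenegN//.
move: (\int[mu]_x _)%E (\int[mu]_x _)%E => [x| |] [y| |]//=; rewrite ?oppr0//.
by rewrite opprB.
Qed.

Lemma integrable_comb (a b : R) (f g : T -> R) :
  mu.-integrable setT (EFin \o f) -> mu.-integrable setT (EFin \o g) ->
  mu.-integrable setT (fun x => (a * f x + b * g x)%:E).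
Proof.
move=> ig ih.
have := integrableD measurableT (integrableZl measurableT a ig) (integrableZl measurableT b ih).
by apply: eq_integrable => // x _ /=; rewrite EFinD !EFinM.
Qed.

Lemma Rintegral_comb (a b : R) (f g : T -> R) :
  mu.-integrable setT (EFin \o f) -> mu.-integrable setT (EFin \o g) ->
  \int[mu]_x (a * f x + b * g x) = a * (\int[mu]_x f x) + b * (\int[mu]_x g x).
Proof.
move=> ig ih; rewrite -!RintegralZl// RintegralD//.
- by have := integrableZl measurableT a ig.
- by have := integrableZl measurableT b ih.
Qed.

End Rintegral_comb.

(** * The kernel in polar form *)

Section Theta_star_kernel.
Context {R : realType} (d : nat) (a : R).
Notation mu := (@lebesgue_measure R).
Notation nu := (lebesgue_n R d).
Local Open Scope complex_scope.

(** The part of the argument of the kernel that does not depend on [x] and [y], and the only place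
    where [z] occurs. *)
Definition phase (z s : R) : R :=
  - Num.sg s * ((d%:R + a + 1) * pi / 4) + z ^+ 2 * (4 * s)^-1.

Definition amplitude (s : R) : R :=
  (2 `^ (d%:R + a) * pi `^ (d%:R / 2) * Gamma ((a + 1) / 2))^-1
  * `|s| `^ (- ((d%:R + a + 1) / 2)).

Lemma SaE (x : Rn R d) z y s : Sa a x z y s =
  (amplitude s * cos (phase z s + (4 * s)^-1 * sqdist x y)) +i*
  (amplitude s * sin (phase z s + (4 * s)^-1 * sqdist x y)).
Proof.
rewrite /Sa -!fmorphV/= /amplitude powRN /phase.
set A := - _ * _; set c := (_ `^ _ * _ * _)^-1; set b := (_ `^ _)^-1.
have -> : (z ^+ 2 + \sum_(i < d) (tnth x i - tnth y i : R) ^+ 2) / (4 * s) =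
    z ^+ 2 * (4 * s)^-1 + (4 * s)^-1 * sqdist x y by rewrite mulrDl [X in _ + X]mulrC.
rewrite -addrA; set B := _ + _ * sqdist _ _.
by apply: complex_eqP; rewrite /expi !(ReM, ImM)/= ?(cosD A) ?(sinD A); ring.
Qed.

Lemma ReSa (x : Rn R d) z y s : complex.Re (Sa a x z y s) =
  amplitude s * cos (phase z s + (4 * s)^-1 * sqdist x y).
Proof. by rewrite SaE. Qed.

Lemma ImSa (x : Rn R d) z y s : complex.Im (Sa a x z y s) =
  amplitude s * sin (phase z s + (4 * s)^-1 * sqdist x y).
Proof. by rewrite SaE. Qed.

(* [Pre + i Pim] is the convolution of [Phi(., tau)] with [e^(i|x|^2/(4(t - tau)))]. *)
Definition Pre (Phi : Rn R d * RM R -> R[i]) (p : Rn R d * RM R) (tau : RM R) : R :=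
  chirp cos (4 * (p.2 - tau))^-1 (fun y => complex.Re (Phi (y, tau))) p.1 -
  chirp sin (4 * (p.2 - tau))^-1 (fun y => complex.Im (Phi (y, tau))) p.1.

Definition Pim (Phi : Rn R d * RM R -> R[i]) (p : Rn R d * RM R) (tau : RM R) : R :=
  chirp cos (4 * (p.2 - tau))^-1 (fun y => complex.Im (Phi (y, tau))) p.1 +
  chirp sin (4 * (p.2 - tau))^-1 (fun y => complex.Re (Phi (y, tau))) p.1.

Definition sections_integrable (Phi : Rn R d * RM R -> R[i]) : Prop :=
  forall tau, nu.-integrable setT (fun y => (complex.Re (Phi (y, tau)))%:E) /\
              nu.-integrable setT (fun y => (complex.Im (Phi (y, tau)))%:E).

Lemma cintegral_Sa Phi p z tau : sections_integrable Phi ->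
  cintegral nu setT (fun y => Sa a p.1 z y (p.2 - tau) * Phi (y, tau)) =
  (amplitude (p.2 - tau) * (cos (phase z (p.2 - tau)) * Pre Phi p tau -
     sin (phase z (p.2 - tau)) * Pim Phi p tau)) +i*
  (amplitude (p.2 - tau) * (cos (phase z (p.2 - tau)) * Pim Phi p tau +
     sin (phase z (p.2 - tau)) * Pre Phi p tau)).
Proof.
move=> /(_ tau)[iu iv].
set s := p.2 - tau; set X := fun y => (4 * s)^-1 * sqdist p.1 y.
pose u y := complex.Re (Phi (y, tau)); pose v y := complex.Im (Phi (y, tau)).
have hc : @cos R = cos \/ @cos R = sin by left.
have hs : @sin R = cos \/ @sin R = sin by right.
have icu := integrable_chirp (4 * s)^-1 p.1 hc iu.
have icv := integrable_chirp (4 * s)^-1 p.1 hc iv.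
have isu := integrable_chirp (4 * s)^-1 p.1 hs iu.
have isv := integrable_chirp (4 * s)^-1 p.1 hs iv.
have EP : Pre Phi p tau = \int[nu]_y (1 * (u y * cos (X y)) + (-1) * (v y * sin (X y))).
  by rewrite Rintegral_comb// mul1r mulN1r.
have EQ : Pim Phi p tau = \int[nu]_y (1 * (v y * cos (X y)) + 1 * (u y * sin (X y))).
  by rewrite Rintegral_comb// !mul1r.
have iP := integrable_comb 1 (-1) icu isv.
have iQ := integrable_comb 1 1 icv isu.
rewrite /cintegral; congr (_ +i* _).
- transitivity (amplitude s * cos (phase z s) * Pre Phi p tau +
      (- (amplitude s * sin (phase z s))) * Pim Phi p tau); last by ring.
  rewrite EP EQ -Rintegral_comb//; apply: eq_Rintegral => y _.
  by rewrite ReM ReSa ImSa cosD sinD /u /v /X; ring.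
- transitivity (amplitude s * cos (phase z s) * Pim Phi p tau +
      (amplitude s * sin (phase z s)) * Pre Phi p tau); last by ring.
  rewrite EP EQ -Rintegral_comb//; apply: eq_Rintegral => y _.
  by rewrite ImM ReSa ImSa cosD sinD /u /v /X; ring.
Qed.

(** The signed indicator of the interval between 0 and [t]. It turns the oriented integral into one
    over the whole line, jointly measurable in its parameters. *)
Definition orient (t tau : R) : R :=
  (0 <= tau)%R%:R * (tau <= t)%R%:R - (t < 0)%R%:R * (t <= tau)%R%:R * (tau <= 0)%R%:R.

Lemma orient_le1 t tau : `|orient t tau| <= 1.
Proof.
rewrite /orient; case: (ltP t 0) => t0.
  case: (leP 0 tau) => tau0; last first.
    by rewrite mul0r sub0r normrN mul1r -natrM ger0_norm// lern1; do 2 case: (_ <= _)%R.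
  rewrite (_ : tau <= t = false); last by apply/negbTE; rewrite -ltNge (lt_le_trans t0).
  by rewrite mulr0 sub0r normrN mul1r -natrM ger0_norm// lern1; do 2 case: (_ <= _)%R.
by rewrite !mul0r subr0 -natrM ger0_norm// lern1; do 2 case: (_ <= _)%R.
Qed.

Lemma cintegral0E t (f : R -> R[i]) : cintegral0 t f =
  (\int[mu]_tau (orient t tau * complex.Re (f tau))) +i*
  (\int[mu]_tau (orient t tau * complex.Im (f tau))).
Proof.
have pos (g : R -> R) : 0 <= t -> \int[mu]_(tau in (`[0%R, t] : set (RM R))) g tau =
    \int[mu]_tau (orient t tau * g tau).
  move=> t0; rewrite Rintegral_mkcond; apply: eq_Rintegral => tau _.
  rewrite patchE mem_setE in_itv/= /orient ltNge t0 !mul0r subr0.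
  by case: (0 <= tau); case: (tau <= t); rewrite ?mulr0 ?mul0r ?mul1r.
have neg (g : R -> R) : t < 0 -> - (\int[mu]_(tau in (`[t, 0%R] : set (RM R))) g tau) =
    \int[mu]_tau (orient t tau * g tau).
  move=> t0; rewrite Rintegral_mkcond.
  have -> : (fun tau => orient t tau * g tau) =
      fun tau => - ((g \_ (`[t, 0%R] : set (RM R))) tau).
    apply/funext => tau.
    rewrite patchE mem_setE in_itv/= /orient t0 mul1r.
    rewrite (_ : (0 <= tau)%R%:R * (tau <= t)%R%:R = 0) ?sub0r; last first.
      case: (leP 0 tau) => tau0; rewrite ?mul0r//.
      by rewrite leNgt (lt_le_trans t0)// mulr0.
    by case: (t <= tau); case: (tau <= 0); rewrite ?mulr0 ?mul0r ?mul1r ?oppr0 ?mul0r ?mulN1r.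
  by rewrite RintegralN.
rewrite /cintegral0; case: (leP 0 t) => t0; rewrite /cintegral.
  by rewrite !pos.
by apply: complex_eqP; rewrite (ReN, ImN)/= neg.
Qed.

End Theta_star_kernel.

Section Theta_star_formula.
Context {R : realType} (d : nat) (a : R).
Notation mu := (@lebesgue_measure R).
Notation nu := (lebesgue_n R d).
Implicit Types (Phi : Rn R d * RM R -> R[i]) (p : Rn R d * RM R).
Local Open Scope complex_scope.

Definition kerRe Phi (z : R) p (tau : RM R) : R := orient p.2 tau *
  (amplitude d a (p.2 - tau) * (cos (phase d a z (p.2 - tau)) * Pre Phi p tau -
     sin (phase d a z (p.2 - tau)) * Pim Phi p tau)).

Definition kerIm Phi (z : R) p (tau : RM R) : R := orient p.2 tau *
  (amplitude d a (p.2 - tau) * (cos (phase d a z (p.2 - tau)) * Pim Phi p tau +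
     sin (phase d a z (p.2 - tau)) * Pre Phi p tau)).

(* The majorant of both kernels used for the dominated convergence [z --> z0]. *)
Definition kerdom Phi p (tau : RM R) : R :=
  `|amplitude d a (p.2 - tau)| * (`|Pre Phi p tau| + `|Pim Phi p tau|).

Lemma kerdom_ge0 Phi p tau : 0 <= kerdom Phi p tau.
Proof. by rewrite mulr_ge0// addr_ge0. Qed.

Let mulNi (A B : R) : - ('i * (A +i* B)) = B +i* - A.
Proof. by apply: complex_eqP; rewrite ?ReN ?ImN ?ReM ?ImM/=; ring. Qed.

(** The factor [-i] sends [A + iB] to [B - iA], so the real part comes from [kerIm]. *)
Lemma Theta_starE Phi z p : sections_integrable Phi -> Theta_star a Phi z p =
  (\int[mu]_tau kerIm Phi z p tau) +i* (- \int[mu]_tau kerRe Phi z p tau).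
Proof.
move=> iPhi; rewrite /Theta_star cintegral0E.
have -> : (\int[mu]_tau kerIm Phi z p tau) = \int[mu]_tau (orient p.2 tau *
    complex.Im (cintegral nu setT (fun y => Sa a p.1 z y (p.2 - tau) * Phi (y, tau)))).
  by apply: eq_Rintegral => tau _; rewrite cintegral_Sa.
have -> : (\int[mu]_tau kerRe Phi z p tau) = \int[mu]_tau (orient p.2 tau *
    complex.Re (cintegral nu setT (fun y => Sa a p.1 z y (p.2 - tau) * Phi (y, tau)))).
  by apply: eq_Rintegral => tau _; rewrite cintegral_Sa.
exact: mulNi.
Qed.

Lemma ReTheta Phi z p : sections_integrable Phi ->
  complex.Re (Theta_star a Phi z p) = \int[mu]_tau kerIm Phi z p tau.
Proof. by move=> iPhi; rewrite Theta_starE. Qed.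

Lemma ImTheta Phi z p : sections_integrable Phi ->
  complex.Im (Theta_star a Phi z p) = - \int[mu]_tau kerRe Phi z p tau.
Proof. by move=> iPhi; rewrite Theta_starE. Qed.

Let norm_comb (o b c e P Q : R) : `|o| <= 1 ->
  `|o * (b * (c * P + e * Q))| <= `|b| * (`|c| * `|P| + `|e| * `|Q|).
Proof.
move=> o1; rewrite normrM (le_trans (ler_piMl (normr_ge0 _) o1))// normrM.
by rewrite ler_wpM2l// (le_trans (ler_normD _ _))// !normrM.
Qed.

Let norm_comb_le (o b c e P Q M : R) : `|o| <= 1 -> `|c| <= M -> `|e| <= M ->
  `|o * (b * (c * P + e * Q))| <= M * (`|b| * (`|P| + `|Q|)).
Proof.
move=> o1 cM eM; apply: (le_trans (norm_comb _ _ _ _ _ o1)).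
by rewrite mulrCA ler_wpM2l// mulrDr lerD// ler_wpM2r.
Qed.

Lemma kerRe_le Phi z p tau : `|kerRe Phi z p tau| <= kerdom Phi p tau.
Proof.
rewrite /kerRe -mulNr -[leRHS]mul1r.
by apply: norm_comb_le; rewrite ?normrN ?orient_le1 ?cos_max ?sin_max.
Qed.

Lemma kerIm_le Phi z p tau : `|kerIm Phi z p tau| <= kerdom Phi p tau.
Proof.
rewrite /kerIm -[leRHS]mul1r /kerdom [X in _ * (_ * X)]addrC.
by apply: norm_comb_le; rewrite ?orient_le1 ?cos_max ?sin_max.
Qed.

(** Bounds the change of the cosine or sine of [phase] between [z] and [z0], with
    [e = |z^2 - z0^2|]: the phases differ by [e / (4|s|)] in modulus, and both functions are
    1-Lipschitz and bounded by 1. It tends to 0 with [e] at each [s]. *)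
Definition osc (e s : R) : R := Num.min 2 (e / (4 * `|s|)).

Lemma osc_ge0 e s : 0 <= e -> 0 <= osc e s.
Proof. by move=> e0; rewrite le_min ler0n/= divr_ge0// mulr_ge0. Qed.

Lemma osc_le2 e s : osc e s <= 2.
Proof. by rewrite ge_min lexx. Qed.

Lemma osc_le e e' s : e <= e' -> osc e s <= osc e' s.
Proof.
move=> ee; rewrite le_min ge_min lexx/= ge_min; apply/orP; right.
by rewrite ler_wpM2r// invr_ge0 mulr_ge0.
Qed.

Lemma cos_lipschitz (x y : R) : `|cos x - cos y| <= `|x - y|.
Proof.
wlog xy : x y / y <= x.
  move=> h; case: (leP y x) => [/h//|/ltW/h].
  by rewrite distrC [in leRHS]distrC.
have cc : {within `[y, x], continuous (@cos R)}.
  by apply: continuous_subspaceT; exact: continuous_cos.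
have [c _ ->] := MVT_segment xy (fun u _ => is_derive_cos u) cc.
by rewrite normrM normrN ler_piMl// sin_max.
Qed.

Lemma sin_lipschitz (x y : R) : `|sin x - sin y| <= `|x - y|.
Proof.
wlog xy : x y / y <= x.
  move=> h; case: (leP y x) => [/h//|/ltW/h].
  by rewrite distrC [in leRHS]distrC.
have cc : {within `[y, x], continuous (@sin R)}.
  by apply: continuous_subspaceT; exact: continuous_sin.
have [c _ ->] := MVT_segment xy (fun u _ => is_derive_sin u) cc.
by rewrite normrM ler_piMl// cos_max.
Qed.

Let phaseB z z0 s : `|phase d a z s - phase d a z0 s| = `|z ^+ 2 - z0 ^+ 2| / (4 * `|s|).
Proof.
rewrite /phase (_ : _ - _ = (z ^+ 2 - z0 ^+ 2) * (4 * s)^-1); last by ring.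
by rewrite normrM normfV normrM (ger0_norm (ler0n _ 4)).
Qed.

Let cos_osc z z0 s : `|cos (phase d a z s) - cos (phase d a z0 s)| <= osc `|z ^+ 2 - z0 ^+ 2| s.
Proof.
rewrite le_min -phaseB cos_lipschitz andbT.
by rewrite (le_trans (ler_normB _ _))// (le_trans (lerD (cos_max _) (cos_max _))).
Qed.

Let sin_osc z z0 s : `|sin (phase d a z s) - sin (phase d a z0 s)| <= osc `|z ^+ 2 - z0 ^+ 2| s.
Proof.
rewrite le_min -phaseB sin_lipschitz andbT.
by rewrite (le_trans (ler_normB _ _))// (le_trans (lerD (sin_max _) (sin_max _))).
Qed.

Lemma kerReB_le Phi z z0 p tau : `|kerRe Phi z p tau - kerRe Phi z0 p tau| <=
  osc `|z ^+ 2 - z0 ^+ 2| (p.2 - tau) * kerdom Phi p tau.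
Proof.
rewrite /kerRe (_ : _ - _ = orient p.2 tau * (amplitude d a (p.2 - tau) *
  ((cos (phase d a z (p.2 - tau)) - cos (phase d a z0 (p.2 - tau))) * Pre Phi p tau +
   (- (sin (phase d a z (p.2 - tau)) - sin (phase d a z0 (p.2 - tau)))) * Pim Phi p tau))); last by ring.
by apply: norm_comb_le; rewrite ?normrN ?orient_le1 ?cos_osc ?sin_osc.
Qed.

Lemma kerImB_le Phi z z0 p tau : `|kerIm Phi z p tau - kerIm Phi z0 p tau| <=
  osc `|z ^+ 2 - z0 ^+ 2| (p.2 - tau) * kerdom Phi p tau.
Proof.
rewrite /kerIm (_ : _ - _ = orient p.2 tau * (amplitude d a (p.2 - tau) *
  ((sin (phase d a z (p.2 - tau)) - sin (phase d a z0 (p.2 - tau))) * Pre Phi p tau +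
   (cos (phase d a z (p.2 - tau)) - cos (phase d a z0 (p.2 - tau))) * Pim Phi p tau))); last by ring.
by apply: norm_comb_le; rewrite ?orient_le1 ?cos_osc ?sin_osc.
Qed.

Let measurable_chirp_param (k : R -> R) (w : Rn R d * RM R -> R) :
  k = cos \/ k = sin -> measurable_fun setT w ->
  measurable_fun setT (fun z : (Rn R d * RM R) * RM R =>
    chirp k (4 * (z.1.2 - z.2))^-1 (fun y => w (y, z.2)) z.1.1).
Proof.
move=> hk mw.
have := measurable_Rintegral_section nu (F := fun z : ((Rn R d * RM R) * RM R) * Rn R d =>
  w (z.2, z.1.2) * k ((4 * (z.1.1.2 - z.1.2))^-1 * sqdist z.1.1.1 z.2)).
apply; apply: measurable_funM.
  apply: (measurableT_comp mw); apply/measurable_fun_pairP; split => /=.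
    exact: measurable_snd.
  exact: (measurableT_comp measurable_snd measurable_fst).
have mk : measurable_fun setT k.
  by case: hk => ->; apply: continuous_measurable_fun;
    [exact: continuous_cos|exact: continuous_sin].
apply: (measurableT_comp mk); apply: measurable_funM.
  by apply: measurable_funV; mfun.
apply: measurable_sqdist; last exact: measurable_snd.
by apply: (measurableT_comp measurable_fst);
  exact: (measurableT_comp measurable_fst measurable_fst).
Qed.

Lemma measurable_Pre Phi : cmeasurable_fun setT Phi ->
  measurable_fun setT (fun z : (Rn R d * RM R) * RM R => Pre Phi z.1 z.2).
Proof.
move=> [mr mi]; apply: measurable_funB.
  by apply: (measurable_chirp_param (k := cos) (w := fun p => complex.Re (Phi p))) => //; left.
by apply: (measurable_chirp_param (k := sin) (w := fun p => complex.Im (Phi p))) => //; right.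
Qed.

Lemma measurable_Pim Phi : cmeasurable_fun setT Phi ->
  measurable_fun setT (fun z : (Rn R d * RM R) * RM R => Pim Phi z.1 z.2).
Proof.
move=> [mr mi]; apply: measurable_funD.
  by apply: (measurable_chirp_param (k := cos) (w := fun p => complex.Im (Phi p))) => //; left.
by apply: (measurable_chirp_param (k := sin) (w := fun p => complex.Re (Phi p))) => //; right.
Qed.

Lemma measurable_amplitude : measurable_fun setT (@amplitude R d a).
Proof. by rewrite /amplitude; mfun. Qed.

Lemma measurable_phase : measurable_fun setT (fun u : R * R => phase d a u.1 u.2).
Proof.
rewrite /phase; apply: measurable_funD; last first.
  by apply: measurable_funM; [mfun|apply: measurable_funV; mfun].
apply: measurable_funM; last exact: measurable_cst.
rewrite (_ : (fun _ => _) = fun x : R * R => (x.2 < 0)%R%:R - (0 < x.2)%R%:R); first by mfun.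
apply/funext => x; case: (ltgtP x.2 0) => h.
- by rewrite (ltr0_sg h) opprK subr0.
- by rewrite (gtr0_sg h) sub0r.
- by rewrite h sgr0 !oppr0 addr0.
Qed.

Lemma measurable_orient : measurable_fun setT (fun u : R * R => orient u.1 u.2).
Proof. by rewrite /orient; mfun. Qed.

Lemma measurable_osc e : measurable_fun setT (osc e).
Proof.
apply: measurable_minr; first exact: measurable_cst.
by apply: measurable_funM; [mfun|apply: measurable_funV; mfun].
Qed.

Lemma measurable_kerdom Phi : cmeasurable_fun setT Phi ->
  measurable_fun setT (fun z : (Rn R d * RM R) * RM R => kerdom Phi z.1 z.2).
Proof.
move=> mPhi; apply: measurable_funM.
  by apply: measurable_funnorm; apply: (measurableT_comp measurable_amplitude); mfun.
by apply: measurable_funD; apply: measurable_funnorm; [exact: measurable_Pre|exact: measurable_Pim].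
Qed.

Let mker (e1 e2 : R * R -> R) Phi (P Q : Rn R d * RM R -> RM R -> R) :
  measurable_fun setT e1 -> measurable_fun setT e2 ->
  measurable_fun setT (fun z : (Rn R d * RM R) * RM R => P z.1 z.2) ->
  measurable_fun setT (fun z : (Rn R d * RM R) * RM R => Q z.1 z.2) ->
  measurable_fun setT (fun u : (R * (Rn R d * RM R)) * RM R => orient u.1.2.2 u.2 *
  (amplitude d a (u.1.2.2 - u.2) * (e1 (u.1.1, u.1.2.2 - u.2) * P u.1.2 u.2 +
    e2 (u.1.1, u.1.2.2 - u.2) * Q u.1.2 u.2))).
Proof.
move=> me1 me2 mP mQ.
have mt : measurable_fun setT (fun u : (R * (Rn R d * RM R)) * RM R => u.1.2.2 - u.2) by mfun.
have mz : measurable_fun setT (fun u : (R * (Rn R d * RM R)) * RM R => (u.1.1, u.1.2.2 - u.2)).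
  by apply: measurable_fun_pair; [exact: (measurableT_comp measurable_fst measurable_fst)|exact: mt].
have mp : measurable_fun setT (fun u : (R * (Rn R d * RM R)) * RM R => (u.1.2, u.2)).
  apply/measurable_fun_pairP; split => /=; last exact: measurable_snd.
  exact: (measurableT_comp measurable_snd measurable_fst).
apply: measurable_funM.
  have mo : measurable_fun setT (fun u : (R * (Rn R d * RM R)) * RM R => (u.1.2.2, u.2)).
    by apply: measurable_fun_pair; mfun.
  exact: (measurableT_comp measurable_orient mo).
apply: measurable_funM; first exact: (measurableT_comp measurable_amplitude mt).
apply: measurable_funD; apply: measurable_funM.
- exact: (measurableT_comp me1 mz).
- exact: (measurableT_comp mP mp).
- exact: (measurableT_comp me2 mz).
- exact: (measurableT_comp mQ mp).
Qed.

Lemma measurable_kerRe Phi : cmeasurable_fun setT Phi ->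
  measurable_fun setT (fun u : (R * (Rn R d * RM R)) * RM R => kerRe Phi u.1.1 u.1.2 u.2).
Proof.
move=> mPhi.
have mp := measurable_phase.
have := mker (e1 := fun u => cos (phase d a u.1 u.2))
  (e2 := fun u => - sin (phase d a u.1 u.2)) Phi _ _
  (measurable_Pre mPhi) (measurable_Pim mPhi).
rewrite (_ : (fun u => kerRe Phi u.1.1 u.1.2 u.2) = (fun u : (R * (Rn R d * RM R)) * RM R =>
  orient u.1.2.2 u.2 * (amplitude d a (u.1.2.2 - u.2) *
   (cos (phase d a u.1.1 (u.1.2.2 - u.2)) * Pre Phi u.1.2 u.2 +
   (- sin (phase d a u.1.1 (u.1.2.2 - u.2))) * Pim Phi u.1.2 u.2)))); last first.
  by apply/funext => u; rewrite /kerRe mulNr.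
apply; first exact: measurable_funcos.
by apply: measurableT_comp => //; exact: measurable_funsin.
Qed.

Lemma measurable_kerIm Phi : cmeasurable_fun setT Phi ->
  measurable_fun setT (fun u : (R * (Rn R d * RM R)) * RM R => kerIm Phi u.1.1 u.1.2 u.2).
Proof.
move=> mPhi; have mp := measurable_phase.
have := mker (e1 := fun u => cos (phase d a u.1 u.2))
  (e2 := fun u => sin (phase d a u.1 u.2)) Phi _ _
  (measurable_Pim mPhi) (measurable_Pre mPhi).
apply; first exact: measurable_funcos.
exact: measurable_funsin.
Qed.

(** Measurability is joint in [(z, x, t)], because the extension is later built as a limit of these
    functions in all variables at once. *)
Lemma cmeasurable_Theta Phi : cmeasurable_fun setT Phi -> sections_integrable Phi ->
  cmeasurable_fun setT (fun u : R * (Rn R d * RM R) => Theta_star a Phi u.1 u.2).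
Proof.
move=> mPhi iPhi; split.
  under eq_fun do rewrite ReTheta//.
  exact: (measurable_Rintegral_section mu (measurable_kerIm mPhi)).
rewrite (_ : (fun _ => _) = fun u => - \int[mu]_tau kerRe Phi u.1 u.2 tau).
  apply: measurableT_comp => //.
  exact: (measurable_Rintegral_section mu (measurable_kerRe mPhi)).
by apply/funext => u; rewrite ImTheta.
Qed.

End Theta_star_formula.

(** * Mixed norms of complex-valued functions *)

Section mixed_norm_theory.
Context {R : realType} (d : nat) (q r : \bar R).
Context (q1 : (1 <= q)%E).
Context (r1 : (1 <= r)%E).
Notation mu := (@lebesgue_measure R).
Notation nu := (lebesgue_n R d).
Implicit Types (f g : Rn R d * RM R -> R[i]).

Lemma mixed_normE f : mixed_norm q r f = mixn nu mu q r (fun p => (Normc.normc (f p))%:E).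
Proof. by []. Qed.

Lemma cmeasurable_enormc f : cmeasurable_fun setT f ->
  measurable_fun setT (fun p => (Normc.normc (f p))%:E).
Proof. by move=> mf; apply/measurable_EFinP; exact: cmeasurable_normc. Qed.

Lemma mixed_norm_comb (k : R[i]) f g : cmeasurable_fun setT f -> cmeasurable_fun setT g ->
  (mixed_norm q r (fun p => k * f p + g p)%R <=
   (Normc.normc k)%:E * mixed_norm q r f + mixed_norm q r g)%E.
Proof.
move=> mf mg; rewrite !mixed_normE -mixnZ//; last 3 first.
- exact: cmeasurable_enormc.
- by move=> p; rewrite lee_fin normc_ge0.
- exact: normc_ge0.
have mkf : measurable_fun setT (fun p => (Normc.normc k)%:E * (Normc.normc (f p))%:E)%E.
  by apply: measurable_funeM; exact: cmeasurable_enormc.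
have kf0 p : (0 <= (Normc.normc k)%:E * (Normc.normc (f p))%:E)%E.
  by rewrite mule_ge0// lee_fin normc_ge0.
have g0 p : (0 <= (Normc.normc (g p))%:E)%E by rewrite lee_fin normc_ge0.
apply: le_trans (mixnD nu mu q1 r1 mkf (cmeasurable_enormc mg) kf0 g0).
apply: le_mixn => //.
- by apply: cmeasurable_enormc; exact: cmeasurable_comb.
- by apply: emeasurable_funD => //; exact: cmeasurable_enormc.
- by move=> p; rewrite lee_fin normc_ge0.
- by move=> p /=; rewrite -EFinM -EFinD lee_fin -Normc.normcM le_normcD.
Qed.

Lemma mixed_norm_eq_ae f g : cmeasurable_fun setT f -> cmeasurable_fun setT g ->
  eq_LqLr f g -> mixed_norm q r f = mixed_norm q r g.
Proof.
move=> mf mg fg; rewrite !mixed_normE; apply/eqP; rewrite eq_le; apply/andP; split.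
all: apply: le_mixn_ae => //; try exact: cmeasurable_enormc;
  try (by move=> p; rewrite lee_fin normc_ge0).
all: by apply: filterS fg => p ->.
Qed.

Lemma mixed_norm_eq0 f : cmeasurable_fun setT f ->
  mixed_norm q r f = 0%E -> eq_LqLr f (fun=> 0).
Proof.
move=> mf; rewrite mixed_normE => h.
have f0 p : (0 <= (Normc.normc (f p))%:E)%E by rewrite lee_fin normc_ge0.
have := iffLR (mixn_eq0 _ _ q1 r1 (cmeasurable_enormc mf) f0) h.
by apply: filterS => p [] /Normc.eq0_normc.
Qed.

End mixed_norm_theory.

(** * Estimates and continuity in [z] on regular data *)

Section Theta_star_bounds.
Context {R : realType} (d : nat) (a : R) (Q : R) (r : \bar R).
Context (Q2 : 2 < Q).
Context (r2 : (2%:E <= r)%E).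
Context (hQr : 2 / Q + d%:R * fine r^-1 = (d%:R + a + 1) / 2).
Notation mu := (@lebesgue_measure R).
Notation nu := (lebesgue_n R d).
Notation r' := (hoelder_conjugate r).
Notation Q' := (Q / (Q - 1)).
Implicit Types (Phi Psi : Rn R d * RM R -> R[i]) (p : Rn R d * RM R).

Let Q0 : 0 < Q. Proof. by rewrite (lt_trans _ Q2). Qed.
Let Q1 : 0 < Q - 1. Proof. by rewrite subr_gt0 (lt_trans _ Q2)// ltr1n. Qed.
Let Qe1 : (1 <= Q%:E)%E. Proof. by rewrite lee_fin (le_trans _ (ltW Q2))// ler1n. Qed.
Let Qe0 : (0 < Q%:E)%E. Proof. by rewrite lte_fin. Qed.
Let r1 : (1 < r)%E. Proof. by rewrite (lt_le_trans _ r2)// lte_fin ltr1n. Qed.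
Let rr1 : (1 <= r)%E. Proof. exact: ltW. Qed.
Let r0 : (0 < r)%E. Proof. by rewrite (lt_trans _ r1). Qed.
Let r'1 : (1 <= r')%E. Proof. by apply: hoelder_conj_ge1; exact: ltW. Qed.
Let r'0 : (0 < r')%E. Proof. by rewrite (lt_le_trans _ r'1). Qed.
Let Q'e1 : (1 <= Q'%:E)%E. Proof. by rewrite lee_fin ler_pdivlMr// mul1r gerBl. Qed.
Let Q'0 : (0 < Q'%:E)%E. Proof. by rewrite (lt_le_trans _ Q'e1). Qed.

(** The slice conditions are required at every time, so that the formulas for [Theta_star] and the
    slice norms are available without exceptional times; Schwartz functions qualify. *)
Definition regular Phi : Prop := [/\ cmeasurable_fun setT Phi, sections_integrable Phi &
  forall tau, (Lnorm nu r' (fun x => (Normc.normc (Phi (x, tau)))%:E) < +oo)%E].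

Definition sect_norm Phi (tau : RM R) : R :=
  fine (Lnorm nu r' (fun x => (Normc.normc (Phi (x, tau)))%:E)).

Lemma sect_norm_ge0 Phi tau : 0 <= sect_norm Phi tau.
Proof. by rewrite fine_ge0// Lnorm_ge0. Qed.

Let normc0 Phi : forall p, (0 <= (Normc.normc (Phi p))%:E)%E.
Proof. by move=> p; rewrite lee_fin normc_ge0. Qed.

Lemma sect_normE Phi tau : regular Phi ->
  (sect_norm Phi tau)%:E = Lnorm nu r' (fun x => (Normc.normc (Phi (x, tau)))%:E).
Proof. by move=> [_ _ h]; rewrite fineK// ge0_fin_numE ?Lnorm_ge0. Qed.

Lemma measurable_sect_norm Phi : cmeasurable_fun setT Phi -> measurable_fun setT (sect_norm Phi).
Proof.
move=> mPhi; apply: measurableT_comp => //.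
exact: (measurable_Lnorm1 _ r'0 (cmeasurable_enormc mPhi) (normc0 Phi)).
Qed.

Lemma Lnorm_sect_norm Phi : regular Phi ->
  Lnorm mu Q'%:E (EFin \o sect_norm Phi) = mixed_norm Q'%:E r' Phi.
Proof. by move=> rPhi; congr Lnorm; apply/funext => tau /=; rewrite sect_normE. Qed.

(** The amplitude is a multiple of [|s|^(-(d+a+1)/2)] and [fixed_time] contributes [|s|^(d/r)]; by
    [hQr] the product is [|s|^(-2/Q)]. *)
Lemma kerdom_bound : exists2 C : R, 0 < C & forall Phi, regular Phi -> forall (t tau : R),
  (Lnorm nu r (fun x => (kerdom a Phi (x, t) tau)%:E) <=
   (C * (`|t - tau| `^ (- (2 / Q)) * sect_norm Phi tau))%:E)%E.
Proof.
have [C C0 hC] := fixed_time d r2.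
pose g := (d%:R + a + 1) / 2.
pose kappa0 := (2 `^ (d%:R + a) * pi `^ (d%:R / 2) * Gamma ((a + 1) / 2))^-1.
(* Four chirps enter through [Pre] and [Pim]; the [+ 1] makes the constant positive without
   examining the value of [Gamma]. *)
exists (4 * C * (`|kappa0| + 1)); first by rewrite mulr_gt0 ?mulr_gt0// ltr_wpDl.
move=> Phi rPhi t tau; have [mPhi iPhi _] := rPhi.
have g0 : 0 < g.
  rewrite /g -hQr ltr_pwDl// ?divr_gt0// mulr_ge0// fine_ge0//.
  by rewrite inve_ge0 ltW.
have h0 := sect_norm_ge0 Phi tau.
(* On the diagonal the amplitude contains a negative power of 0, which is 0 by convention. *)
have [st|st] := eqVneq (t - tau) 0.
  rewrite (_ : (fun _ => _) = cst 0%E); last first.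
    apply/funext => x; rewrite /kerdom /= st /amplitude normr0 powR0 ?mulr0 ?normr0 ?mul0r//.
    by rewrite oppr_eq0 gt_eqF.
  rewrite Lnorm0 ?gt_eqF// lee_fin !mulr_ge0 ?powR_ge0 ?addr_ge0 ?(ltW C0)//.
set s := t - tau in st *.
have s0 : 0 < `|s| by rewrite normr_gt0.
pose u y := complex.Re (Phi (y, tau)); pose v y := complex.Im (Phi (y, tau)).
have [iu iv] := iPhi tau.
have mu' : measurable_fun setT u by apply/measurable_EFinP; exact: (measurable_int _ iu).
have mv' : measurable_fun setT v by apply/measurable_EFinP; exact: (measurable_int _ iv).
pose N k w (x : Rn R d) := `|chirp k (4 * s)^-1 w x|.
have mN k w : k = cos \/ k = sin -> measurable_fun setT w -> measurable_fun setT (EFin \o N k w).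
  by move=> hk mw; apply/measurable_EFinP; apply: measurable_funnorm; exact: measurable_chirp.
have N0 k w (x : Rn R d) : (0 <= (EFin \o N k w) x)%E by rewrite /= lee_fin normr_ge0.
have hc : @cos R = cos \/ @cos R = sin by left.
have hs : @sin R = cos \/ @sin R = sin by right.
pose K := C * `|s| `^ (d%:R * fine r^-1) * sect_norm Phi tau.
have one k w : k = cos \/ k = sin -> nu.-integrable setT (EFin \o w) ->
    (forall y, `|w y| <= Normc.normc (Phi (y, tau))) -> (Lnorm nu r (EFin \o N k w) <= K%:E)%E.
  move=> hk iw wle; apply: (le_trans (hC k s w hk st iw)).
  have -> : (K%:E = (C * `|s| `^ (d%:R * fine r^-1))%:E * (sect_norm Phi tau)%:E)%E.
    by rewrite -EFinM.
  rewrite sect_normE//; apply: lee_wpmul2l.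
    by rewrite lee_fin mulr_ge0 ?powR_ge0 ?(ltW C0).
  apply: le_Lnorm => //.
  - apply/measurable_EFinP; apply: measurable_funnorm; apply/measurable_EFinP.
    exact: (measurable_int _ iw).
  - have mm := measurable_section1 (T3 := \bar R) tau (cmeasurable_enormc mPhi). exact mm.
have mA : measurable_fun setT ((EFin \o N cos u) \+ (EFin \o N sin v))%E.
  by apply: emeasurable_funD; exact: mN.
have mB : measurable_fun setT ((EFin \o N cos v) \+ (EFin \o N sin u))%E.
  by apply: emeasurable_funD; exact: mN.
apply: (@le_trans _ _ (`|amplitude d a s|%:E * Lnorm nu r
  (((EFin \o N cos u) \+ (EFin \o N sin v)) \+ ((EFin \o N cos v) \+ (EFin \o N sin u)))))%E.
  rewrite -ge0_LnormZ//; last 2 first.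
  - exact: emeasurable_funD.
  - by move=> x; rewrite !adde_ge0.
  apply: le_Lnorm => //.
  - apply/measurable_EFinP; apply: (measurable_section1 (F := fun z => kerdom a Phi (z.1, t) z.2) tau).
    have mm : measurable_fun setT (fun z : Rn R d * RM R => ((z.1, t), z.2)).
      by do 2 (apply: measurable_fun_pair => //=; try exact: measurable_snd; try exact: measurable_fst).
    exact: (measurableT_comp (measurable_kerdom a mPhi) mm).
  - by apply: measurable_funeM; exact: emeasurable_funD.
  - by move=> x; rewrite lee_fin kerdom_ge0.
  - move=> x; rewrite /kerdom /= -/s -!EFinD -EFinM lee_fin ler_wpM2l// lerD//.
      exact: ler_normB.
    exact: ler_normD.
apply: (@le_trans _ _ (`|amplitude d a s|%:E * ((K%:E + K%:E) + (K%:E + K%:E)))%E).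
  apply: lee_wpmul2l => //.
  apply: (le_trans (ge0_LnormD nu rr1 mA mB _ _)); try by move=> x; rewrite adde_ge0.
  apply: leeD.
    apply: (le_trans (ge0_LnormD nu rr1 (mN _ _ hc mu') (mN _ _ hs mv') (N0 _ _) (N0 _ _))).
    by apply: leeD; apply: one => // y; [exact: le_Re_normc|exact: le_Im_normc].
  apply: (le_trans (ge0_LnormD nu rr1 (mN _ _ hc mv') (mN _ _ hs mu') (N0 _ _) (N0 _ _))).
  by apply: leeD; apply: one => // y; [exact: le_Im_normc|exact: le_Re_normc].
rewrite -!EFinD -EFinM lee_fin /amplitude -/g -/kappa0 normrM (ger0_norm (powR_ge0 _ _)).
have -> : - (2 / Q) = - g + d%:R * fine r^-1 by rewrite /g -hQr; ring.
rewrite powRD ?(gt_eqF s0) ?implybT// /K.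
have k1 : `|kappa0| <= `|kappa0| + 1 by rewrite lerDl.
rewrite [leLHS](_ : _ = 4 * C * `|kappa0| * (`|s| `^ (- g) * `|s| `^ (d%:R * fine r^-1) * sect_norm Phi tau)); last by ring.
by rewrite ler_wpM2r ?mulr_ge0 ?powR_ge0// ler_wpM2l// mulr_ge0// ltW.
Qed.

(** The weight [w] will be 1 for the norm estimate and [osc] for the continuity in [z]. *)
Definition Jw (w : R -> R) Phi p : \bar R :=
  (\int[mu]_tau (w (p.2 - tau) * kerdom a Phi p tau)%:E)%E.

Lemma Jw_ge0 (w : R -> R) Phi p : (forall s, 0 <= w s) -> (0 <= Jw w Phi p)%E.
Proof. by move=> w0; apply: integral_ge0 => tau _; rewrite lee_fin mulr_ge0// kerdom_ge0. Qed.

Let measurable_wker (w : R -> R) Phi : measurable_fun setT w -> cmeasurable_fun setT Phi ->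
  measurable_fun setT (fun z : (Rn R d * RM R) * RM R => (w (z.1.2 - z.2) * kerdom a Phi z.1 z.2)%:E).
Proof.
move=> mw mPhi; apply/measurable_EFinP; apply: measurable_funM; last exact: measurable_kerdom.
by apply: (measurableT_comp mw); mfun.
Qed.

Lemma measurable_Jw (w : R -> R) Phi : measurable_fun setT w -> (forall s, 0 <= w s) ->
  cmeasurable_fun setT Phi -> measurable_fun setT (Jw w Phi).
Proof.
move=> mw w0 mPhi.
apply: (measurable_fun_fubini_tonelli_F (m2 := mu) _ (measurable_wker mw mPhi)) => z.
by rewrite lee_fin mulr_ge0// kerdom_ge0.
Qed.

(** For constant [w] this is a multiple of the Riesz potential of [h] with kernel [|t|^(-2/Q)]. The
    constant [C] stays inside the integrand, so that potentials with different [C] and [w] compare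
    pointwise. *)
Definition potential (C : R) (w : R -> R) (h : R -> R) (t : R) : \bar R :=
  (\int[mu]_tau (w (t - tau) * (C * (`|t - tau| `^ (- (2 / Q)) * h tau)))%:E)%E.

Let measurable_pot C (w h : R -> R) : measurable_fun setT w -> measurable_fun setT h ->
  measurable_fun setT (fun z : R * R =>
    (w (z.1 - z.2) * (C * (`|z.1 - z.2| `^ (- (2 / Q)) * h z.2)))%:E).
Proof.
move=> mw mh; apply/measurable_EFinP; apply: measurable_funM; last by mfun.
by apply: (measurableT_comp mw); mfun.
Qed.

Lemma measurable_potential C (w h : R -> R) : 0 <= C -> measurable_fun setT w -> measurable_fun setT h ->
  (forall s, 0 <= w s) -> (forall s, 0 <= h s) -> measurable_fun setT (potential C w h).
Proof.
move=> C0 mw mh w0 h0.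
apply: (measurable_fun_fubini_tonelli_F (m2 := mu) _ (measurable_pot C mw mh)) => z.
by rewrite lee_fin !mulr_ge0// powR_ge0.
Qed.

(** Minkowski's integral inequality moves the [L^r_x] norm inside the time integral, where
    [kerdom_bound] applies slice by slice; a one-dimensional potential of [sect_norm Phi] is
    left. *)
Lemma mixn_Jw : exists2 C : R, 0 < C & forall Phi (w : R -> R), regular Phi ->
  measurable_fun setT w -> (forall s, 0 <= w s) ->
  (mixn nu mu Q%:E r (Jw w Phi) <= Lnorm mu Q%:E (potential C w (sect_norm Phi)))%E.
Proof.
have [C C0 hC] := kerdom_bound; exists C => // Phi w rPhi mw w0.
have [mPhi iPhi _] := rPhi.
have mh := measurable_sect_norm mPhi; have h0 := sect_norm_ge0 Phi.
apply: le_Lnorm => //.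
- apply: measurable_Lnorm1 => //; first exact: measurable_Jw.
  by move=> z; exact: Jw_ge0.
- by apply: measurable_potential => //; exact: ltW.
- by move=> t; exact: Lnorm_ge0.
move=> t.
have mz : measurable_fun setT (fun z : Rn R d * RM R => ((z.1, t), z.2)).
  by do 2 (apply: measurable_fun_pair => //=; try exact: measurable_snd; try exact: measurable_fst).
have mt : measurable_fun setT (fun tau : RM R => (t, tau)) by apply: measurable_fun_pair.
have := @Lnorm_integral_le _ _ _ _ _ nu mu r (fun z => w (t - z.2) * kerdom a Phi (z.1, t) z.2)
  (fun tau => w (t - tau) * (C * (`|t - tau| `^ (- (2 / Q)) * sect_norm Phi tau))).
apply => //.
- apply/measurable_EFinP; exact: (measurableT_comp (measurable_wker mw mPhi) mz).
- by move=> z; rewrite mulr_ge0// kerdom_ge0.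
- apply/measurable_EFinP; exact: (measurableT_comp (measurable_pot C mw mh) mt).
- by move=> tau; rewrite !mulr_ge0 ?powR_ge0// ltW.
move=> tau.
rewrite (_ : (fun _ => _) = fun x => ((w (t - tau))%:E * (kerdom a Phi (x, t) tau)%:E)%E)//.
rewrite ge0_LnormZ//; last 2 first.
- have mm : measurable_fun setT (fun x : Rn R d => ((x, t), tau)).
    by do 2 (apply: measurable_fun_pair => //=).
  apply/measurable_EFinP; exact: (measurableT_comp (measurable_kerdom a mPhi) mm).
- by move=> x; rewrite lee_fin kerdom_ge0.
by rewrite EFinM; apply: lee_wpmul2l; [rewrite lee_fin|exact: hC].
Qed.

Let one : R -> R := cst 1.
Let m1 : measurable_fun setT one. Proof. exact: measurable_cst. Qed.
Let one0 s : 0 <= one s. Proof. exact: ler01. Qed.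

Lemma Lnorm_potential : exists2 K : R, 0 < K & forall (C M : R) (h : R -> R),
  0 <= C -> 0 <= M -> measurable_fun setT h -> (forall s, 0 <= h s) ->
  (Lnorm mu Q%:E (potential C (cst M) h) <= (M * C * K)%:E * Lnorm mu Q'%:E (EFin \o h))%E.
Proof.
have [K K0 hK] := @hardy_littlewood_sobolev R Q Q2.
exists K => // C M h C0 M0 mh h0.
have mk : measurable_fun setT (fun z : R * R => (`|z.1 - z.2| `^ (- (2 / Q)) * h z.2)%:E).
  by mfun.
have -> : potential C (cst M) h =
    fun t => ((M * C)%:E * \int[mu]_tau (`|t - tau| `^ (- (2 / Q)) * h tau)%:E)%E.
  apply/funext => t; rewrite /potential -ge0_integralMl ?mulr_ge0//.
  - by apply: eq_integral => tau _; congr EFin; rewrite /=; ring.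
  - by apply/measurable_EFinP; have mm := measurable_section2 (T3 := \bar R) t mk; exact mm.
  - by move=> s; rewrite mulr_ge0 ?powR_ge0.
rewrite ge0_LnormZ ?mulr_ge0//; last 2 first.
- apply: (measurable_fun_fubini_tonelli_F (m2 := mu) _ mk) => z.
  by rewrite lee_fin mulr_ge0 ?powR_ge0.
- by move=> t; apply: integral_ge0 => s _; rewrite lee_fin mulr_ge0 ?powR_ge0.
rewrite (EFinM (M * C) K) -muleA; apply: lee_wpmul2l; first by rewrite lee_fin mulr_ge0.
exact: hK.
Qed.

Lemma cmeasurable_Theta_section Phi z : regular Phi -> cmeasurable_fun setT (Theta_star a Phi z).
Proof.
move=> [mPhi iPhi _]; have [mr mi] := cmeasurable_Theta a mPhi iPhi.
by split; [have mm := measurable_section2 (T3 := R) z mr|have mm := measurable_section2 (T3 := R) z mi]; exact mm.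
Qed.

Lemma mixn_Jw_lty Phi : regular Phi -> (mixed_norm Q'%:E r' Phi < +oo)%E ->
  forall M, 0 <= M -> (Lnorm mu Q%:E (potential M (cst M) (sect_norm Phi)) < +oo)%E.
Proof.
move=> rPhi fPhi M M0; have [mPhi _ _] := rPhi.
have [K K0 hK] := Lnorm_potential.
apply: (le_lt_trans (hK M M _ M0 M0 (measurable_sect_norm mPhi) (sect_norm_ge0 Phi))).
by rewrite Lnorm_sect_norm// lte_mul_pinfty// lee_fin !mulr_ge0// ltW.
Qed.

Lemma mixn_J_le : exists2 C : R, 0 < C & forall Phi, regular Phi ->
  (mixn nu mu Q%:E r (Jw one Phi) <= C%:E * mixed_norm Q'%:E r' Phi)%E.
Proof.
have [C C0 hC] := mixn_Jw; have [K K0 hK] := Lnorm_potential.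
exists (C * K); first by rewrite mulr_gt0.
move=> Phi rPhi; have [mPhi _ _] := rPhi.
apply: (le_trans (hC Phi one rPhi m1 one0)).
have := hK C 1 _ (ltW C0) ler01 (measurable_sect_norm mPhi) (sect_norm_ge0 Phi).
by rewrite mul1r Lnorm_sect_norm.
Qed.

Lemma J_ae_fin Phi : regular Phi -> (mixed_norm Q'%:E r' Phi < +oo)%E ->
  \forall p \ae (nu \x mu)%E, (Jw one Phi p < +oo)%E.
Proof.
move=> rPhi fPhi; have [C C0 hC] := mixn_J_le; have [mPhi _ _] := rPhi.
apply: (mixn_lty_ae Qe1 rr1).
- exact: measurable_Jw.
- by move=> p; exact: Jw_ge0.
- by apply: (le_lt_trans (hC _ rPhi)); rewrite lte_mul_pinfty// lee_fin ltW.
Qed.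

Let mkdom Phi p : regular Phi -> measurable_fun setT (kerdom a Phi p).
Proof. by move=> [mPhi _ _]; exact: (measurable_section2 p (measurable_kerdom a mPhi)). Qed.

Let mkre Phi z p : regular Phi -> measurable_fun setT (kerRe a Phi z p).
Proof. by move=> [mPhi _ _]; exact: (measurable_section2 (z, p) (measurable_kerRe a mPhi)). Qed.

Let mkim Phi z p : regular Phi -> measurable_fun setT (kerIm a Phi z p).
Proof. by move=> [mPhi _ _]; exact: (measurable_section2 (z, p) (measurable_kerIm a mPhi)). Qed.

(** The phase enters only through [|cos|, |sin| <= 1], so [z] is absent from the right; the factor 2
    adds the real and the imaginary part. *)
Lemma normc_Theta_le Phi z p : regular Phi ->
  ((Normc.normc (Theta_star a Phi z p))%:E <= 2%:E * Jw one Phi p)%E.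
Proof.
move=> rPhi; have [mPhi iPhi _] := rPhi.
have half (g : RM R -> R) : measurable_fun setT g -> (forall tau, `|g tau| <= kerdom a Phi p tau) ->
    (`|\int[mu]_tau g tau|%:E <= Jw one Phi p)%E.
  move=> mg gle; apply: (le_trans (normr_Rintegral_le mu mg)).
  apply: ge0_le_integral => //.
  - by apply/measurable_EFinP; exact: measurable_funnorm.
  - by apply/measurable_EFinP; apply: measurable_funM => //; exact: mkdom.
  - by move=> tau _; rewrite /one /= mul1r lee_fin.
apply: (@le_trans _ _ (`|\int[mu]_tau kerIm a Phi z p tau|%:E + `|\int[mu]_tau kerRe a Phi z p tau|%:E)%E).
  by rewrite -EFinD lee_fin (le_trans (normc_le_ReIm _))// ReTheta// ImTheta// normrN.
rewrite (_ : 2%:E = 1%:E + 1%:E :> \bar R)%E; last by rewrite -EFinD.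
rewrite ge0_muleDl// !mul1e; apply: leeD; apply: half.
- exact: mkim.
- by move=> tau; exact: kerIm_le.
- exact: mkre.
- by move=> tau; exact: kerRe_le.
Qed.

Lemma Theta_bound : exists2 C : R, 0 < C & forall Phi z, regular Phi ->
  (mixed_norm Q%:E r (Theta_star a Phi z) <= C%:E * mixed_norm Q'%:E r' Phi)%E.
Proof.
have [C C0 hC] := mixn_J_le; exists (2 * C); first by rewrite mulr_gt0.
move=> Phi z rPhi; have [mPhi iPhi _] := rPhi.
have mJ := measurable_Jw m1 one0 mPhi.
apply: (@le_trans _ _ (2%:E * mixn nu mu Q%:E r (Jw one Phi))%E).
  rewrite -mixnZ//; last first.
  - by move=> p; exact: Jw_ge0.
  rewrite mixed_normE; apply: le_mixn => //.
  - by apply: cmeasurable_enormc; exact: cmeasurable_Theta_section.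
  - exact: measurable_funeM.
  - by move=> p; exact: normc_Theta_le.
by rewrite (EFinM 2 C) -muleA; apply: lee_wpmul2l => //; exact: hC.
Qed.

Let integrable_kdom Phi p : regular Phi -> (Jw one Phi p < +oo)%E ->
  mu.-integrable setT (EFin \o kerdom a Phi p).
Proof.
move=> rPhi fin; apply/integrableP; split; first by apply/measurable_EFinP; exact: mkdom.
rewrite (le_lt_trans _ fin)// le_eqVlt; apply/orP; left; apply/eqP.
by apply: eq_integral => tau _; rewrite /one /= mul1r ger0_norm// kerdom_ge0.
Qed.

Let integrable_kim Phi z p : regular Phi -> (Jw one Phi p < +oo)%E ->
  mu.-integrable setT (EFin \o kerIm a Phi z p).
Proof.
move=> rPhi fin; apply: (le_integrable measurableT _ _ (integrable_kdom rPhi fin)).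
  by apply/measurable_EFinP; exact: mkim.
by move=> tau _; rewrite /= lee_fin (le_trans (kerIm_le _ _ _ _ _))// ler_norm.
Qed.

Let integrable_kre Phi z p : regular Phi -> (Jw one Phi p < +oo)%E ->
  mu.-integrable setT (EFin \o kerRe a Phi z p).
Proof.
move=> rPhi fin; apply: (le_integrable measurableT _ _ (integrable_kdom rPhi fin)).
  by apply/measurable_EFinP; exact: mkre.
by move=> tau _; rewrite /= lee_fin (le_trans (kerRe_le _ _ _ _ _))// ler_norm.
Qed.

(** Combining two real integrals into one requires both to converge, which the finiteness of
    [Jw one Phi p] guarantees for every [z]. *)
Lemma normc_ThetaB_le Phi z z0 p : regular Phi -> (Jw one Phi p < +oo)%E ->
  ((Normc.normc (Theta_star a Phi z p - Theta_star a Phi z0 p))%:E <=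
   2%:E * Jw (osc `|z ^+ 2 - z0 ^+ 2|%R) Phi p)%E.
Proof.
move=> rPhi fin; have [mPhi iPhi _] := rPhi.
set w := osc _; have w0 s : 0 <= w s by exact: osc_ge0.
have half (g g0 : RM R -> R) : mu.-integrable setT (EFin \o g) -> mu.-integrable setT (EFin \o g0) ->
    (forall tau, `|g tau - g0 tau| <= w (p.2 - tau) * kerdom a Phi p tau) ->
    (`|\int[mu]_tau g tau - \int[mu]_tau g0 tau|%R%:E <= Jw w Phi p)%E.
  move=> ig ig0 gle; rewrite -RintegralB//.
  have mg : measurable_fun setT (fun tau => g tau - g0 tau).
    by apply: measurable_funB; apply/measurable_EFinP; [exact: (measurable_int _ ig)|exact: (measurable_int _ ig0)].
  apply: (le_trans (normr_Rintegral_le mu mg)).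
  apply: ge0_le_integral => //.
  - by apply/measurable_EFinP; exact: measurable_funnorm.
  - apply/measurable_EFinP; apply: measurable_funM; last exact: mkdom.
    by apply: (measurableT_comp (measurable_osc _)); mfun.
  - by move=> tau _; rewrite lee_fin.
apply: (@le_trans _ _ (`|\int[mu]_tau kerIm a Phi z p tau - \int[mu]_tau kerIm a Phi z0 p tau|%R%:E
   + `|\int[mu]_tau kerRe a Phi z p tau - \int[mu]_tau kerRe a Phi z0 p tau|%R%:E)%E).
  rewrite -EFinD lee_fin (le_trans (normc_le_ReIm _))//.
  rewrite ReD ImD (ReN (Theta_star a Phi z0 p)) (ImN (Theta_star a Phi z0 p)).
  have aux (A A0 B B0 C C0 D D0 : R) : A = C -> A0 = C0 -> B = - D -> B0 = - D0 ->
      `|A - A0| + `|B - B0| <= `|C - C0| + `|D - D0|.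
    by move=> -> -> -> ->; rewrite -opprD normrN.
  exact: aux (ReTheta a z p iPhi) (ReTheta a z0 p iPhi) (ImTheta a z p iPhi) (ImTheta a z0 p iPhi).
rewrite (_ : 2%:E = 1%:E + 1%:E :> \bar R)%E; last by rewrite -EFinD.
rewrite ge0_muleDl// !mul1e; apply: leeD; apply: half.
- exact: integrable_kim.
- exact: integrable_kim.
- by move=> tau; exact: kerImB_le.
- exact: integrable_kre.
- exact: integrable_kre.
- by move=> tau; exact: kerReB_le.
Qed.

(** As [r] may be infinite, dominated convergence is not applied in [x]: [mixn_Jw] first reduces to
    a potential, then it is applied in [tau] for almost every [t], and in the [L^Q] norm in [t],
    where [Q] is finite. *)
Let osc_cvg Phi : regular Phi -> (mixed_norm Q'%:E r' Phi < +oo)%E ->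
  mixn nu mu Q%:E r (Jw (osc n.+1%:R^-1) Phi) @[n --> \oo] --> 0%E.
Proof.
move=> rPhi fPhi; have [mPhi iPhi _] := rPhi.
have [C C0 hC] := mixn_Jw.
set h := sect_norm Phi; have h0 := sect_norm_ge0 Phi; have mh := measurable_sect_norm mPhi.
pose e (n : nat) : R := n.+1%:R^-1; have e0 n : 0 <= e n by rewrite invr_ge0.
have e1 n : e n <= 1 by rewrite invf_le1// ler1n.
(* One number bounds both [osc], by 2, and the constant [C], so [potential M (cst M) h] dominates
   the whole sequence. *)
pose M := Num.max 2 C.
have M0 : 0 <= M by rewrite le_max ler0n.
have M2 : 2 <= M by rewrite le_max lexx.
have MC : C <= M by rewrite le_max lexx orbT.
have kh0 (t tau : R) : 0 <= `|t - tau| `^ (- (2 / Q)) * h tau by rewrite mulr_ge0 ?powR_ge0.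
have mpot (c : R) (w : R -> R) (t : R) : measurable_fun setT w -> measurable_fun setT
    (fun tau : R => (w (t - tau) * (c * (`|t - tau| `^ (- (2 / Q)) * h tau)))%:E).
  move=> mw; have mm := measurable_section2 (T3 := \bar R) t (measurable_pot c mw mh). exact mm.
have Fle n t : (potential C (osc (e n)) h t <= potential M (cst M) h t)%E.
  apply: ge0_le_integral => //.
  - by move=> tau _; rewrite lee_fin !mulr_ge0// ?osc_ge0// ltW.
  - exact: (mpot C _ t (measurable_osc _)).
  - exact: (mpot M _ t (measurable_cst _)).
  - move=> tau _; rewrite lee_fin ler_pM ?osc_ge0 ?mulr_ge0 ?(ltW C0)//.
      by rewrite (le_trans (osc_le2 _ _)).
    by rewrite ler_wpM2r.
have Ffin := mixn_Jw_lty rPhi fPhi M0.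
suff F0 : Lnorm mu Q%:E (potential C (osc (e n)) h) @[n --> \oo] --> 0%E.
  apply: (@squeeze_cvge _ _ _ _ (cst 0%E) _ (fun n => Lnorm mu Q%:E (potential C (osc (e n)) h))) => //.
  - apply: nearW => n; rewrite mixn_ge0/=; apply: hC => //; first exact: measurable_osc.
    by move=> s; exact: osc_ge0.
  - exact: cvg_cst.
have mp c (w : R -> R) : 0 <= c -> measurable_fun setT w -> (forall s, 0 <= w s) ->
    measurable_fun setT (potential c w h).
  by move=> c0 mw w0; exact: measurable_potential.
have := @Lnorm_dominated R _ _ mu Q (fun n => potential C (osc (e n)) h) (potential M (cst M) h).
apply => //.
- by move=> n; apply: mp; [exact: ltW|exact: measurable_osc|move=> s; exact: osc_ge0].
- by apply: mp => // s.
- by move=> n t; apply: integral_ge0 => tau _; rewrite lee_fin !mulr_ge0 ?osc_ge0// ltW.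
have pge0 (t tau : R) : (0 <= (cst M (t - tau) * (M * (`|t - tau| `^ (- (2 / Q)) * h tau)))%:E)%E.
  by rewrite lee_fin !mulr_ge0.
have Mpot0 t : (0 <= potential M (cst M) h t)%E by apply: integral_ge0 => tau _; exact: pge0.
have := @Lnorm_lty_ae _ _ _ mu _ _ Qe0 (mp M (cst M) M0 (measurable_cst _) (fun=> M0)) Mpot0 Ffin.
apply: filterS => t tfin.
have [] := @dominated_convergence _ _ _ mu setT measurableT
  (fun n tau => (osc (e n) (t - tau) * (C * (`|t - tau| `^ (- (2 / Q)) * h tau)))%:E)
  (cst 0%E) (fun tau => (M * (M * (`|t - tau| `^ (- (2 / Q)) * h tau)))%:E).
- by move=> n; exact: (mpot C _ t (measurable_osc _)).
- exact: measurable_cst.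
- apply: aeW => tau _; apply: cvg_EFin; first exact: nearW.
  rewrite -[X in _ --> X](mul0r (C * (`|t - tau| `^ (- (2 / Q)) * h tau))).
  apply: cvgMl.
  apply: (@squeeze_cvgr _ _ _ _ (cst 0) (fun n => e n / (4 * `|t - tau|))).
  + by apply: nearW => n; rewrite osc_ge0//= ge_min lexx orbT.
  + exact: cvg_cst.
  + rewrite -[X in _ --> X](mul0r (4 * `|t - tau|)^-1); apply: cvgMl.
    exact: cvg_harmonic.
- apply/integrableP; split; first exact: (mpot M _ t (measurable_cst M)).
  rewrite (le_lt_trans _ tfin)// le_eqVlt; apply/orP; left; apply/eqP.
  by apply: eq_integral => tau _; exact: (gee0_abs (pge0 t tau)).
- apply: aeW => tau n _; rewrite gee0_abs; last by rewrite lee_fin !mulr_ge0// ?osc_ge0// ltW.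
  rewrite lee_fin ler_pM ?osc_ge0 ?mulr_ge0 ?(ltW C0)//.
    by rewrite (le_trans (osc_le2 _ _)).
  by rewrite ler_wpM2r.
by rewrite integral0.
Qed.

(** [osc] is monotone in its first argument, so convergence along [1/(n+1)] controls all [z] with
    [|z^2 - z0^2| <= 1/(n+1)]. *)
Lemma Theta_continuous Phi (z0 : R) : regular Phi -> (mixed_norm Q'%:E r' Phi < +oo)%E ->
  mixed_norm Q%:E r (fun p => Theta_star a Phi z p - Theta_star a Phi z0 p) @[z --> z0] --> 0%E.
Proof.
move=> rPhi fPhi; have [mPhi iPhi _] := rPhi.
apply/(@ge0_cvge0P R _ (nbhs z0) (nbhs_pfilter z0)) => [z|e e0]; first exact: Lnorm_ge0.
have J0 (w : R -> R) n : (0 <= mixn nu mu Q%:E r (Jw (osc n.+1%:R^-1) Phi))%E by exact: mixn_ge0.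
have /(ge0_cvge0P _ (J0 one)) := osc_cvg rPhi fPhi.
move=> /(_ (e / 2)); rewrite divr_gt0// => /(_ isT)[n _ hn].
have {hn} hn := hn n (leqnn n).
have sqc : (fun z => `|z ^+ 2 - z0 ^+ 2|) z @[z --> z0] --> (0 : R).
  rewrite -[X in _ --> X](@normr0 _ R) -(subrr (z0 ^+ 2)); apply: cvg_norm.
  by apply: cvgB; [exact: exprn_continuous|exact: cvg_cst].
have n0 : 0 < n.+1%:R^-1 :> R by rewrite invr_gt0.
move/cvgrPdist_le : sqc => /(_ _ n0); apply: filterS => z /=.
rewrite sub0r normrN normr_id => zn.
have mosc e' : measurable_fun setT (@osc R e') by exact: measurable_osc.
have w0 s : 0 <= osc `|z ^+ 2 - z0 ^+ 2| s by exact: osc_ge0.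
have wn0 (s : R) : 0 <= osc (n.+1%:R^-1) s by apply: osc_ge0; exact: ltW.
apply: (@le_trans _ _ (2%:E * mixn nu mu Q%:E r (Jw (osc n.+1%:R^-1) Phi))%E); last first.
  by rewrite (_ : e = 2 * (e / 2)) ?EFinM ?lee_wpmul2l//; field.
rewrite -mixnZ//; last 2 first.
- exact: measurable_Jw.
- by move=> p; exact: Jw_ge0.
rewrite mixed_normE; apply: le_mixn_ae => //.
- apply: cmeasurable_enormc.
  exact (cmeasurable_sub (cmeasurable_Theta_section z rPhi) (cmeasurable_Theta_section z0 rPhi)).
- by apply: measurable_funeM; exact: measurable_Jw.
- by move=> p; rewrite lee_fin normc_ge0.
- by move=> p; rewrite mule_ge0// Jw_ge0.
have := J_ae_fin rPhi fPhi; apply: filterS => p Jp.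
apply: (le_trans (normc_ThetaB_le z z0 rPhi Jp)).
apply: lee_wpmul2l => //; apply: ge0_le_integral => //.
- by move=> tau _; rewrite lee_fin mulr_ge0// kerdom_ge0.
- apply/measurable_EFinP; apply: measurable_funM; last exact: mkdom.
  by apply: (measurableT_comp (mosc _)); mfun.
- apply/measurable_EFinP; apply: measurable_funM; last exact: mkdom.
  by apply: (measurableT_comp (mosc _)); mfun.
- by move=> tau _; rewrite lee_fin ler_wpM2r ?kerdom_ge0// osc_le.
Qed.

Lemma regular_comb (k : R[i]) Phi Psi : regular Phi -> regular Psi ->
  regular (fun p => k * Phi p + Psi p).
Proof.
move=> rPhi rPsi; have [mPhi iPhi fPhi] := rPhi; have [mPsi iPsi fPsi] := rPsi.
split; first exact: cmeasurable_comb.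
- move=> tau; have [iu iv] := iPhi tau; have [iu' iv'] := iPsi tau; split.
    have := integrable_comb 1 1 (integrable_comb (complex.Re k) (- complex.Im k) iu iv) iu'.
    by apply: eq_integrable => // y _ /=; congr EFin; rewrite ReD ReM; ring.
  have := integrable_comb 1 1 (integrable_comb (complex.Re k) (complex.Im k) iv iu) iv'.
  by apply: eq_integrable => // y _ /=; congr EFin; rewrite ImD ImM; ring.
move=> tau.
have mn (F : Rn R d * RM R -> R[i]) : cmeasurable_fun setT F ->
    measurable_fun setT (fun x => (Normc.normc (F (x, tau)))%:E).
  by move=> mF; have mm := measurable_section1 (T3 := \bar R) tau (cmeasurable_enormc mF); exact mm.
have n0 (F : Rn R d * RM R -> R[i]) x : (0 <= (Normc.normc (F (x, tau)))%:E)%E.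
  by rewrite lee_fin normc_ge0.
have mk : measurable_fun setT (fun x => (Normc.normc k)%:E * (Normc.normc (Phi (x, tau)))%:E)%E.
  by apply: measurable_funeM; exact: mn.
have k0 x : (0 <= (Normc.normc k)%:E * (Normc.normc (Phi (x, tau)))%:E)%E.
  by rewrite mule_ge0 ?lee_fin ?normc_ge0.
apply: (@le_lt_trans _ _ ((Normc.normc k)%:E * Lnorm nu r' (fun x => (Normc.normc (Phi (x, tau)))%:E) +
   Lnorm nu r' (fun x => (Normc.normc (Psi (x, tau)))%:E))%E).
  rewrite -ge0_LnormZ ?normc_ge0//; last exact: mn.
  apply: le_trans (ge0_LnormD nu r'1 mk (mn _ mPsi) k0 (n0 Psi)).
  apply: le_Lnorm => //.
  - apply/measurable_EFinP.
    have mm := measurable_section1 (T3 := R) tau (cmeasurable_normc (cmeasurable_comb k mPhi mPsi)); exact mm.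
  - by apply: emeasurable_funD => //; exact: mn.
  - by move=> x; rewrite lee_fin normc_ge0.
  - by move=> x /=; rewrite -EFinM -EFinD lee_fin -Normc.normcM le_normcD.
by rewrite lte_add_pinfty// lte_mul_pinfty// lee_fin normc_ge0.
Qed.

Let chirp_comb (k : R -> R) (theta c1 c2 : R) (f g h : Rn R d -> R) x : k = cos \/ k = sin ->
  nu.-integrable setT (EFin \o f) -> nu.-integrable setT (EFin \o g) ->
  nu.-integrable setT (EFin \o h) ->
  chirp k theta (fun y => c1 * f y + c2 * g y + h y) x =
  c1 * chirp k theta f x + c2 * chirp k theta g x + chirp k theta h x.
Proof.
move=> hk jf jg jh.
have ef := integrable_chirp theta x hk jf; have eg := integrable_chirp theta x hk jg.
have eh := integrable_chirp theta x hk jh.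
rewrite /chirp -Rintegral_comb// -[in RHS](mul1r (\int[nu]_y (c1 * _ + c2 * _))).
rewrite -[X in _ + X]mul1r -Rintegral_comb//; last exact: integrable_comb.
by apply: eq_Rintegral => y _; ring.
Qed.

(** The exceptional points are those where one of the majorants [Jw one Phi] and [Jw one Psi] is
    infinite; these do not involve [z], so one null set serves all [z]. Elsewhere all time integrals
    converge and can be combined. *)
Lemma Theta_comb (k : R[i]) Phi Psi : regular Phi -> regular Psi ->
  (mixed_norm Q'%:E r' Phi < +oo)%E -> (mixed_norm Q'%:E r' Psi < +oo)%E ->
  \forall p \ae (nu \x mu)%E, forall z, Theta_star a (fun p => k * Phi p + Psi p) z p =
    k * Theta_star a Phi z p + Theta_star a Psi z p.
Proof.
move=> rPhi rPsi fPhi fPsi; have [mPhi iPhi _] := rPhi; have [mPsi iPsi _] := rPsi.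
have [mC iC _] := regular_comb k rPhi rPsi.
have := J_ae_fin rPsi fPsi; apply: aeS2 (J_ae_fin rPhi fPhi) => p J1 J2 z.
have hc : @cos R = cos \/ @cos R = sin by left.
have hs : @sin R = cos \/ @sin R = sin by right.
set k1 := complex.Re k; set k2 := complex.Im k.
set Xi := fun p => k * Phi p + Psi p.
have eP tau : Pre Xi p tau = k1 * Pre Phi p tau - k2 * Pim Phi p tau + Pre Psi p tau.
  have [iu iv] := iPhi tau; have [iu' iv'] := iPsi tau.
  rewrite /Pre /Pim.
  rewrite (_ : (fun y => complex.Re (Xi (y, tau))) = fun y => k1 * complex.Re (Phi (y, tau)) +
     (- k2) * complex.Im (Phi (y, tau)) + complex.Re (Psi (y, tau))); last first.
    by apply/funext => y; rewrite /Xi ReD ReM -/k1 -/k2 mulNr.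
  rewrite (_ : (fun y => complex.Im (Xi (y, tau))) = fun y => k1 * complex.Im (Phi (y, tau)) +
     k2 * complex.Re (Phi (y, tau)) + complex.Im (Psi (y, tau))); last first.
    by apply/funext => y; rewrite /Xi ImD ImM.
  by rewrite !chirp_comb//; ring.
have eQ tau : Pim Xi p tau = k1 * Pim Phi p tau + k2 * Pre Phi p tau + Pim Psi p tau.
  have [iu iv] := iPhi tau; have [iu' iv'] := iPsi tau.
  rewrite /Pre /Pim.
  rewrite (_ : (fun y => complex.Re (Xi (y, tau))) = fun y => k1 * complex.Re (Phi (y, tau)) +
     (- k2) * complex.Im (Phi (y, tau)) + complex.Re (Psi (y, tau))); last first.
    by apply/funext => y; rewrite /Xi ReD ReM -/k1 -/k2 mulNr.
  rewrite (_ : (fun y => complex.Im (Xi (y, tau))) = fun y => k1 * complex.Im (Phi (y, tau)) +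
     k2 * complex.Re (Phi (y, tau)) + complex.Im (Psi (y, tau))); last first.
    by apply/funext => y; rewrite /Xi ImD ImM.
  by rewrite !chirp_comb//; ring.
have ki := integrable_kim z rPhi J1; have kr := integrable_kre z rPhi J1.
have ki' := integrable_kim z rPsi J2; have kr' := integrable_kre z rPsi J2.
have eI : \int[mu]_tau kerIm a Xi z p tau = k1 * (\int[mu]_tau kerIm a Phi z p tau) +
    k2 * (\int[mu]_tau kerRe a Phi z p tau) + \int[mu]_tau kerIm a Psi z p tau.
  rewrite -Rintegral_comb// -[in RHS](mul1r (\int[mu]_tau (k1 * _ + k2 * _))).
  rewrite -[X in _ + X]mul1r -Rintegral_comb//; last exact: integrable_comb.
  by apply: eq_Rintegral => tau _; rewrite /kerIm /kerRe eP eQ; ring.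
have eR : \int[mu]_tau kerRe a Xi z p tau = k1 * (\int[mu]_tau kerRe a Phi z p tau) +
    (- k2) * (\int[mu]_tau kerIm a Phi z p tau) + \int[mu]_tau kerRe a Psi z p tau.
  rewrite -Rintegral_comb// -[in RHS](mul1r (\int[mu]_tau (k1 * _ + (- k2) * _))).
  rewrite -[X in _ + X]mul1r -Rintegral_comb//; last exact: integrable_comb.
  by apply: eq_Rintegral => tau _; rewrite /kerIm /kerRe eP eQ; ring.
have aux (w w1 w2 : R[i]) (A B C A1 B1 C1 : R) : complex.Re w = k1 * A + k2 * B + C ->
    complex.Im w = - (k1 * A1 + (- k2) * B1 + C1) -> complex.Re w1 = A -> complex.Im w1 = - B ->
    complex.Re w2 = C -> complex.Im w2 = - C1 -> A1 = B -> B1 = A -> w = k * w1 + w2.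
  move=> e1 e2 e3 e4 e5 e6 e7 e8; apply: complex_eqP.
    by rewrite ReD ReM e1 e3 e4 e5 -/k1 -/k2; ring.
  by rewrite ImD ImM e2 e3 e4 e6 e7 e8 -/k1 -/k2; ring.
apply: (aux _ _ _ _ _ _ _ _ _ (etrans (ReTheta a z p iC) eI)
  (etrans (ImTheta a z p iC) (congr1 -%R eR)) (ReTheta a z p iPhi) (ImTheta a z p iPhi)
  (ReTheta a z p iPsi) (ImTheta a z p iPsi)) => //.
Qed.

End Theta_star_bounds.

(** * Density of Schwartz functions *)

Section schwartz_tensor.
Context {R : realType} (d : nat).
Implicit Types (p v : 'rV[R]_d * R).

Lemma le_coord_norm p (i : 'I_d) : `|p.1 0 i| <= `|p|.
Proof.
rewrite prod_normE le_max; apply/orP; left.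
by rewrite [leRHS](_ : _ = mx_norm p.1)// mx_normrE; apply/bigmax_geP; right; exists (0, i).
Qed.

Lemma le_time_norm p : `|p.2| <= `|p|.
Proof. by rewrite prod_normE le_max lexx orbT. Qed.

Lemma norm_le_coord p (B : R) : 0 <= B -> (forall i, `|p.1 0 i| <= B) -> `|p.2| <= B -> `|p| <= B.
Proof.
move=> B0 h1 h2; rewrite prod_normE ge_max h2 andbT.
rewrite [leLHS](_ : _ = mx_norm p.1)//.
have [->//|/mx_norm_neq0[[i j] ->]/=] := eqVneq (mx_norm p.1) 0.
by rewrite ord1.
Qed.

Definition tensor (h : 'I_d -> R -> R) (g : R -> R) p : R :=
  (\prod_(i < d) h i (p.1 0 i)) * g p.2.

Lemma differentiable_tensor (h : 'I_d -> R -> R) (g : R -> R) p : (forall i x, derivable (h i) x 1) ->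
  (forall x, derivable g x 1) -> differentiable (tensor h g) p.
Proof.
move=> dh dg; apply: differentiableM; last first.
  apply: (@differentiable_comp _ _ _ _ snd g p); last exact/derivable1_diffP.
  by apply: linear_differentiable => q; exact: cvg_snd.
have dprod s : differentiable (fun q : 'rV[R]_d * R => \prod_(i <- s) h i (q.1 0 i)) p.
  elim: s => [|i s ih].
    rewrite (_ : (fun q => _) = cst 1); first exact: differentiable_cst.
    by apply/funext => q; rewrite big_nil.
  rewrite (_ : (fun q => _) = (fun q : 'rV[R]_d * R => h i (q.1 0 i)) *
    (fun q => \prod_(i <- s) h i (q.1 0 i))); last by apply/funext => q; rewrite big_cons.
  apply: differentiableM => //.
  apply: (@differentiable_comp _ _ _ _ (fun q : 'rV[R]_d * R => q.1 0 i) (h i) p); last exact/derivable1_diffP.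
  apply: (@differentiable_comp _ _ _ _ fst (fun x : 'rV[R]_d => x 0 i) p).
    by apply: linear_differentiable => q; exact: cvg_fst.
  exact: differentiable_coord.
exact: dprod.
Qed.

Lemma derive_line (F : 'rV[R]_d * R -> R) (h : R -> R) p v (x c : R) :
  derivable h x 1 -> (forall s, F (s *: v + p) = c * h (s + x)) ->
  'D_v F p = c * h^`()%classic x.
Proof.
move=> dh e; rewrite derive1E /derive.
have Fp : F p = c * h x by rewrite -[in LHS](add0r p) -(scale0r v) e add0r.
rewrite (_ : (fun s => _) = c *: (fun s : R => s^-1 *: ((h \o shift x) (s *: (1 : R)) - h x))).
  exact: limZr.
apply/funext => s; rewrite [RHS](_ : _ = c * (s^-1 * (h (s * 1 + x) - h x)))// mulr1.
by rewrite [LHS](_ : _ = s^-1 * (F (s *: v + p) - F p))// Fp e; ring.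
Qed.

Lemma derive_tensor_time (h : 'I_d -> R -> R) (g : R -> R) p : (forall x, derivable g x 1) ->
  'D_(coord_dir R None) (tensor h g) p = tensor h g^`()%classic p.
Proof.
move=> dg; rewrite /tensor; apply: derive_line => // s.
congr (_ * _); first by apply: eq_bigr => i _; rewrite /= scaler0 add0r.
by rewrite /= /GRing.scale/= mulr1.
Qed.

Lemma derive_tensor_space (h : 'I_d -> R -> R) (g : R -> R) p (j : 'I_d) : (forall x, derivable (h j) x 1) ->
  'D_(coord_dir R (Some j)) (tensor h g) p =
  tensor (fun i => if i == j then (h j)^`()%classic else h i) g p.
Proof.
move=> dh; rewrite /tensor (bigD1 j)//= eqxx.
rewrite (derive_line (h := h j) (x := p.1 0 j) (c := (\prod_(i < d | i != j) h i (p.1 0 i)) * g p.2))//.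
  rewrite [RHS](_ : _ = (h j)^`()%classic (p.1 0 j) * \prod_(i < d | i != j) h i (p.1 0 i) * g p.2).
    by ring.
  by congr (_ * _ * _); apply: eq_bigr => i /negbTE ->.
move=> s; rewrite (bigD1 j)//= !mxE !eqxx/= mulr1 scaler0 add0r.
rewrite (eq_bigr (fun i => h i (p.1 0 i))); first by ring.
by move=> i ij; rewrite !mxE eqxx/= (negbTE ij) mulr0 add0r.
Qed.

Section gaussian_type.
Context (E : 'I_d -> {poly R}) (E0 : {poly R}).

Definition expoly (P e : {poly R}) (x : R) : R := P.[x] * expR (- e.[x]).

Definition rapid (e : {poly R}) := forall P : {poly R}, exists C, forall x, `|expoly P e x| <= C.

Lemma derive_expoly P e x : is_derive x (1 : R) (expoly P e) (expoly (P^`() - P * e^`()) e x).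
Proof.
have de : is_derive x (1 : R) (fun y => - e.[y]) (- e^`().[x]) by exact: is_deriveN.
have dx : is_derive x (1 : R) (expR \o (fun y => - e.[y])) (expR (- e.[x]) * - e^`().[x]).
  exact: is_derive1_comp.
apply: is_derive_eq (is_deriveM (is_derive_poly P x) dx) _.
by rewrite /expoly hornerD hornerN hornerM /GRing.scale/=; ring.
Qed.

Lemma derivable_expoly P e x : derivable (expoly P e) x 1.
Proof. by have [] := derive_expoly P e x. Qed.

Lemma derive1_expoly P e : (expoly P e)^`()%classic = expoly (P^`() - P * e^`()) e.
Proof. by apply/funext => x; rewrite derive1E; have [_ ->] := derive_expoly P e x. Qed.

Definition gtensor (P : 'I_d -> {poly R}) (P0 : {poly R}) :=
  tensor (fun i => expoly (P i) (E i)) (expoly P0 E0).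

(** The family is stable under partial derivatives, since [(P e^-E)' = (P' - P E') e^-E] with the
    same [E]; decay then has to be proved for its members only. *)
Lemma iter_partial_gtensor (s : seq (option 'I_d)) P P0 :
  exists P' P0', iter_partial s (gtensor P P0) = gtensor P' P0'.
Proof.
elim: s => [|o s [P' [P0' ih]]]; first by exists P, P0.
rewrite /= ih; case: o => [j|].
  exists (fun i => if i == j then (P' j)^`() - P' j * (E j)^`() else P' i), P0'.
  apply/funext => p; rewrite derive_tensor_space; last by move=> x; exact: derivable_expoly.
  rewrite derive1_expoly /gtensor /tensor; congr (_ * _); apply: eq_bigr => i _.
  by case: eqP => [->|].
exists P', (P0'^`() - P0' * E0^`()); apply/funext => p.
by rewrite derive_tensor_time ?derive1_expoly// => x; exact: derivable_expoly.
Qed.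

Context (rE : forall i, rapid (E i)).
Context (rE0 : rapid E0).

Lemma gtensor_decay P P0 (k : nat) : exists C : R, forall p, `|p| ^+ k * `|gtensor P P0 p| <= C.
Proof.
(* [W >= 1] and [W >= |x|], so [|p|] is at most the product of [W] over all coordinates: the moment
   [|p|^k] is bounded by a product that is absorbed into the polynomials. *)
pose W : {poly R} := 1 + 'X^2.
have W1 x : 1 <= W.[x] by rewrite !hornerE/= lerDl sqr_ge0.
have WX x : `|x| <= W.[x].
  rewrite !hornerE/= -real_normK ?num_real//; move: (normr_ge0 x); move: `|x| => u u0.
  by rewrite -subr_ge0 (_ : _ - u = (u - 2^-1) ^+ 2 + 3 / 4) ?addr_ge0 ?sqr_ge0//; field.
have /choice[C hC] i : exists C, forall x, `|expoly (W ^+ k * P i) (E i) x| <= C by exact: rE.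
have [C0 hC0] : exists C, forall x, `|expoly (W ^+ k * P0) E0 x| <= C by exact: rE0.
exists ((\prod_(i < d) C i) * C0) => p.
pose B := (\prod_(i < d) W.[p.1 0 i]) * W.[p.2].
have P1 : 1 <= \prod_(i < d) W.[p.1 0 i] by elim/big_ind : _ => // x y x1 y1; rewrite mulr_ege1.
have pB : `|p| <= B.
  apply: norm_le_coord; first by rewrite mulr_ge0// (le_trans ler01).
  - move=> i; apply: (le_trans (WX _)); rewrite /B -[leLHS]mulr1 ler_pM ?(le_trans ler01)//.
    rewrite (bigD1 i)//= ler_peMr ?(le_trans ler01)//.
    by elim/big_ind : _ => // x y x1 y1; rewrite mulr_ege1.
  - by apply: (le_trans (WX _)); rewrite ler_peMl ?(le_trans ler01).
apply: (@le_trans _ _ (B ^+ k * `|gtensor P P0 p|)).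
  by rewrite ler_wpM2r// lerXn2r ?nnegrE// (le_trans (normr_ge0 _) pB).
rewrite /B /gtensor /tensor normrM normr_prod exprMn -prodrXl.
rewrite [leLHS](_ : _ = (\prod_(i < d) (W.[p.1 0 i] ^+ k * `|expoly (P i) (E i) (p.1 0 i)|)) *
  (W.[p.2] ^+ k * `|expoly P0 E0 p.2|)); last by rewrite big_split/=; ring.
have e (Q e : {poly R}) x : W.[x] ^+ k * `|expoly Q e x| = `|expoly (W ^+ k * Q) e x|.
  rewrite /expoly hornerM horner_exp -mulrA (normrM (W.[x] ^+ k)) (ger0_norm (exprn_ge0 _ _))//.
  exact: le_trans ler01 (W1 x).
apply: ler_pM.
- by apply: prodr_ge0 => i _; rewrite e.
- by rewrite e.
- by apply: ler_prod => i _; rewrite e normr_ge0 hC.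
- by rewrite e.
Qed.

Lemma schwartz_real_gtensor P P0 : schwartz_real (gtensor P P0).
Proof.
move=> s; have [P' [P0' ->]] := iter_partial_gtensor s P P0; split; last first.
  by move=> k; exact: gtensor_decay.
by move=> p; apply: differentiable_tensor => [i|] x; exact: derivable_expoly.
Qed.

End gaussian_type.

Lemma iter_partial_comb (s : seq (option 'I_d)) (a b : R) (f g : 'rV[R]_d * R -> R) :
  schwartz_real f -> schwartz_real g ->
  iter_partial s (fun p => a * f p + b * g p) =
  fun p => a * iter_partial s f p + b * iter_partial s g p.
Proof.
move=> sf sg; elim: s => [//|o s ih] /=.
rewrite ih; apply/funext => p.
have [/(_ p) df _] := sf s; have [/(_ p) dg _] := sg s.
have := @deriveD _ _ _ (a *: iter_partial s f) (b *: iter_partial s g) p (coord_dir R o)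
  (derivableZ (diff_derivable df)) (derivableZ (diff_derivable dg)).
rewrite !deriveZ; [|exact: diff_derivable|exact: diff_derivable].
exact.
Qed.

Lemma schwartz_real_comb (a b : R) (f g : 'rV[R]_d * R -> R) :
  schwartz_real f -> schwartz_real g -> schwartz_real (fun p => a * f p + b * g p).
Proof.
move=> sf sg s; rewrite iter_partial_comb//.
have [df hf] := sf s; have [dg hg] := sg s; split.
  move=> p; apply: (@differentiableD _ _ _ (a *: iter_partial s f) (b *: iter_partial s g)).
    exact: differentiableZ.
  exact: differentiableZ.
move=> k; have [C hC] := hf k; have [C' hC'] := hg k.
exists (`|a| * C + `|b| * C') => p.
apply: (@le_trans _ _ (`|a| * (`|p| ^+ k * `|iter_partial s f p|) + `|b| * (`|p| ^+ k * `|iter_partial s g p|))).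
  rewrite [leRHS](_ : _ = `|p| ^+ k * (`|a| * `|iter_partial s f p| + `|b| * `|iter_partial s g p|)); last by ring.
  by rewrite ler_wpM2l ?exprn_ge0// (le_trans (ler_normD _ _))// !normrM.
by rewrite lerD// ler_wpM2l.
Qed.

Lemma schwartz_comb (k : R[i]) (Phi Psi : Rn R d * RM R -> R[i]) :
  schwartz Phi -> schwartz Psi -> schwartz (fun z => k * Phi z + Psi z).
Proof.
move=> [r1 i1] [r2 i2]; split => /=.
  have := schwartz_real_comb 1 1 (schwartz_real_comb (complex.Re k) (- complex.Im k) r1 i1) r2.
  by congr schwartz_real; apply/funext => p; rewrite ReD ReM; ring.
have := schwartz_real_comb 1 1 (schwartz_real_comb (complex.Re k) (complex.Im k) i1 r1) i2.
by congr schwartz_real; apply/funext => p; rewrite ImD ImM; ring.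
Qed.

Lemma schwartz0 : schwartz (fun _ : Rn R d * RM R => 0 : R[i]).
Proof.
have z : schwartz_real (fun _ : 'rV[R]_d * R => 0 : R).
  have e s : iter_partial s (fun _ : 'rV[R]_d * R => 0 : R) = fun=> 0.
    by elim: s => [//|o s ih] /=; rewrite ih; apply/funext => p; exact: derive_cst.
  move=> s; rewrite e; split; first by move=> p; exact: differentiable_cst.
  by move=> k; exists 0 => p; rewrite normr0 mulr0.
by split.
Qed.

End schwartz_tensor.

(** * Products of Cauchy weights as integrable majorants *)

Section cauchy_weight.
Context {R : realType}.
Notation mu := (@lebesgue_measure R).

Definition cauchy (x : R) : R := (1 + x ^+ 2)^-1.

Lemma cauchy_gt0 x : 0 < cauchy x.
Proof. by rewrite invr_gt0 ltr_pwDl// sqr_ge0. Qed.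

Lemma cauchy_le1 x : cauchy x <= 1.
Proof. by rewrite invf_le1 ?ltr_pwDl ?sqr_ge0// lerDl sqr_ge0. Qed.

Lemma measurable_cauchy : measurable_fun setT cauchy.
Proof. by apply: measurable_funV; mfun. Qed.

Lemma integral_cauchy_lty : (\int[mu]_x (cauchy x)%:E < +oo)%E.
Proof.
rewrite ge0_integral_even.
- rewrite [X in (_ * X)%E](_ : _ = (pi / 2)%:E) -?EFinM ?ltry//.
  exact: integral0y_oneDsqr.
- by apply/measurable_EFinP; exact: measurable_cauchy.
- by move=> x; rewrite lee_fin ltW// cauchy_gt0.
- by move=> x; rewrite /cauchy sqrrN.
Qed.

Definition cauchy_n d (x : Rn R d) : R := \prod_(i < d) cauchy (tnth x i).

Lemma cauchy_n_ge0 d (x : Rn R d) : 0 <= cauchy_n x.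
Proof. by apply: prodr_ge0 => i _; exact/ltW/cauchy_gt0. Qed.

Lemma cauchy_n_le1 d (x : Rn R d) : cauchy_n x <= 1.
Proof.
apply: (@le_trans _ _ (\prod_(i < d) 1)); last by rewrite big1.
by apply: ler_prod => i _; rewrite ltW ?cauchy_gt0 ?cauchy_le1.
Qed.

Lemma measurable_cauchy_n d : measurable_fun setT (@cauchy_n d).
Proof.
apply: measurable_prod => i _; apply: (measurableT_comp measurable_cauchy).
exact: measurable_tnth.
Qed.

Lemma cauchy_n_tcons d s (x : Rn R d) : cauchy_n (tcons (s, x)) = cauchy s * cauchy_n x.
Proof.
rewrite /cauchy_n big_ord_recl; congr (_ * _).
by apply: eq_bigr => i _; rewrite tnthS.
Qed.

Lemma integral_cauchy_n_lty d : (\int[lebesgue_n R d]_x (cauchy_n x)%:E < +oo)%E.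
Proof.
elim: d => [|d ih].
  rewrite integral_dirac//=.
    by rewrite diracT mul1e ltry.
  by apply/measurable_EFinP; exact: measurable_cauchy_n.
rewrite ge0_integral_lebesgue_nS; last 2 first.
- by apply/measurable_EFinP; exact: measurable_cauchy_n.
- by move=> x; rewrite lee_fin cauchy_n_ge0.
set I := (\int[lebesgue_n R d]_x (cauchy_n x)%:E)%E in ih *.
have I0 : (0 <= I)%E by apply: integral_ge0 => x _; rewrite lee_fin cauchy_n_ge0.
have Ifin : (I \is a fin_num)%E by rewrite ge0_fin_numE.
under eq_integral => s _.
  under eq_integral => y _ do rewrite cauchy_n_tcons.
  rewrite ge0_integralMl ?(ltW (cauchy_gt0 _))//; [|exact: measurable_cauchy_n|exact: cauchy_n_ge0].
  rewrite -/I -(fineK Ifin) -EFinM mulrC; over.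
rewrite ge0_integralMl ?fine_ge0//; [|exact: measurable_cauchy|by move=> x; exact/ltW/cauchy_gt0].
by rewrite lte_mul_pinfty// ?integral_cauchy_lty// lee_fin fine_ge0.
Qed.

(** [f^r <= f] since [0 <= f <= 1] and [r >= 1]: one integrability statement serves all finite
    exponents. *)
Lemma Lnorm_lty_le1 {d'} {T : measurableType d'} (m : {measure set T -> \bar R}) (r : R) (f : T -> R) :
  1 <= r -> measurable_fun setT f -> (forall x, 0 <= f x <= 1) ->
  (\int[m]_x (f x)%:E < +oo)%E -> (Lnorm m r%:E (EFin \o f) < +oo)%E.
Proof.
move=> r1 mf f01 fin; have r0 : 0 < r by rewrite (lt_le_trans _ r1).
rewrite ge0_LnormE; last by move=> x /=; have /andP[? _] := f01 x; rewrite lee_fin.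
rewrite poweR_lty//; apply: le_lt_trans fin.
apply: ge0_le_integral => //.
- by move=> x _; exact: poweR_ge0.
- by apply: measurable_fun_poweR; exact/measurable_EFinP.
- exact/measurable_EFinP.
- move=> x _; have /andP[f0 f1] := f01 x.
  rewrite [X in (X <= _)%E](_ : _ = (f x `^ r)%:E)// lee_fin.
  have [->|fx] := eqVneq (f x) 0; first by rewrite powR0// gt_eqF.
  rewrite (_ : r = 1 + (r - 1)); last by ring.
  have : f x `^ (r - 1) <= 1 `^ (r - 1) by apply: ge0_ler_powR; rewrite ?nnegrE ?subr_ge0.
  by rewrite [f x `^ (1 + (r - 1))]powRD ?fx ?implybT// powRr1// powR1; exact: ler_piMr.
Qed.

End cauchy_weight.

(** * Schwartz functions: decay, measurability, finite norms *)

Section schwartz_bounds.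
Context {R : realType} (d : nat).
Notation mu := (@lebesgue_measure R).
Notation nu := (lebesgue_n R d).

Definition cauchy_w (z : Rn R d * RM R) : R := cauchy_n z.1 * cauchy z.2.

Lemma cauchy_w_ge0 z : 0 <= cauchy_w z.
Proof. by rewrite mulr_ge0 ?cauchy_n_ge0// ltW// cauchy_gt0. Qed.

Lemma measurable_cauchy_w : measurable_fun setT cauchy_w.
Proof.
apply: measurable_funM; first exact: (measurableT_comp (@measurable_cauchy_n R d) measurable_fst).
exact: (measurableT_comp (@measurable_cauchy R) measurable_snd).
Qed.

Lemma Lnorm_cauchy_n_lty (r : R) : 1 <= r -> (Lnorm nu r%:E (EFin \o @cauchy_n R d) < +oo)%E.
Proof.
move=> r1; apply: Lnorm_lty_le1 => //; first exact: measurable_cauchy_n.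
- by move=> x; rewrite cauchy_n_ge0 cauchy_n_le1.
- exact: integral_cauchy_n_lty.
Qed.

Lemma mixn_cauchy_w_lty (q r : R) : 1 <= q -> 1 <= r ->
  (mixn nu mu q%:E r%:E (EFin \o cauchy_w) < +oo)%E.
Proof.
move=> q1 r1; have q0 : (0 < q%:E)%E by rewrite lte_fin (lt_le_trans _ q1).
have r0 : (0 < r%:E)%E by rewrite lte_fin (lt_le_trans _ r1).
have Lf := Lnorm_cauchy_n_lty r1; set L := Lnorm _ _ _ in Lf.
have L0 : (0 <= L)%E by exact: Lnorm_ge0.
have Lfin : (L \is a fin_num)%E by rewrite ge0_fin_numE.
have mc : measurable_fun setT (EFin \o @cauchy R) by apply/measurable_EFinP; exact: measurable_cauchy.
have c0 x : (0 <= (EFin \o @cauchy R) x)%E by rewrite lee_fin ltW// cauchy_gt0.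
rewrite /mixn (_ : (fun t => _) = fun t => ((fine L)%:E * (EFin \o @cauchy R) t)%E).
  rewrite ge0_LnormZ ?fine_ge0// lte_mul_pinfty ?lee_fin ?fine_ge0//.
  apply: Lnorm_lty_le1 => //; first exact: measurable_cauchy.
  - by move=> x; rewrite ltW ?cauchy_gt0 ?cauchy_le1.
  - exact: integral_cauchy_lty.
apply/funext => t; rewrite fineK// muleC /= -ge0_LnormZ//.
- by congr Lnorm; apply/funext => x; rewrite /= /cauchy_w /= -EFinM mulrC.
- by apply/measurable_EFinP; exact: measurable_cauchy_n.
- by move=> x; rewrite lee_fin cauchy_n_ge0.
- exact/ltW/cauchy_gt0.
Qed.

(** Each of the [d + 1] factors satisfies [1 + u^2 <= 1 + m] with [m = |p|^2], and
    [(1 + m)^(d+1) <= 2^(d+1) (1 + m^(d+1))]; hence the moments of order 0 and [2(d+1)] suffice. *)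
Lemma schwartz_real_le_cauchy (f : 'rV[R]_d * R -> R) : schwartz_real f ->
  exists2 C, 0 <= C & forall p, `|f p| <= C * ((\prod_(i < d) cauchy (p.1 0 i)) * cauchy p.2).
Proof.
move=> /(_ [::])[_ hf]; have [C0 hC0] := hf 0%N; have [C1 hC1] := hf (2 * d.+1)%N.
have {}hC0 p : `|f p| <= C0 by have := hC0 p; rewrite expr0 mul1r.
have C00 : 0 <= C0 by exact: le_trans (normr_ge0 _) (hC0 (0, 0)).
have C10 : 0 <= C1 by apply: le_trans (hC1 (0, 0)); rewrite mulr_ge0// exprn_ge0.
exists (2 ^+ d.+1 * (C0 + C1)); first by rewrite mulr_ge0 ?exprn_ge0 ?addr_ge0.
move=> p; rewrite [X in _ * X](_ : _ = ((\prod_(i < d) (1 + p.1 0 i ^+ 2)) * (1 + p.2 ^+ 2))^-1); last first.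
  by rewrite invfM prodfV.
have P1 : 0 < \prod_(i < d) (1 + p.1 0 i ^+ 2).
  by apply: prodr_gt0 => i _; rewrite ltr_pwDl// sqr_ge0.
have T1 : 0 < 1 + p.2 ^+ 2 by rewrite ltr_pwDl// sqr_ge0.
rewrite ler_pdivlMr ?mulr_gt0//.
set m := `|p| ^+ 2; have m0 : 0 <= m by exact: sqr_ge0.
have cm u : `|u| <= `|p| -> 1 + u ^+ 2 <= 1 + m.
  by move=> up; rewrite lerD2l -(real_normK (num_real u)) lerXn2r// nnegrE.
have le1 : (\prod_(i < d) (1 + p.1 0 i ^+ 2)) * (1 + p.2 ^+ 2) <= (1 + m) ^+ d.+1.
  have h1 : \prod_(i < d) (1 + p.1 0 i ^+ 2) <= (1 + m) ^+ d.
    rewrite -[d in leRHS]card_ord -prodr_const; apply: ler_prod => i _.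
    by rewrite (cm _ (le_coord_norm p i)) addr_ge0// sqr_ge0.
  by rewrite [leRHS]exprSr; exact: (ler_pM (ltW P1) (ltW T1) h1 (cm _ (le_time_norm p))).
have le2 : (1 + m) ^+ d.+1 <= 2 ^+ d.+1 * (1 + m ^+ d.+1).
  have [m1|m1] := leP m 1.
    apply: (@le_trans _ _ (2 ^+ d.+1)).
      by rewrite lerXn2r ?nnegrE ?addr_ge0// -[2]/(1 + 1) lerD2l.
    by rewrite ler_peMr ?exprn_ge0// lerDl exprn_ge0.
  apply: (@le_trans _ _ ((2 * m) ^+ d.+1)).
    by rewrite lerXn2r ?nnegrE ?addr_ge0 ?mulr_ge0// mulr_natl mulr2n lerD2r ltW.
  by rewrite exprMn ler_wpM2l ?exprn_ge0// lerDr.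
apply: (le_trans (ler_wpM2l (normr_ge0 _) (le_trans le1 le2))).
rewrite mulrCA; apply: ler_wpM2l; first exact: exprn_ge0.
rewrite mulrDr mulr1 lerD// mulrC -exprM; exact: hC1.
Qed.

Let row_of (z : Rn R d * RM R) : 'rV[R]_d * R := (\row_i tnth z.1 i, z.2).

(** Continuity lives on row vectors and measurability on tuples. The open set is the countable union
    of the cubes with rational centre and size that it contains; a cube violating [J] contributes
    the empty set. *)
Lemma measurable_open_row (O : set ('rV[R]_d * R)) : open O ->
  measurable [set z : Rn R d * RM R | O (row_of z)].
Proof.
move=> oO.
pose U := ((d.-tuple rat * rat) * rat)%type.
pose near_ (c : U) (x : 'rV[R]_d) (t : R) :=
  (forall i, `|x 0 i - ratr (tnth c.1.1 i)| < ratr c.2) /\ `|t - ratr c.1.2| < ratr c.2.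
pose J (c : U) := forall x t, near_ c x t -> O (x, t).
pose F (c : U) : set (Rn R d * RM R) :=
  [set z | J c /\ near_ c (row_of z).1 (row_of z).2].
rewrite (_ : [set z | _] = \bigcup_c F c).
  apply: countable_bigcupT_measurable; first exact: countableP.
  move=> c; rewrite (_ : F c = [set z | J c] `&` ((\bigcap_(i in [set: 'I_d])
     [set z : Rn R d * RM R | `|tnth z.1 i - ratr (tnth c.1.1 i)| < ratr c.2]) `&`
     [set z : Rn R d * RM R | `|z.2 - ratr c.1.2| < ratr c.2])); last first.
    apply/seteqP; split => z /=.
      by move=> [Ic [h1 h2]]; split => //; split => // i _ /=; have := h1 i; rewrite mxE.
    by move=> [Ic [h1 h2]]; split => //; split => // i; rewrite mxE; exact: h1.
  have mlt (h : Rn R d * RM R -> R) (e : R) : measurable_fun setT h ->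
      measurable [set z | `|h z| < e].
    move=> mh; rewrite -[X in measurable X]setTI.
    rewrite (_ : [set z | _] = (fun z => `|h z|) @^-1` `]-oo, e[%classic); last first.
      by apply/seteqP; split => z /=; rewrite in_itv.
    exact: (measurable_funnorm mh).
  apply: measurableI.
    have [Jc|nJ] := pselect (J c).
      by rewrite (_ : [set z | _] = setT)//; apply/seteqP; split.
    by rewrite (_ : [set z | _] = set0)//; apply/seteqP; split.
  apply: measurableI.
    apply: fin_bigcap_measurable => // i _; apply: mlt.
    apply: measurable_funB => //.
    exact: (measurableT_comp (measurable_tnth i) measurable_fst).
  by apply: mlt; mfun.
apply/seteqP; split => z /=; last first.
  by move=> [c _ [Ic nc]]; have := Ic _ _ nc.
move=> Oz; have /nbhs_ballP[e /= e0 be] : nbhs (row_of z) O by exact: open_nbhs_nbhs.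
have e20 : 0 < e / 2 by rewrite divr_gt0.
(* With a rational size below [e/2] and a centre within that distance, the cube contains the point
   and stays in its ball of radius [e]. *)
have [rho] := rat_in_itvoo e20; rewrite in_itv/= => /andP[rho0 rhoe].
have close (u : R) : exists c : rat, `|u - ratr c| < ratr rho.
  have /rat_in_itvoo[c] : u - ratr rho < u + ratr rho by lra.
  by rewrite in_itv/= => /andP[h1 h2]; exists c; rewrite ltr_norml; apply/andP; split; lra.
have /choice[c hc] : forall i : 'I_d, exists c : rat, `|tnth z.1 i - ratr c| < ratr rho by move=> i; exact: close.
have [c0 hc0] := close z.2.
exists (([tuple c i | i < d], c0), rho) => //; split; last first.
  by split => /= [i|//]; rewrite mxE tnth_mktuple.
move=> x t [h1 h2]; apply: be; split => /=.
  split => // i j; rewrite ord1 /ball/= !mxE.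
  have := h1 j; rewrite tnth_mktuple /= => h; have := hc j.
  move: h; rewrite !ltr_norml => /andP[a1 a2] /andP[b1 b2].
  by apply/andP; split; lra.
rewrite /ball/=; move: h2 hc0; rewrite /= !ltr_norml => /andP[a1 a2] /andP[b1 b2].
by apply/andP; split; lra.
Qed.

Lemma measurable_continuous_row (f : 'rV[R]_d * R -> R) : continuous f ->
  measurable_fun setT (fun z : Rn R d * RM R => f (row_of z)).
Proof.
move=> cf; apply: (measurability _ (RGenOpens.measurableE R)) => _ [_ [x [y ->]] <-].
rewrite setTI; apply: (@measurable_open_row (f @^-1` `]x, y[%classic)).
by apply: open_comp => [q _|]; [exact: cf|exact: interval_open].
Qed.

Lemma schwartz_cmeasurable (Phi : Rn R d * RM R -> R[i]) : schwartz Phi -> cmeasurable_fun setT Phi.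
Proof.
have row_ofK z : ([tuple (row_of z).1 0 i | i < d], (row_of z).2) = z.
  by case: z => x t; congr pair; apply: eq_from_tnth => i; rewrite tnth_mktuple mxE.
move=> [/(_ [::])[dr _] /(_ [::])[di _]]; split.
  have := measurable_continuous_row (fun p => differentiable_continuous (dr p)).
  by congr measurable_fun; apply/funext => z /=; rewrite row_ofK.
have := measurable_continuous_row (fun p => differentiable_continuous (di p)).
by congr measurable_fun; apply/funext => z /=; rewrite row_ofK.
Qed.

Lemma schwartz_le_cauchy (Phi : Rn R d * RM R -> R[i]) : schwartz Phi ->
  exists2 C, 0 <= C & forall z, Normc.normc (Phi z) <= C * cauchy_w z.
Proof.
have row_ofK z : ([tuple (row_of z).1 0 i | i < d], (row_of z).2) = z.
  by case: z => x t; congr pair; apply: eq_from_tnth => i; rewrite tnth_mktuple mxE.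
move=> [/schwartz_real_le_cauchy[C C0 hC] /schwartz_real_le_cauchy[C' C'0 hC']].
exists (C + C') => [|z]; first by rewrite addr_ge0.
apply: (le_trans (normc_le_ReIm _)); rewrite mulrDl.
have e : cauchy_w z = (\prod_(i < d) cauchy ((row_of z).1 0 i)) * cauchy (row_of z).2.
  by congr (_ * _); apply: eq_bigr => i _; rewrite mxE.
rewrite e; apply: lerD; [have := hC (row_of z)|have := hC' (row_of z)]; by rewrite row_ofK.
Qed.

Lemma mixed_norm_schwartz_lty (q r : R) Phi : 1 <= q -> 1 <= r -> schwartz Phi ->
  (@mixed_norm R d q%:E r%:E Phi < +oo)%E.
Proof.
move=> q1 r1 sPhi; have [C C0 hC] := schwartz_le_cauchy sPhi.
have mW : measurable_fun setT (EFin \o cauchy_w) by apply/measurable_EFinP; exact: measurable_cauchy_w.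
have W0 z : (0 <= (EFin \o cauchy_w) z)%E by rewrite lee_fin cauchy_w_ge0.
have q1e : (1 <= q%:E)%E by rewrite lee_fin.
have r1e : (1 <= r%:E)%E by rewrite lee_fin.
apply: (@le_lt_trans _ _ (C%:E * mixn nu mu q%:E r%:E (EFin \o cauchy_w))%E); last first.
  by rewrite lte_mul_pinfty ?lee_fin// mixn_cauchy_w_lty.
rewrite -mixnZ// mixed_normE; apply: le_mixn => //.
- by apply: cmeasurable_enormc; exact: schwartz_cmeasurable.
- exact: measurable_funeM.
- by move=> z; rewrite lee_fin normc_ge0.
Qed.

Lemma schwartz_regular (r : \bar R) (rho : R) Phi : hoelder_conjugate r = rho%:E -> 1 <= rho ->
  schwartz Phi -> regular (d := d) r Phi.
Proof.
move=> rE r1 sPhi; have [C C0 hC] := schwartz_le_cauchy sPhi.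
have mPhi := schwartz_cmeasurable sPhi.
have hC' x tau : Normc.normc (Phi (x, tau)) <= C * cauchy_n x.
  apply: (le_trans (hC _)); rewrite ler_wpM2l// /cauchy_w/= ler_piMr ?cauchy_n_ge0//.
  exact: cauchy_le1.
have ic : nu.-integrable setT (EFin \o @cauchy_n R d).
  apply/integrableP; split; first by apply/measurable_EFinP; exact: measurable_cauchy_n.
  apply: le_lt_trans (integral_cauchy_n_lty d).
  rewrite le_eqVlt; apply/orP; left; apply/eqP; apply: eq_integral => x _.
  by rewrite /= ger0_norm// cauchy_n_ge0.
have iC := integrableZl measurableT C ic.
split => //.
- move=> tau; have [mr mi] := mPhi.
  have mr' : measurable_fun setT (fun y => complex.Re (Phi (y, tau))).
    have mm := measurable_section1 (T3 := R) tau mr; exact mm.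
  have mi' : measurable_fun setT (fun y => complex.Im (Phi (y, tau))).
    have mm := measurable_section1 (T3 := R) tau mi; exact mm.
  split; apply: (le_integrable measurableT _ _ iC); try exact/measurable_EFinP.
    move=> y _; rewrite [X in (_ <= X)%E](_ : _ = `|C * cauchy_n y|%:E)//
      [X in (X <= _)%E](_ : _ = `|complex.Re (Phi (y, tau))|%:E)//
      lee_fin (le_trans (le_Re_normc _))// (le_trans (hC' _ _))//.
    exact: ler_norm.
  move=> y _; rewrite [X in (_ <= X)%E](_ : _ = `|C * cauchy_n y|%:E)//
      [X in (X <= _)%E](_ : _ = `|complex.Im (Phi (y, tau))|%:E)//
      lee_fin (le_trans (le_Im_normc _))// (le_trans (hC' _ _))//.
  exact: ler_norm.
move=> tau; rewrite rE.
have rho0 : (0 < rho%:E)%E by rewrite lte_fin (lt_le_trans _ r1).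
apply: (@le_lt_trans _ _ (C%:E * Lnorm nu rho%:E (EFin \o @cauchy_n R d))%E); last first.
  by rewrite lte_mul_pinfty ?lee_fin ?Lnorm_ge0// Lnorm_cauchy_n_lty.
rewrite -ge0_LnormZ//; last 2 first.
- by apply/measurable_EFinP; exact: measurable_cauchy_n.
- by move=> x; rewrite lee_fin cauchy_n_ge0.
apply: le_Lnorm => //.
- have mm := measurable_section1 (T3 := \bar R) tau (cmeasurable_enormc mPhi); exact mm.
- by apply: measurable_funeM; apply/measurable_EFinP; exact: measurable_cauchy_n.
- by move=> x; rewrite lee_fin normc_ge0.
- by move=> x; rewrite /= -EFinM lee_fin.
Qed.

End schwartz_bounds.

(** * Approximating the indicator of an interval by [e^(-P)] *)

Section bump.
Context {R : realType}.

(** [1 - s^n = (1 - s)(1 + ... + s^(n-1))], and each of the [n] terms of the sum is at least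
    [s^n]. *)
Lemma scaled_expr_le (s : R) n : 0 <= s <= 1 -> n%:R * s ^+ n * (1 - s) <= 1 - s ^+ n.
Proof.
move=> /andP[s0 s1]; elim: n => [|n ih]; first by rewrite expr0 mul0r mul0r subrr.
have sn0 : 0 <= s ^+ n.+1 by rewrite exprn_ge0.
have sn1 : s ^+ n.+1 <= 1 by rewrite exprn_ile1.
apply: (@le_trans _ _ (s * (1 - s ^+ n) + s ^+ n.+1 * (1 - s))).
  rewrite (_ : n.+1%:R * s ^+ n.+1 * (1 - s) = s * (n%:R * s ^+ n * (1 - s)) + s ^+ n.+1 * (1 - s)).
    by rewrite lerD2r ler_wpM2l.
  by rewrite -[n.+1%:R]natr1 exprS; ring.
rewrite exprS -subr_ge0.
rewrite (_ : _ - _ = (1 - s) * (1 - s * s ^+ n)); last by ring.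
by rewrite mulr_ge0 ?subr_ge0// -exprS.
Qed.

(** With [v = s^2], one factor [s^(n+1)] absorbs [n + 1] by [scaled_expr_le] and the other tends to
    0. *)
Lemma cvg_scaled_expr (v : R) : 0 <= v < 1 -> n.+1%:R * v ^+ n.+1 @[n --> \oo] --> (0 : R).
Proof.
move=> /andP[v0 v1]; pose s := Num.sqrt v.
have s0 : 0 <= s by rewrite sqrtr_ge0.
have s1 : s < 1 by rewrite -[ltRHS]sqrtr1 ltr_sqrt.
have vE : v = s * s by rewrite -expr2 sqr_sqrtr.
have s10 : 0 < 1 - s by rewrite subr_gt0.
apply: (@squeeze_cvgr _ _ _ _ (cst 0) (fun n => (1 - s)^-1 * s ^+ n.+1)).
- apply: nearW => n; rewrite mulr_ge0 ?exprn_ge0//=.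
  rewrite vE exprMn mulrA ler_wpM2r ?exprn_ge0//.
  rewrite -[leRHS]mul1r ler_pdivlMr//; apply: (le_trans (scaled_expr_le n.+1 _)).
    by rewrite s0 ltW.
  by rewrite gerBl exprn_ge0.
- exact: cvg_cst.
- rewrite -[X in _ --> X](mulr0 (1 - s)^-1); apply: cvgMr.
  have h : s ^+ n @[n --> \oo] --> (0 : R) by apply: cvg_expr; rewrite ger0_norm.
  by move: h; rewrite -cvg_shiftS.
Qed.

Context (c w : R).
Context (w0 : 0 < w).
Let u (x : R) : R := (x - c) / w.

(** With [u = (x - c)/w] this is [(n+1) u^(2(n+1))], which tends to 0 for [|u| < 1] and to infinity
    for [|u| > 1]. The factor [n + 1] makes it diverge at [|u| = 1] too, so [bump] converges
    everywhere to the indicator of the open interval. *)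
Definition bump_poly (n : nat) : {poly R} := n.+1%:R *: (w^-1 *: ('X - c%:P)) ^+ (2 * n.+1).

Lemma bump_polyE n x : (bump_poly n).[x] = n.+1%:R * (u x ^+ 2) ^+ n.+1.
Proof.
by rewrite /bump_poly hornerZ horner_exp hornerZ hornerXsubC exprM /u [w^-1 * _]mulrC.
Qed.

(** A lower bound independent of [n], whence one Gaussian majorant for all [bump n]. *)
Let u2_le (n : nat) x : u x ^+ 2 - 1 <= (bump_poly n).[x].
Proof.
rewrite bump_polyE; set v := u x ^+ 2; have v0 : 0 <= v by exact: sqr_ge0.
have [v1|v1] := leP v 1.
  by rewrite (@le_trans _ _ 0) ?subr_le0// mulr_ge0// exprn_ge0.
apply: (@le_trans _ _ v); first by rewrite gerBl.
apply: (@le_trans _ _ (1 * v ^+ n.+1)); first by rewrite mul1r exprS ler_peMr// exprn_ege1// ltW.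
by apply: ler_wpM2r; [exact: exprn_ge0|rewrite ler1n].
Qed.

Let exp_bump_le n x : expR (- (bump_poly n).[x]) <= expR 1 * expR (- u x ^+ 2).
Proof. by rewrite -expRD ler_expR; have := u2_le n x; lra. Qed.

Let poly_le (P : {poly R}) : exists2 K, 0 <= K & exists m, forall x, `|P.[x]| <= K * (1 + u x ^+ 2) ^+ m.
Proof.
elim/poly_ind: P => [|P k [K K0 [m h]]].
  by exists 0 => //; exists 0%N => x; rewrite horner0 normr0 mul0r.
exists (K * (`|c| + w) + `|k|); first by rewrite addr_ge0// mulr_ge0// addr_ge0// ltW.
exists m.+1 => x; rewrite !hornerE.
have v0 : 0 <= u x ^+ 2 by exact: sqr_ge0.
have v1 : 1 <= 1 + u x ^+ 2 by rewrite lerDl.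
have xle : `|x| <= (`|c| + w) * (1 + u x ^+ 2).
  have {1}-> : x = c + w * u x by rewrite /u; field; rewrite gt_eqF.
  apply: (le_trans (ler_normD _ _)); rewrite normrM (gtr0_norm w0) mulrDl lerD//.
    by rewrite ler_peMr.
  rewrite ler_wpM2l ?(ltW w0)//.
  rewrite -(real_normK (num_real (u x))); move: (normr_ge0 (u x)); move: `|u x| => y y0.
  by rewrite -subr_ge0 (_ : _ - y = (y - 2^-1) ^+ 2 + 3 / 4) ?addr_ge0 ?sqr_ge0//; field.
apply: (le_trans (ler_normD _ _)); rewrite mulrDl lerD//.
  rewrite normrM exprSr [leRHS](_ : _ = (K * (1 + u x ^+ 2) ^+ m) * ((`|c| + w) * (1 + u x ^+ 2))); last by ring.
  exact: ler_pM.
by rewrite ler_peMr// exprn_ege1.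
Qed.

Lemma rapid_bump n : rapid (bump_poly n).
Proof.
move=> P; have [K K0 [m h]] := poly_le P.
exists (K * (m.+1%:R ^+ m.+1 * expR 1)) => x.
set v := u x ^+ 2; have v0 : 0 <= v by exact: sqr_ge0.
have v1 : 1 <= 1 + v by rewrite lerDl.
(* From [1 + y <= e^y] at [y = v/(m+1)], raised to the power [m + 1]. *)
have vm : (1 + v) ^+ m <= m.+1%:R ^+ m.+1 * expR v.
  apply: (@le_trans _ _ ((1 + v) ^+ m.+1)); first by rewrite exprS ler_peMl// exprn_ge0// addr_ge0.
  have m0 : 0 < m.+1%:R :> R by [].
  have -> : expR v = expR (v / m.+1%:R) ^+ m.+1.
    by rewrite -expRM_natl; congr expR; field; rewrite gt_eqF.
  rewrite -exprMn lerXn2r ?nnegrE ?addr_ge0// ?mulr_ge0 ?expR_ge0//.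
  apply: (@le_trans _ _ (m.+1%:R * (1 + v / m.+1%:R))).
    by rewrite mulrDr mulr1 mulrCA divff ?gt_eqF// mulr1 lerD2r ler1n.
  by rewrite ler_wpM2l// expR_ge1Dx.
rewrite /expoly normrM (ger0_norm (expR_ge0 _)).
apply: (@le_trans _ _ ((K * (1 + v) ^+ m) * (expR 1 * expR (- v)))).
  by apply: ler_pM => //; exact: exp_bump_le.
rewrite [leLHS](_ : _ = K * ((1 + v) ^+ m * expR (- v) * expR 1)); last by ring.
rewrite ler_wpM2l// ler_wpM2r ?expR_ge0//.
by rewrite expRN ler_pdivrMr ?expR_gt0.
Qed.

Definition bump (n : nat) (x : R) : R := expR (- (bump_poly n).[x]).

Lemma bump_ge0 n x : 0 <= bump n x. Proof. exact: expR_ge0. Qed.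

Lemma bump_le_cauchy : exists2 M, 0 <= M & forall n x, bump n x <= M * cauchy x.
Proof.
(* From [x = c + w u] one gets [x^2 <= 2 c^2 + 2 w^2 u^2], hence [1 + x^2 <= k (1 + u^2)]. *)
pose k := 1 + 2 * c ^+ 2 + 2 * w ^+ 2.
have k0 : 0 <= k by rewrite !addr_ge0// mulr_ge0// sqr_ge0.
exists (expR 1 * k) => [|n x]; first by rewrite mulr_ge0// expR_ge0.
apply: (le_trans (exp_bump_le n x)); rewrite -mulrA ler_wpM2l ?expR_ge0//.
set v := u x ^+ 2; have v0 : 0 <= v by exact: sqr_ge0.
rewrite expRN; apply: (@le_trans _ _ (1 + v)^-1).
  by rewrite lef_pV2 ?posrE ?expR_gt0 ?expR_ge1Dx// ltr_pwDl.
have x0 : 0 < 1 + x ^+ 2 by rewrite ltr_pwDl// sqr_ge0.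
rewrite /cauchy ler_pdivlMr// mulrC ler_pdivrMr ?ltr_pwDl//.
have -> : x = c + w * u x by rewrite /u; field; rewrite gt_eqF.
rewrite -subr_ge0 /k (_ : _ - _ = (c - w * u x) ^+ 2 + 2 * w ^+ 2 + v + 2 * c ^+ 2 * v); last first.
  by rewrite /v; ring.
rewrite addr_ge0//; last by rewrite mulr_ge0// mulr_ge0// sqr_ge0.
by rewrite addr_ge0// addr_ge0 ?sqr_ge0// mulr_ge0// sqr_ge0.
Qed.

Lemma cvg_bump x : bump n x @[n --> \oo] --> ((c - w < x < c + w)%R%:R : R).
Proof.
have [xin|xout] := boolP (c - w < x < c + w).
  have v1 : 0 <= u x ^+ 2 < 1.
    rewrite sqr_ge0/= -(real_normK (num_real (u x))) exprn_ilt1//.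
    rewrite /u normrM normfV (gtr0_norm w0) ltr_pdivrMr// mul1r ltr_norml.
    by move: xin => /andP[h1 h2]; apply/andP; split; lra.
  rewrite /= -[X in _ --> X]expR0 -oppr0.
  apply: (cvg_comp _ expR) => /=; last exact: continuous_expR.
  apply: cvgN; rewrite (_ : (fun n => _) = fun n => n.+1%:R * (u x ^+ 2) ^+ n.+1); last first.
    by apply/funext => n; rewrite bump_polyE.
  exact: cvg_scaled_expr.
have v1 : 1 <= u x ^+ 2.
  rewrite -(real_normK (num_real (u x))) exprn_ege1//.
  rewrite /u normrM normfV (gtr0_norm w0) ler_pdivlMr// mul1r leNgt; apply: contra xout.
  by rewrite ltr_norml => /andP[h1 h2]; apply/andP; split; lra.
rewrite /=; apply: (@squeeze_cvgr _ _ _ _ (cst 0) (fun n => n.+1%:R^-1)).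
- apply: nearW => n; rewrite bump_ge0/= /bump expRN lef_pV2 ?posrE ?expR_gt0//.
  apply: (@le_trans _ _ (1 + (bump_poly n).[x])); last exact: expR_ge1Dx.
  rewrite bump_polyE ler_wpDl// ler_peMr//; exact: exprn_ege1.
- exact: cvg_cst.
- exact: cvg_harmonic.
Qed.

End bump.

(** * From boxes to all functions of finite mixed norm *)

Section approximable.
Context {R : realType} (d : nat) (q r : R).
Context (q1 : 1 <= q).
Context (r1 : 1 <= r).
Notation mu := (@lebesgue_measure R).
Notation nu := (lebesgue_n R d).
Notation mixed := (@mixed_norm R d q%:E r%:E).
Implicit Types (f g h psi : Rn R d * RM R -> R[i]) (G : Rn R d * RM R -> R) (A : set (Rn R d * RM R)).
Local Open Scope complex_scope.

Let q1e : (1 <= q%:E)%E. Proof. by rewrite lee_fin. Qed.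
Let r1e : (1 <= r%:E)%E. Proof. by rewrite lee_fin. Qed.
Let q0 : 0 < q. Proof. exact: lt_le_trans q1. Qed.
Let r0 : 0 < r. Proof. exact: lt_le_trans r1. Qed.

Definition approximable f := cmeasurable_fun setT f /\
  forall e : R, 0 < e -> exists2 psi : Rn R d * RM R -> R[i], schwartz psi &
    (mixed (fun z => f z - psi z)%R <= e%:E)%E.

Let mixed_ext f g : f =1 g -> mixed f = mixed g. Proof. by move=> /funext ->. Qed.

Lemma mixed_normB f g : cmeasurable_fun setT f -> cmeasurable_fun setT g ->
  (mixed (fun z => f z - g z)%R <= mixed f + mixed g)%E.
Proof.
move=> mf mg; have := mixed_norm_comb q1e r1e (-1) mg mf.
rewrite normcN Normc.normc1 mul1e addeC; apply: le_trans.
by rewrite (@mixed_ext (fun z => f z - g z) (fun z => -1 * g z + f z))// => z; rewrite mulN1r addrC.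
Qed.

Lemma mixed_norm_triangle f g h : cmeasurable_fun setT f -> cmeasurable_fun setT g ->
  cmeasurable_fun setT h ->
  (mixed (fun z => f z - h z)%R <= mixed (fun z => f z - g z)%R + mixed (fun z => g z - h z)%R)%E.
Proof.
move=> mf mg mh; have := mixed_norm_comb q1e r1e 1 (cmeasurable_sub mf mg) (cmeasurable_sub mg mh).
rewrite Normc.normc1 mul1e; apply: le_trans.
rewrite (@mixed_ext (fun z => f z - h z) (fun z => 1 * (f z - g z) + (g z - h z)))// => z.
by rewrite mul1r addrA subrK.
Qed.

Lemma approximable_schwartz psi : schwartz psi -> approximable psi.
Proof.
move=> spsi; split; first exact: schwartz_cmeasurable.
move=> e e0; exists psi => //.
rewrite (@mixed_ext _ (fun=> 0)); last by move=> z; rewrite subrr.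
rewrite mixed_normE (_ : mixn _ _ _ _ _ = 0%E) ?lee_fin ?ltW//.
apply: (iffRL (mixn_eq0 _ _ q1e r1e _ _)).
- by rewrite Normc.normc0; exact: measurable_cst.
- by move=> p; rewrite Normc.normc0.
- by apply: aeW => p; rewrite Normc.normc0.
Qed.

Lemma approximable0 : approximable (fun=> 0).
Proof. by apply: approximable_schwartz; exact: schwartz0. Qed.

Lemma approximable_comb (k : R[i]) f g : approximable f -> approximable g ->
  approximable (fun z => k * f z + g z).
Proof.
move=> [mf hf] [mg hg]; split; first exact: cmeasurable_comb.
move=> e e0; have k0 : 0 < Normc.normc k + 1 by rewrite ltr_wpDl// normc_ge0.
have [psi s1 h1] := hf (e / 2 / (Normc.normc k + 1)) (divr_gt0 (divr_gt0 e0 (ltr0Sn _ 1)) k0).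
have [phi s2 h2] := hg (e / 2) (divr_gt0 e0 (ltr0Sn _ 1)).
exists (fun z => k * psi z + phi z); first exact: schwartz_comb.
rewrite (@mixed_ext _ (fun z => k * (f z - psi z) + (g z - phi z))); last by move=> z; ring.
apply: (le_trans (mixed_norm_comb q1e r1e k (cmeasurable_sub mf (schwartz_cmeasurable s1))
  (cmeasurable_sub mg (schwartz_cmeasurable s2)))).
apply: (@le_trans _ _ ((Normc.normc k)%:E * (e / 2 / (Normc.normc k + 1))%:E + (e / 2)%:E)%E).
  by apply: leeD => //; apply: lee_wpmul2l => //; rewrite lee_fin normc_ge0.
rewrite -EFinM -EFinD lee_fin [leRHS](_ : _ = e / 2 + e / 2); last by field.
rewrite lerD2r mulrCA ler_piMr ?divr_ge0 ?(ltW e0)// ler_pdivrMr// mul1r.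
by rewrite lerDl.
Qed.

Lemma approximable_limit f (f_ : nat -> Rn R d * RM R -> R[i]) : cmeasurable_fun setT f ->
  (forall n, approximable (f_ n)) ->
  mixed (fun z => f z - f_ n z) @[n --> \oo] --> 0%E -> approximable f.
Proof.
move=> mf hf /ge0_cvge0P => /(_ (fun n => Lnorm_ge0 _ _ _)) h; split=> // e e0.
have e20 : 0 < e / 2 by rewrite divr_gt0.
have [n _ /(_ n (leqnn n)) hn] := h _ e20.
have [mfn /(_ _ e20)[psi spsi hpsi]] := hf n.
exists psi => //; apply: (le_trans (mixed_norm_triangle mf mfn (schwartz_cmeasurable spsi))).
by rewrite (_ : e = e / 2 + e / 2) ?EFinD ?leeD//; field.
Qed.

Lemma approximable_dominated f (f_ : nat -> Rn R d * RM R -> R[i]) G :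
  cmeasurable_fun setT f -> (forall n, approximable (f_ n)) -> measurable_fun setT G ->
  (mixn nu mu q%:E r%:E (EFin \o G) < +oo)%E ->
  (forall n z, Normc.normc (f z - f_ n z) <= G z) ->
  (forall z, Normc.normc (f z - f_ n z) @[n --> \oo] --> (0 : R)) -> approximable f.
Proof.
move=> mf hf mG finG fG fc; apply: (approximable_limit mf hf).
have := @mixn_dominated _ _ _ _ R nu mu q r (fun n z => (Normc.normc (f z - f_ n z))%:E) (EFin \o G) q0 r0.
apply.
- by move=> n; apply: cmeasurable_enormc; apply: cmeasurable_sub => //; have [] := hf n.
- exact/measurable_EFinP.
- by move=> n z; rewrite lee_fin normc_ge0.
- by move=> n z; rewrite lee_fin.
- exact: finG.
- by apply: aeW => z; apply: cvg_EFin; [exact: nearW|exact: fc].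
Qed.

Lemma normc_real (x : R) : Normc.normc (x%:C) = `|x|.
Proof. by rewrite normcE/= expr0n addr0 sqrtr_sqr. Qed.

Lemma normc_realB (x y : R) : Normc.normc (x%:C - y%:C) = `|x - y|.
Proof. by rewrite normcE ReD ImD ReN ImN /= subr0 expr0n addr0 sqrtr_sqr. Qed.

Definition rind A (z : Rn R d * RM R) : R[i] := (\1_A z : R)%:C.

Lemma cmeasurable_rind A : measurable A -> cmeasurable_fun setT (rind A).
Proof. by move=> mA; split; [exact: measurable_indic|exact: measurable_cst]. Qed.

Definition fbox (l u : 'I_d -> R) (l0 u0 : R) : set (Rn R d * RM R) :=
  [set z | (forall i, l i < tnth z.1 i < u i) /\ l0 < z.2 < u0].

Lemma measurable_fbox l u l0 u0 : measurable (fbox l u l0 u0).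
Proof.
rewrite (_ : fbox _ _ _ _ = (\bigcap_(i in [set: 'I_d])
   ((fun z : Rn R d * RM R => tnth z.1 i) @^-1` `]l i, u i[%classic)) `&`
   (snd @^-1` `]l0, u0[%classic)); last first.
  apply/seteqP; split => z /=.
    by move=> [h1 h2]; split; rewrite ?in_itv//= => i _ /=; rewrite in_itv/= h1.
  move=> [h1 h2]; split; last by move: h2; rewrite in_itv.
  by move=> i; have := h1 i I; rewrite /= in_itv.
apply: measurableI.
  apply: fin_bigcap_measurable => // i _.
  have mt : measurable_fun setT (fun z : Rn R d * RM R => tnth z.1 i).
    exact: (measurableT_comp (measurable_tnth i) measurable_fst).
  by rewrite -[X in measurable X]setTI; exact: mt.
by rewrite -[X in measurable X]setTI; exact: measurable_snd.
Qed.

Lemma cvg_prod_seq (I : Type) (s : seq I) (x_ : I -> nat -> R) (x : I -> R) :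
  (forall i, x_ i n @[n --> \oo] --> x i) ->
  \prod_(i <- s) x_ i n @[n --> \oo] --> \prod_(i <- s) x i.
Proof.
move=> h; elim: s => [|i s ih].
  by rewrite big_nil; under eq_fun do rewrite big_nil; exact: cvg_cst.
by rewrite big_cons; under eq_fun do rewrite big_cons; exact: cvgM.
Qed.

(** The tensor product of bumps is a Schwartz function, converges pointwise to the indicator, and
    has a multiple of [cauchy_w] as majorant for all [n]. A degenerate box is empty. *)
Lemma approximable_fbox l u l0 u0 : approximable (rind (fbox l u l0 u0)).
Proof.
have [ne|] := pselect ((forall i, l i < u i) /\ l0 < u0); last first.
  move=> e; rewrite (_ : rind _ = fun=> 0); first exact: approximable0.
  apply/funext => z; rewrite /rind indicE memNset// => -[h1 h2]; apply: e; split.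
    by move=> i; have /andP[h3 h4] := h1 i; exact: lt_trans h4.
  by have /andP[h3 h4] := h2; exact: lt_trans h4.
have [lu lu0] := ne.
pose c i := (l i + u i) / 2; pose w i := (u i - l i) / 2.
pose c0 := (l0 + u0) / 2; pose w0 := (u0 - l0) / 2.
have wp i : 0 < w i by rewrite divr_gt0// subr_gt0.
have w0p : 0 < w0 by rewrite divr_gt0// subr_gt0.
have lE i : l i = c i - w i by rewrite /c /w; field.
have uE i : u i = c i + w i by rewrite /c /w; field.
have l0E : l0 = c0 - w0 by rewrite /c0 /w0; field.
have u0E : u0 = c0 + w0 by rewrite /c0 /w0; field.
pose T n (z : Rn R d * RM R) : R := (\prod_(i < d) bump (c i) (w i) n (tnth z.1 i)) * bump c0 w0 n z.2.
have /choice[M hM] i : exists M, 0 <= M /\ forall n x, bump (c i) (w i) n x <= M * cauchy x.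
  by have [M M0 h] := bump_le_cauchy (c i) (wp i); exists M.
have [M0 M00 hM0] := bump_le_cauchy c0 w0p.
pose G z := (\prod_(i < d) M i) * M0 * @cauchy_w R d z.
have K0 : 0 <= (\prod_(i < d) M i) * M0 by rewrite mulr_ge0// prodr_ge0// => i _; have [] := hM i.
have T0 n z : 0 <= T n z.
  by rewrite mulr_ge0 ?bump_ge0// prodr_ge0// => i _; exact: bump_ge0.
have TG n z : T n z <= G z.
  rewrite /G /cauchy_w [leRHS](_ : _ = (\prod_(i < d) (M i * cauchy (tnth z.1 i))) * (M0 * cauchy z.2)); last first.
    by rewrite big_split/= /cauchy_n; ring.
  apply: ler_pM => //; [by apply: prodr_ge0 => i _; exact: bump_ge0|exact: bump_ge0|].
  by apply: ler_prod => i _; rewrite bump_ge0/=; have [_] := hM i.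
have Tc z : T n z @[n --> \oo] --> (\1_(fbox l u l0 u0) z : R).
  have -> : \1_(fbox l u l0 u0) z = (\prod_(i <- index_enum 'I_d) (c i - w i < tnth z.1 i < c i + w i)%R%:R)
      * (c0 - w0 < z.2 < c0 + w0)%R%:R :> R.
    have [zb|zb] := pselect (fbox l u l0 u0 z).
      rewrite indicE mem_set//; have [h1 h2] := zb.
      rewrite -l0E -u0E h2 mulr1 big1// => i _.
      by rewrite -lE -uE h1.
    rewrite indicE memNset//; apply/esym/eqP; rewrite mulf_eq0.
    apply: contra_notT zb; rewrite negb_or => /andP[/prodf_neq0 h1 h2]; split.
      move=> i; have := h1 i; move=> /(_ isT).
      by rewrite -lE -uE; case: (l i < _ < u i); rewrite // eqxx.
    by move: h2; rewrite -l0E -u0E; case: (l0 < _ < u0); rewrite // eqxx.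
  apply: cvgM; last exact: cvg_bump.
  by apply: cvg_prod_seq => i; exact: cvg_bump.
have IG z : \1_(fbox l u l0 u0) z <= G z.
  exact: (cvgr_to_le (Tc z) (nearW _ (fun n => TG n z))).
apply: (@approximable_dominated _ (fun n z => (T n z)%:C) (fun z => 2 * G z)).
- by apply: cmeasurable_rind; exact: measurable_fbox.
- move=> n; apply: approximable_schwartz; split => /=; last first.
    by have [] := @schwartz0 R d.
  have := schwartz_real_gtensor (fun i => rapid_bump (c i) (wp i) n) (rapid_bump c0 w0p n) (fun=> 1) 1.
  congr schwartz_real; apply/funext => p; rewrite /gtensor /tensor /T /expoly /bump hornerC mul1r /=.
  by congr (_ * _); apply: eq_bigr => i _; rewrite hornerC mul1r tnth_mktuple.
- by apply: measurable_funM => //; apply: measurable_funM => //; exact: measurable_cauchy_w.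
- rewrite (_ : EFin \o _ = fun z => ((2 * ((\prod_(i < d) M i) * M0))%:E * (EFin \o @cauchy_w R d) z)%E); last first.
    by apply/funext => z; rewrite /= -EFinM /G mulrA.
  rewrite mixnZ ?(mulr_ge0 (ler0n _ 2) K0)//.
  + by rewrite lte_mul_pinfty ?mixn_cauchy_w_lty// lee_fin (mulr_ge0 (ler0n _ 2) K0).
  + by apply/measurable_EFinP; exact: measurable_cauchy_w.
  + by move=> z; rewrite lee_fin cauchy_w_ge0.
- move=> n z; rewrite normc_realB.
  by rewrite (le_trans (ler_normB _ _))// (ger0_norm (T0 n z)) ger0_norm// mulr_natl mulr2n lerD.
- move=> z; rewrite (_ : (fun n => _) = fun n => `|(\1_(fbox l u l0 u0) z : R) - T n z|); last first.
    by apply/funext => n; exact: normc_realB.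
  rewrite -[X in _ --> X](@normr0 _ R) -(subrr (\1_(fbox l u l0 u0) z : R)); apply: cvg_norm.
  by apply: cvgB; [exact: cvg_cst|exact: Tc].
Qed.

Lemma approximable_lty f : approximable f -> (mixed f < +oo)%E.
Proof.
move=> [mf /(_ 1 ltr01)[psi spsi h]].
have mpsi := schwartz_cmeasurable spsi.
have := mixed_norm_comb q1e r1e 1 (cmeasurable_sub mf mpsi) mpsi.
rewrite (@mixed_ext (fun p => 1 * (f p - psi p) + psi p) f); last by move=> z; rewrite mul1r subrK.
move=> /le_lt_trans; apply; rewrite Normc.normc1 mul1e lte_add_pinfty//.
  by rewrite (le_lt_trans h)// ltry.
exact: mixed_norm_schwartz_lty.
Qed.

Definition cube (N : nat) : set (Rn R d * RM R) :=
  fbox (fun=> - N.+1%:R) (fun=> N.+1%:R) (- N.+1%:R) N.+1%:R.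

Lemma cube_cover (z : Rn R d * RM R) : exists N0, forall N, (N0 <= N)%N -> cube N z.
Proof.
pose M := (\sum_(i < d) `|tnth z.1 i : R|) + `|z.2 : R|.
have M0 : 0 <= M by rewrite addr_ge0// sumr_ge0.
exists (Num.bound M) => N hN.
have MN : M < N.+1%:R.
  by rewrite (lt_le_trans (archi_boundP M0))// ler_nat (leq_trans hN).
split => [i|]; rewrite -ltr_norml (le_lt_trans _ MN)// /M.
  by rewrite (bigD1 i)//= -addrA lerDl addr_ge0// sumr_ge0.
by rewrite lerDr sumr_ge0.
Qed.

(** With [clamp_hi], the finite endpoints of the trace on [(-N, N)] of an interval with extended
    endpoints; an empty trace shows as a lower endpoint not below the upper one. *)
Definition clamp_lo (N : R) (l : \bar R) : R :=
  match l with EFin x => Num.max x (- N) | +oo%E => N | -oo%E => - N end.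

Definition clamp_hi (N : R) (u : \bar R) : R :=
  match u with EFin x => Num.min x N | +oo%E => N | -oo%E => - N end.

Let clampP (N : R) l u (x : R) : 0 <= N ->
  ((l < x%:E < u)%E /\ - N < x < N) <-> clamp_lo N l < x < clamp_hi N u.
Proof.
move=> N0.
have lo1 : - N < x -> (l < x%:E)%E -> clamp_lo N l < x.
  by case: l => [l| |]//= h; rewrite lte_fin gt_max h => ->.
have hi1 : x < N -> (x%:E < u)%E -> x < clamp_hi N u.
  by case: u => [u| |]//= h; rewrite lte_fin lt_min h => ->.
have lo2 : clamp_lo N l < x -> - N < x.
  by case: l {lo1} => [l| |]//=; [rewrite gt_max => /andP[]|lra].
have hi2 : x < clamp_hi N u -> x < N.
  by case: u {hi1} => [u| |]//=; [rewrite lt_min => /andP[]|lra].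
have lo3 : x < N -> clamp_lo N l < x -> (l < x%:E)%E.
  case: l {lo1 lo2} => [l| |]//= h; first by rewrite lte_fin gt_max => /andP[].
    by move=> /(lt_trans h); rewrite ltxx.
  by rewrite ltNyr.
have hi3 : - N < x -> x < clamp_hi N u -> (x%:E < u)%E.
  case: u {hi1 hi2} => [u| |]//= h; first by rewrite lte_fin lt_min => /andP[].
    by rewrite ltry.
  by move=> /(lt_trans h); rewrite ltxx.
split; first by move=> [/andP[h1 h2] /andP[h3 h4]]; rewrite lo1// hi1.
move=> /andP[h1 h2]; have h3 := lo2 h1; have h4 := hi2 h2.
by rewrite h3 h4 lo3// hi3.
Qed.

(** With infinite endpoints allowed, the preimages of intervals under a single coordinate are boxes
    too, so boxes generate the sigma-algebra while being closed under intersection; the cubes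
    restore boundedness. *)
Definition ebox (l u : 'I_d -> \bar R) (l0 u0 : \bar R) : set (Rn R d * RM R) :=
  [set z | (forall i, l i < (tnth z.1 i : R)%:E < u i)%E /\ (l0 < (z.2 : R)%:E < u0)%E].

Lemma ebox_cube l u l0 u0 N : ebox l u l0 u0 `&` cube N =
  fbox (fun i => clamp_lo N.+1%:R (l i)) (fun i => clamp_hi N.+1%:R (u i))
    (clamp_lo N.+1%:R l0) (clamp_hi N.+1%:R u0).
Proof.
apply/seteqP; split => z.
  by move=> [[h1 h2] [h3 h4]]; split => [i|]; apply/clampP.
move=> [h1 h2]; split; split.
- by move=> i; have /(clampP _ _ _ (ler0n _ _))[] := h1 i.
- by have /(clampP _ _ _ (ler0n _ _))[] := h2.
- by move=> i; have /(clampP _ _ _ (ler0n _ _))[] := h1 i.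
- by have /(clampP _ _ _ (ler0n _ _))[] := h2.
Qed.

Lemma measurable_ebox l u l0 u0 : measurable (ebox l u l0 u0).
Proof.
rewrite (_ : ebox l u l0 u0 = \bigcup_N (ebox l u l0 u0 `&` cube N)).
  by apply: bigcupT_measurable => N; rewrite ebox_cube; exact: measurable_fbox.
apply/seteqP; split => [z zb|z [N _ []]//].
by have [N0 /(_ N0 (leqnn _)) h] := cube_cover z; exists N0.
Qed.

Definition eboxes : set (set (Rn R d * RM R)) :=
  [set A | exists l u l0 u0, A = ebox l u l0 u0].

Lemma setI_closed_eboxes : setI_closed eboxes.
Proof.
move=> _ _ [l [u [l0 [u0 ->]]]] [l' [u' [l0' [u0' ->]]]].
exists (fun i => Order.max (l i) (l' i)), (fun i => Order.min (u i) (u' i)).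
exists (Order.max l0 l0'), (Order.min u0 u0').
apply/seteqP; split => z.
  move=> [[h1 h2] [h3 h4]]; split => [i|]; rewrite gt_max lt_min.
    by have /andP[-> ->] := h1 i; have /andP[-> ->] := h3 i.
  by have /andP[-> ->] := h2; have /andP[-> ->] := h4.
move=> [h1 h2]; move: h2; rewrite gt_max lt_min => /andP[/andP[a1 a2] /andP[a3 a4]].
split; split; rewrite ?a1 ?a2 ?a3 ?a4//.
- by move=> i; have := h1 i; rewrite gt_max lt_min => /andP[/andP[-> _] /andP[-> _]].
- by move=> i; have := h1 i; rewrite gt_max lt_min => /andP[/andP[_ ->] /andP[_ ->]].
Qed.

Lemma eboxes_generate : @measurable _ (Rn R d * RM R)%type = <<s eboxes >>.
Proof.
apply/seteqP; split; last first.
  apply: smallest_sub; first exact: sigma_algebra_measurable.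
  by move=> _ [l [u [l0 [u0 ->]]]]; exact: measurable_ebox.
have mcoord (h : Rn R d * RM R -> R) : (forall x y, eboxes (h @^-1` `]x, y[%classic)) ->
    measurable_fun [set: g_sigma_algebraType eboxes] (h : g_sigma_algebraType eboxes -> R).
  move=> hh; apply: (measurability _ (RGenOpens.measurableE R)) => _ [_ [x [y ->]] <-].
  by rewrite setTI; apply: sub_sigma_algebra; exact: hh.
have mid : measurable_fun [set: g_sigma_algebraType eboxes]
    (id : g_sigma_algebraType eboxes -> Rn R d * RM R).
  apply/measurable_fun_pairP; split.
    apply/measurable_fun_tnthP => i; apply: (mcoord (fun z => tnth z.1 i)) => x y.
    exists (fun j => if j == i then x%:E else -oo%E), (fun j => if j == i then y%:E else +oo%E).
    exists -oo%E, +oo%E; apply/seteqP; split => z /=; rewrite in_itv/=.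
      move=> h; split; last by rewrite ltNyr ltry.
      by move=> j; case: eqP => [->|_]; rewrite ?lte_fin ?ltNyr ?ltry.
    by move=> [/(_ i)]; rewrite eqxx !lte_fin.
  apply: (mcoord snd) => x y.
  exists (fun=> -oo%E), (fun=> +oo%E), x%:E, y%:E; apply/seteqP; split => z /=; rewrite in_itv/=.
    by move=> h; split => [j|]; rewrite ?lte_fin ?ltNyr ?ltry.
  by move=> [_]; rewrite !lte_fin.
move=> A mA; have := mid measurableT A mA.
by rewrite setTI preimage_id.
Qed.

(** Dynkin's theorem on the boxes. Intersecting with a fixed cube keeps all norms finite:
    complements become differences with the cube, and the partial unions of a disjoint sequence are
    dominated by its indicator. *)
Lemma approximable_rind_cube A N : measurable A -> approximable (rind (A `&` cube N)).
Proof.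
have mcube k : measurable (cube k) by exact: measurable_fbox.
have acube k : approximable (rind (cube k)) by exact: approximable_fbox.
suff h : forall S, <<s eboxes >> S -> forall N, approximable (rind (S `&` cube N)).
  by rewrite eboxes_generate => ?; exact: h.
have := @dynkin_induction _ _ eboxes (fun S => forall N, approximable (rind (S `&` cube N)))
  eboxes_generate setI_closed_eboxes.
apply.
- by move=> k; rewrite setTI.
- by move=> _ [l [u [l0 [u0 ->]]]] k; rewrite ebox_cube; exact: approximable_fbox.
- move=> S mS hS k; have := approximable_comb (-1) (hS k) (acube k).
  congr approximable; apply/funext => z; apply: complex_eqP; rewrite /rind ?(ReD, ImD) ?(ReM, ImM)/=; last by ring.
  rewrite !indicE !in_setI in_setC.
  by case: (z \in S); case: (z \in cube k); rewrite /=; ring.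
move=> F mF tF hF k.
pose U n := \big[setU/set0]_(i < n) F i.
have mU n : measurable (U n) by apply: bigsetU_measurable.
have inU n z : U n z <-> exists2 i, (i < n)%N & F i z.
  rewrite /U -bigcup_mkord; split; first by move=> [i /= ni Fi]; exists i.
  by move=> [i ni Fi]; exists i.
have aU n : approximable (rind (U n `&` cube k)).
  elim: n => [|n ih].
    rewrite (_ : rind _ = fun=> 0); first exact: approximable0.
    by apply/funext => z; rewrite /rind /U big_ord0 set0I indic0.
  have := approximable_comb 1 ih (hF n k).
  congr approximable; apply/funext => z; apply: complex_eqP; rewrite /rind ?(ReD, ImD) ?(ReM, ImM)/=; last by ring.
  rewrite /U big_ord_recr/= -/(U n) !indicE !in_setI in_setU.
  have : ~~ ((z \in U n) && (z \in F n)).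
    apply/negP => /andP[/set_mem/inU[i ni Fi] /set_mem Fn].
    by move/trivIsetP : tF => /(_ i n I I); rewrite ltn_eqF// => /(_ isT)/seteqP[+ _] => /(_ z); apply.
  by case: (z \in U n); case: (z \in F n); case: (z \in cube k) => //= _; ring.
apply: (@approximable_dominated _ (fun n => rind (U n `&` cube k)) (\1_(cube k))) => //.
- by apply: cmeasurable_rind; apply: measurableI => //; exact: bigcupT_measurable.
- have := approximable_lty (acube k); rewrite mixed_normE.
  by congr (mixn _ _ _ _ _ < _)%E; apply/funext => z; rewrite /rind normc_real ger0_norm.
- move=> n z; rewrite normc_realB; move: (cube k) => B; rewrite !indicE !in_setI.
  have : (z \in U n) ==> (z \in \bigcup_i F i).
    by apply/implyP => /set_mem/inU[i _ Fi]; apply/mem_set; exists i.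
  case: (z \in U n); case: (z \in \bigcup_i F i); case: (z \in B) => //= _;
    by rewrite ?subrr ?subr0 ?normr0 ?normr1.
move=> z; have [[i _ Fi]|nF] := pselect ((\bigcup_i F i) z).
  apply: cvg_near_cst; near=> n.
  rewrite normc_realB !indicE !in_setI mem_set; last by exists i.
  rewrite (_ : z \in U n) ?subrr ?normr0//; apply/mem_set/inU; exists i => //.
  by near: n; exact: nbhs_infty_gt.
apply: cvg_near_cst; apply: nearW => n.
have nU : ~ U n z by move=> /inU[i _ Fi]; apply: nF; exists i.
rewrite normc_realB; move: (cube k) => B; rewrite !indicE !in_setI (memNset nF) (memNset nU).
by rewrite subrr normr0.
Unshelve. all: by end_near. Qed.

Lemma approximable_sum (s : seq R) (k : R -> R[i]) (g : R -> Rn R d * RM R -> R[i]) :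
  (forall y, approximable (g y)) -> approximable (fun z => \sum_(y <- s) k y * g y z).
Proof.
move=> h; elim: s => [|y s ih].
  rewrite (_ : (fun z => _) = fun=> 0); first exact: approximable0.
  by apply/funext => z; rewrite big_nil.
have := approximable_comb (k y) (h y) ih.
by congr approximable; apply/funext => z; rewrite big_cons.
Qed.

Import HBNNSimple.

(** Simple functions increasing to [f], cut to growing cubes, are combinations of the indicators
    already treated; [f] itself dominates the error. *)
Lemma approximable_ge0 (f : Rn R d * RM R -> R) : measurable_fun setT f -> (forall z, 0 <= f z) ->
  (mixn nu mu q%:E r%:E (EFin \o f) < +oo)%E -> approximable (fun z => (f z)%:C).
Proof.
move=> mf f0 finf.
have mEf : measurable_fun setT (EFin \o f) by exact/measurable_EFinP.
pose fn n : Rn R d * RM R -> R := nnsfun_approx measurableT mEf n.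
have mfn n : measurable_fun setT (fn n) by exact: measurable_funP.
have fn0 n z : 0 <= fn n z by exact: fun_ge0.
have fnE n z : fn n z = \sum_(y <- finmap.enum_fset (fset_set (range (fn n)))) y * \1_(fn n @^-1` [set y]) z.
  by rewrite {1}/fn fimfunE fsbig_finite//; exact: fimfunP.
have fc z : (fn n z)%:E @[n --> \oo] --> (f z)%:E.
  by have := @cvg_nnsfun_approx _ _ R _ measurableT _ mEf (fun z _ => f0 z) z I.
have fnf n z : fn n z <= f z.
  rewrite -lee_fin -(cvg_lim _ (fc z))//.
  apply: (@le_limn_nd R (fun n => (fn n z)%:E)) => m p mp; rewrite lee_fin.
  by have /lefP := @nd_nnsfun_approx _ _ R _ measurableT _ mEf m p mp; exact.
pose g n z : R := fn n z * \1_(cube n) z.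
have g0 n z : 0 <= g n z by rewrite mulr_ge0.
have gf n z : g n z <= f z.
  by rewrite (le_trans _ (fnf n z))// ler_piMr// indicE lern1 leq_b1.
apply: (@approximable_dominated _ (fun n z => (g n z)%:C) f) => //.
- move=> n; pose s := finmap.enum_fset (fset_set (range (fn n))).
  have mpre y : measurable (fn n @^-1` [set y]).
    by rewrite -[X in measurable X]setTI; apply: mfn.
  have := @approximable_sum s (fun y => y%:C) (fun y => rind ((fn n @^-1` [set y]) `&` cube n))
    (fun y => approximable_rind_cube n (mpre y)).
  congr approximable; apply/funext => z; rewrite /g fnE mulr_suml rmorph_sum.
  apply: eq_bigr => y _; rewrite -mulrA rmorphM; congr (_ * _).
  by rewrite /rind indicI.
- move=> n z; rewrite normc_realB ger0_norm ?subr_ge0//.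
  by rewrite gerBl.
move=> z; have [N0 hN0] := cube_cover z.
rewrite (_ : (fun n => _) = fun n => `|f z - g n z|); last by apply/funext => n; exact: normc_realB.
rewrite -[X in _ --> X](@normr0 _ R) -(subrr (f z)); apply: cvg_norm; apply: cvgB; first exact: cvg_cst.
have := fc z => /fine_cvg /=; apply: cvg_trans; apply: near_eq_cvg.
near=> n; rewrite /g indicE mem_set ?mulr1//; apply: hN0; near: n; exact: nbhs_infty_ge.
Unshelve. all: by end_near. Qed.

Theorem schwartz_dense f : cmeasurable_fun setT f -> (mixed f < +oo)%E -> approximable f.
Proof.
move=> mf finf; have [mr mi] := mf.
have part (h : Rn R d * RM R -> R) : measurable_fun setT h ->
    (forall z, `|h z| <= Normc.normc (f z)) -> approximable (fun z => (Num.max (h z) 0)%:C).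
  move=> mh hf; apply: approximable_ge0.
  - by apply: measurable_maxr => //; exact: measurable_cst.
  - by move=> z; rewrite le_max lexx orbT.
  apply: le_lt_trans finf; rewrite mixed_normE; apply: le_mixn => //.
  - by apply/measurable_EFinP; apply: measurable_maxr => //; exact: measurable_cst.
  - exact: cmeasurable_enormc.
  - by move=> z; rewrite lee_fin le_max lexx orbT.
  - by move=> z; rewrite lee_fin ge_max normc_ge0 andbT (le_trans (ler_norm _)).
have p1 := part _ mr (fun z => le_Re_normc (f z)).
have p2 := part (fun z => - complex.Re (f z)) (measurableT_comp _ mr) _.
have p3 := part _ mi (fun z => le_Im_normc (f z)).
have p4 := part (fun z => - complex.Im (f z)) (measurableT_comp _ mi) _.
have {}p2 : approximable (fun z => (Num.max (- complex.Re (f z)) 0)%:C).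
  by apply: p2 => // z; rewrite normrN le_Re_normc.
have {}p4 : approximable (fun z => (Num.max (- complex.Im (f z)) 0)%:C).
  by apply: p4 => // z; rewrite normrN le_Im_normc.
have := approximable_comb 1 p1 (approximable_comb (-1) p2 (approximable_comb 'i p3
  (approximable_comb (- 'i) p4 approximable0))).
congr approximable; apply/funext => z.
have mx (x : R) : Num.max x 0 - Num.max (- x) 0 = x.
  by case: (leP 0 x) => x0; [rewrite max_r ?oppr_le0// subr0|rewrite max_l ?oppr_ge0 1?ltW// opprK add0r].
apply: complex_eqP; rewrite ?(ReD, ImD) ?(ReM, ImM)/= -[RHS]mx; ring.
Qed.

End approximable.

(** * The extension by density *)

Section mixed_norm_triangle.
Context {R : realType} (d : nat) (q r : \bar R).
Context (q1 : (1 <= q)%E) (r1 : (1 <= r)%E).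
Notation N := (@mixed_norm R d q r).
Implicit Types (f g h : Rn R d * RM R -> R[i]).

Lemma eq_mixed_norm f g : f =1 g -> N f = N g.
Proof. by move=> /funext ->. Qed.

Lemma mixed_norm_subC f g : N (fun p => f p - g p) = N (fun p => g p - f p).
Proof.
rewrite !mixed_normE; apply: eq_mixn => p.
by rewrite -opprB normcN.
Qed.

Lemma mixed_norm_sub_triangle f g h : cmeasurable_fun setT f -> cmeasurable_fun setT g ->
  cmeasurable_fun setT h ->
  (N (fun p => f p - h p)%R <= N (fun p => f p - g p)%R + N (fun p => g p - h p)%R)%E.
Proof.
move=> mf mg mh; have := mixed_norm_comb q1 r1 1 (cmeasurable_sub mf mg) (cmeasurable_sub mg mh).
rewrite Normc.normc1 mul1e; apply: le_trans.
rewrite (@eq_mixed_norm (fun p => f p - h p) (fun p => 1 * (f p - g p) + (g p - h p)))// => p.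
by rewrite mul1r addrA subrK.
Qed.

Lemma mixed_norm_sub_eq0 f g : cmeasurable_fun setT f -> cmeasurable_fun setT g ->
  (forall e : R, 0 < e -> (N (fun p => f p - g p)%R <= e%:E)%E) -> eq_LqLr f g.
Proof.
move=> mf mg h.
have N0 : N (fun p => f p - g p) = 0%E.
  apply/eqP; rewrite eq_le Lnorm_ge0 andbT; apply/lee_addgt0Pr => e e0.
  by rewrite add0e h.
have := mixed_norm_eq0 q1 r1 (cmeasurable_sub mf mg) N0.
by apply: filterS => p /subr0_eq.
Qed.

Lemma mixed_norm0 : N (fun=> 0) = 0%E.
Proof.
rewrite mixed_normE; apply: (iffRL (mixn_eq0 _ _ q1 r1 _ _)).
- by rewrite Normc.normc0; exact: measurable_cst.
- by move=> p; rewrite Normc.normc0.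
- by apply: aeW => p; rewrite Normc.normc0.
Qed.

Lemma le_mixed_norm_sub f g : cmeasurable_fun setT f -> cmeasurable_fun setT g ->
  (N f <= N (fun p => f p - g p)%R + N g)%E.
Proof.
move=> mf mg; have := mixed_norm_comb q1 r1 1 (cmeasurable_sub mf mg) mg.
rewrite Normc.normc1 mul1e; apply: le_trans.
by rewrite (@eq_mixed_norm f (fun p => 1 * (f p - g p) + g p))// => p; rewrite mul1r subrK.
Qed.

End mixed_norm_triangle.

Section limits.
Context {R : realType}.

Lemma limn_einf_le_cvg (u v : (\bar R)^nat) (l : \bar R) :
  (forall n, u n <= v n)%E -> v n @[n --> \oo] --> l -> (limn_einf u <= l)%E.
Proof.
move=> uv vl; rewrite limn_einf_lim -(cvg_lim _ vl)//.
apply: lee_lim.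
- by apply: ereal_nondecreasing_is_cvgn; exact: nondecreasing_einfs.
- by apply/cvg_ex; exists l.
- apply: nearW => n; apply: le_trans (uv n).
  by apply: ereal_inf_lbound; exists n => //=.
Qed.

(** Absolute convergence of the telescoping series. *)
Lemma cvg_summable_increments (u : R^nat) (c : R^nat) :
  (forall n, `|u n.+1 - u n| <= c n) -> (\sum_(0 <= n <oo) (c n)%:E < +oo)%E -> cvgn u.
Proof.
move=> uc csum.
have c0 n : 0 <= c n by exact: le_trans (normr_ge0 _) (uc n).
have -> : u = (fun n => u 0%N + series (fun k => u k.+1 - u k) n).
  by apply/funext => n; rewrite /series/= telescope_sumr// addrC subrK.
apply: is_cvgD; first exact: is_cvg_cst.
apply: normed_cvg; apply: nondecreasing_is_cvgn.
  by apply: nondecreasing_series => n _ _; exact: normr_ge0.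
exists (fine (\sum_(0 <= n <oo) (c n)%:E)%E) => _ [n _ <-].
have s0 : (0 <= \sum_(0 <= n <oo) (c n)%:E)%E by apply: nneseries_ge0 => k _ _; rewrite lee_fin.
rewrite -lee_fin fineK ?ge0_fin_numE//.
apply: (@le_trans _ _ (\sum_(0 <= k < n) (c k)%:E)%E).
  by rewrite /series/= sumEFin lee_fin; apply: ler_sum => k _; exact: uc.
by apply: nneseries_lim_ge => k _ _; rewrite lee_fin.
Qed.

End limits.

(** * Construction of the extension for every [z], and its identification *)

Section extension.
Context {R : realType} (d : nat) (a : R) (Q : R) (r : \bar R) (rho : R).
Context (Q2 : 2 < Q) (r2 : (2%:E <= r)%E).
Context (hQr : 2 / Q + d%:R * fine r^-1 = (d%:R + a + 1) / 2).
Context (rE : hoelder_conjugate r = rho%:E) (rho1 : 1 <= rho).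
Notation mu := (@lebesgue_measure R).
Notation nu := (lebesgue_n R d).
Notation Q' := (Q / (Q - 1)).
Notation N := (@mixed_norm R d Q%:E r).
Notation N' := (@mixed_norm R d Q'%:E rho%:E).
Notation Th := (@Theta_star R d a).
Implicit Types (Phi Psi psi phi : Rn R d * RM R -> R[i]).

Let Q1 : 0 < Q - 1. Proof. by rewrite subr_gt0 (lt_trans _ Q2)// ltr1n. Qed.
Let Qe1 : (1 <= Q%:E)%E. Proof. by rewrite lee_fin (le_trans _ (ltW Q2))// ler1n. Qed.
Let re1 : (1 <= r)%E. Proof. by rewrite (le_trans _ r2)// lee_fin ler1n. Qed.
Let Q'1 : 1 <= Q'. Proof. by rewrite (ler_pdivlMr _ _ Q1) mul1r gerBl. Qed.
Let Q'e1 : (1 <= Q'%:E)%E. Proof. by rewrite lee_fin. Qed.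
Let rhoe1 : (1 <= rho%:E)%E. Proof. by rewrite lee_fin. Qed.

Let reg psi : schwartz psi -> regular r psi.
Proof. exact: schwartz_regular rE rho1. Qed.

Let finS psi : schwartz psi -> (N' psi < +oo)%E.
Proof. exact: mixed_norm_schwartz_lty. Qed.

Let finS' psi : schwartz psi -> (mixed_norm Q'%:E (hoelder_conjugate r) psi < +oo)%E.
Proof. by rewrite rE; exact: finS. Qed.

Let mTh psi z : schwartz psi -> cmeasurable_fun setT (Th psi z).
Proof. by move=> s; exact: (cmeasurable_Theta_section a z (reg s)). Qed.

Let bound : exists2 C : R, 0 < C & forall psi z, schwartz psi -> (N (Th psi z) <= C%:E * N' psi)%E.
Proof.
have [C C0 hC] := Theta_bound Q2 r2 hQr; exists C => // psi z s.
by have := hC psi z (reg s); rewrite rE.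
Qed.

Let linear (k : R[i]) psi phi : schwartz psi -> schwartz phi ->
  \forall p \ae (nu \x mu)%E, forall z, Th (fun p => k * psi p + phi p) z p = k * Th psi z p + Th phi z p.
Proof. by move=> s1 s2; apply: (Theta_comb Q2 r2 hQr); [exact: reg|exact: reg|exact: finS'|exact: finS']. Qed.

Lemma Theta_schwartzB_bound : exists2 C : R, 0 < C & forall psi phi z, schwartz psi -> schwartz phi ->
  (N (fun p => Th psi z p - Th phi z p)%R <= C%:E * N' (fun p => psi p - phi p)%R)%E.
Proof.
have [C C0 hC] := bound; exists C => // psi phi z s1 s2.
have := hC _ z (schwartz_comb (-1) s2 s1).
rewrite (@eq_mixed_norm _ _ _ _ (fun p => -1 * phi p + psi p) (fun p => psi p - phi p)); last first.
  by move=> p; rewrite mulN1r addrC.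
apply: le_trans; rewrite le_eqVlt; apply/orP; left; apply/eqP.
apply: (mixed_norm_eq_ae Qe1 re1).
- exact (cmeasurable_sub (mTh z s1) (mTh z s2)).
- exact: (mTh z (schwartz_comb (-1) s2 s1)).
- have := linear (-1) s2 s1; apply: filterS => p ->.
  by rewrite mulN1r addrC.
Qed.

(** The Riesz-Fischer argument with [z] as a parameter: for each [z] the increments of
    [Theta_star (psi n)] have summable norms, at a rate independent of [z], so the sequence
    converges almost everywhere and Fatou's lemma gives the estimate. It holds at every [z], which
    the continuity proof relies on. *)
Lemma extension_exists : exists2 C : R, 0 < C & forall Phi, in_LqLr Q'%:E rho%:E Phi ->
  exists V : R -> Rn R d * RM R -> R[i],
    cmeasurable_fun setT (fun u : R * (Rn R d * RM R) => V u.1 u.2) /\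
    forall z psi, schwartz psi ->
      (N (fun p => V z p - Th psi z p)%R <= C%:E * N' (fun p => Phi p - psi p)%R)%E.
Proof.
have [C C0 hC] := Theta_schwartzB_bound; exists C => // Phi [mPhi fPhi].
have [_ dens] := schwartz_dense Q'1 rho1 mPhi fPhi.
have e0 n : 0 < 2^-1 ^+ n :> R by rewrite exprn_gt0.
have /choice[psi hpsi] n : exists psi, schwartz psi /\ (N' (fun p => Phi p - psi p)%R <= (2^-1 ^+ n)%:E)%E.
  by have [psi s h] := dens _ (e0 n); exists psi.
have spsi n : schwartz (psi n) by have [] := hpsi n.
have mpsi n := schwartz_cmeasurable (spsi n).
(* A measurable choice of limit defined everywhere: it is the limit wherever the sequence converges,
   so one formula defines [V] for all [z], although the set of convergence may vary with [z]. *)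
pose lim_ (f : nat -> R) : R := fine (limn_esup (fun n => (f n)%:E)).
pose V z p : R[i] := (lim_ (fun n => complex.Re (Th (psi n) z p)) +i* lim_ (fun n => complex.Im (Th (psi n) z p)))%C.
have mJ n := cmeasurable_Theta a (mpsi n) (let: And3 _ h _ := reg (spsi n) in h).
have mV : cmeasurable_fun setT (fun u : R * (Rn R d * RM R) => V u.1 u.2).
  split; apply: measurableT_comp => //; apply: measurable_fun_limn_esup => n; apply/measurable_EFinP.
    by have [mr _] := mJ n; exact: mr.
  by have [_ mi] := mJ n; exact: mi.
exists V; split => // z phi sphi.
have mVz : cmeasurable_fun setT (V z).
  have [mr mi] := mV.
  by split; [have mm := measurable_section2 (T3 := R) z mr|have mm := measurable_section2 (T3 := R) z mi]; exact mm.
pose D n p := Normc.normc (Th (psi n.+1) z p - Th (psi n) z p).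
have mD n : measurable_fun setT (EFin \o D n).
  exact (cmeasurable_enormc (cmeasurable_sub (mTh z (spsi n.+1)) (mTh z (spsi n)))).
have D0 n p : (0 <= (EFin \o D n) p)%E by rewrite lee_fin normc_ge0.
have Dle n : (mixn nu mu Q%:E r (EFin \o D n) <= (2 * C * 2^-1 ^+ n)%:E)%E.
  apply: (le_trans (hC _ _ z (spsi n.+1) (spsi n))).
  apply: (@le_trans _ _ (C%:E * ((2^-1 ^+ n.+1)%:E + (2^-1 ^+ n)%:E))%E).
    apply: lee_wpmul2l; first by rewrite lee_fin ltW.
    apply: (le_trans (mixed_norm_sub_triangle Q'e1 rhoe1 (mpsi n.+1) mPhi (mpsi n))).
    rewrite mixed_norm_subC; apply: leeD; [by have [] := hpsi n.+1|by have [] := hpsi n].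
  rewrite -EFinD -EFinM lee_fin exprS.
  have := e0 n; move: (2^-1 ^+ n) => x x0; rewrite -subr_ge0 (_ : _ - _ = C * x / 2); last by field.
  by rewrite divr_ge0// mulr_ge0// ltW.
have Dfin : (mixn nu mu Q%:E r (fun p => \sum_(0 <= n <oo) (EFin \o D n) p)%E < +oo)%E.
  apply: (le_lt_trans (mixn_series nu mu Qe1 re1 mD D0)).
  apply: (@le_lt_trans _ _ (\sum_(0 <= n <oo) (2 * C * 2^-1 ^+ n)%:E)%E).
    by apply: lee_nneseries => n *; [exact: mixn_ge0|exact: Dle].
  have cg : series (geometric (2 * C) 2^-1) n @[n --> \oo] --> (2 * C * (1 - 2^-1)^-1 : R).
    by apply: cvg_geometric_series; rewrite ger0_norm ?invr_ge0// invf_lt1// ltr1n.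
  have ec : (\sum_(0 <= k < n) (2 * C * 2^-1 ^+ k)%:E)%E @[n --> \oo] --> (2 * C * (1 - 2^-1)^-1)%:E.
    rewrite (_ : (fun n => _) = EFin \o series (geometric (2 * C) 2^-1)).
      by apply: cvg_EFin; [exact: nearW|exact: cg].
    by apply/funext => n; rewrite /= /series/= sumEFin.
  by rewrite (cvg_lim _ ec)// ltry.
have mS : measurable_fun setT (fun p => \sum_(0 <= n <oo) (EFin \o D n) p)%E.
  by apply: ge0_emeasurable_sum => [n p _ _|n _]; [exact: D0|exact: mD].
have S0 p : (0 <= \sum_(0 <= n <oo) (EFin \o D n) p)%E by apply: nneseries_ge0 => n _ _; exact: D0.
have aeS := mixn_lty_ae Qe1 re1 mS S0 Dfin.
have cvV p : (\sum_(0 <= n <oo) (EFin \o D n) p < +oo)%E ->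
    (complex.Re (Th (psi n) z p) @[n --> \oo] --> complex.Re (V z p)) /\
    (complex.Im (Th (psi n) z p) @[n --> \oo] --> complex.Im (V z p)).
  move=> Sfin.
  have limE (f : R^nat) : cvgn f -> f n @[n --> \oo] --> lim_ f.
    move=> cf; have ecf : (f n)%:E @[n --> \oo] --> (limn f)%:E.
      by apply: cvg_EFin; [exact: nearW|exact: cf].
    by rewrite /lim_ (cvg_limn_einf_sup ecf).
  have B (w1 w2 : R[i]) : `|complex.Re w1 - complex.Re w2| <= Normc.normc (w1 - w2) /\
      `|complex.Im w1 - complex.Im w2| <= Normc.normc (w1 - w2).
    split; [apply: le_trans (le_Re_normc _)|apply: le_trans (le_Im_normc _)].
      by rewrite ReD ReN.
    by rewrite ImD ImN.
  split; apply: limE; apply: (cvg_summable_increments (c := fun n => D n p)) => // n.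
    by have [] := B (Th (psi n.+1) z p) (Th (psi n) z p).
  by have [] := B (Th (psi n.+1) z p) (Th (psi n) z p).
pose E n p := (Normc.normc (Th (psi n) z p - Th phi z p))%:E.
have mE n : measurable_fun setT (E n).
  exact (cmeasurable_enormc (cmeasurable_sub (mTh z (spsi n)) (mTh z sphi))).
have E0 n p : (0 <= E n p)%E by rewrite lee_fin normc_ge0.
apply: (@le_trans _ _ (mixn nu mu Q%:E r (fun p => limn_einf (E ^~ p)))).
  rewrite mixed_normE; apply: (le_mixn_ae Qe1 re1) => //.
  - exact (cmeasurable_enormc (cmeasurable_sub mVz (mTh z sphi))).
  - exact: measurable_limn_einf.
  - by move=> p; rewrite lee_fin normc_ge0.
  - by move=> p; exact: limn_einf_ge0.
  apply: filterS aeS => p /cvV[cr ci].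
  have nE (w1 w2 : R[i]) : Normc.normc (w1 - w2) =
      Num.sqrt ((complex.Re w1 - complex.Re w2) ^+ 2 + (complex.Im w1 - complex.Im w2) ^+ 2).
    by rewrite normcE ReD ImD ReN ImN.
  have cE : E n p @[n --> \oo] --> (Normc.normc (V z p - Th phi z p))%:E.
    apply: cvg_EFin; first exact: nearW.
    rewrite nE (_ : _ \o _ = fun n => Num.sqrt ((complex.Re (Th (psi n) z p) - complex.Re (Th phi z p)) ^+ 2 +
      (complex.Im (Th (psi n) z p) - complex.Im (Th phi z p)) ^+ 2)); last by apply/funext => n; exact: nE.
    apply: (cvg_comp _ Num.sqrt); last exact: sqrt_continuous.
    have sq (u : R^nat) (l : R) : u n @[n --> \oo] --> l -> u n ^+ 2 @[n --> \oo] --> l ^+ 2.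
      by move=> ul; exact: (cvgM ul ul).
    by apply: cvgD; apply: sq; apply: cvgB => //; exact: cvg_cst.
  by rewrite (cvg_limn_einf_sup cE).
apply: (le_trans (mixn_fatou nu mu Qe1 re1 mE E0)).
have mphi := schwartz_cmeasurable sphi.
have fin : (N' (fun p => Phi p - phi p)%R \is a fin_num)%E.
  rewrite ge0_fin_numE ?Lnorm_ge0//.
  apply: (le_lt_trans (mixed_normB Q'1 rho1 mPhi mphi)); apply: lte_add_pinfty => //; exact: finS.
apply: (@limn_einf_le_cvg R _ (fun n => C%:E * ((2^-1 ^+ n)%:E + N' (fun p => Phi p - phi p)%R))%E).
  move=> n; apply: (le_trans (hC _ _ z (spsi n) sphi)); apply: lee_wpmul2l; first by rewrite lee_fin ltW.
  apply: (le_trans (mixed_norm_sub_triangle Q'e1 rhoe1 (mpsi n) mPhi mphi)).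
  by rewrite mixed_norm_subC leeD2r//; have [] := hpsi n.
rewrite -(fineK fin); set x := fine _.
rewrite (_ : (fun n => _) = EFin \o (fun n => C * (2^-1 ^+ n + x))); last first.
  by apply/funext => n; rewrite /= -EFinD -EFinM.
rewrite -EFinM; apply: cvg_EFin; first exact: nearW.
rewrite -[X in _ --> C * X]add0r; apply: cvgMr; apply: cvgD; last exact: cvg_cst.
by apply: cvg_expr; rewrite ger0_norm ?invr_ge0// invf_lt1// ltr1n.
Qed.

(** Comparison with all Schwartz [psi] at every [z] pins down the values: [psi = 0] gives
    boundedness, [psi] close to [Phi] gives continuity, and letting [psi] approach [Phi] gives
    uniqueness. *)
Definition is_extension_of (C : R) Phi (V : R -> Rn R d * RM R -> R[i]) : Prop :=
  cmeasurable_fun setT (fun u : R * (Rn R d * RM R) => V u.1 u.2) /\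
  forall z psi, schwartz psi ->
    (N (fun p => V z p - Th psi z p)%R <= C%:E * N' (fun p => Phi p - psi p)%R)%E.

Let inS psi : schwartz psi -> in_LqLr Q'%:E rho%:E psi.
Proof. by move=> s; split; [exact: schwartz_cmeasurable|exact: finS]. Qed.

Let in_comb (k : R[i]) Phi Psi : in_LqLr Q'%:E rho%:E Phi -> in_LqLr Q'%:E rho%:E Psi ->
  in_LqLr Q'%:E rho%:E (fun p => k * Phi p + Psi p).
Proof.
move=> [m1 f1] [m2 f2]; split; first exact: cmeasurable_comb.
apply: (le_lt_trans (mixed_norm_comb Q'e1 rhoe1 k m1 m2)).
by rewrite lte_add_pinfty// lte_mul_pinfty// lee_fin normc_ge0.
Qed.

Let approx Phi e : in_LqLr Q'%:E rho%:E Phi -> 0 < e ->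
  exists2 psi, schwartz psi & (N' (fun p => Phi p - psi p)%R <= e%:E)%E.
Proof. by move=> [m f]; have [_] := schwartz_dense Q'1 rho1 m f; apply. Qed.

Section is_extension_of.
Context (C : R) (C0 : 0 < C) Phi (inPhi : in_LqLr Q'%:E rho%:E Phi).
Context (V : R -> Rn R d * RM R -> R[i]) (extV : is_extension_of C Phi V).

Lemma cmeasurable_extension z : cmeasurable_fun setT (V z).
Proof.
have [[mr mi] _] := extV.
by split; [have mm := measurable_section2 (T3 := R) z mr|have mm := measurable_section2 (T3 := R) z mi]; exact mm.
Qed.

Let approxC e : 0 < e -> exists2 psi, schwartz psi & (C%:E * N' (fun p => Phi p - psi p)%R <= e%:E)%E /\
  (N' (fun p => Phi p - psi p)%R <= e%:E)%E.
Proof.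
move=> e0; have C1 : 0 < C + 1 by rewrite addr_gt0.
have [psi s h] := approx inPhi (divr_gt0 e0 C1); exists psi => //; split.
  apply: (@le_trans _ _ (C%:E * (e / (C + 1))%:E)%E).
    by apply: lee_wpmul2l => //; rewrite lee_fin ltW.
  by rewrite -EFinM lee_fin mulrCA ler_piMr ?(ltW e0)// ler_pdivrMr// mul1r lerDl.
apply: (le_trans h); rewrite lee_fin ler_pdivrMr// ler_peMr ?(ltW e0)//.
by rewrite lerDr ltW.
Qed.

Lemma extension_bound z : (N (V z) <= C%:E * N' Phi)%E.
Proof.
have s0 := @schwartz0 R d.
have [K K0 hK] := bound; have [_ hV] := extV.
apply: (le_trans (le_mixed_norm_sub Qe1 re1 (cmeasurable_extension z) (mTh z s0))).
have -> : N (Th (fun=> 0) z) = 0%E.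
  apply/eqP; rewrite eq_le Lnorm_ge0 andbT; apply: (le_trans (hK _ z s0)).
  by rewrite mixed_norm0// mule0.
rewrite adde0; apply: (le_trans (hV z _ s0)).
by rewrite (@eq_mixed_norm _ _ _ _ _ Phi)// => p; rewrite subr0.
Qed.

Lemma extension_continuous (z0 : R) : N (fun p => V z p - V z0 p) @[z --> z0] --> 0%E.
Proof.
apply/(@ge0_cvge0P R _ (nbhs z0) (nbhs_pfilter z0)) => [z|e e0]; first exact: Lnorm_ge0.
have e30 : 0 < e / 3 by rewrite divr_gt0.
have [psi spsi [hpsi _]] := approxC e30.
have [_ hV] := extV.
have := Theta_continuous Q2 r2 hQr z0 (reg spsi) (finS' spsi).
move/(@ge0_cvge0P R _ (nbhs z0) (nbhs_pfilter z0)) => /(_ (fun z => Lnorm_ge0 _ _ _)) /(_ _ e30).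
apply: filterS => z hz.
have mV := cmeasurable_extension.
apply: (le_trans (mixed_norm_sub_triangle Qe1 re1 (mV z) (mTh z spsi) (mV z0))).
apply: (@le_trans _ _ ((e / 3)%:E + ((e / 3)%:E + (e / 3)%:E))%E).
  apply: leeD; first exact: le_trans (hV z psi spsi) hpsi.
  apply: (le_trans (mixed_norm_sub_triangle Qe1 re1 (mTh z spsi) (mTh z0 spsi) (mV z0))).
  apply: leeD => //; rewrite mixed_norm_subC.
  exact: le_trans (hV z0 psi spsi) hpsi.
by rewrite -!EFinD lee_fin le_eqVlt; apply/orP; left; apply/eqP; field.
Qed.

Lemma extension_unique z W : cmeasurable_fun setT W ->
  (forall e : R, 0 < e -> exists2 psi, schwartz psi &
    (N (fun p => W p - Th psi z p)%R <= e%:E)%E /\ (N' (fun p => Phi p - psi p)%R <= e%:E)%E) ->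
  eq_LqLr (V z) W.
Proof.
move=> mW hW; apply: (mixed_norm_sub_eq0 Qe1 re1 (cmeasurable_extension z) mW) => e e0.
have C1 : 0 < C + 1 by rewrite addr_gt0.
have [psi spsi [h1 h2]] := hW _ (divr_gt0 e0 C1); have [_ hV] := extV.
apply: (le_trans (mixed_norm_sub_triangle Qe1 re1 (cmeasurable_extension z) (mTh z spsi) mW)).
apply: (@le_trans _ _ (C%:E * (e / (C + 1))%:E + (e / (C + 1))%:E)%E).
  apply: leeD; last by rewrite mixed_norm_subC.
  by apply: (le_trans (hV z psi spsi)); apply: lee_wpmul2l => //; rewrite lee_fin ltW.
rewrite -EFinM -EFinD lee_fin le_eqVlt; apply/orP; left; apply/eqP; field.
by rewrite gt_eqF.
Qed.

End is_extension_of.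

Lemma ae_lebesgue_pos : \forall z \ae lebesgue_pos R, 0 < z.
Proof.
exists (`]-oo, 0%R]%classic : set (RM R)); split; first exact: measurable_itv.
  change (lebesgue_measure ((`]-oo, 0%R]%classic `&` `]0%R, +oo[%classic) : set (RM R)) = 0)%E.
  rewrite (_ : _ `&` _ = set0) ?measure0//.
  apply/seteqP; split => // x [] /=; rewrite !in_itv/= andbT => x0.
  by rewrite ltNge x0.
by move=> x /= /negP; rewrite -leNgt in_itv.
Qed.

(** An interval to the right of [z0] has positive measure, so a property true almost everywhere
    holds somewhere in it; working on the right side covers [z0 = 0]. *)
Lemma lebesgue_pos_dense (P : R -> Prop) (z0 e : R) : (\forall z \ae lebesgue_pos R, P z) ->
  0 <= z0 -> 0 < e -> exists z, z0 < z < z0 + e /\ P z.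
Proof.
move=> [M [mM M0 PM]] z00 e0; apply: contrapT => h.
have sub : (`]z0, (z0 + e)%R[%classic : set (RM R)) `<=` M `&` `]0%R, +oo[.
  move=> z /=; rewrite !in_itv/= andbT => hz; split.
    by apply: PM => Pz; apply: h; exists z.
  by have /andP[h1 _] := hz; exact: le_lt_trans h1.
have : (lebesgue_measure (`]z0, (z0 + e)%R[%classic : set (RM R)) <= 0)%E.
  rewrite -M0; apply: le_measure => //; rewrite inE; first exact: measurable_itv.
  by apply: measurableI => //; exact: measurable_itv.
rewrite lebesgue_measure_itv/= lte_fin ltrDl e0 -EFinB lee_fin leNgt.
by rewrite (_ : z0 + e - z0 = e) ?e0//; ring.
Qed.

Lemma cmeasurable_slice (W : R -> Rn R d * RM R -> R[i]) z : 0 < z ->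
  cmeasurable_fun (`]0%R, +oo[ `*` setT : set (RM R * (Rn R d * RM R))) (fun u => W u.1 u.2) ->
  cmeasurable_fun setT (W z).
Proof.
move=> z0 [mr mi].
have mD : measurable (`]0%R, +oo[ `*` setT : set (RM R * (Rn R d * RM R))).
  by apply: measurableX => //; exact: measurable_itv.
have sD : pair z @` [set: Rn R d * RM R] `<=` (`]0%R, +oo[ `*` setT).
  by move=> _ [p _ <-]; split => //=; rewrite in_itv/= andbT.
by split; [have mm := measurable_comp mD sD mr (measurable_pair1 (z : RM R))
          |have mm := measurable_comp mD sD mi (measurable_pair1 (z : RM R))]; exact mm.
Qed.

Lemma continuous_extension_exists : hoelder_conjugate Q%:E = Q'%:E ->
  exists T, @continuous_extension R d a Q%:E r T.
Proof.
move=> QE; have [C C0 hC] := extension_exists.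
(* A choice of extension for each [Phi] in the space, and 0 elsewhere. *)
pose T Phi := if pselect (in_LqLr Q'%:E rho%:E Phi) is left h then projT1 (cid (hC Phi h)) else fun _ _ => 0.
have hT Phi : in_LqLr Q'%:E rho%:E Phi -> is_extension_of C Phi (T Phi).
  by move=> h; rewrite /T; case: pselect => // h'; exact: (projT2 (cid (hC Phi h'))).
exists T; rewrite /continuous_extension QE rE; split.
- move=> Phi inPhi; have [mJ _] := hT _ inPhi; have [mPhi fPhi] := inPhi; split.
    by have [mr mi] := mJ; split; exact: measurable_funTS.
  apply: (@le_lt_trans _ _ (C%:E * N' Phi)%E); last by rewrite lte_mul_pinfty// lee_fin ltW.
  by apply/ess_supP; apply: aeW => z; exact: (extension_bound (hT _ inPhi)).
- move=> k Phi Psi inPhi inPsi; apply: aeW => z.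
  have i3 := in_comb k inPhi inPsi.
  have mPhi := cmeasurable_extension (hT _ inPhi) z; have mPsi := cmeasurable_extension (hT _ inPsi) z.
  apply: (extension_unique C0 (hT _ i3)); first exact: cmeasurable_comb.
  move=> e e0; have k0 : 0 < Normc.normc k + 1 by rewrite ltr_wpDl// normc_ge0.
  have C1 : 0 < C + 1 by rewrite addr_gt0.
  (* Chosen so that [(|k| + 1)(C + 1) e' = e], which covers the errors in both spaces,
     [(|k| + 1) C e'] and [(|k| + 1) e']. *)
  pose e' := e / (Normc.normc k + 1) / (C + 1).
  have e'0 : 0 < e' by rewrite !divr_gt0.
  have [psi s1 h1] := approx inPhi e'0; have [phi s2 h2] := approx inPsi e'0.
  have e'E : (Normc.normc k + 1) * (C + 1) * e' = e by rewrite /e'; field; rewrite !gt_eqF.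
  have mp1 := schwartz_cmeasurable s1; have mp2 := schwartz_cmeasurable s2.
  have [m1 _] := inPhi; have [m2 _] := inPsi.
  exists (fun p => k * psi p + phi p); first exact: schwartz_comb.
  split.
    rewrite (_ : N _ = N (fun p => k * (T Phi z p - Th psi z p) + (T Psi z p - Th phi z p))); last first.
      apply: (mixed_norm_eq_ae Qe1 re1).
      - exact (cmeasurable_sub (cmeasurable_comb k mPhi mPsi) (mTh z (schwartz_comb k s1 s2))).
      - exact (cmeasurable_comb k (cmeasurable_sub mPhi (mTh z s1)) (cmeasurable_sub mPsi (mTh z s2))).
      - have := linear k s1 s2; apply: filterS => p ->.
        by move: (T Phi z p) (T Psi z p) (Th psi z p) (Th phi z p) => u v u' v'; ring.
    apply: (le_trans (mixed_norm_comb Qe1 re1 k (cmeasurable_sub mPhi (mTh z s1)) (cmeasurable_sub mPsi (mTh z s2)))).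
    apply: (@le_trans _ _ ((Normc.normc k)%:E * (C * e')%:E + (C * e')%:E)%E).
      have [_ hV1] := hT _ inPhi; have [_ hV2] := hT _ inPsi.
      apply: leeD; [apply: lee_wpmul2l; first by rewrite lee_fin normc_ge0|].
        by apply: (le_trans (hV1 z psi s1)); rewrite (EFinM C e'); apply: lee_wpmul2l => //; rewrite lee_fin ltW.
      by apply: (le_trans (hV2 z phi s2)); rewrite (EFinM C e'); apply: lee_wpmul2l => //; rewrite lee_fin ltW.
    rewrite -EFinM -EFinD lee_fin -e'E -subr_ge0.
    rewrite (_ : _ - _ = (Normc.normc k + 1) * e'); last by ring.
    by rewrite mulr_ge0// ltW.
  rewrite (@eq_mixed_norm _ _ _ _ _ (fun p => k * (Phi p - psi p) + (Psi p - phi p))); last first.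
    by move=> p; ring.
  apply: (le_trans (mixed_norm_comb Q'e1 rhoe1 k (cmeasurable_sub m1 mp1) (cmeasurable_sub m2 mp2))).
  apply: (@le_trans _ _ ((Normc.normc k)%:E * e'%:E + e'%:E)%E).
    by apply: leeD => //; apply: lee_wpmul2l => //; rewrite lee_fin normc_ge0.
  rewrite -EFinM -EFinD lee_fin -e'E -subr_ge0.
  rewrite (_ : _ - _ = (Normc.normc k + 1) * C * e'); last by ring.
  by apply: mulr_ge0; [apply: mulr_ge0|]; exact: ltW.
- exists C => Phi inPhi; apply/ess_supP; apply: aeW => z; exact: (extension_bound (hT _ inPhi)).
- move=> Phi sPhi; apply: aeW => z.
  apply: (extension_unique C0 (hT _ (inS sPhi)) (mTh z sPhi)) => e e0.
  exists Phi => //; split.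
    rewrite (@eq_mixed_norm _ _ _ _ _ (fun=> 0)); last by move=> p; rewrite subrr.
    by rewrite mixed_norm0// lee_fin ltW.
  rewrite (@eq_mixed_norm _ _ _ _ _ (fun=> 0)); last by move=> p; rewrite subrr.
  by rewrite mixed_norm0// lee_fin ltW.
Qed.

(** [T] is known through its four properties, which control it only for almost every [z]. Linearity,
    the bound on [Phi - psi n] and the agreement on Schwartz functions put [T Phi z] close to
    [Theta_star (psi n) z] off a null set of [z]; countably many [n] leave one null set, off which
    [extension_unique] applies. *)
Lemma continuous_extension_representative T Phi : hoelder_conjugate Q%:E = Q'%:E ->
  @continuous_extension R d a Q%:E r T -> in_LqLr Q'%:E rho%:E Phi ->
  exists V : R -> Rn R d * RM R -> R[i],
    [/\ in_CbLqLr Q%:E r V, eq_LinfLqLr V (T Phi) &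
        forall V' : R -> Rn R d * RM R -> R[i], in_CbLqLr Q%:E r V' -> eq_LinfLqLr V' (T Phi) ->
          forall z : R, 0 <= z -> eq_LqLr (V' z) (V z)].
Proof.
move=> QE; rewrite /continuous_extension QE rE => -[T1 T2 [CT T3] T4] inPhi.
have [C C0 hC] := extension_exists; have [V extV] := hC _ inPhi.
have [mPhi fPhi] := inPhi.
have mV z : cmeasurable_fun setT (V z) by exact: cmeasurable_extension extV z.
have Vc z0 : N (fun p => V z p - V z0 p) @[z --> z0] --> 0%E by exact: (extension_continuous C0 inPhi extV).
have VT : eq_LinfLqLr V (T Phi).
  pose en (n : nat) : R := n.+1%:R^-1.
  have en0 n : 0 < en n by rewrite invr_gt0.
  (* The constant of [T] may have any sign, hence the positive substitute [|CT| + 1]. *)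
  have K0 : 0 < `|CT| + 1 by rewrite ltr_wpDl.
  have /choice[psi hpsi] n : exists psi, schwartz psi /\
      (N' (fun p => Phi p - psi p)%R <= (en n / (`|CT| + 1))%:E)%E.
    by have [psi s h] := approx inPhi (divr_gt0 (en0 n) K0); exists psi.
  have spsi n : schwartz (psi n) by have [] := hpsi n.
  pose X n p := -1 * psi n p + Phi p.
  have inX n : in_LqLr Q'%:E rho%:E (X n) by exact: in_comb (inS (spsi n)) inPhi.
  have NX n : N' (X n) = N' (fun p => Phi p - psi n p).
    by apply: eq_mixed_norm => p; rewrite /X mulN1r addrC.
  have good n : \forall z \ae lebesgue_pos R, 0 < z ->
      (N (fun p => T Phi z p - Th (psi n) z p)%R <= (en n)%:E)%E.
    have h1 : \forall z \ae lebesgue_pos R, (N (T (X n) z) <= CT%:E * N' (X n))%E.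
      by apply/ess_supP; exact: T3.
    have h2 := T2 (-1) (psi n) Phi (inS (spsi n)) inPhi.
    have h3 := T4 _ (spsi n).
    have [mX _] := T1 _ (inX n); have [mTP _] := T1 _ inPhi.
    apply: aeS2 h3 (aeS2 _ h1 h2); last by move=> z; exact: conj.
    move=> z e3 [b1 e2] z0.
    apply: (@le_trans _ _ (N (T (X n) z))).
      rewrite le_eqVlt; apply/orP; left; apply/eqP; apply: (mixed_norm_eq_ae Qe1 re1).
      - exact (cmeasurable_sub (cmeasurable_slice z0 mTP) (mTh z (spsi n))).
      - exact: cmeasurable_slice z0 mX.
      - by apply: aeS2 e3 e2 => p e3 ->; rewrite e3 mulN1r addrC.
    apply: (le_trans b1); rewrite NX; have [_ hn] := hpsi n.
    apply: (@le_trans _ _ ((`|CT| + 1)%:E * (en n / (`|CT| + 1))%:E)%E).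
      apply: (@le_trans _ _ ((`|CT| + 1)%:E * N' (fun p => Phi p - psi n p)%R)%E).
        apply: lee_wpmul2r; first exact: Lnorm_ge0.
        by rewrite lee_fin (le_trans (ler_norm _))// lerDl.
      by apply: lee_wpmul2l => //; rewrite lee_fin ltW.
    by rewrite -EFinM lee_fin mulrC divfK// gt_eqF.
  have [mTP _] := T1 _ inPhi.
  have := ae_foralln good; apply: aeS2 ae_lebesgue_pos => z z0 hz.
  apply: (extension_unique C0 extV (cmeasurable_slice z0 mTP)) => e e0.
  have [n _ hn] : exists2 n, True & en n <= e.
    exists (Num.bound e^-1) => //; rewrite /en invf_ple ?posrE// ltW//.
    by rewrite (lt_le_trans (archi_boundP _)) ?invr_ge0 ?(ltW e0)// ler_nat.
  exists (psi n) => //; split; first by apply: (le_trans (hz n z0)); rewrite lee_fin.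
  have [_ h] := hpsi n; apply: (le_trans h); rewrite lee_fin (le_trans _ hn)//.
  by rewrite ler_pdivrMr// ler_peMr ?(ltW (en0 n))// lerDr.
exists V; split => //.
- split.
  + move=> z _; split => //; apply: (le_lt_trans (extension_bound extV z)).
    by rewrite lte_mul_pinfty// lee_fin ltW.
  + exists (C * fine (N' Phi)) => z _; rewrite EFinM fineK ?ge0_fin_numE ?Lnorm_ge0//.
    exact: (extension_bound extV z).
  + by move=> z0 _; apply: cvg_within_filter; exact: Vc.
(* Uniqueness: both functions are continuous in [z] and agree for almost every [z > 0], and every
   [z0 >= 0] is a limit from the right of such [z]. *)
move=> V' [V'1 _ V'c] V'T z0 z00.
have mV' z : 0 <= z -> cmeasurable_fun setT (V' z) by move=> /V'1[].
apply: (mixed_norm_sub_eq0 Qe1 re1 (mV' _ z00) (mV z0)) => e e0.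
have e20 : 0 < e / 2 by rewrite divr_gt0.
have /(ge0_cvge0P _ (fun z => Lnorm_ge0 _ _ _)) /(_ _ e20) h1 := V'c z0 z00.
have /(ge0_cvge0P _ (fun z => Lnorm_ge0 _ _ _)) /(_ _ e20) h2 := Vc z0.
have [del /= del0 hdel] : exists2 del : R, 0 < del & forall z, 0 <= z -> `|z0 - z| < del ->
    (N (fun p => V' z p - V' z0 p)%R <= (e / 2)%:E)%E /\ (N (fun p => V z p - V z0 p)%R <= (e / 2)%:E)%E.
  (* The trace on [[0, +oo)] of the neighbourhoods of [z0] is proper because [z0] itself belongs to
     that half-line. *)
  have PF : ProperFilter (within `[0%R, +oo[%classic (nbhs z0)).
    split; last exact: within_filter.
    by move=> /nbhs_singleton; apply; rewrite /= in_itv/= andbT.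
  have {}h1 := h1 PF.
  have [d1 /= d10 b1] := (iffLR (nbhs_ballP _ _) h1).
  have [d2 /= d20 b2] := (iffLR (nbhs_ballP _ _) h2).
  exists (Num.min d1 d2); first by rewrite lt_min d10.
  move=> z zp; rewrite lt_min => /andP[zd1 zd2]; split; last exact: b2.
  by apply: b1 => //=; rewrite in_itv/= andbT.
have good : \forall z \ae lebesgue_pos R, eq_LqLr (V' z) (V z).
  apply: aeS2 VT V'T => z e1 e2; apply: aeS2 e1 e2 => p -> -> //.
have [z [/andP[z0z zdel] Pz]] := lebesgue_pos_dense good z00 del0.
have zp : 0 <= z by rewrite (le_trans z00)// ltW.
have dz : `|z0 - z| < del by rewrite distrC gtr0_norm ?subr_gt0//; lra.
have [a1 a2] := hdel z zp dz.
apply: (le_trans (mixed_norm_sub_triangle Qe1 re1 (mV' _ z00) (mV' _ zp) (mV z0))).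
rewrite (_ : e = e / 2 + e / 2) ?EFinD; last by field.
apply: leeD; first by rewrite mixed_norm_subC.
rewrite (@mixed_norm_eq_ae _ _ _ _ Qe1 re1 _ (fun p => V z p - V z0 p))//.
- exact (cmeasurable_sub (mV' _ zp) (mV z0)).
- exact (cmeasurable_sub (mV z) (mV z0)).
- by apply: filterS Pz => p ->.
Qed.

End extension.

Theorem theorem8p1 (R : realType) (d : nat) (a : R) (q r : \bar R)
    (hd : (1 <= d)%N) (ha : -1 < a < 1)
    (hqr : (2%:E * q^-1 + d%:R%:E * r^-1 = ((d%:R + a + 1) / 2)%:E)%E)
    (hr : (2%:E <= r)%E) (hq : (2%:E < q)%E) :
  (exists T, @continuous_extension R d a q r T) /\
  (forall T, @continuous_extension R d a q r T ->
   forall Phi : Rn R d * RM R -> R[i],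
   in_LqLr (hoelder_conjugate q) (hoelder_conjugate r) Phi ->
   exists V : R -> Rn R d * RM R -> R[i],
     [/\ in_CbLqLr q r V,
         eq_LinfLqLr V (T Phi) &
         forall V' : R -> Rn R d * RM R -> R[i],
           in_CbLqLr q r V' -> eq_LinfLqLr V' (T Phi) ->
           forall z : R, 0 <= z -> eq_LqLr (V' z) (V z)]).
Proof.
(* The conjugate of [r] is finite and [1/r] lies in [[0, 1/2]], for [r = +oo] too; from here on
   [1/r] is handled as the real [fine r^-1]. *)
have [rho [rE rho1 rV]] : exists rho : R, [/\ hoelder_conjugate r = rho%:E, 1 <= rho &
    (r^-1 = (fine r^-1)%:E)%E /\ 0 <= fine r^-1 <= 2^-1].
  case: r hr {hqr} => [s| |//].
    rewrite lee_fin => s2; exists (s / (s - 1)).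
    have s1 : 0 < s - 1 by rewrite subr_gt0 (lt_le_trans _ s2)// ltr1n.
    have s0 : 0 < s by rewrite (lt_le_trans _ s2).
    rewrite hoelder_conjugate_EFin ?(lt_le_trans _ s2) ?ltr1n//; split => //.
      by rewrite (ler_pdivlMr _ _ s1) mul1r gerBl.
    rewrite inver gt_eqF//=; split => //.
    by rewrite invr_ge0 ltW//= lef_pV2 ?posrE.
  move=> _; exists 1; rewrite hoelder_conjugatey invey.
  by split => //; split => //=; apply/andP; split => //; rewrite invr_ge0.
(* [q = +oo] contradicts the exponent relation: it would give [d/r = (d+a+1)/2 > d/2], while
   [r >= 2]. *)
case: q hq hqr => [Q| |//]; last first.
  move=> _; rewrite invey mule0 add0e; have [-> /andP[s0 s1]] := rV.
  rewrite -EFinM => -[]; have d0 : 0 <= d%:R :> R by [].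
  have : d%:R * fine r^-1 <= d%:R * 2^-1 by rewrite ler_wpM2l.
  by have /andP[a1 a2] := ha; lra.
rewrite lte_fin => Q2 hqr.
have hQr : 2 / Q + d%:R * fine r^-1 = (d%:R + a + 1) / 2.
  move: hqr; have [-> _] := rV.
  by rewrite inver gt_eqF ?(lt_trans _ Q2)//= -!EFinM -EFinD => -[].
have QE : hoelder_conjugate Q%:E = (Q / (Q - 1))%:E.
  by rewrite hoelder_conjugate_EFin// (lt_trans _ Q2)// ltr1n.
split; first exact: (continuous_extension_exists Q2 hr hQr rE rho1 QE).
move=> T hT Phi; rewrite QE rE => inPhi.
exact: (continuous_extension_representative Q2 hr hQr rE rho1 QE hT inPhi).
Qed.
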